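(* Let $T>0$, $r\ge0$, $\mu\in\mathbb R$, $\rho\in[-1,1]$, $\alpha\ge0$, $K>0$, $\beta:\mathbb R\to(0,\infty)$ non-decreasing, $a(\sigma,t),b(\sigma,t)$ functions on $\mathbb R\times[0,T]$, and $\gamma(\sigma,t)=a(\sigma,t)-\frac{(\mu-r)\rho b(\sigma,t)}{\beta(\sigma)}+\alpha\sqrt{1-\rho^2}\,b(\sigma,t)$. Assume: $a,b,\beta$ are bounded; there is $\delta>0$ with $\max(\beta(\sigma),b(\sigma,t))\ge\delta$; $\beta,b,\gamma$ are Lipschitz in $\sigma$ uniformly in $t$ and differentiable in $\sigma$; $\beta_\sigma,b_\sigma,\gamma_\sigma$ are bounded and $\beta_\sigma,b_\sigma$ are Lipschitz in $\sigma$ uniformly in $t$. Let $g(S)=(K-S)_+$. Then the solution $P$ (continuous viscosity solution in $\mathcal C$) of $$P_t+rSP_S+\Big(a-\frac{(\mu-r)\rho b}{\beta(\sigma)}\Big)P_\sigma+\alpha\sqrt{1-\rho^2}\,b|P_\sigma|+\tfrac12\beta(\sigma)^2S^2P_{SS}+\rho\beta(\sigma)bSP_{S\sigma}+\tfrac12b^2P_{\sigma\sigma}-rP=0,\quad P(S,\sigma,T)=g(S),$$ equals the solution $G$ (in $\mathcal C$) of $$G_t+rSG_S+\gamma(\sigma,t)G_\sigma+\tfrac12\beta(\sigma)^2S^2G_{SS}+\rho\beta(\sigma)bSG_{S\sigma}+\tfrac12b^2G_{\sigma\sigma}-rG=0,\quad G(S,\sigma,T)=g(S),$$ where $a,b$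 are evaluated at $(\sigma,t)$.
   Context: Model: $dS_t=\mu S_tdt+\beta(\sigma_t)S_tdB_t$, $d\sigma_t=a(\sigma_t,t)dt+b(\sigma_t,t)dW_t$, $B,W$ Brownian motions of correlation $\rho$; the nonlinear PDE gives the writer's price of a European put with instantaneous Sharpe ratio $\alpha$. $\mathcal C$ is the class of locally bounded $u$ with $u(S,\sigma,t)/(1+(|\ln S|+|\sigma|)^k)\to0$ uniformly in $t$ as $|\ln S|+|\sigma|\to\infty$ for some $k>0$. *)

(* Defs.v *)
From Stdlib Require Import Reals.
From Coquelicot Require Import Coquelicot.
Open Scope R_scope.

Definition cont_on_dom (T : R) (u : R -> R -> R -> R) : Prop :=
  forall S s t, 0 < S -> 0 <= t <= T ->
  forall eps, 0 < eps -> exists d, 0 < d /\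
    forall S' s' t', 0 < S' -> 0 <= t' <= T ->
      Rabs (S' - S) < d -> Rabs (s' - s) < d -> Rabs (t' - t) < d ->
      Rabs (u S' s' t' - u S s t) < eps.

Definition cont_pos (f : R -> R -> R -> R) : Prop :=
  forall S s t, 0 < S ->
  forall eps, 0 < eps -> exists d, 0 < d /\
    forall S' s' t', 0 < S' ->
      Rabs (S' - S) < d -> Rabs (s' - s) < d -> Rabs (t' - t) < d ->
      Rabs (f S' s' t' - f S s t) < eps.

Definition test_fun (phi phit phiS phis phiSS phiSs phiss : R -> R -> R -> R)
  : Prop :=
  (forall S s t, 0 < S ->
     is_derive (fun x => phi S s x) t (phit S s t) /\
     is_derive (fun x => phi x s t) S (phiS S s t) /\
     is_derive (fun x => phi S x t) s (phis S s t) /\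
     is_derive (fun x => phiS x s t) S (phiSS S s t) /\
     is_derive (fun x => phiS S x t) s (phiSs S s t) /\
     is_derive (fun x => phis S x t) s (phiss S s t)) /\
  cont_pos phi /\ cont_pos phit /\ cont_pos phiS /\ cont_pos phis /\
  cont_pos phiSS /\ cont_pos phiSs /\ cont_pos phiss.

(* A "Hamiltonian" H S sigma t v p_S p_sigma p_SS p_Ssigma p_sigmasigma;
   the PDE is  u_t + H(S,sigma,t,u,Du,D^2u) = 0  on S>0, 0<t<T. *)
Definition Ham := R -> R -> R -> R -> R -> R -> R -> R -> R -> R.

Definition loc_max_at (T : R) (w : R -> R -> R -> R) (S0 s0 t0 : R) : Prop :=
  exists d, 0 < d /\ forall S s t, 0 < S -> 0 < t < T ->
    Rabs (S - S0) < d -> Rabs (s - s0) < d -> Rabs (t - t0) < d ->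
    w S s t <= w S0 s0 t0.

Definition loc_min_at (T : R) (w : R -> R -> R -> R) (S0 s0 t0 : R) : Prop :=
  exists d, 0 < d /\ forall S s t, 0 < S -> 0 < t < T ->
    Rabs (S - S0) < d -> Rabs (s - s0) < d -> Rabs (t - t0) < d ->
    w S0 s0 t0 <= w S s t.

Definition visc_sub (T : R) (H : Ham) (u : R -> R -> R -> R) : Prop :=
  forall phi phit phiS phis phiSS phiSs phiss,
    test_fun phi phit phiS phis phiSS phiSs phiss ->
    forall S0 s0 t0, 0 < S0 -> 0 < t0 < T ->
    loc_max_at T (fun S s t => u S s t - phi S s t) S0 s0 t0 ->
    0 <= phit S0 s0 t0 + H S0 s0 t0 (u S0 s0 t0) (phiS S0 s0 t0) (phis S0 s0 t0)
                          (phiSS S0 s0 t0) (phiSs S0 s0 t0) (phiss S0 s0 t0).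

Definition visc_super (T : R) (H : Ham) (u : R -> R -> R -> R) : Prop :=
  forall phi phit phiS phis phiSS phiSs phiss,
    test_fun phi phit phiS phis phiSS phiSs phiss ->
    forall S0 s0 t0, 0 < S0 -> 0 < t0 < T ->
    loc_min_at T (fun S s t => u S s t - phi S s t) S0 s0 t0 ->
    phit S0 s0 t0 + H S0 s0 t0 (u S0 s0 t0) (phiS S0 s0 t0) (phis S0 s0 t0)
                     (phiSS S0 s0 t0) (phiSs S0 s0 t0) (phiss S0 s0 t0) <= 0.

Definition class_C (T : R) (u : R -> R -> R -> R) : Prop :=
  (forall M, exists C, forall S s t, 0 < S -> 0 <= t <= T ->
      Rabs (ln S) + Rabs s <= M -> Rabs (u S s t) <= C) /\
  exists k, 0 < k /\
    forall eps, 0 < eps -> exists N, forall S s t, 0 < S -> 0 <= t <= T ->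
      N <= Rabs (ln S) + Rabs s ->
      Rabs (u S s t) / (1 + Rpower (Rabs (ln S) + Rabs s) k) <= eps.

Definition visc_sol_C (T : R) (H : Ham) (g : R -> R) (u : R -> R -> R -> R)
  : Prop :=
  cont_on_dom T u /\ class_C T u /\
  (forall S s, 0 < S -> u S s T = g S) /\
  visc_sub T H u /\ visc_super T H u.

Definition put_payoff (K : R) (S : R) : R := Rmax (K - S) 0.

Definition gam (r mu rho alpha : R) (beta : R -> R) (a b : R -> R -> R)
  (s t : R) : R :=
  a s t - (mu - r) * rho * b s t / beta s + alpha * sqrt (1 - rho ^ 2) * b s t.

Definition H_P (r mu rho alpha : R) (beta : R -> R) (a b : R -> R -> R) : Ham :=
  fun S s t v pS ps pSS pSs pss =>
    r * S * pS + (a s t - (mu - r) * rho * b s t / beta s) * ps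
    + alpha * sqrt (1 - rho ^ 2) * b s t * Rabs ps
    + / 2 * (beta s) ^ 2 * S ^ 2 * pSS + rho * beta s * b s t * S * pSs
    + / 2 * (b s t) ^ 2 * pss - r * v.

Definition H_G (r mu rho alpha : R) (beta : R -> R) (a b : R -> R -> R) : Ham :=
  fun S s t v pS ps pSS pSs pss =>
    r * S * pS + gam r mu rho alpha beta a b s t * ps
    + / 2 * (beta s) ^ 2 * S ^ 2 * pSS + rho * beta s * b s t * S * pSs
    + / 2 * (b s t) ^ 2 * pss - r * v.

(* Main.v *)
Require Import Defs.
From Stdlib Require Import Reals.
From Coquelicot Require Import Coquelicot.
From Stdlib Require Import Lra Lia Classical ClassicalChoice.
Open Scope R_scope.

(* Where [u_sigma >= 0] the two equations coincide, so it suffices to produce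
   smooth functions, nearly nondecreasing in sigma, that approximate the solution
   of either equation. Such functions come from a random walk run backward from
   a smoothed payoff: with x = ln S, one step preserves [f_xx - f_x >= 0]
   (convexity in S), and because beta is nonnegative and nondecreasing this
   convexity makes the step preserve [f_sigma >= 0] up to an error of higher
   order in the time step.

   Viscosity solutions are compared with these smooth functions only. For a
   smooth [Psi] and a barrier [chi], the function
   [t -> sup (+-(e^(r (T - t)) u - Psi) - chi)] can only be touched from above
   by C1 functions of slope at least minus the residual of [Psi].

   The coefficients need not even be measurable in t. The family b(., t),
   gamma(., t) is equi-Lipschitz, hence takes finitely many values up to a small
   error on compact sets; this splits [0, T] into finitely many arbitrary
   classes of times. By Lebesgue's density theorem for outer measures, [0, T] is
   partitioned into short intervals, most of each of which belongs to the class
   of its tag, and the walk uses the coefficients frozen at the tag. On the few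
   remaining times the residual is merely bounded, which costs little because
   the slope condition at a touching point is integrated against outer
   measure. *)

(** * Outer measure on an interval *)

(** What makes the scheme converge is a hierarchy of constants. [beta] and [b] have Lipschitz
    derivatives in sigma, [gamma] is merely Lipschitz, and mollification makes the further
    derivatives explode. An error in [gamma] is multiplied only by first derivatives of the
    approximant, whose growth under the walk involves only first derivatives of the coefficients. An
    error in [beta] or [b] is multiplied by derivatives up to second order, whose growth involves
    second derivatives of the coefficients: these depend on the scale at which [gamma] is smoothed,
    but not on the scale for [beta] and [b]. Third derivatives, which depend on everything, occur
    only multiplied by the square root of the mesh, and the mesh is chosen last. Hence the jets of
    order three and the separate bounds for each order.

    A single approximant is compared with both solutions, from above and from below, so that two
    viscosity solutions are never compared with each other. *)

Definition Rinf (P : R -> Prop) : R := real (Glb_Rbar P).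

Lemma Rinf_spec (P : R -> Prop) (m x0 : R) :
  P x0 -> (forall y, P y -> m <= y) ->
  (forall y, P y -> Rinf P <= y) /\
  (forall c, (forall y, P y -> c <= y) -> c <= Rinf P).
Proof.
  intros H0 Hm. unfold Rinf. destruct (Glb_Rbar_correct P) as [H1 H2].
  assert (A : Rbar_le m (Glb_Rbar P)) by (apply H2; intros y Hy; apply Hm, Hy).
  assert (B : Rbar_le (Glb_Rbar P) x0) by (apply H1, H0).
  destruct (Glb_Rbar P) as [l| |]; simpl in *; try easy.
  split; [exact H1|]. intros c Hc. apply (H2 (Finite c)). exact Hc.
Qed.

Lemma Rinf_approx (P : R -> Prop) (m x0 eps : R) :
  P x0 -> (forall y, P y -> m <= y) -> 0 < eps -> exists y, P y /\ y < Rinf P + eps.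
Proof.
  intros H0 Hm He. destruct (Rinf_spec P m x0 H0 Hm) as [_ H2].
  apply NNPP. intros N.
  assert (Rinf P + eps <= Rinf P); [|lra].
  apply H2. intros y Hy. apply Rnot_lt_le. intros Hlt. apply N. exists y; tauto.
Qed.

Definition nondec (v : R -> R) (a b : R) : Prop :=
  forall x y, a <= x -> x <= y -> y <= b -> v x <= v y.

Definition lipl (K : R) (v : R -> R) (a b : R) : Prop :=
  forall x y, a <= x -> x <= y -> y <= b -> v y - v x <= K * (y - x).

(** A whole neighbourhood of each point of [E] is required, as in a covering by open intervals: if
    [U] is open and contains [E], the length of the part of [U] below [x] is such a function. *)
Definition steep (v : R -> R) (E : R -> Prop) (a b : R) : Prop :=
  forall t, a <= t <= b -> E t -> exists d, 0 < d /\
    forall x y, a <= x -> x <= y -> y <= b -> Rabs (x - t) < d -> Rabs (y - t) < d ->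
      y - x <= v y - v x.

(* The infimum of [v b - v a] over all covers is the Lebesgue outer measure of
   [E] in [a, b]; covering functions replace coverings by intervals. *)
Definition cover (E : R -> Prop) (a b : R) (v : R -> R) : Prop :=
  nondec v a b /\ lipl 1 v a b /\ steep v E a b.

Definition om (E : R -> Prop) (a b : R) : R :=
  Rinf (fun l => exists v, cover E a b v /\ l = v b - v a).

Lemma cover_id E a b : cover E a b (fun x => x).
Proof.
  repeat split.
  - intros x y; lra.
  - intros x y; lra.
  - intros t _ _. exists 1. split; [lra|]. intros; lra.
Qed.

Lemma om_spec E a b : a <= b ->
  (forall v, cover E a b v -> om E a b <= v b - v a) /\
  (forall c, (forall v, cover E a b v -> c <= v b - v a) -> c <= om E a b).
Proof.
  intros Hab. unfold om.
  destruct (Rinf_spec (fun l => exists v, cover E a b v /\ l = v b - v a) 0 (b - a)) as [H1 H2].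
  - exists (fun x => x). split; [apply cover_id|reflexivity].
  - intros y [v [[Hv _] ->]]. specialize (Hv a b). lra.
  - split.
    + intros v Hv. apply H1. now exists v.
    + intros c Hc. apply H2. intros y [v [Hv ->]]. now apply Hc.
Qed.

Lemma om_approx E a b eps : a <= b -> 0 < eps ->
  exists v, cover E a b v /\ v b - v a < om E a b + eps.
Proof.
  intros Hab He. unfold om.
  destruct (Rinf_approx (fun l => exists v, cover E a b v /\ l = v b - v a) 0 (b - a) eps)
    as [y [[v [Hv ->]] Hy]]; trivial.
  - exists (fun x => x). split; [apply cover_id|reflexivity].
  - intros y [v [[Hv _] ->]]. specialize (Hv a b). lra.
  - now exists v.
Qed.

Lemma om_ge0 E a b : a <= b -> 0 <= om E a b.
Proof.
  intros Hab. apply om_spec; trivial. intros v [Hv _]. specialize (Hv a b). lra.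
Qed.

Lemma om_le E a b : a <= b -> om E a b <= b - a.
Proof. intros Hab. apply (proj1 (om_spec E a b Hab) (fun x => x)), cover_id. Qed.

(** Additivity holds for arbitrary [E] because only intervals are split: covers glue at [b] and
    restrict to both sides. *)
Lemma om_add E a b c : a <= b -> b <= c -> om E a c = om E a b + om E b c.
Proof.
  intros Hab Hbc. apply Rle_antisym.
  - apply le_epsilon. intros eps He.
    destruct (om_approx E a b (eps / 2)) as [v [[N1 [L1 S1]] Hv]]; [lra|lra|].
    destruct (om_approx E b c (eps / 2)) as [w [[N2 [L2 S2]] Hw]]; [lra|lra|].
    set (u := fun x => if Rle_dec x b then v x else w x - w b + v b).
    assert (Hu1 : forall x, x <= b -> u x = v x).
    { intros x Hx. unfold u. destruct (Rle_dec x b); lra. }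
    assert (Hu2 : forall x, b <= x -> u x = w x - w b + v b).
    { intros x Hx. unfold u. destruct (Rle_dec x b); [|lra].
      replace x with b by lra. lra. }
    assert (Cu : cover E a c u).
    { repeat split.
      - intros x y Hx Hxy Hy. destruct (Rle_dec y b).
        + rewrite !Hu1 by lra. apply N1; lra.
        + destruct (Rle_dec x b).
          * rewrite (Hu1 x), (Hu2 y) by lra. specialize (N1 x b); specialize (N2 b y); lra.
          * rewrite !Hu2 by lra. specialize (N2 x y); lra.
      - intros x y Hx Hxy Hy. destruct (Rle_dec y b).
        + rewrite !Hu1 by lra. apply L1; lra.
        + destruct (Rle_dec x b).
          * rewrite (Hu1 x), (Hu2 y) by lra. specialize (L1 x b); specialize (L2 b y); lra.
          * rewrite !Hu2 by lra. specialize (L2 x y); lra.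
      - intros t Ht HEt.
        destruct (Rtotal_order t b) as [Hlt|[Heq|Hgt]].
        + destruct (S1 t) as [d [Hd Hs]]; [lra|trivial|].
          exists (Rmin d (b - t)). split; [apply Rmin_pos; lra|].
          intros x y Hx Hxy Hy H1 H2.
          pose proof (Rmin_l d (b - t)). pose proof (Rmin_r d (b - t)).
          assert (y <= b) by (apply Rabs_def2 in H2; lra).
          rewrite !Hu1 by lra. apply Hs; lra.
        + destruct (S1 t) as [d [Hd Hs]]; [lra|trivial|].
          destruct (S2 t) as [d' [Hd' Hs']]; [lra|trivial|].
          exists (Rmin d d'). split; [apply Rmin_pos; lra|].
          intros x y Hx Hxy Hy H1 H2. pose proof (Rmin_l d d'). pose proof (Rmin_r d d').
          assert (Rabs (b - t) < Rmin d d') by (subst t; rewrite Rminus_diag, Rabs_R0; apply Rmin_pos; lra).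
          destruct (Rle_dec y b).
          * rewrite !Hu1 by lra. apply Hs; lra.
          * destruct (Rle_dec x b).
            -- rewrite (Hu1 x), (Hu2 y) by lra. specialize (Hs x b); specialize (Hs' b y); lra.
            -- rewrite !Hu2 by lra. specialize (Hs' x y); lra.
        + destruct (S2 t) as [d [Hd Hs]]; [lra|trivial|].
          exists (Rmin d (t - b)). split; [apply Rmin_pos; lra|].
          intros x y Hx Hxy Hy H1 H2.
          pose proof (Rmin_l d (t - b)). pose proof (Rmin_r d (t - b)).
          assert (b <= x) by (apply Rabs_def2 in H1; lra).
          rewrite !Hu2 by lra. assert (y - x <= w y - w x) by (apply Hs; lra). lra. }
    pose proof (proj1 (om_spec E a c ltac:(lra)) u Cu) as Hle.
    rewrite (Hu1 a), (Hu2 c) in Hle by lra. lra.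
  - apply om_spec; [lra|]. intros v [Nv [Lv Sv]].
    assert (C1 : cover E a b v).
    { repeat split.
      - intros x y ? ? ?; apply Nv; lra.
      - intros x y ? ? ?; apply Lv; lra.
      - intros t Ht HE. destruct (Sv t) as [d [Hd Hs]]; [lra|trivial|].
        exists d; split; trivial. intros; apply Hs; lra. }
    assert (C2 : cover E b c v).
    { repeat split.
      - intros x y ? ? ?; apply Nv; lra.
      - intros x y ? ? ?; apply Lv; lra.
      - intros t Ht HE. destruct (Sv t) as [d [Hd Hs]]; [lra|trivial|].
        exists d; split; trivial. intros; apply Hs; lra. }
    apply (proj1 (om_spec E a b Hab)) in C1. apply (proj1 (om_spec E b c Hbc)) in C2. lra.
Qed.

(* Truncating the slopes of [v] at 1 by inf-convolution. *)
Lemma steep_cover E a b v : a <= b -> nondec v a b -> steep v E a b ->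
  om E a b <= v b - v a.
Proof.
  intros Hab Nv Sv.
  set (P := fun x z => exists s, a <= s <= x /\ z = v s + x - s).
  set (w := fun x => Rinf (P x)).
  assert (Hw : forall x, a <= x <= b ->
    (forall s, a <= s <= x -> w x <= v s + x - s) /\
    (forall c, (forall s, a <= s <= x -> c <= v s + x - s) -> c <= w x)).
  { intros x Hx. destruct (Rinf_spec (P x) (v a) (v x + x - x)) as [H1 H2].
    - exists x. lra.
    - intros y [s [Hs ->]]. specialize (Nv a s). lra.
    - split.
      + intros s Hs. apply H1. now exists s.
      + intros c Hc. apply H2. intros y [s [Hs ->]]. now apply Hc. }
  assert (Cw : cover E a b w).
  { repeat split.
    - intros x y Hx Hxy Hy. apply (Hw y); [lra|]. intros s Hs.
      destruct (Rle_dec s x).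
      + pose proof (proj1 (Hw x ltac:(lra)) s). lra.
      + pose proof (proj1 (Hw x ltac:(lra)) x). specialize (Nv x s). lra.
    - intros x y Hx Hxy Hy.
      enough (w y - (y - x) <= w x) by lra.
      apply (Hw x); [lra|]. intros s Hs. pose proof (proj1 (Hw y ltac:(lra)) s). lra.
    - intros t Ht HE. destruct (Sv t Ht HE) as [d [Hd Hs]]. exists d. split; trivial.
      intros x y Hx Hxy Hy H1 H2.
      enough (w x + (y - x) <= w y) by lra.
      apply (Hw y); [lra|]. intros s Hs'.
      destruct (Rle_dec s x).
      + pose proof (proj1 (Hw x ltac:(lra)) s). lra.
      + pose proof (proj1 (Hw x ltac:(lra)) x ltac:(lra)).
        assert (Rabs (s - t) < d) by (apply Rabs_def2 in H1, H2; apply Rabs_def1; lra).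
        specialize (Hs x s); lra. }
  pose proof (proj1 (om_spec E a b Hab) w Cw).
  pose proof (proj1 (Hw b ltac:(lra)) b ltac:(lra)).
  assert (v a <= w a).
  { apply (Hw a); [lra|]. intros s Hs. replace s with a by lra. lra. }
  lra.
Qed.

(* [ge] is the running infimum of [F - V] from the right. *)
Lemma envelope_r (F V : R -> R) (a b KF KV : R) : a <= b ->
  nondec F a b -> lipl KF F a b -> nondec V a b -> lipl KV V a b ->
  exists ge, nondec ge a b /\ nondec (fun x => F x - ge x) a b /\
    (F b - ge b) - (F a - ge a) <= V b - V a /\
    forall t s, a <= t -> t < s -> s <= b -> F s - F t < V s - V t ->
      exists d, 0 < d /\ forall x, a <= x <= b -> Rabs (x - t) < d -> ge x = ge t.
Proof.
  intros Hab NF LF NV LV.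
  set (P := fun x z => exists s, x <= s <= b /\ z = F s - V s).
  set (ge := fun x => Rinf (P x)).
  assert (Hw : forall x, a <= x <= b ->
    (forall s, x <= s <= b -> ge x <= F s - V s) /\
    (forall c, (forall s, x <= s <= b -> c <= F s - V s) -> c <= ge x)).
  { intros x Hx. destruct (Rinf_spec (P x) (F a - V b) (F x - V x)) as [H1 H2].
    - exists x. lra.
    - intros y [s [Hs ->]]. specialize (NF a s). specialize (NV s b). lra.
    - split.
      + intros s Hs. apply H1. now exists s.
      + intros c Hc. apply H2. intros y [s [Hs ->]]. now apply Hc. }
  assert (Ng : nondec ge a b).
  { intros x y Hx Hxy Hy. apply (Hw y); [lra|]. intros s Hs. apply (Hw x); lra. }
  assert (NFg : nondec (fun x => F x - ge x) a b).
  { intros x y Hx Hxy Hy.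
    enough (ge y - (F y - F x) <= ge x) by lra.
    apply (Hw x); [lra|]. intros s Hs. destruct (Rle_dec y s).
    - pose proof (proj1 (Hw y ltac:(lra)) s ltac:(lra)). specialize (NF x y). lra.
    - pose proof (proj1 (Hw y ltac:(lra)) y ltac:(lra)).
      specialize (NF x s). specialize (NV s y). lra. }
  exists ge. repeat split; trivial.
  - assert (F b - V b <= ge b).
    { apply (Hw b); [lra|]. intros s Hs. replace s with b by lra. lra. }
    pose proof (proj1 (Hw a ltac:(lra)) a ltac:(lra)). lra.
  - intros t s Ht Hts Hs Hlt.
    set (K := Rmax KF 0 + Rmax KV 0 + 1).
    pose proof (Rmax_l KF 0). pose proof (Rmax_r KF 0).
    pose proof (Rmax_l KV 0). pose proof (Rmax_r KV 0).
    (* As in the rising sun lemma: within this distance of [t] the Lipschitz bounds keep [F - V]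
       above its value at [s], so these points do not affect the running infimum, which is constant
       there. *)
    set (e := (V s - V t - (F s - F t)) / K).
    assert (HK : 0 < K) by (unfold K; lra).
    assert (He : 0 < e) by (apply Rdiv_lt_0_compat; unfold K; lra).
    assert (HeK : e * K = V s - V t - (F s - F t)) by (unfold e; field; lra).
    exists (Rmin e (s - t)). split; [apply Rmin_pos; lra|].
    pose proof (Rmin_l e (s - t)). pose proof (Rmin_r e (s - t)).
    assert (near : forall x, a <= x <= b -> Rabs (x - t) < e -> F s - V s < F x - V x).
    { intros x Hx Hd. apply Rabs_def2 in Hd.
      assert (F t - F x <= Rmax KF 0 * e).
      { destruct (Rle_dec x t).
        - specialize (LF x t ltac:(lra) ltac:(lra) ltac:(lra)).
          apply Rle_trans with (1 := LF). apply Rle_trans with (Rmax KF 0 * (t - x)).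
          + apply Rmult_le_compat_r; lra.
          + apply Rmult_le_compat_l; lra.
        - specialize (NF t x). assert (0 <= Rmax KF 0 * e) by (apply Rmult_le_pos; lra). lra. }
      assert (V x - V t <= Rmax KV 0 * e).
      { destruct (Rle_dec t x).
        - specialize (LV t x ltac:(lra) ltac:(lra) ltac:(lra)).
          apply Rle_trans with (1 := LV). apply Rle_trans with (Rmax KV 0 * (x - t)).
          + apply Rmult_le_compat_r; lra.
          + apply Rmult_le_compat_l; lra.
        - specialize (NV x t). assert (0 <= Rmax KV 0 * e) by (apply Rmult_le_pos; lra). lra. }
      assert (e * K = Rmax KF 0 * e + Rmax KV 0 * e + e) by (unfold K; ring). lra. }
    assert (const : forall u w, a <= u -> u <= w -> w <= b -> Rabs (u - t) < Rmin e (s - t) ->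
        Rabs (w - t) < Rmin e (s - t) -> ge w = ge u).
    { intros u w Hu Huw Hw' H5 H6. apply Rle_antisym; [|apply Ng; lra].
      apply (Hw u); [lra|]. intros z Hz. apply Rabs_def2 in H5, H6.
      destruct (Rle_dec w z).
      - apply (Hw w); lra.
      - apply Rle_trans with (F s - V s).
        + apply (Hw w); lra.
        + apply Rlt_le, near; [lra|]. apply Rabs_def1; lra. }
    assert (Htt : Rabs (t - t) < Rmin e (s - t)).
    { rewrite Rminus_diag, Rabs_R0. apply Rmin_pos; lra. }
    intros x Hx Hd. destruct (Rle_dec x t).
    + symmetry. apply const; lra.
    + apply const; lra.
Qed.

Lemma envelope_l (F V : R -> R) (a b KF KV : R) : a <= b ->
  nondec F a b -> lipl KF F a b -> nondec V a b -> lipl KV V a b ->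
  exists ge, nondec ge a b /\ nondec (fun x => F x - ge x) a b /\
    (F b - ge b) - (F a - ge a) <= V b - V a /\
    forall t s, a <= s -> s < t -> t <= b -> F t - F s < V t - V s ->
      exists d, 0 < d /\ forall x, a <= x <= b -> Rabs (x - t) < d -> ge x = ge t.
Proof.
  intros Hab NF LF NV LV.
  destruct (envelope_r (fun x => - F (- x)) (fun x => - V (- x)) (- b) (- a) KF KV)
    as [ge [N1 [N2 [D Hl]]]].
  - lra.
  - intros x y ? ? ?. specialize (NF (- y) (- x)). lra.
  - intros x y ? ? ?. specialize (LF (- y) (- x)). lra.
  - intros x y ? ? ?. specialize (NV (- y) (- x)). lra.
  - intros x y ? ? ?. specialize (LV (- y) (- x)). lra.
  - exists (fun x => - ge (- x)). repeat split.
    + intros x y ? ? ?. specialize (N1 (- y) (- x)). lra.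
    + intros x y ? ? ?. specialize (N2 (- y) (- x)).
      simpl in N2. rewrite !Ropp_involutive in N2. lra.
    + rewrite !Ropp_involutive in D. lra.
    + intros t s Hs Hst Ht Hlt.
      destruct (Hl (- t) (- s)) as [d [Hd Hc]]; try lra.
      { rewrite !Ropp_involutive. lra. }
      exists d. split; trivial. intros x Hx Hxd. f_equal. apply Hc; [lra|].
      replace (- x - - t) with (- (x - t)) by ring. now rewrite Rabs_Ropp.
Qed.

(** * Null sets, kinks of monotone functions, Lebesgue density *)

Definition null (E : R -> Prop) (a b : R) : Prop :=
  forall eps, 0 < eps -> exists v, nondec v a b /\ steep v E a b /\ v b - v a <= eps.

Lemma om_null E a b : a <= b -> om E a b <= 0 -> null E a b.
Proof.
  intros Hab H0 eps He. destruct (om_approx E a b eps) as [v [[N [L S]] Hv]]; trivial.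
  exists v. repeat split; trivial. lra.
Qed.

Lemma null_incl (E E' : R -> Prop) a b :
  (forall t, a <= t <= b -> E' t -> E t) -> null E a b -> null E' a b.
Proof.
  intros Hi HE eps He. destruct (HE eps He) as [v [N [S Hv]]].
  exists v. repeat split; trivial. intros t Ht HEt. apply S; auto.
Qed.

Lemma null_point c a b : a <= b -> null (fun t => t = c) a b.
Proof.
  intros Hab eps He. exists (fun x => Rmax (- (eps / 2)) (Rmin (eps / 2) (x - c))).
  repeat split.
  - intros x y _ Hxy _. apply Rle_max_compat_l. apply Rle_min_compat_l. lra.
  - intros t Ht ->. exists (eps / 2). split; [lra|].
    intros x y _ Hxy _ H1 H2. apply Rabs_def2 in H1, H2.
    rewrite !(Rmin_right (eps / 2)) by lra. rewrite !Rmax_right by lra. lra.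
  - pose proof (Rmax_l (- (eps / 2)) (Rmin (eps / 2) (a - c))).
    assert (Rmax (- (eps / 2)) (Rmin (eps / 2) (b - c)) <= eps / 2); [|lra].
    apply Rmax_lub; [lra|apply Rmin_l].
Qed.

(** A series of functions of growth at most [eps / 2 * (/ 2) ^ n] is steep wherever one of its terms
    is, the others being nondecreasing. Such a sum need not be 1-Lipschitz, which is why [null]
    omits that condition; [steep_cover] makes up for it. *)
Lemma null_union (E : nat -> R -> Prop) a b : a <= b ->
  (forall n, null (E n) a b) -> null (fun t => exists n, E n t) a b.
Proof.
  intros Hab HE eps He.
  assert (Hpos : forall n, 0 < eps / 2 * (/ 2) ^ n).
  { intros n. apply Rmult_lt_0_compat; [lra|]. apply pow_lt; lra. }
  assert (Hv : forall n, exists v, nondec v a b /\ steep v (E n) a b /\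
             v b - v a <= eps / 2 * (/ 2) ^ n) by (intros n; now apply HE).
  apply ClassicalChoice.choice in Hv. destruct Hv as [v Hv].
  (* Clamping to [[a, b]] makes the series converge at every real [x]. *)
  set (c := fun x => Rmax a (Rmin b x)).
  assert (Hc : forall x, a <= c x <= b).
  { intros x. unfold c. split; [apply Rmax_l|]. apply Rmax_lub; trivial. apply Rmin_l. }
  assert (Hcx : forall x, a <= x <= b -> c x = x).
  { intros x Hx. unfold c. rewrite Rmin_right, Rmax_right; lra. }
  set (u := fun x n => v n (c x) - v n a).
  assert (Hu : forall x n, 0 <= u x n <= eps / 2 * (/ 2) ^ n).
  { intros x n. unfold u. destruct (Hv n) as [N [_ B]]. specialize (Hc x).
    pose proof (N a (c x)). pose proof (N (c x) b). lra. }
  assert (Hg : is_series (fun n => eps / 2 * (/ 2) ^ n) (eps / 2 * / (1 - / 2))).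
  { apply (is_series_scal_l (eps / 2) (fun n => (/ 2) ^ n) (/ (1 - / 2))).
    apply is_series_geom. rewrite Rabs_pos_eq; lra. }
  assert (Hex : forall x, ex_series (u x)).
  { intros x. apply (ex_series_le (u x) (fun n => eps / 2 * (/ 2) ^ n)).
    - intros n. unfold norm; simpl. unfold abs; simpl.
      rewrite Rabs_pos_eq; apply Hu.
    - now exists (eps / 2 * / (1 - / 2)). }
  assert (Hdiff : forall x y, Series (u y) - Series (u x) = Series (fun n => u y n - u x n)).
  { intros x y. symmetry. apply Series_minus; apply Hex. }
  assert (Hdex : forall x y, ex_series (fun n => u y n - u x n)).
  { intros x y. apply (ex_series_minus (u y) (u x)); apply Hex. }
  assert (Hle : forall (p q : nat -> R), (forall n, p n <= q n) -> ex_series p -> ex_series q ->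
            Series p <= Series q).
  { intros p q Hpq [lp Hp] [lq Hq]. rewrite (is_series_unique _ _ Hp), (is_series_unique _ _ Hq).
    apply (is_lim_seq_le (sum_n p) (sum_n q) lp lq); trivial.
    intros n. apply sum_n_m_le. trivial. }
  assert (Hnd : forall n x y, a <= x -> x <= y -> y <= b -> u x n <= u y n).
  { intros n x y Hx Hxy Hy. unfold u. rewrite !Hcx by lra.
    destruct (Hv n) as [N _]. specialize (N x y). lra. }
  exists (fun x => Series (u x)). repeat split.
  - intros x y Hx Hxy Hy. apply Hle; trivial. intros n. now apply Hnd.
  - intros t Ht [n HEn]. destruct (Hv n) as [N [S _]].
    destruct (S t Ht HEn) as [d [Hd Hs]]. exists d. split; trivial.
    intros x y Hx Hxy Hy H1 H2. rewrite Hdiff.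
    specialize (Hs x y Hx Hxy Hy H1 H2).
    apply Rle_trans with (u y n - u x n); [unfold u; rewrite !Hcx by lra; lra|].
    rewrite (Series_incr_n _ (Datatypes.S n)); [|lia|apply Hdex]. simpl pred.
    assert (0 <= Series (fun k => u y (Datatypes.S n + k)%nat - u x (Datatypes.S n + k)%nat)).
    { replace 0 with (Series (fun k => 0 * 0)) by (rewrite Series_scal_l; ring).
      apply Hle.
      - intros k. specialize (Hnd (Datatypes.S n + k)%nat x y Hx Hxy Hy). lra.
      - exists 0. apply (is_series_ext (fun _ => 0)); [intros; symmetry; apply Rmult_0_l|].
        apply is_series_Reals. intros e Hepos. exists 0%nat. intros m _.
        rewrite sum_cte. unfold R_dist. rewrite Rmult_0_l, Rminus_diag, Rabs_R0. trivial.
      - apply (ex_series_incr_n (fun k => u y k - u x k)). apply Hdex. }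
    assert (u y n - u x n <= sum_f_R0 (fun k => u y k - u x k) n); [|lra].
    destruct n as [|n]; simpl; [lra|].
    assert (0 <= sum_f_R0 (fun k => u y k - u x k) n); [|lra].
    apply cond_pos_sum. intros k. specialize (Hnd k x y Hx Hxy Hy). lra.
  - rewrite Hdiff. apply Rle_trans with (Series (fun n => eps / 2 * (/ 2) ^ n)).
    + apply Hle; trivial.
      * intros n. pose proof (Hu a n). pose proof (Hu b n). lra.
      * now exists (eps / 2 * / (1 - / 2)).
    + rewrite (is_series_unique _ _ Hg). lra.
Qed.

Lemma null_union2 (E E' : R -> Prop) a b : null E a b -> null E' a b ->
  null (fun t => E t \/ E' t) a b.
Proof.
  intros H1 H2 eps He.
  destruct (H1 (eps / 2)) as [v [N [S D]]]; [lra|].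
  destruct (H2 (eps / 2)) as [v' [N' [S' D']]]; [lra|].
  exists (fun x => v x + v' x). repeat split.
  - intros x y ? ? ?. specialize (N x y). specialize (N' x y). lra.
  - intros t Ht [HE|HE].
    + destruct (S t Ht HE) as [d [Hd Hs]]. exists d; split; trivial. intros x y ? ? ? ? ?.
      assert (y - x <= v y - v x) by (apply Hs; trivial).
      assert (v' x <= v' y) by (apply N'; trivial). lra.
    + destruct (S' t Ht HE) as [d [Hd Hs]]. exists d; split; trivial. intros x y ? ? ? ? ?.
      assert (y - x <= v' y - v' x) by (apply Hs; trivial).
      assert (v x <= v y) by (apply N; trivial). lra.
  - lra.
Qed.

Lemma om_le_mod_null (E N : R -> Prop) v a b : a <= b -> null N a b ->
  nondec v a b -> steep v (fun t => E t /\ ~ N t) a b -> om E a b <= v b - v a.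
Proof.
  intros Hab HN Nv Sv. apply le_epsilon. intros eps He.
  destruct (HN eps He) as [w [Nw [Sw Dw]]].
  enough (om E a b <= (v b + w b) - (v a + w a)) by lra.
  apply (steep_cover E a b (fun x => v x + w x)); trivial.
  - intros x y ? ? ?. specialize (Nv x y). specialize (Nw x y). lra.
  - intros t Ht HE. destruct (classic (N t)) as [Hn|Hn].
    + destruct (Sw t Ht Hn) as [d [Hd Hs]]. exists d; split; trivial. intros x y ? ? ? ? ?.
      assert (y - x <= w y - w x) by (apply Hs; trivial).
      assert (v x <= v y) by (apply Nv; trivial). lra.
    + destruct (Sv t Ht (conj HE Hn)) as [d [Hd Hs]]. exists d; split; trivial. intros x y ? ? ? ? ?.
      assert (y - x <= v y - v x) by (apply Hs; trivial).
      assert (w x <= w y) by (apply Nw; trivial). lra.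
Qed.
(** At these points the lower right derivate of [f] is at most [q] and the upper left one at least
    [q']. Let [v0] nearly realise the outer measure of their set [A]. To the right [f] falls short
    of [q * v0], so the envelope [g1] is constant near [A], and [f - g1] keeps the increments of [f]
    there with a total growth of at most [q * (om A + eps)]. To the left this remainder outgrows
    [q' * x], so the same device gives [q' * x - g2], of slope [q'] near [A] and of no larger total
    growth. Hence [q' * om A <= q * (om A + eps)], and [om A] vanishes. *)
Lemma kink_null f a b K q q' : a <= b -> 0 < q -> q < q' -> nondec f a b -> lipl K f a b ->
  null (fun t =>
    (forall d, 0 < d -> exists s, t < s <= b /\ s - t < d /\ f s - f t < q * (s - t)) /\
    (forall d, 0 < d -> exists s, a <= s < t /\ t - s < d /\ q' * (t - s) < f t - f s)) a b.
Proof.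
  intros Hab Hq Hqq Nf Lf. set (A := fun t => _). apply om_null; trivial.
  enough (key : forall eps, 0 < eps -> q' * om A a b <= q * (om A a b + eps)).
  { apply Rnot_lt_le. intros Hpos.
    assert (Hr : 0 < (q' - q) / q * om A a b) by (apply Rmult_lt_0_compat; trivial; apply Rdiv_lt_0_compat; lra).
    specialize (key ((q' - q) / q * om A a b / 2) ltac:(lra)).
    assert (q * ((q' - q) / q * om A a b / 2) = (q' - q) * om A a b / 2) by (field; lra).
    assert (0 < (q' - q) * om A a b) by (apply Rmult_lt_0_compat; lra). lra. }
  intros eps He. destruct (om_approx A a b eps Hab He) as [v0 [[N0 [L0 S0]] D0]].
  destruct (envelope_r f (fun x => q * v0 x) a b K q) as [g1 [Ng1 [Nf1 [Df1 C1]]]]; trivial.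
  { intros x y ? ? ?. apply Rmult_le_compat_l; [lra|]. apply N0; trivial. }
  { intros x y ? ? ?. rewrite <- Rmult_minus_distr_l. apply Rmult_le_compat_l; [lra|].
    rewrite <- (Rmult_1_l (y - x)). apply L0; trivial. }
  destruct (envelope_l (fun x => q' * x) (fun x => f x - g1 x) a b q' K) as [g2 [Ng2 [Nf2 [Df2 C2]]]]; trivial.
  { intros x y ? ? ?. apply Rmult_le_compat_l; lra. }
  { intros x y ? ? ?. lra. }
  { intros x y ? ? ?. specialize (Ng1 x y). specialize (Lf x y). lra. }
  assert (Hom : om A a b <= (q' * b - g2 b) / q' - (q' * a - g2 a) / q').
  { apply (steep_cover A a b (fun x => (q' * x - g2 x) / q')); trivial.
    - intros x y Hx Hxy Hy. apply Rmult_le_compat_r; [apply Rlt_le, Rinv_0_lt_compat; lra|].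
      apply Nf2; trivial.
    - intros t Ht HA. destruct HA as [Hr Hl].
      destruct (S0 t Ht (conj Hr Hl)) as [d0 [Hd0 Hs0]].
      destruct (Hr d0 Hd0) as [s [Hs [Hsd Hfs]]].
      assert (q * (s - t) <= q * (v0 s - v0 t)).
      { apply Rmult_le_compat_l; [lra|]. apply Hs0; try lra.
        - rewrite Rminus_diag, Rabs_R0. trivial.
        - rewrite Rabs_pos_eq; lra. }
      destruct (C1 t s) as [d1 [Hd1 Hc1]]; try lra.
      destruct (Hl d1 Hd1) as [s' [Hs' [Hsd' Hfs']]].
      destruct (C2 t s') as [d2 [Hd2 Hc2]]; try lra.
      { rewrite (Hc1 s'); [lra|lra|]. rewrite Rabs_left; lra. }
      exists d2. split; trivial. intros x y Hx Hxy Hy Hx2 Hy2.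
      rewrite (Hc2 x), (Hc2 y) by (trivial; lra). apply Req_le. field. lra. }
  assert (E1 : (q' * b - g2 b) / q' - (q' * a - g2 a) / q' = (q' * b - g2 b - (q' * a - g2 a)) / q')
    by (field; lra).
  rewrite E1 in Hom.
  assert (Hq'0 : q' * om A a b <= q' * b - g2 b - (q' * a - g2 a)).
  { apply Rmult_le_compat_l with (r := q') in Hom; [|lra].
    replace (q' * ((q' * b - g2 b - (q' * a - g2 a)) / q')) with (q' * b - g2 b - (q' * a - g2 a)) in Hom
      by (field; lra). trivial. }
  assert (q * (v0 b - v0 a) <= q * (om A a b + eps)) by (apply Rmult_le_compat_l; lra).
  lra.
Qed.

Lemma om_nondec E a b : nondec (fun x => om E a x) a b.
Proof. intros x y ? ? ?. rewrite (om_add E a x y) by lra. pose proof (om_ge0 E x y). lra. Qed.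

Lemma om_lipl E a b : lipl 1 (fun x => om E a x) a b.
Proof. intros x y ? ? ?. rewrite (om_add E a x y) by lra. pose proof (om_le E x y). lra. Qed.

Lemma cover_minus_om E a b w : cover E a b w -> nondec (fun x => w x - om E a x) a b.
Proof.
  intros [N [L S]] x y Hx Hxy Hy. rewrite (om_add E a x y) by lra.
  assert (om E x y <= w y - w x); [|lra].
  apply (proj1 (om_spec E x y Hxy) w). repeat split.
  - intros ? ? ? ? ?; apply N; lra.
  - intros ? ? ? ? ?; apply L; lra.
  - intros t Ht HE. destruct (S t) as [d [Hd Hs]]; [lra|trivial|].
    exists d; split; trivial. intros; apply Hs; lra.
Qed.

(** Let [A] be an exceptional set, [v0] a nearly optimal cover of [A] and [w] one of [E]. The
    envelope [g] of [om E] against [q * v0] is constant near [A], so [w - g] is still steep there.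
    Its growth is that of [w - om E], at most [eps], plus that of [om E - g], at most
    [q * (om A + eps)]. Thus [om A <= eps + q * (om A + eps)] with [q < 1]. *)
Lemma density_null E a b q : a <= b -> 0 < q < 1 ->
  null (fun t => E t /\
    forall d, 0 < d -> exists s, t < s <= b /\ s - t < d /\ om E t s < q * (s - t)) a b /\
  null (fun t => E t /\
    forall d, 0 < d -> exists s, a <= s < t /\ t - s < d /\ om E s t < q * (t - s)) a b.
Proof.
  intros Hab Hq.
  assert (main : forall A : R -> Prop, (forall t, A t -> E t) ->
    (forall v0, nondec v0 a b -> lipl 1 v0 a b -> steep v0 A a b ->
     exists g, nondec g a b /\ nondec (fun x => om E a x - g x) a b /\
       (om E a b - g b) - (om E a a - g a) <= q * (v0 b - v0 a) /\
       forall t, a <= t <= b -> A t ->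
         exists d, 0 < d /\ forall x, a <= x <= b -> Rabs (x - t) < d -> g x = g t) ->
    null A a b).
  { intros A HAE HA. apply om_null; trivial.
    enough (key : forall eps, 0 < eps -> om A a b <= eps + q * (om A a b + eps)).
    { apply Rnot_lt_le. intros Hpos.
      assert (Hp : 0 < (1 - q) * om A a b) by (apply Rmult_lt_0_compat; lra).
      specialize (key ((1 - q) * om A a b / 4) ltac:(lra)).
      assert (q * ((1 - q) * om A a b / 4) <= 1 * ((1 - q) * om A a b / 4))
        by (apply Rmult_le_compat_r; lra). lra. }
    intros eps He. destruct (om_approx A a b eps Hab He) as [v0 [[N0 [L0 S0]] D0]].
    destruct (om_approx E a b eps Hab He) as [w [Cw Dw]].
    destruct (HA v0 N0 L0 S0) as [g [Ng [Ng' [Dg Cg]]]].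
    pose proof (cover_minus_om E a b w Cw) as Nw. destruct Cw as [N [L S]].
    assert (Hom : om A a b <= (w b - g b) - (w a - g a)).
    { apply (steep_cover A a b (fun x => w x - g x)); trivial.
      - intros x y ? ? ?. specialize (Nw x y). specialize (Ng' x y). lra.
      - intros t Ht HAt. destruct (S t Ht (HAE t HAt)) as [d [Hd Hs]].
        destruct (Cg t Ht HAt) as [d' [Hd' Hc]].
        exists (Rmin d d'). split; [apply Rmin_pos; trivial|].
        intros x y Hx Hxy Hy H1 H2. pose proof (Rmin_l d d'). pose proof (Rmin_r d d').
        rewrite (Hc x), (Hc y) by lra. 
        assert (y - x <= w y - w x) by (apply Hs; lra). lra. }
    assert (q * (v0 b - v0 a) <= q * (om A a b + eps)) by (apply Rmult_le_compat_l; lra).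
    pose proof (om_le E a a). pose proof (om_ge0 E a a).
    specialize (Nw a b). lra. }
  assert (LV : forall v0, lipl 1 v0 a b -> lipl q (fun x => q * v0 x) a b).
  { intros v0 L0 x y ? ? ?. rewrite <- Rmult_minus_distr_l. apply Rmult_le_compat_l; [lra|].
    rewrite <- (Rmult_1_l (y - x)). apply L0; trivial. }
  assert (NV : forall v0, nondec v0 a b -> nondec (fun x => q * v0 x) a b).
  { intros v0 N0 x y ? ? ?. apply Rmult_le_compat_l; [lra|]. apply N0; trivial. }
  split; apply main; try (now intros t [HE _]); intros v0 N0 L0 S0.
  - destruct (envelope_r (fun x => om E a x) (fun x => q * v0 x) a b 1 q)
      as [g [Ng [Ng' [Dg Cg]]]]; auto using om_nondec, om_lipl.
    exists g. repeat split; trivial; [lra|].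
    intros t Ht HA. destruct (S0 t Ht HA) as [d [Hd Hs]].
    destruct HA as [HE HA]. destruct (HA d Hd) as [s [H1 [H2 H3]]].
    apply (Cg t s); try lra. rewrite (om_add E a t s) by lra.
    assert (q * (s - t) <= q * (v0 s - v0 t)); [|lra].
    apply Rmult_le_compat_l; [lra|]. apply Hs; try lra.
    + rewrite Rminus_diag, Rabs_R0. trivial.
    + rewrite Rabs_pos_eq; lra.
  - destruct (envelope_l (fun x => om E a x) (fun x => q * v0 x) a b 1 q)
      as [g [Ng [Ng' [Dg Cg]]]]; auto using om_nondec, om_lipl.
    exists g. repeat split; trivial; [lra|].
    intros t Ht HA. destruct (S0 t Ht HA) as [d [Hd Hs]].
    destruct HA as [HE HA]. destruct (HA d Hd) as [s [H1 [H2 H3]]].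
    apply (Cg t s); try lra. rewrite (om_add E a s t) by lra.
    assert (q * (t - s) <= q * (v0 t - v0 s)); [|lra].
    apply Rmult_le_compat_l; [lra|]. apply Hs; try lra.
    + rewrite Rabs_left; lra.
    + rewrite Rminus_diag, Rabs_R0. trivial.
Qed.

(** Built from the right end leftwards, in the order of the backward walk. The last index adds up
    the deficits, length minus outer measure of the class of the tag, that is, the inner measure of
    the complement of the class. *)
Inductive part (E : R -> R -> Prop) (h b : R) : R -> R -> Prop :=
| part_nil : part E h b b 0
| part_cons : forall x y s d, part E h b y d -> x < y -> y - x <= h -> x <= s <= y ->
    part E h b x (d + (y - x - om (E s) x y)).

Lemma finite_cost_cover (A : nat -> R -> Prop) a b N eps : (forall n, null (A n) a b) -> 0 < eps ->
  exists v, nondec v a b /\ v b - v a <= eps /\ forall n, (n < N)%nat -> steep v (A n) a b.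
Proof.
  intros HA He.
  assert (H : null (fun t => exists n, (n < N)%nat /\ A n t) a b).
  { clear He eps. induction N as [|N IH].
    - intros eps He. exists (fun _ => 0). repeat split.
      + intros x y _ _ _. lra.
      + intros t _ [n [Hn _]]. lia.
      + lra.
    - apply (null_incl (fun t => (exists n, (n < N)%nat /\ A n t) \/ A N t)).
      + intros t _ [n [Hn Ht]]. destruct (Nat.eq_dec n N) as [->|]; [now right|].
        left. exists n. split; trivial; lia.
      + apply null_union2; trivial. }
  destruct (H eps He) as [v [Nv [Sv Dv]]]. exists v. repeat split; trivial.
  intros n Hn t Ht HAt. apply Sv; trivial. now exists n.
Qed.

(* Cousin's lemma: a tag is either a density point of its class or lies in a
   null set whose cover pays for the interval. *)
Lemma schedule (code : R -> nat) (N : nat) a b h eps :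
  a <= b -> 0 < h -> 0 < eps -> (forall t, (code t < N)%nat) ->
  exists d, d <= eps /\ part (fun s t => code t = code s) h b a d.
Proof.
  intros Hab Hh He Hcode.
  (* [1 - th] is the density required of a tag in its class. The deficits of such intervals add up
     to at most [th * (b - a) <= eps / 2]; the exceptional tags on either side are allowed
     [eps / 4]. *)
  set (th := Rmin (/ 2) (eps / (2 * (b - a + 1)))).
  assert (Hth0 : 0 < th).
  { unfold th. apply Rmin_pos; [lra|]. apply Rdiv_lt_0_compat; lra. }
  assert (Hth1 : th <= / 2) by apply Rmin_l.
  assert (Hthb : th * (b - a) <= eps / 2).
  { apply Rle_trans with (eps / (2 * (b - a + 1)) * (b - a)).
    - apply Rmult_le_compat_r; [lra|apply Rmin_r].
    - replace (eps / (2 * (b - a + 1)) * (b - a)) with (eps / 2 * ((b - a) / (b - a + 1))) by (field; lra).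
      rewrite <- (Rmult_1_r (eps / 2)) at 2. apply Rmult_le_compat_l; [lra|].
      apply Rmult_le_reg_r with (b - a + 1); [lra|]. field_simplify; lra. }
  set (Ec := fun n t => code t = n).
  assert (Hnull := fun n => density_null (Ec n) a b (1 - th) Hab ltac:(lra)).
  destruct (finite_cost_cover _ a b N (eps / 4) (fun n => proj1 (Hnull n)) ltac:(lra))
    as [v1 [N1 [D1 S1]]].
  destruct (finite_cost_cover _ a b N (eps / 4) (fun n => proj2 (Hnull n)) ltac:(lra))
    as [v2 [N2 [D2 S2]]].
  (* A potential of total growth at most [eps] that pays for the deficit of every sufficiently short
     interval tagged by one of its endpoints. *)
  set (Phi := fun x => th * x + v1 x + v2 x).
  set (E := fun s t => code t = code s).
  assert (HE : forall s x y, om (E s) x y = om (Ec (code s)) x y) by reflexivity.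
  assert (right : forall c, a <= c <= b -> exists d, 0 < d /\ forall x, c < x <= b -> x - c < d ->
            x - c - om (E c) c x <= Phi x - Phi c).
  { intros c Hc. destruct (classic (forall d, 0 < d ->
      exists s, c < s <= b /\ s - c < d /\ om (Ec (code c)) c s < (1 - th) * (s - c))) as [Hy|Hn].
    - destruct (S1 (code c) (Hcode c) c Hc (conj eq_refl Hy)) as [d [Hd Hs]].
      exists d. split; trivial. intros x Hx Hxd.
      assert (x - c <= v1 x - v1 c).
      { apply Hs; try lra. - rewrite Rminus_diag, Rabs_R0; trivial. - rewrite Rabs_pos_eq; lra. }
      specialize (N2 c x). pose proof (om_ge0 (E c) c x ltac:(lra)).
      assert (0 <= th * (x - c)) by (apply Rmult_le_pos; lra). unfold Phi. lra.
    - apply not_all_ex_not in Hn. destruct Hn as [d Hn]. apply imply_to_and in Hn.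
      destruct Hn as [Hd Hn]. exists d. split; trivial. intros x Hx Hxd.
      rewrite HE. assert ((1 - th) * (x - c) <= om (Ec (code c)) c x).
      { apply Rnot_lt_le. intros Hlt. apply Hn. exists x. lra. }
      specialize (N1 c x). specialize (N2 c x). unfold Phi. lra. }
  assert (left : forall c, a <= c <= b -> exists d, 0 < d /\ forall x, a <= x < c -> c - x < d ->
            c - x - om (E c) x c <= Phi c - Phi x).
  { intros c Hc. destruct (classic (forall d, 0 < d ->
      exists s, a <= s < c /\ c - s < d /\ om (Ec (code c)) s c < (1 - th) * (c - s))) as [Hy|Hn].
    - destruct (S2 (code c) (Hcode c) c Hc (conj eq_refl Hy)) as [d [Hd Hs]].
      exists d. split; trivial. intros x Hx Hxd.
      assert (c - x <= v2 c - v2 x).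
      { apply Hs; try lra. - rewrite Rabs_left; lra. - rewrite Rminus_diag, Rabs_R0; trivial. }
      specialize (N1 x c). pose proof (om_ge0 (E c) x c ltac:(lra)).
      assert (0 <= th * (c - x)) by (apply Rmult_le_pos; lra). unfold Phi. lra.
    - apply not_all_ex_not in Hn. destruct Hn as [d Hn]. apply imply_to_and in Hn.
      destruct Hn as [Hd Hn]. exists d. split; trivial. intros x Hx Hxd.
      rewrite HE. assert ((1 - th) * (c - x) <= om (Ec (code c)) x c).
      { apply Rnot_lt_le. intros Hlt. apply Hn. exists x. lra. }
      specialize (N1 x c). specialize (N2 x c). unfold Phi. lra. }
  (* The points reachable from [b] within the budget. Their infimum [c] is itself reachable, by an
     interval tagged by its left endpoint [c]; an interval tagged by its right endpoint [c] then
     goes below [c], unless [c = a]. *)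
  set (Q := fun x => a <= x <= b /\ exists d, d <= Phi b - Phi x /\ part E h b x d).
  assert (Qb : Q b).
  { split; [lra|]. exists 0. split; [lra|constructor]. }
  assert (Qlb : forall y, Q y -> a <= y) by (intros y [Hy _]; lra).
  destruct (Rinf_spec Q a b Qb Qlb) as [I1 I2]. set (c := Rinf Q) in *.
  assert (Hc : a <= c <= b) by (split; [apply I2; auto|apply I1; trivial]).
  assert (Qc : Q c).
  { destruct (right c Hc) as [d [Hd Hr]].
    destruct (Rinf_approx Q a b (Rmin d h) Qb Qlb) as [y [Qy Hy]]; [apply Rmin_pos; lra|].
    fold c in Hy. pose proof (Rmin_l d h). pose proof (Rmin_r d h).
    pose proof (I1 y Qy). destruct (Req_dec y c) as [->|Hne]; [trivial|].
    destruct Qy as [Hyab [d0 [Hd0 Py]]]. split; trivial.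
    exists (d0 + (y - c - om (E c) c y)). split.
    - specialize (Hr y ltac:(lra) ltac:(lra)). lra.
    - apply part_cons; trivial; lra. }
  destruct (Req_dec c a) as [Hca|Hca].
  - destruct Qc as [_ [d [Hd Pd]]]. rewrite Hca in *. exists d. split; trivial.
    unfold Phi in Hd. lra.
  - exfalso. destruct (left c Hc) as [d [Hd Hl]].
    set (x := c - Rmin (Rmin d h) (c - a) / 2).
    assert (H0 : 0 < Rmin (Rmin d h) (c - a)) by (repeat apply Rmin_pos; lra).
    pose proof (Rmin_l (Rmin d h) (c - a)). pose proof (Rmin_r (Rmin d h) (c - a)).
    pose proof (Rmin_l d h). pose proof (Rmin_r d h).
    destruct Qc as [_ [d0 [Hd0 Pc]]].
    assert (Qx : Q x).
    { split; [unfold x; lra|]. exists (d0 + (c - x - om (E c) x c)). split.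
      - specialize (Hl x). unfold x in *. lra.
      - apply part_cons; trivial; unfold x; lra. }
    specialize (I1 x Qx). unfold x in I1. lra.
Qed.

(** * Continuous functions touched from above *)

Definition contin_on (y : R -> R) (a b : R) : Prop :=
  forall t, a <= t <= b -> forall eps, 0 < eps ->
  exists d, 0 < d /\ forall s, a <= s <= b -> Rabs (s - t) < d -> Rabs (y s - y t) < eps.

Definition touches (y : R -> R) (a b t0 : R) (z z1 : R -> R) : Prop :=
  (forall t, is_derive z t (z1 t)) /\ (forall t, continuous z1 t) /\
  exists d, 0 < d /\ forall t, a < t < b -> Rabs (t - t0) < d -> y t - z t <= y t0 - z t0.

Lemma contin_on_max y a b : a <= b -> contin_on y a b ->
  exists m, a <= m <= b /\ forall t, a <= t <= b -> y t <= y m.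
Proof.
  intros Hab Hy. set (c := fun x => Rmax a (Rmin b x)).
  assert (Hc : forall x, a <= c x <= b).
  { intros x. unfold c. split; [apply Rmax_l|]. apply Rmax_lub; trivial. apply Rmin_l. }
  assert (Hcx : forall x, a <= x <= b -> c x = x).
  { intros x Hx. unfold c. rewrite Rmin_right, Rmax_right; lra. }
  destruct (continuity_ab_maj (fun x => y (c x)) a b Hab) as [m [Hm1 Hm2]].
  - intros x Hx e He. destruct (Hy x Hx e He) as [d [Hd Hs]]. exists d. split; trivial.
    intros z [_ Hz]. simpl in *. unfold R_dist in *. rewrite (Hcx x Hx). apply Hs; trivial.
    apply Rle_lt_trans with (2 := Hz). unfold c.
    destruct (Rle_dec z b); [rewrite (Rmin_right b z) by lra|rewrite (Rmin_left b z) by lra].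
    + destruct (Rle_dec a z); [rewrite Rmax_right by lra; lra|rewrite Rmax_left by lra].
      rewrite !Rabs_left1; lra.
    + rewrite Rmax_right by lra. rewrite !Rabs_pos_eq; lra.
  - exists m. split; trivial. intros t Ht. specialize (Hm1 t Ht). rewrite !Hcx in Hm1; trivial.
Qed.

Lemma le_of_derive_le (f g f1 g1 : R -> R) a b : a <= b ->
  (forall x, a <= x <= b -> is_derive f x (f1 x)) ->
  (forall x, a <= x <= b -> is_derive g x (g1 x)) ->
  (forall x, a <= x <= b -> f1 x <= g1 x) -> f b - f a <= g b - g a.
Proof.
  intros Hab Hf Hg Hle.
  destruct (MVT_gen (fun x => g x - f x) a b (fun x => g1 x - f1 x)) as [c [Hc1 Hc2]].
  - intros x Hx. rewrite Rmin_left, Rmax_right in Hx by lra.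
    apply (is_derive_minus g f); [apply Hg|apply Hf]; lra.
  - intros x Hx. rewrite Rmin_left, Rmax_right in Hx by lra.
    apply continuity_pt_filterlim, (ex_derive_continuous (fun x => g x - f x)).
    exists (g1 x - f1 x). apply (is_derive_minus g f); [apply Hg|apply Hf]; lra.
  - rewrite Rmin_left, Rmax_right in Hc1 by lra. specialize (Hle c Hc1).
    assert (0 <= (g1 c - f1 c) * (b - a)) by (apply Rmult_le_pos; lra). lra.
Qed.

Lemma antiderivative (f : R -> R) : (forall x, continuous f x) ->
  exists F, forall x, is_derive F x (f x).
Proof.
  intros Hf. exists (fun x => RInt f 0 x). intros x.
  apply (is_derive_RInt f (fun x => RInt f 0 x) 0 x); trivial.
  apply filter_forall. intros y. apply (RInt_correct f).
  apply (ex_RInt_continuous (V := R_CompleteNormedModule)). intros; apply Hf.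
Qed.

(* With [D tau] the excess of the difference quotient, the continuous even
   function [W s = sup_tau D tau * min 1 (2 |s| / |tau|)] dominates [D] on
   [|tau| <= 2 |s|], so that twice its primitive dominates [D tau * |tau|]. *)
Lemma touch_of_slope (y : R -> R) a b t0 p : a < t0 < b ->
  (forall eta, 0 < eta -> exists d, 0 < d /\ forall s, a < s < b -> Rabs (s - t0) < d ->
     y s - y t0 <= - p * (s - t0) + eta * Rabs (s - t0)) ->
  exists z z1, touches y a b t0 z z1 /\ z1 t0 = - p.
Proof.
  intros Ht0 Hsl. destruct (Hsl 1 ltac:(lra)) as [d0 [Hd0 H1]].
  set (V := fun tau => a < t0 + tau < b /\ Rabs tau < d0 /\ tau <> 0).
  set (D := fun tau => (y (t0 + tau) - y t0 + p * tau) / Rabs tau).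
  (* Suprema are taken as infima of the negatives. The value 0 keeps the set nonempty and makes [W]
     nonnegative. *)
  set (P := fun s x => x = 0 \/ exists tau, V tau /\ x = - (Rmax 0 (D tau) * Rmin 1 (2 * Rabs s / Rabs tau))).
  set (W := fun s => - Rinf (P s)).
  assert (HD : forall tau eta, V tau -> 0 < eta -> y (t0 + tau) - y t0 <= - p * tau + eta * Rabs tau ->
    0 <= Rmax 0 (D tau) <= eta).
  { intros tau eta [_ [_ Hn]] He Hle. split; [apply Rmax_l|]. apply Rmax_lub; [lra|].
    assert (0 < Rabs tau) by (apply Rabs_pos_lt; trivial).
    unfold D. apply Rmult_le_reg_r with (Rabs tau); trivial. field_simplify; lra. }
  assert (HD1 : forall tau, V tau -> 0 <= Rmax 0 (D tau) <= 1).
  { intros tau HV. apply HD; trivial; [lra|]. destruct HV as [Hv1 [Hv2 _]].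
    specialize (H1 (t0 + tau) Hv1). replace (t0 + tau - t0) with tau in H1 by ring. auto. }
  assert (Hm : forall s tau, V tau -> 0 <= Rmin 1 (2 * Rabs s / Rabs tau) <= 1).
  { intros s tau [_ [_ Hn]]. split; [|apply Rmin_l]. apply Rmin_glb; [lra|].
    apply Rmult_le_pos; [pose proof (Rabs_pos s); lra|].
    apply Rlt_le, Rinv_0_lt_compat, Rabs_pos_lt; trivial. }
  assert (HW : forall s, 0 <= W s /\
    (forall tau, V tau -> Rmax 0 (D tau) * Rmin 1 (2 * Rabs s / Rabs tau) <= W s) /\
    (forall c, 0 <= c -> (forall tau, V tau -> Rmax 0 (D tau) * Rmin 1 (2 * Rabs s / Rabs tau) <= c) -> W s <= c)).
  { intros s. destruct (Rinf_spec (P s) (-1) 0) as [I1 I2].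
    - now left.
    - intros x [->|[tau [HV ->]]]; [lra|]. specialize (HD1 tau HV). specialize (Hm s tau HV).
      assert (Rmax 0 (D tau) * Rmin 1 (2 * Rabs s / Rabs tau) <= 1 * 1) by (apply Rmult_le_compat; lra). lra.
    - repeat split.
      + unfold W. specialize (I1 0 ltac:(now left)). lra.
      + intros tau HV. unfold W.
        specialize (I1 (- (Rmax 0 (D tau) * Rmin 1 (2 * Rabs s / Rabs tau))) ltac:(right; exists tau; tauto)). lra.
      + intros c Hc Hall. unfold W. enough (- c <= Rinf (P s)) by lra. apply I2.
        intros x [->|[tau [HV ->]]]; [lra|]. specialize (Hall tau HV). lra. }
  assert (W1 : forall s, W s <= 1).
  { intros s. apply HW; [lra|]. intros tau HV. specialize (HD1 tau HV). specialize (Hm s tau HV).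
    assert (Rmax 0 (D tau) * Rmin 1 (2 * Rabs s / Rabs tau) <= 1 * 1) by (apply Rmult_le_compat; lra). lra. }
  assert (Wdom : forall s tau, V tau -> Rabs tau <= 2 * Rabs s -> Rmax 0 (D tau) <= W s).
  { intros s tau HV Hle. apply Rle_trans with (2 := proj1 (proj2 (HW s)) tau HV).
    rewrite Rmin_left; [lra|]. destruct HV as [_ [_ Hn]].
    assert (0 < Rabs tau) by (apply Rabs_pos_lt; trivial).
    apply Rmult_le_reg_r with (Rabs tau); trivial. field_simplify; lra. }
  assert (W0 : forall eta, 0 < eta -> exists d, 0 < d /\ forall s, Rabs s < d -> W s <= eta).
  { intros eta He. destruct (Hsl eta He) as [d [Hd H2]].
    exists (eta * d / 2). split.
    { apply Rmult_lt_0_compat; [apply Rmult_lt_0_compat; trivial|lra]. }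
    intros s Hs. apply HW; [lra|]. intros tau HV.
    specialize (HD1 tau HV). specialize (Hm s tau HV).
    destruct (Rlt_dec (Rabs tau) d) as [Hlt|Hge].
    - assert (HDe : 0 <= Rmax 0 (D tau) <= eta).
      { apply HD; trivial. destruct HV as [Hv1 _].
        specialize (H2 (t0 + tau) Hv1). replace (t0 + tau - t0) with tau in H2 by ring. auto. }
      rewrite <- (Rmult_1_r eta). apply Rmult_le_compat; lra.
    - rewrite <- (Rmult_1_l eta). apply Rmult_le_compat; try lra.
      apply Rle_trans with (1 := Rmin_r _ _). apply Rmult_le_reg_r with (Rabs tau); [lra|].
      field_simplify; [|lra]. assert (eta * d <= eta * Rabs tau) by (apply Rmult_le_compat_l; lra). lra. }
  (* [W] is nondecreasing in [|s|] and [W s / |s|] nonincreasing, as [min 1 (l * x) <= l * min 1 x]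
     for [l >= 1]. This is what makes a supremum of infinitely many functions continuous away from
     0. *)
  assert (Wmon : forall s s', 0 < Rabs s' <= Rabs s -> W s' <= W s <= Rabs s / Rabs s' * W s').
  { intros s s' Hss. split.
    - apply HW; [apply HW|]. intros tau HV. apply Rle_trans with (2 := proj1 (proj2 (HW s)) tau HV).
      apply Rmult_le_compat_l; [apply Rmax_l|]. apply Rle_min_compat_l.
      apply Rmult_le_compat_r; [|lra]. destruct HV as [_ [_ Hn]].
      apply Rlt_le, Rinv_0_lt_compat, Rabs_pos_lt; trivial.
    - assert (Hr : 1 <= Rabs s / Rabs s').
      { apply Rmult_le_reg_r with (Rabs s'); [lra|]. field_simplify; lra. }
      apply HW; [apply Rmult_le_pos; [lra|apply HW]|]. intros tau HV.
      apply Rle_trans with (Rabs s / Rabs s' * (Rmax 0 (D tau) * Rmin 1 (2 * Rabs s' / Rabs tau))).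
      + rewrite (Rmult_comm (Rabs s / Rabs s')), Rmult_assoc. apply Rmult_le_compat_l; [apply Rmax_l|].
        destruct HV as [_ [_ Hn]]. assert (0 < Rabs tau) by (apply Rabs_pos_lt; trivial).
        destruct (Rle_dec 1 (2 * Rabs s' / Rabs tau)).
        * rewrite (Rmin_left _ (2 * Rabs s' / Rabs tau)) by lra.
          pose proof (Rmin_l 1 (2 * Rabs s / Rabs tau)). lra.
        * rewrite (Rmin_right _ (2 * Rabs s' / Rabs tau)) by lra.
          apply Rle_trans with (1 := Rmin_r _ _). apply Req_le. field. lra.
      + apply Rmult_le_compat_l; [lra|]. apply (HW s'); trivial. }
  assert (Wcont : forall s0, continuous (fun s => sign s * (2 * W s)) s0).
  { intros s0. apply continuity_pt_filterlim. intros e He.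
    destruct (Req_dec s0 0) as [->|Hs0].
    - destruct (W0 (e / 4) ltac:(lra)) as [d [Hd H2]]. exists d. split; trivial.
      intros x [_ Hx]. simpl in *. unfold R_dist in *. rewrite Rminus_0_r in Hx.
      rewrite sign_0, Rmult_0_l, Rminus_0_r. specialize (H2 x Hx).
      pose proof (proj1 (HW x)). rewrite Rabs_mult, (Rabs_pos_eq (2 * W x)) by lra.
      assert (Rabs (sign x) <= 1).
      { destruct (Rtotal_order x 0) as [Hl|[->|Hl]].
        - rewrite sign_eq_m1, Rabs_left; lra.
        - rewrite sign_0, Rabs_R0; lra.
        - rewrite sign_eq_1, Rabs_pos_eq; lra. }
      assert (Rabs (sign x) * (2 * W x) <= 1 * (2 * W x)) by (apply Rmult_le_compat_r; lra). lra.
    - assert (Hp : 0 < Rabs s0) by (apply Rabs_pos_lt; trivial).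
      exists (Rmin (Rabs s0 / 2) (Rabs s0 * e / 8)). split.
      { apply Rmin_pos; [lra|]. assert (0 < Rabs s0 * e) by (apply Rmult_lt_0_compat; lra). lra. }
      intros x [_ Hx]. simpl in *. unfold R_dist in *.
      pose proof (Rmin_l (Rabs s0 / 2) (Rabs s0 * e / 8)).
      pose proof (Rmin_r (Rabs s0 / 2) (Rabs s0 * e / 8)).
      assert (Hss : sign x = sign s0).
      { destruct (Rdichotomy s0 0 Hs0).
        - rewrite (Rabs_left s0) in * by lra. apply Rabs_def2 in Hx. rewrite !sign_eq_m1; lra.
        - rewrite (Rabs_pos_eq s0) in * by lra. apply Rabs_def2 in Hx. rewrite !sign_eq_1; lra. }
      rewrite Hss, <- Rmult_minus_distr_l, Rabs_mult.
      assert (Hsg : Rabs (sign s0) = 1).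
      { destruct (Rdichotomy s0 0 Hs0).
        - rewrite sign_eq_m1, Rabs_left; lra.
        - rewrite sign_eq_1, Rabs_pos_eq; lra. }
      rewrite Hsg, Rmult_1_l, <- Rmult_minus_distr_l, Rabs_mult, (Rabs_pos_eq 2) by lra.
      assert (Hcl : forall u v, Rabs s0 / 2 <= Rabs u -> Rabs u <= Rabs v ->
                Rabs v - Rabs u <= Rabs s0 * e / 8 -> W v - W u <= e / 4 /\ W u <= W v).
      { intros u v Hu Huv Hd. destruct (Wmon v u) as [A B]; [lra|]. split; trivial.
        apply Rle_trans with ((Rabs v / Rabs u - 1) * W u); [lra|].
        apply Rle_trans with ((Rabs v / Rabs u - 1) * 1).
        - apply Rmult_le_compat_l; [|apply W1].
          assert (1 <= Rabs v / Rabs u); [|lra].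
          apply Rmult_le_reg_r with (Rabs u); [lra|]. field_simplify; lra.
        - apply Rmult_le_reg_r with (Rabs u); [lra|]. field_simplify; [|lra].
          assert (Rabs s0 / 2 * e <= Rabs u * e) by (apply Rmult_le_compat_r; lra). lra. }
      pose proof (Rabs_triang_inv2 x s0) as T.
      destruct (Rle_dec (Rabs x) (Rabs s0)) as [Hle|Hle].
      + rewrite Rabs_left1 in T by lra.
        destruct (Hcl x s0) as [A B]; try lra. rewrite Rabs_left1; lra.
      + rewrite Rabs_pos_eq in T by lra.
        destruct (Hcl s0 x) as [A B]; try lra. rewrite Rabs_pos_eq; lra. }
  destruct (antiderivative _ Wcont) as [F HF].
  (* Only the outer half [s / 2 <= |x| <= s] is used, where [D tau <= W x]; the factor 2 in the
     integrand makes up for the half discarded. *)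
  assert (HF' : forall s, 0 < s -> forall tau, V tau -> Rabs tau = s ->
            D tau * s <= F s - F 0 /\ D tau * s <= F (- s) - F 0).
  { intros s Hs tau HV Htau.
    assert (Hpos : forall x, 0 <= 2 * W x) by (intros x; pose proof (proj1 (HW x)); lra).
    assert (HDW : forall x, s / 2 <= Rabs x -> D tau <= W x).
    { intros x Hx. apply Rle_trans with (1 := Rmax_r 0 _). apply Wdom; trivial. lra. }
    assert (lin : forall c x : R, is_derive (fun x => c * x) x c).
    { intros c x. auto_derive; trivial. ring. }
    split.
    - pose proof (le_of_derive_le (fun x => (2 * D tau) * x) F (fun _ => 2 * D tau) _ (s / 2) s ltac:(lra)
        (fun x _ => lin _ x) (fun x _ => HF x)) as A.
      pose proof (le_of_derive_le (fun x => 0 * x) F (fun _ => 0) _ 0 (s / 2) ltac:(lra)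
        (fun x _ => lin _ x) (fun x _ => HF x)) as B.
      cbv beta in A, B.
      specialize (A ltac:(intros x Hx; rewrite sign_eq_1 by lra; specialize (HDW x); rewrite Rabs_pos_eq in HDW by lra; lra)).
      specialize (B ltac:(intros x Hx; destruct (Req_dec x 0) as [->|]; [rewrite sign_0; lra|rewrite sign_eq_1 by lra; specialize (Hpos x); lra])).
      lra.
    - pose proof (le_of_derive_le F (fun x => - (2 * D tau) * x) _ (fun _ => - (2 * D tau)) (- s) (- (s / 2)) ltac:(lra)
        (fun x _ => HF x) (fun x _ => lin _ x)) as A.
      pose proof (le_of_derive_le F (fun x => 0 * x) _ (fun _ => 0) (- (s / 2)) 0 ltac:(lra)
        (fun x _ => HF x) (fun x _ => lin _ x)) as B.
      cbv beta in A, B.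
      specialize (A ltac:(intros x Hx; rewrite sign_eq_m1 by lra; specialize (HDW x); rewrite Rabs_left in HDW by lra; lra)).
      specialize (B ltac:(intros x Hx; destruct (Req_dec x 0) as [->|]; [rewrite sign_0; lra|rewrite sign_eq_m1 by lra; specialize (Hpos x); lra])).
      lra. }
  exists (fun t => - p * (t - t0) + F (t - t0)).
  exists (fun t => - p + sign (t - t0) * (2 * W (t - t0))).
  split; [split; [|split]|].
  - intros t. apply (is_derive_plus (fun t => - p * (t - t0)) (fun t => F (t - t0))).
    + auto_derive; trivial. ring.
    + evar_last.
      * apply (is_derive_comp F (fun t => t - t0)); [apply HF|].
        apply (is_derive_minus (fun t => t) (fun _ => t0)); [apply @is_derive_id|apply @is_derive_const].
      * unfold scal, minus, plus, opp, one, zero; simpl; unfold mult; simpl. ring.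
  - intros t. apply (continuous_plus (fun _ => - p) (fun t => sign (t - t0) * (2 * W (t - t0)))).
    + apply continuous_const.
    + apply (continuous_comp (fun t => t - t0) (fun s => sign s * (2 * W s))); [|apply Wcont].
      apply (continuous_minus (fun t => t) (fun _ => t0)); [apply continuous_id|apply continuous_const].
  - exists d0. split; trivial. intros t Ht Hd. destruct (Req_dec t t0) as [->|Hne]; [lra|].
    set (tau := t - t0) in *. assert (HV : V tau) by (unfold V, tau; split; [|split]; trivial; lra).
    assert (Hp : 0 < Rabs tau) by (apply Rabs_pos_lt; unfold tau; lra).
    destruct (HF' (Rabs tau) Hp tau HV eq_refl) as [A B].
    assert (E : D tau * Rabs tau = y t - y t0 + p * tau).
    { unfold D. replace (t0 + tau) with t by (unfold tau; ring). field. lra. }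
    rewrite E in A, B. replace (t0 - t0) with 0 by ring. 
    unfold Rabs in A, B. destruct (Rcase_abs tau); [rewrite Ropp_involutive in B|]; lra.
  - rewrite Rminus_diag, sign_0. ring.
Qed.

(** If [y + C * x] dropped from [s] to [t], so would [Y = y + C' * x] with [C'] slightly larger.
    Subtracting a multiple of the C1 function [k ^ 2], which vanishes beyond [s + e], moves the
    maximum on [[s, t]] to the interior, and there [y] is touched by a function of slope at most
    [- C']. *)
Lemma mono_of_touch y a b C : contin_on y a b ->
  (forall t0 z z1, a < t0 < b -> touches y a b t0 z z1 -> - C <= z1 t0) ->
  forall s t, a <= s -> s <= t -> t <= b -> y s + C * s <= y t + C * t.
Proof.
  intros Hy Hz s t Hs Hst Ht. destruct (Req_dec s t) as [->|Hne]; [lra|].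
  apply Rnot_lt_le. intros Hlt.
  set (gap := y s + C * s - (y t + C * t)).
  set (C' := C + gap / (2 * (t - s))).
  assert (HC' : C < C').
  { unfold C'. assert (0 < gap / (2 * (t - s))); [|lra]. apply Rdiv_lt_0_compat; unfold gap; lra. }
  set (Y := fun x => y x + C' * x).
  assert (HYst : Y t < Y s).
  { unfold Y, C'. assert (gap / (2 * (t - s)) * t - gap / (2 * (t - s)) * s = gap / 2) by (field; lra).
    unfold gap in *; lra. }
  assert (HYc : contin_on Y a b).
  { intros x Hx eps He. destruct (Hy x Hx (eps / 2) ltac:(lra)) as [d [Hd Hs']].
    pose proof (Rabs_pos C').
    exists (Rmin d (eps / (2 * (Rabs C' + 1)))). split.
    { apply Rmin_pos; trivial. apply Rdiv_lt_0_compat; lra. }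
    intros u Hu Hux. pose proof (Rmin_l d (eps / (2 * (Rabs C' + 1)))).
    pose proof (Rmin_r d (eps / (2 * (Rabs C' + 1)))).
    unfold Y. replace (y u + C' * u - (y x + C' * x)) with ((y u - y x) + C' * (u - x)) by ring.
    apply Rle_lt_trans with (1 := Rabs_triang _ _). specialize (Hs' u Hu ltac:(lra)).
    rewrite Rabs_mult.
    assert (Rabs C' * Rabs (u - x) <= (Rabs C' + 1) * (eps / (2 * (Rabs C' + 1)))).
    { apply Rmult_le_compat; try lra. apply Rabs_pos. }
    replace ((Rabs C' + 1) * (eps / (2 * (Rabs C' + 1)))) with (eps / 2) in * by (field; lra). lra. }
  destruct (HYc s ltac:(lra) (Y s - Y t) ltac:(lra)) as [d [Hd Hnear]].
  set (e := Rmin d (t - s) / 2).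
  assert (He : 0 < Rmin d (t - s)) by (apply Rmin_pos; lra).
  pose proof (Rmin_l d (t - s)). pose proof (Rmin_r d (t - s)).
  assert (HYe : Y t < Y (s + e)).
  { specialize (Hnear (s + e)). replace (s + e - s) with e in Hnear by ring.
    rewrite (Rabs_pos_eq e) in Hnear by (unfold e; lra).
    specialize (Hnear ltac:(unfold e; lra) ltac:(unfold e; lra)). apply Rabs_def2 in Hnear. lra. }
  (* Large enough that the penalty at [s], where [k = e], exceeds any advantage of [Y s] over
     [Y (s + e)], so [s] is no maximiser; [Y t < Y (s + e)] excludes [t]. *)
  set (N := (Rabs (Y s - Y (s + e)) + 1) / (e * e)).
  assert (Hee : 0 < e * e) by (apply Rmult_lt_0_compat; unfold e; lra).
  assert (HN : 0 < N).
  { apply Rdiv_lt_0_compat; trivial. pose proof (Rabs_pos (Y s - Y (s + e))). lra. }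
  set (k := fun x => Rmax 0 (s + e - x)).
  set (Z := fun x => Y x - N * (k x * k x)).
  assert (HZ : contin_on Z s t).
  { assert (Hk : forall x x', Rabs (k x - k x') <= Rabs (x - x')).
    { intros x x'. unfold k. unfold Rmax. destruct (Rle_dec 0 (s + e - x)), (Rle_dec 0 (s + e - x'));
      unfold Rabs; destruct (Rcase_abs _), (Rcase_abs _); lra. }
    assert (Hkb : forall x, s <= x -> 0 <= k x <= e).
    { intros x Hx. unfold k. split; [apply Rmax_l|]. apply Rmax_lub; [unfold e; lra|lra]. }
    intros x Hx eps Hep. destruct (HYc x ltac:(lra) (eps / 2) ltac:(lra)) as [d' [Hd' Hs']].
    assert (HNe : 0 < 4 * (N * e + 1)).
    { assert (0 < N * e) by (apply Rmult_lt_0_compat; unfold e; lra). lra. }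
    exists (Rmin d' (eps / (4 * (N * e + 1)))). split.
    { apply Rmin_pos; trivial. apply Rdiv_lt_0_compat; lra. }
    intros u Hu Hux. pose proof (Rmin_l d' (eps / (4 * (N * e + 1)))).
    pose proof (Rmin_r d' (eps / (4 * (N * e + 1)))).
    unfold Z. replace (Y u - N * (k u * k u) - (Y x - N * (k x * k x)))
      with ((Y u - Y x) - N * (k u + k x) * (k u - k x)) by ring.
    unfold Rminus at 1. apply Rle_lt_trans with (1 := Rabs_triang _ _).
    specialize (Hs' u ltac:(lra) ltac:(lra)). rewrite Rabs_Ropp, Rabs_mult.
    pose proof (Hkb u ltac:(lra)). pose proof (Hkb x ltac:(lra)).
    assert (HA : Rabs (N * (k u + k x)) * Rabs (k u - k x) <= (2 * (N * e + 1)) * (eps / (4 * (N * e + 1)))).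
    { apply Rmult_le_compat; try apply Rabs_pos.
      - assert (0 <= N * (k u + k x)) by (apply Rmult_le_pos; lra). rewrite Rabs_pos_eq by trivial.
        assert (N * (k u + k x) <= N * (2 * e)) by (apply Rmult_le_compat_l; lra). lra.
      - specialize (Hk u x). lra. }
    replace (2 * (N * e + 1) * (eps / (4 * (N * e + 1)))) with (eps / 2) in HA by (field; lra). lra. }
  destruct (contin_on_max Z s t Hst HZ) as [t0 [Ht0 Hmax]].
  assert (Hke : k (s + e) = 0) by (unfold k; rewrite Rmax_left; lra).
  assert (Hks : k s = e) by (unfold k; rewrite Rmax_right; unfold e; lra).
  assert (Hkt : k t = 0) by (unfold k; rewrite Rmax_left; unfold e; lra).
  assert (Hse := Hmax (s + e) ltac:(unfold e; lra)).
  assert (t0 <> s).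
  { intros ->. unfold Z in Hse. rewrite Hke, Hks in Hse.
    assert (N * (e * e) = Rabs (Y s - Y (s + e)) + 1) by (unfold N; field; unfold e; lra).
    pose proof (Rle_abs (Y s - Y (s + e))). lra. }
  assert (t0 <> t).
  { intros ->. unfold Z in Hse. rewrite Hke, Hkt in Hse. lra. }
  set (z := fun x => N * (k x * k x) - C' * x).
  set (z1 := fun x => N * (- (2 * k x)) - C').
  assert (Hk2 : forall x, is_derive (fun x => k x * k x) x (- (2 * k x))).
  { intros x. destruct (Rtotal_order x (s + e)) as [Hl|[He'|Hg]].
    - apply (is_derive_ext_loc (fun x => (s + e - x) * (s + e - x))).
      + exists (mkposreal (s + e - x) ltac:(lra)). intros u Hu. unfold ball in Hu; simpl in Hu.
        unfold AbsRing_ball, abs, minus, plus, opp in Hu; simpl in Hu. apply Rabs_def2 in Hu.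
        unfold k. rewrite Rmax_right; [reflexivity|lra].
      + unfold k. rewrite Rmax_right by lra. auto_derive; trivial. ring.
    - assert (k x = 0) as -> by (unfold k; rewrite Rmax_left; lra).
      apply is_derive_Reals. intros ep Hep. exists (mkposreal ep Hep). intros u Hu Hue. simpl in Hue.
      assert (Hkx : k x = 0) by (unfold k; rewrite Rmax_left; lra). rewrite Hkx.
      assert (Hku : 0 <= k (x + u) <= Rabs u).
      { unfold k. split; [apply Rmax_l|]. apply Rmax_lub; [apply Rabs_pos|].
        pose proof (Rle_abs (- u)). rewrite Rabs_Ropp in *. lra. }
      assert (0 < Rabs u) by (apply Rabs_pos_lt; trivial).
      replace ((k (x + u) * k (x + u) - 0 * 0) / u - - (2 * 0)) with (k (x + u) * k (x + u) / u) by (field; trivial).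
      rewrite Rabs_div, Rabs_mult, (Rabs_pos_eq (k (x + u))) by (trivial; lra).
      apply Rle_lt_trans with (2 := Hue). apply Rmult_le_reg_r with (Rabs u); trivial.
      replace (k (x + u) * k (x + u) / Rabs u * Rabs u) with (k (x + u) * k (x + u)) by (field; lra).
      apply Rmult_le_compat; lra.
    - apply (is_derive_ext_loc (fun x => 0)).
      + exists (mkposreal (x - (s + e)) ltac:(lra)). intros u Hu. unfold ball in Hu; simpl in Hu.
        unfold AbsRing_ball, abs, minus, plus, opp in Hu; simpl in Hu. apply Rabs_def2 in Hu.
        unfold k. rewrite Rmax_left; [symmetry; apply Rmult_0_l|lra].
      + unfold k. rewrite Rmax_left by lra. auto_derive; trivial. simpl. ring. }
  assert (Hkc : forall x, continuous k x).
  { intros x. apply continuity_pt_filterlim. intros ep Hep. exists ep. split; trivial.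
    intros u [_ Hu]. simpl in *. unfold R_dist in *. apply Rle_lt_trans with (2 := Hu).
    unfold k, Rmax. destruct (Rle_dec 0 (s + e - x)), (Rle_dec 0 (s + e - u));
      unfold Rabs; destruct (Rcase_abs _), (Rcase_abs _); lra. }
  assert (Htouch : touches y a b t0 z z1).
  { split; [|split].
    - intros x. unfold z, z1. apply (is_derive_minus (fun x => N * (k x * k x)) (fun x => C' * x)).
      + apply (is_derive_scal (fun x => k x * k x) x N). apply Hk2.
      + auto_derive; trivial. ring.
    - intros x. unfold z1. apply (continuous_minus (fun x => N * (- (2 * k x))) (fun _ => C')).
      + apply (continuous_scal_r N (fun x => - (2 * k x))).
        apply (continuous_opp (fun x => 2 * k x)). apply (continuous_scal_r 2 k). apply Hkc.
      + apply continuous_const.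
    - exists (Rmin (t0 - s) (t - t0)). split; [apply Rmin_pos; lra|].
      intros x Hx Hd'. pose proof (Rmin_l (t0 - s) (t - t0)). pose proof (Rmin_r (t0 - s) (t - t0)).
      apply Rabs_def2 in Hd'. specialize (Hmax x ltac:(lra)). unfold Z, Y in Hmax. unfold z. lra. }
  specialize (Hz t0 z z1 ltac:(lra) Htouch). unfold z1 in Hz.
  assert (0 <= k t0) by apply Rmax_l. assert (0 <= N * (2 * k t0)) by (apply Rmult_le_pos; lra). lra.
Qed.

(** [- f] is the least nonincreasing majorant of [Y = y + eta * t]; by [mono_of_touch] it falls at
    rate at most [C]. Where it falls at a positive rate it meets [Y], and if such a point is not a
    kink, [y] is touched there by a C1 function of slope below [- eta], which is excluded on [E].
    So, up to a growth of [eps * (b - a)], [f] is constant near each point of [E] outside a null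
    set, and the rest of its growth is at most [C] times the deficit of [E]. *)
Lemma decrease_bound y a b C eta (E : R -> Prop) : a < b -> 0 < C -> 0 <= eta ->
  contin_on y a b ->
  (forall t0 z z1, a < t0 < b -> touches y a b t0 z z1 -> - C <= z1 t0) ->
  (forall t0 z z1, a < t0 < b -> E t0 -> touches y a b t0 z z1 -> - eta <= z1 t0) ->
  y a <= y b + eta * (b - a) + C * (b - a - om E a b).
Proof.
  intros Hab HC Heta Hy Hall HE.
  pose proof (mono_of_touch y a b C Hy Hall) as Hmono.
  set (Y := fun t => y t + eta * t).
  set (P := fun x z => exists s, x <= s <= b /\ z = - Y s).
  set (f := fun x => Rinf (P x)).
  assert (HYm : forall s t, a <= s -> s <= t -> t <= b -> Y s <= Y t + C * (t - s)).
  { intros s t H1 H2 H3. specialize (Hmono s t H1 H2 H3). unfold Y.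
    assert (eta * s <= eta * t) by (apply Rmult_le_compat_l; lra). lra. }
  assert (Hf : forall x, a <= x <= b ->
    (forall s, x <= s <= b -> f x <= - Y s) /\
    (forall c, (forall s, x <= s <= b -> c <= - Y s) -> c <= f x)).
  { intros x Hx. destruct (Rinf_spec (P x) (- (Y b + C * (b - a))) (- Y x)) as [H1 H2].
    - exists x. split; trivial; lra.
    - intros z [s [Hs ->]]. specialize (HYm s b ltac:(lra) ltac:(lra) ltac:(lra)).
      assert (C * (b - s) <= C * (b - a)) by (apply Rmult_le_compat_l; lra). lra.
    - split.
      + intros s Hs. apply H1. now exists s.
      + intros c Hc. apply H2. intros z [s [Hs ->]]. now apply Hc. }
  assert (Nf : nondec f a b).
  { intros x x' Hx Hxx Hx'. apply (Hf x'); [lra|]. intros s Hs. apply (Hf x); lra. }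
  assert (Lf : lipl C f a b).
  { intros x x' Hx Hxx Hx'. enough (f x' - C * (x' - x) <= f x) by lra.
    assert (0 <= C * (x' - x)) by (apply Rmult_le_pos; lra).
    apply (Hf x); [lra|]. intros s Hs. destruct (Rle_dec x' s).
    - pose proof (proj1 (Hf x' ltac:(lra)) s ltac:(lra)). lra.
    - pose proof (proj1 (Hf x' ltac:(lra)) x' ltac:(lra)).
      specialize (HYm s x' ltac:(lra) ltac:(lra) ltac:(lra)).
      assert (C * (x' - s) <= C * (x' - x)) by (apply Rmult_le_compat_l; lra). lra. }
  (* Slopes are separated by consecutive points of the grids of step [/ (k + 1)], so that countably
     many sets contain every interior point at which the lower right derivate of [f] is less than
     the upper left one. *)
  set (A := fun (k i : nat) t =>
    (forall d, 0 < d -> exists s, t < s <= b /\ s - t < d /\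
       f s - f t < (INR i + 1) / (INR k + 1) * (s - t)) /\
    (forall d, 0 < d -> exists s, a <= s < t /\ t - s < d /\
       (INR i + 2) / (INR k + 1) * (t - s) < f t - f s)).
  set (N := fun t => (t = a \/ t = b) \/ exists k i, A k i t).
  assert (HN : null N a b).
  { apply null_union2.
    - apply null_union2; apply null_point; lra.
    - apply null_union; [lra|]. intros k. apply null_union; [lra|]. intros i.
      pose proof (pos_INR k). pose proof (pos_INR i).
      apply (kink_null f a b C); trivial; [lra| |].
      + apply Rdiv_lt_0_compat; lra.
      + apply Rmult_lt_compat_r; [apply Rinv_0_lt_compat|]; lra. }
  enough (key : forall eps, 0 < eps -> f b - f a <= C * (b - a - om E a b) + eps * (b - a)).
  { pose proof (proj1 (Hf a ltac:(lra)) a ltac:(lra)) as H1.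
    assert (H2 : - Y b <= f b).
    { apply (Hf b); [lra|]. intros s Hs. replace s with b by lra. lra. }
    assert (H3 : f b - f a <= C * (b - a - om E a b)).
    { apply le_epsilon. intros e He. specialize (key (e / (b - a)) ltac:(apply Rdiv_lt_0_compat; lra)).
      replace (e / (b - a) * (b - a)) with e in key by (field; lra). lra. }
    unfold Y in *. lra. }
  intros eps He.
  destruct (envelope_r f (fun x => eps * x) a b C eps) as [g [Ng [Nfg [Dg Cg]]]]; trivial.
  { lra. }
  { intros x x' ? ? ?. apply Rmult_le_compat_l; lra. }
  { intros x x' ? ? ?. lra. }
  assert (Hv : om E a b <= (b - g b / C) - (a - g a / C)).
  { apply (om_le_mod_null E N (fun x => x - g x / C)); trivial; [lra| |].
    - intros x x' Hx Hxx Hx'. specialize (Nfg x x' Hx Hxx Hx'). specialize (Lf x x' Hx Hxx Hx').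
      simpl in Nfg. assert ((g x' - g x) / C <= x' - x); [|unfold Rdiv in *; lra].
      apply Rmult_le_reg_r with C; trivial. unfold Rdiv. rewrite Rmult_assoc, Rinv_l by lra. lra.
    - intros t Ht [HEt HNt].
      destruct (classic (exists s, t < s <= b /\ f s - f t < eps * s - eps * t)) as [[s [Hs Hfs]]|Hno].
      { destruct (Cg t s) as [d [Hd Hc]]; try lra. exists d. split; trivial.
        intros x x' Hx Hxx Hx' H1 H2. rewrite (Hc x), (Hc x') by (trivial; lra). lra. }
      exfalso.
      assert (Hinc : forall s, t < s <= b -> eps * (s - t) <= f s - f t).
      { intros s Hs. apply Rnot_lt_le. intros Hlt. apply Hno. exists s. split; trivial. lra. }
      assert (Hta : t <> a /\ t <> b) by (unfold N in HNt; tauto).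
      (* The supremum [p] of [S] is the lower right derivate of [f] at [t], here between [eps] and
         [C]. *)
      set (S := fun q => exists d, 0 < d /\ forall s, t < s <= b -> s - t < d -> q * (s - t) <= f s - f t).
      assert (Seps : S eps) by (exists 1; split; [lra|auto]).
      assert (SC : forall q, S q -> q <= C).
      { intros q [d [Hd Hq]]. set (s := t + Rmin d (b - t) / 2).
        assert (0 < Rmin d (b - t)) by (apply Rmin_pos; lra).
        pose proof (Rmin_l d (b - t)). pose proof (Rmin_r d (b - t)).
        specialize (Hq s ltac:(unfold s; lra) ltac:(unfold s; lra)).
        specialize (Lf t s ltac:(lra) ltac:(unfold s; lra) ltac:(unfold s; lra)).
        apply Rmult_le_reg_r with (s - t); [unfold s; lra|]. lra. }
      destruct (completeness S) as [p [Hp1 Hp2]].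
      { exists C. intros q Hq. auto. }
      { now exists eps. }
      assert (Hpe : eps <= p) by (apply Hp1; trivial).
      (* As [f] increases strictly to the right of [t], the infimum of [- Y] over [[t, b]] does not
         come from points away from [t]; were it below [- Y t], continuity would exclude the points
         near [t] as well. *)
      assert (Hcontact : Y t = - f t).
      { pose proof (proj1 (Hf t Ht) t ltac:(lra)) as H1.
        destruct (Req_dec (Y t) (- f t)) as [|Hne]; trivial. exfalso.
        set (th := - Y t - f t). assert (Hth : 0 < th) by (unfold th; lra).
        destruct (Hy t Ht (th / 4) ltac:(lra)) as [d [Hd Hs]].
        set (d' := Rmin (Rmin d (b - t)) (th / (4 * (eta + 1)))).
        assert (Hd' : 0 < d') by (repeat apply Rmin_pos; try lra; apply Rdiv_lt_0_compat; lra).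
        assert (D1 : d' <= d) by (unfold d'; eapply Rle_trans; [apply Rmin_l|apply Rmin_l]).
        assert (D2 : d' <= b - t) by (unfold d'; eapply Rle_trans; [apply Rmin_l|apply Rmin_r]).
        assert (D3 : d' <= th / (4 * (eta + 1))) by apply Rmin_r.
        assert (D4 : eta * d' <= th / 4).
        { apply Rle_trans with ((eta + 1) * (th / (4 * (eta + 1)))).
          - apply Rmult_le_compat; lra.
          - apply Req_le. field. lra. }
        set (s1 := t + d' / 2).
        assert (Hs1 : t < s1 <= b) by (unfold s1; lra).
        specialize (Hinc s1 Hs1). assert (0 < eps * (s1 - t)) by (apply Rmult_lt_0_compat; lra).
        assert (Rmin (f t + th / 2) (f s1) <= f t).
        { apply (Hf t Ht). intros s Hs'. destruct (Rle_dec s1 s).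
          - apply Rle_trans with (1 := Rmin_r _ _). apply (Hf s1); lra.
          - apply Rle_trans with (1 := Rmin_l _ _).
            specialize (Hs s ltac:(lra)). rewrite Rabs_pos_eq in Hs by lra.
            specialize (Hs ltac:(unfold s1 in *; lra)). apply Rabs_def2 in Hs.
            assert (eta * s <= eta * t + eta * d').
            { rewrite <- Rmult_plus_distr_l. apply Rmult_le_compat_l; unfold s1 in *; lra. }
            unfold th, Y in *. lra. }
        unfold Rmin in *. destruct (Rle_dec (f t + th / 2) (f s1)); lra. }
      destruct (touch_of_slope y a b t (p + eta)) as [z [z1 [Hz Hz1]]]; [lra| |].
      { intros e' He'.
        destruct (classic (exists q, S q /\ p - e' < q)) as [[q [[d1 [Hd1 Hq]] Hqp]]|Hn].
        2: { exfalso. assert (p <= p - e'); [|lra]. apply Hp2. intros q Hq.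
             apply Rnot_lt_le. intros Hlt. apply Hn. now exists q. }
        (* [k] and [i] are such that [p < (i + 1) / (k + 1)] and [(i + 2) / (k + 1) < p + e']. As
           [t] is not in [A k i], the left difference quotients of [f] near [t] stay below
           [p + e']. *)
        destruct (nfloor_ex (3 / e')) as [k Hk]; [apply Rlt_le, Rdiv_lt_0_compat; lra|].
        pose proof (pos_INR k).
        destruct (nfloor_ex (p * (INR k + 1))) as [i Hi]; [apply Rmult_le_pos; lra|].
        assert (Hk1 : 3 / (INR k + 1) < e').
        { apply Rmult_lt_reg_r with (INR k + 1); [lra|].
          replace (3 / (INR k + 1) * (INR k + 1)) with (3 / e' * e') by (field; lra).
          rewrite (Rmult_comm e'). apply Rmult_lt_compat_r; lra. }
        assert (Hip : p < (INR i + 1) / (INR k + 1)).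
        { apply Rmult_lt_reg_r with (INR k + 1); [lra|]. unfold Rdiv. rewrite Rmult_assoc, Rinv_l; lra. }
        assert (Hiq : (INR i + 2) / (INR k + 1) < p + e').
        { apply Rle_lt_trans with (p + 2 / (INR k + 1)).
          - apply Rmult_le_reg_r with (INR k + 1); [lra|]. field_simplify; lra.
          - assert (2 / (INR k + 1) < 3 / (INR k + 1)); [|lra].
            apply Rmult_lt_compat_r; [apply Rinv_0_lt_compat|]; lra. }
        assert (HnA : ~ A k i t) by (intros HA; apply HNt; right; exists k, i; trivial).
        apply not_and_or in HnA. destruct HnA as [HnA|HnA];
          apply not_all_ex_not in HnA; destruct HnA as [d2 HnA]; apply imply_to_and in HnA;
          destruct HnA as [Hd2 HnA].
        { exfalso. assert ((INR i + 1) / (INR k + 1) <= p); [|lra]. apply Hp1.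
          exists d2. split; trivial. intros s Hs Hsd. apply Rnot_lt_le. intros Hlt.
          apply HnA. exists s. tauto. }
        exists (Rmin d1 d2). split; [apply Rmin_pos; trivial|].
        pose proof (Rmin_l d1 d2). pose proof (Rmin_r d1 d2).
        intros s Hs Hsd. apply Rabs_def2 in Hsd.
        pose proof (proj1 (Hf s ltac:(lra)) s ltac:(lra)) as Hfs.
        assert (HYs : Y s - Y t <= f t - f s) by lra.
        assert (Hgoal : f t - f s <= - p * (s - t) + e' * Rabs (s - t)).
        { destruct (Rtotal_order s t) as [Hl|[->|Hg]].
          - rewrite Rabs_left by lra.
            assert (f t - f s <= (INR i + 2) / (INR k + 1) * (t - s)).
            { apply Rnot_lt_le. intros Hlt. apply HnA. exists s. repeat split; lra. }
            assert ((INR i + 2) / (INR k + 1) * (t - s) <= (p + e') * (t - s))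
              by (apply Rmult_le_compat_r; lra). lra.
          - rewrite !Rminus_diag, Rabs_R0. lra.
          - rewrite Rabs_pos_eq by lra. specialize (Hq s ltac:(lra) ltac:(lra)).
            assert ((p - e') * (s - t) <= q * (s - t)) by (apply Rmult_le_compat_r; lra). lra. }
        unfold Y in HYs. lra. }
      specialize (HE t z z1 ltac:(lra) HEt Hz). lra. }
  assert (Hgg : C * om E a b <= C * (b - a) - (g b - g a)).
  { apply Rle_trans with (C * (b - g b / C - (a - g a / C))).
    - apply Rmult_le_compat_l; lra.
    - apply Req_le. field. lra. }
  lra.
Qed.

(** A uniform neighbourhood of [p] comes from a gauge on [[a, b]] by compactness. Of [dist] only
    [dist p p = 0] is asked, so the parameter can first be a pair and then a real, to maximise over
    [x] and then over [s]. *)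
Lemma max_param (X : Type) (dist : X -> X -> R) (D : X -> Prop) (g : R -> X -> R) a b :
  a <= b -> (forall p, D p -> dist p p = 0) ->
  (forall x p, a <= x <= b -> D p -> forall eps, 0 < eps -> exists d, 0 < d /\
     forall x' p', a <= x' <= b -> D p' -> Rabs (x' - x) < d -> dist p' p < d ->
       Rabs (g x' p' - g x p) < eps) ->
  exists M : X -> R,
    (forall p, D p -> (forall x, a <= x <= b -> g x p <= M p) /\
       exists x, a <= x <= b /\ g x p = M p) /\
    (forall p, D p -> forall eps, 0 < eps -> exists d, 0 < d /\
       forall p', D p' -> dist p' p < d -> Rabs (M p' - M p) < eps).
Proof.
  intros Hab Hrefl Hg.
  assert (Hmax : forall p, exists m, D p ->
     (forall x, a <= x <= b -> g x p <= m) /\ exists x, a <= x <= b /\ g x p = m).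
  { intros p. destruct (classic (D p)) as [Hp|Hp]; [|exists 0; tauto].
    destruct (contin_on_max (fun x => g x p) a b Hab) as [x [Hx Hm]].
    - intros x Hx eps He. destruct (Hg x p Hx Hp eps He) as [d [Hd Hs]].
      exists d. split; trivial. intros s Hs1 Hs2. apply Hs; trivial. rewrite Hrefl; trivial.
    - exists (g x p). intros _. split; trivial. now exists x. }
  destruct (choice _ Hmax) as [M HM]. exists M. split; [exact HM|].
  intros p Hp eps He.
  assert (Hdel : forall x, exists d : posreal, a <= x <= b ->
     forall x' p', a <= x' <= b -> D p' -> Rabs (x' - x) < d -> dist p' p < d ->
       Rabs (g x' p' - g x p) < eps).
  { intros x. destruct (classic (a <= x <= b)) as [Hx|Hx].
    - destruct (Hg x p Hx Hp eps He) as [d [Hd Hs]]. exists (mkposreal d Hd). intros _. exact Hs.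
    - exists (mkposreal 1 Rlt_0_1). tauto. }
  destruct (choice _ Hdel) as [delta Hdelta].
  destruct (compactness_value_1d a b delta) as [d Hd].
  destruct (HM p Hp) as [HM1 [x0 [Hx0 HM2]]].
  exists (Rmin d (delta x0)). split; [apply Rmin_pos; apply cond_pos|].
  intros p' Hp' Hdist. pose proof (Rmin_l d (delta x0)). pose proof (Rmin_r d (delta x0)).
  destruct (HM p' Hp') as [HM1' [x1 [Hx1 HM2']]].
  assert (Hlow : Rabs (g x0 p' - g x0 p) < eps).
  { apply Hdelta; trivial; [|lra]. rewrite Rminus_diag, Rabs_R0. apply cond_pos. }
  specialize (HM1' x0 Hx0). apply Rabs_def2 in Hlow.
  assert (Hup : M p' < M p + eps).
  { apply NNPP. intros Hn. apply (Hd x1 Hx1). intros [t [Ht [Hxt Hdt]]]. apply Hn.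
    assert (Hc : Rabs (g x1 p' - g t p) < eps) by (apply Hdelta; trivial; lra).
    apply Rabs_def2 in Hc. specialize (HM1 t Ht). lra. }
  apply Rabs_def1; lra.
Qed.

Definition contin3 (w : R -> R -> R -> R) (a b : R) : Prop :=
  forall x s t, a <= t <= b -> forall eps, 0 < eps -> exists d, 0 < d /\
    forall x' s' t', a <= t' <= b -> Rabs (x' - x) < d -> Rabs (s' - s) < d ->
      Rabs (t' - t) < d -> Rabs (w x' s' t' - w x s t) < eps.

(** Coercivity confines the supremum over [x] and [s] to a box, where it is attained and continuous
    in [t]. A C1 function of [t] touching the supremum touches [w] at a maximiser, so
    [decrease_bound] applies to the supremum. *)
Lemma sup_decrease (w : R -> R -> R -> R) a b C eta (E : R -> Prop) :
  a < b -> 0 < C -> 0 <= eta -> contin3 w a b ->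
  (forall c, exists A, forall x s t, a <= t <= b -> A <= Rabs x + Rabs s -> w x s t <= c) ->
  (forall x0 s0 t0 z z1, a < t0 < b ->
     (forall t, is_derive z t (z1 t)) -> (forall t, continuous z1 t) ->
     (exists d, 0 < d /\ forall x s t, a < t < b -> Rabs (t - t0) < d ->
        w x s t - z t <= w x0 s0 t0 - z t0) ->
     - C <= z1 t0 /\ (E t0 -> - eta <= z1 t0)) ->
  forall m, (forall x s, w x s b <= m) ->
  forall x s, w x s a <= m + eta * (b - a) + C * (b - a - om E a b).
Proof.
  intros Hab HC Heta Hw Hco Htouch m Hm x s.
  (* The least value of [w 0 0 t] over time is a level below which [w] stays outside one box, for
     all times at once. *)
  destruct (contin_on_max (fun t => - w 0 0 t) a b) as [tm [Htm Hmin]]; [lra| |].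
  { intros t Ht eps He. destruct (Hw 0 0 t Ht eps He) as [d [Hd Hs]]. exists d. split; trivial.
    intros u Hu Hut. rewrite <- Rabs_Ropp.
    replace (- (- w 0 0 u - - w 0 0 t)) with (w 0 0 u - w 0 0 t) by ring.
    apply Hs; trivial; rewrite Rminus_diag, Rabs_R0; trivial. }
  destruct (Hco (w 0 0 tm)) as [A0 HA0].
  set (A := Rmax A0 0).
  assert (HA : 0 <= A) by apply Rmax_r. assert (HAA : A0 <= A) by apply Rmax_l.
  destruct (max_param (R * R) (fun p q => Rmax (Rabs (fst p - fst q)) (Rabs (snd p - snd q)))
    (fun p => a <= snd p <= b) (fun x p => w x (fst p) (snd p)) (- A) A) as [M1 [M1a M1b]].
  { lra. }
  { intros p _. rewrite !Rminus_diag, Rabs_R0. apply Rmax_left. lra. }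
  { intros x' p _ Hp eps He. destruct (Hw x' (fst p) (snd p) Hp eps He) as [d [Hd Hs]].
    exists d. split; trivial. intros x'' p' _ Hp' H1 H2.
    apply Hs; trivial; (eapply Rle_lt_trans; [|exact H2]); [apply Rmax_l|apply Rmax_r]. }
  destruct (max_param R (fun t u => Rabs (t - u)) (fun t => a <= t <= b)
    (fun s t => M1 (s, t)) (- A) A) as [M2 [M2a M2b]].
  { lra. }
  { intros t _. rewrite Rminus_diag, Rabs_R0. trivial. }
  { intros s' t _ Ht eps He. destruct (M1b (s', t) Ht eps He) as [d [Hd Hs]].
    exists d. split; trivial. intros s'' t' _ Ht' H1 H2. apply Hs; trivial. simpl.
    now apply Rmax_lub_lt. }
  assert (Hub : forall t, a <= t <= b -> forall x s, w x s t <= M2 t).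
  { intros t Ht x' s'.
    assert (H0 : w 0 0 t <= M2 t).
    { apply Rle_trans with (M1 (0, t)); [apply (proj1 (M1a (0, t) Ht) 0)|apply (proj1 (M2a t Ht) 0)]; lra. }
    destruct (Rle_dec A0 (Rabs x' + Rabs s')).
    - specialize (HA0 x' s' t Ht r). specialize (Hmin t Ht). lra.
    - pose proof (Rabs_pos x'). pose proof (Rabs_pos s').
      assert (- A <= x' <= A) by (apply Rabs_le_between; lra).
      assert (- A <= s' <= A) by (apply Rabs_le_between; lra).
      apply Rle_trans with (M1 (s', t)); [apply (proj1 (M1a (s', t) Ht) x')|apply (proj1 (M2a t Ht) s')]; trivial. }
  assert (Hat : forall t, a <= t <= b -> exists x s, w x s t = M2 t).
  { intros t Ht. destruct (M2a t Ht) as [_ [s' [Hs' E2]]].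
    destruct (M1a (s', t) Ht) as [_ [x' [Hx' E1]]]. exists x', s'. rewrite <- E2, <- E1. reflexivity. }
  assert (Hc : contin_on M2 a b).
  { intros t Ht eps He. destruct (M2b t Ht eps He) as [d [Hd Hs]]. exists d. auto. }
  assert (Htt : forall t0 z z1, a < t0 < b -> touches M2 a b t0 z z1 ->
            - C <= z1 t0 /\ (E t0 -> - eta <= z1 t0)).
  { intros t0 z z1 Ht0 [Hz [Hz1 [d [Hd Hs]]]].
    destruct (Hat t0 ltac:(lra)) as [x0 [s0 E0]].
    apply (Htouch x0 s0 t0 z z1 Ht0 Hz Hz1). exists d. split; trivial.
    intros x' s' t Ht Htd. rewrite E0. specialize (Hs t Ht Htd).
    specialize (Hub t ltac:(lra) x' s'). lra. }
  assert (Hfin := decrease_bound M2 a b C eta E Hab HC Heta Hc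
    (fun t0 z z1 H1 H2 => proj1 (Htt t0 z z1 H1 H2))
    (fun t0 z z1 H1 H2 H3 => proj2 (Htt t0 z z1 H1 H3) H2)).
  destruct (Hat b ltac:(lra)) as [x1 [s1 E1]]. specialize (Hm x1 s1).
  specialize (Hub a ltac:(lra) x s). lra.
Qed.

(** * Jets and random walks *)

(** One partial derivative is continuous at the point, the other merely exists there; that suffices
    for the total derivative on which the chain rule rests. *)
Lemma is_derive_comp2 (f : R -> R -> R) fx fs (u v : R -> R) s u1 v1 :
  (forall x y, is_derive (fun x => f x y) x (fx x y)) ->
  is_derive (fun y => f (u s) y) (v s) fs ->
  continuous (fun p : R * R => fx (fst p) (snd p)) (u s, v s) ->
  is_derive u s u1 -> is_derive v s v1 ->
  is_derive (fun s => f (u s) (v s)) s (u1 * fx (u s) (v s) + v1 * fs).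
Proof.
  intros Hx Hs Hc Hu Hv. apply is_derive_Reals.
  replace (u1 * fx (u s) (v s) + v1 * fs) with (fx (u s) (v s) * u1 + fs * v1) by ring.
  apply (derivable_pt_lim_comp_2d f u v); [|now apply is_derive_Reals|now apply is_derive_Reals].
  intros eps. set (e := mkposreal (eps / 2) (is_pos_div_2 eps)).
  apply is_derive_Reals in Hs.
  destruct (Hs e (cond_pos e)) as [d1 Hd1].
  assert (Hloc := Hc (ball (fx (u s) (v s)) e) (locally_ball _ e)).
  destruct Hloc as [d2 Hd2].
  exists (mkposreal (Rmin d1 d2) (Rmin_pos _ _ (cond_pos d1) (cond_pos d2))).
  intros x y Hxu Hyv. simpl in Hxu, Hyv.
  pose proof (Rmin_l d1 d2). pose proof (Rmin_r d1 d2).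
  set (x0 := u s) in *. set (y0 := v s) in *.
  assert (A : Rabs (f x0 y - f x0 y0 - fs * (y - y0)) <= eps / 2 * Rabs (y - y0)).
  { destruct (Req_dec y y0) as [->|Hne].
    - rewrite !Rminus_diag, Rmult_0_r, Rminus_0_r, Rabs_R0. lra.
    - assert (Hh : y - y0 <> 0) by lra.
      assert (Hlt : Rabs (y - y0) < d1) by lra.
      specialize (Hd1 (y - y0) Hh Hlt). replace (y0 + (y - y0)) with y in Hd1 by ring. simpl in Hd1.
      replace (f x0 y - f x0 y0 - fs * (y - y0)) with (((f x0 y - f x0 y0) / (y - y0) - fs) * (y - y0))
        by (field; trivial).
      rewrite Rabs_mult. apply Rmult_le_compat_r; [apply Rabs_pos|lra]. }
  assert (B : Rabs (f x y - f x0 y - fx x0 y0 * (x - x0)) <= eps / 2 * Rabs (x - x0)).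
  { destruct (MVT_gen (fun x => f x y) x0 x (fun x => fx x y)) as [c [Hc1 Hc2]].
    - intros c _. apply Hx.
    - intros c _. apply continuity_pt_filterlim, (ex_derive_continuous (fun x => f x y)).
      exists (fx c y). apply Hx.
    - rewrite Hc2. replace (fx c y * (x - x0) - fx x0 y0 * (x - x0)) with ((fx c y - fx x0 y0) * (x - x0)) by ring.
      rewrite Rabs_mult. apply Rmult_le_compat_r; [apply Rabs_pos|].
      assert (Hcx : Rabs (c - x0) <= Rabs (x - x0)).
      { unfold Rmin, Rmax in Hc1. destruct (Rle_dec x0 x).
        - rewrite !Rabs_pos_eq; lra.
        - rewrite !Rabs_left1; lra. }
      assert (Hb : ball (x0, y0) d2 (c, y)).
      { split; [change (Rabs (c - x0) < d2)|change (Rabs (y - y0) < d2)]; lra. }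
      specialize (Hd2 (c, y) Hb). change (Rabs (fx c y - fx x0 y0) < eps / 2) in Hd2. lra. }
  replace (f x y - f x0 y0 - (fx x0 y0 * (x - x0) + fs * (y - y0)))
    with ((f x y - f x0 y - fx x0 y0 * (x - x0)) + (f x0 y - f x0 y0 - fs * (y - y0))) by ring.
  apply Rle_trans with (1 := Rabs_triang _ _).
  pose proof (Rmax_l (Rabs (x - x0)) (Rabs (y - y0))). pose proof (Rmax_r (Rabs (x - x0)) (Rabs (y - y0))).
  pose proof (cond_pos eps).
  assert (eps / 2 * Rabs (x - x0) <= eps / 2 * Rmax (Rabs (x - x0)) (Rabs (y - y0))) by (apply Rmult_le_compat_l; lra).
  assert (eps / 2 * Rabs (y - y0) <= eps / 2 * Rmax (Rabs (x - x0)) (Rabs (y - y0))) by (apply Rmult_le_compat_l; lra).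
  lra.
Qed.

(* [f i j] stands for the derivative of order [i] in the first and [j] in the
   second variable of [f 0 0]; only [i + j <= 3] matters. *)
Definition jet := nat -> nat -> R -> R -> R.

Definition smooth3 (f : jet) : Prop :=
  (forall i j x s, (i + j < 3)%nat ->
     is_derive (fun x => f i j x s) x (f (S i) j x s) /\
     is_derive (fun s => f i j x s) s (f i (S j) x s)) /\
  (forall i j x s, (i + j <= 3)%nat ->
     continuous (fun p : R * R => f i j (fst p) (snd p)) (x, s)).

Definition smooth_coef (c : nat -> R -> R) : Prop :=
  (forall n s, (n < 3)%nat -> is_derive (c n) s (c (S n) s)) /\
  (forall s, continuous (c 3%nat) s).

Lemma smooth_coef_continuous c n s : smooth_coef c -> (n <= 3)%nat -> continuous (c n) s.
Proof.
  intros [H1 H2] Hn. destruct (Nat.eq_dec n 3) as [->|]; [apply H2|].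
  apply (ex_derive_continuous (c n)). exists (c (S n) s). apply H1. lia.
Qed.

(* A step of the walk: [(x, s) -> (x + k xo + k^2 xe, s + k so + k^2 se)], where
   the coefficients depend on [s] only and [c n] is the n-th derivative of [c 0];
   odd parts change sign with [k]. *)
Section Walk.
Variables xo xe so se : nat -> R -> R.

Definition dx (k : R) (n : nat) (s : R) : R := k * xo n s + k ^ 2 * xe n s.
Definition ds (k : R) (n : nat) (s : R) : R := k * so n s + k ^ 2 * se n s.

(** The chain rule for [f] composed with the step, written out to third order so that later
    identities are polynomial. The displacement depends on [s] only, so a derivative in [x] just
    raises [i]. The last clause is meant for [j = 3]. *)
Definition pull (k : R) (f : jet) : jet := fun i j x s =>
  let g i j := f i j (x + dx k 0 s) (s + ds k 0 s) in
  let p1 := dx k 1 s in let q1 := 1 + ds k 1 s in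
  let p2 := dx k 2 s in let q2 := ds k 2 s in
  match j with
  | 0%nat => g i 0%nat
  | 1%nat => p1 * g (S i) 0%nat + q1 * g i 1%nat
  | 2%nat => p2 * g (S i) 0%nat + q2 * g i 1%nat + p1 ^ 2 * g (S (S i)) 0%nat
             + 2 * p1 * q1 * g (S i) 1%nat + q1 ^ 2 * g i 2%nat
  | _ => dx k 3 s * g (S i) 0%nat + ds k 3 s * g i 1%nat
         + 3 * p1 * p2 * g (S (S i)) 0%nat + 3 * (p1 * q2 + p2 * q1) * g (S i) 1%nat
         + 3 * q1 * q2 * g i 2%nat
         + p1 ^ 3 * g (S (S (S i))) 0%nat + 3 * p1 ^ 2 * q1 * g (S (S i)) 1%nat
         + 3 * p1 * q1 ^ 2 * g (S i) 2%nat + q1 ^ 3 * g i 3%nat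
  end.

Hypothesis Hxo : smooth_coef xo.
Hypothesis Hxe : smooth_coef xe.
Hypothesis Hso : smooth_coef so.
Hypothesis Hse : smooth_coef se.

Lemma is_derive_dx k n s : (n < 3)%nat -> is_derive (dx k n) s (dx k (S n) s).
Proof.
  intros Hn. unfold dx. apply (is_derive_plus (fun s => k * xo n s) (fun s => k ^ 2 * xe n s)).
  - apply (is_derive_scal (xo n)), Hxo, Hn.
  - apply (is_derive_scal (xe n)), Hxe, Hn.
Qed.

Lemma is_derive_ds k n s : (n < 3)%nat -> is_derive (ds k n) s (ds k (S n) s).
Proof.
  intros Hn. unfold ds. apply (is_derive_plus (fun s => k * so n s) (fun s => k ^ 2 * se n s)).
  - apply (is_derive_scal (so n)), Hso, Hn.
  - apply (is_derive_scal (se n)), Hse, Hn.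
Qed.

Lemma continuous_dx k n s : (n <= 3)%nat -> continuous (dx k n) s.
Proof.
  intros Hn. apply (continuous_plus (fun s => k * xo n s) (fun s => k ^ 2 * xe n s)).
  - apply (continuous_scal_r k (xo n)). now apply smooth_coef_continuous.
  - apply (continuous_scal_r (k ^ 2) (xe n)). now apply smooth_coef_continuous.
Qed.

Lemma continuous_ds k n s : (n <= 3)%nat -> continuous (ds k n) s.
Proof.
  intros Hn. apply (continuous_plus (fun s => k * so n s) (fun s => k ^ 2 * se n s)).
  - apply (continuous_scal_r k (so n)). now apply smooth_coef_continuous.
  - apply (continuous_scal_r (k ^ 2) (se n)). now apply smooth_coef_continuous.
Qed.

Lemma is_derive_term (c : R -> R) c1 k f i j x s : smooth3 f -> (i + j < 3)%nat -> is_derive c s c1 ->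
  is_derive (fun s => c s * f i j (x + dx k 0 s) (s + ds k 0 s)) s
    (c1 * f i j (x + dx k 0 s) (s + ds k 0 s)
     + c s * (dx k 1 s * f (S i) j (x + dx k 0 s) (s + ds k 0 s)
              + (1 + ds k 1 s) * f i (S j) (x + dx k 0 s) (s + ds k 0 s))).
Proof.
  intros [Hf1 Hf2] Hij Hc.
  apply (is_derive_mult c (fun s => f i j (x + dx k 0 s) (s + ds k 0 s))); trivial.
  - apply (is_derive_comp2 (f i j) (f (S i) j) _ (fun s => x + dx k 0 s) (fun s => s + ds k 0 s)).
    + intros. now apply Hf1.
    + now apply Hf1.
    + apply Hf2. lia.
    + rewrite <- (Rplus_0_l (dx k 1 s)).
      apply (is_derive_plus (fun _ => x) (dx k 0)); [apply @is_derive_const|apply is_derive_dx; lia].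
    + apply (is_derive_plus (fun s => s) (ds k 0)); [apply @is_derive_id|apply is_derive_ds; lia].
  - intros; apply Rmult_comm.
Qed.

Lemma is_derive_shift (g : R -> R) c x l : is_derive g (x + c) l -> is_derive (fun x => g (x + c)) x l.
Proof.
  intros H. rewrite <- (Rmult_1_l l).
  apply (is_derive_comp g (fun x => x + c)); trivial.
  rewrite <- (Rplus_0_r 1). apply (is_derive_plus (fun x => x) (fun _ => c)); [apply @is_derive_id|apply @is_derive_const].
Qed.

Ltac derive_const_sum :=
  repeat match goal with
  | |- is_derive (fun x => _ + _) _ (_ + _) => apply @is_derive_plus
  | |- is_derive (fun x => _ * _) _ (_ * _) => apply is_derive_scal
  end.

Lemma pull_smooth3 k f : smooth3 f -> smooth3 (pull k f).
Proof.
  intros Hf. pose proof Hf as [Hf1 Hf2]. split.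
  - intros i j x s Hij. split.
    + destruct j as [|[|[|j]]]; [| | |lia]; unfold pull; cbv zeta; derive_const_sum;
        apply (is_derive_shift (fun x => f _ _ x _)); apply Hf1; lia.
    + pose proof (fun n Hn => is_derive_dx k n s Hn) as Dx.
      pose proof (fun n Hn => is_derive_ds k n s Hn) as Ds.
      assert (Dq : is_derive (fun s => 1 + ds k 1 s) s (ds k 2 s)).
      { rewrite <- (Rplus_0_l (ds k 2 s)). apply (is_derive_plus (fun _ => 1) (ds k 1)); [apply @is_derive_const|apply Ds; lia]. }
      destruct j as [|[|[|j]]]; [| | |lia]; unfold pull; cbv zeta.
      * apply (is_derive_ext (fun s => 1 * f i 0%nat (x + dx k 0 s) (s + ds k 0 s))); [intros; apply Rmult_1_l|].
        evar_last; [apply is_derive_term; trivial; apply @is_derive_const|].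
        unfold zero; simpl. ring.
      * pose proof (is_derive_term (dx k 1) _ k f (S i) 0 x s Hf ltac:(lia) (Dx 1%nat ltac:(lia))) as T1.
        pose proof (is_derive_term (fun s => 1 + ds k 1 s) _ k f i 1 x s Hf ltac:(lia) Dq) as T2.
        pose proof (is_derive_plus _ _ _ _ _ T1 T2) as T. clear T1 T2.
        refine (eq_ind _ (fun l : R => is_derive _ s l) T _ _). clear T. match goal with |- ?a = ?b => change (@eq R a b) end.
        change plus with Rplus. cbv beta. ring.
      * pose proof (is_derive_term (dx k 2) _ k f (S i) 0 x s Hf ltac:(lia) (Dx 2%nat ltac:(lia))) as T1.
        pose proof (is_derive_term (ds k 2) _ k f i 1 x s Hf ltac:(lia) (Ds 2%nat ltac:(lia))) as T2.
        pose proof (is_derive_pow (dx k 1) 2 s _ (Dx 1%nat ltac:(lia))) as P1.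
        pose proof (is_derive_term _ _ k f (S (S i)) 0 x s Hf ltac:(lia) P1) as T3.
        pose proof (is_derive_mult (fun s => 2 * dx k 1 s) (fun s => 1 + ds k 1 s) s _ _
          (is_derive_scal (dx k 1) s 2 _ (Dx 1%nat ltac:(lia))) Dq Rmult_comm) as P2.
        pose proof (is_derive_term _ _ k f (S i) 1 x s Hf ltac:(lia) P2) as T4.
        pose proof (is_derive_pow (fun s => 1 + ds k 1 s) 2 s _ Dq) as P3.
        pose proof (is_derive_term _ _ k f i 2 x s Hf ltac:(lia) P3) as T5.
        pose proof (is_derive_plus _ _ _ _ _ (is_derive_plus _ _ _ _ _ (is_derive_plus _ _ _ _ _
          (is_derive_plus _ _ _ _ _ T1 T2) T3) T4) T5) as T. clear T1 T2 T3 T4 T5.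
        refine (eq_ind _ (fun l : R => is_derive _ s l) T _ _). clear T. match goal with |- ?a = ?b => change (@eq R a b) end.
        change plus with Rplus. change mult with Rmult. cbv beta. simpl pred. simpl INR. simpl pow. ring.
  - intros i j x s Hij.
    assert (Cx : forall n, (n <= 3)%nat -> continuous (fun p : R * R => dx k n (snd p)) (x, s)).
    { intros n Hn. apply (continuous_comp (fun p : R * R => snd p) (dx k n)); [apply continuous_snd|].
      now apply continuous_dx. }
    assert (Cs : forall n, (n <= 3)%nat -> continuous (fun p : R * R => ds k n (snd p)) (x, s)).
    { intros n Hn. apply (continuous_comp (fun p : R * R => snd p) (ds k n)); [apply continuous_snd|].
      now apply continuous_ds. }
    assert (Cq : continuous (fun p : R * R => 1 + ds k 1 (snd p)) (x, s)).
    { apply (continuous_plus (fun _ => 1) (fun p : R * R => ds k 1 (snd p))); [apply continuous_const|apply Cs; lia]. }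
    assert (Cf : forall i j, (i + j <= 3)%nat ->
      continuous (fun p : R * R => f i j (fst p + dx k 0 (snd p)) (snd p + ds k 0 (snd p))) (x, s)).
    { intros i' j' Hi. apply (continuous_comp_2 (fun p : R * R => fst p + dx k 0 (snd p))
        (fun p : R * R => snd p + ds k 0 (snd p)) (f i' j')).
      - apply (continuous_plus (fun p : R * R => fst p)); [apply continuous_fst|apply Cx; lia].
      - apply (continuous_plus (fun p : R * R => snd p)); [apply continuous_snd|apply Cs; lia].
      - now apply Hf2. }
    assert (Cm : forall u v : R * R -> R, continuous u (x, s) -> continuous v (x, s) ->
      continuous (fun p => u p * v p) (x, s)) by (intros; now apply @continuous_mult).
    assert (Cp : forall u v : R * R -> R, continuous u (x, s) -> continuous v (x, s) ->
      continuous (fun p => u p + v p) (x, s)) by (intros; now apply @continuous_plus).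
    assert (Cc : forall c : R, continuous (fun _ : R * R => c) (x, s)) by (intros; apply continuous_const).
    destruct j as [|[|[|[|j]]]]; [| | | |lia]; unfold pull, pow; cbv zeta;
      repeat match goal with
      | |- continuous (fun p => f _ _ (@?u p) (@?v p)) _ => simple apply Cf; lia
      | |- continuous (fun p => dx _ _ (@?u p)) _ => simple apply Cx; lia
      | |- continuous (fun p => ds _ _ (@?u p)) _ => simple apply Cs; lia
      | |- continuous (fun p => @?u p + @?v p) _ => refine (Cp u v _ _)
      | |- continuous (fun p => @?u p * @?v p) _ => refine (Cm u v _ _)
      | |- continuous (fun p => ?c) _ => exact (Cc c)
      end.
Qed.

End Walk.

(** * Growth of derivatives under a pair of opposite steps *)

Lemma Rabs_mul_le a b A B : Rabs a <= A -> Rabs b <= B -> Rabs (a * b) <= A * B.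
Proof.
  intros. rewrite Rabs_mult. apply Rmult_le_compat; trivial; apply Rabs_pos.
Qed.

Lemma Rabs_add_le a b A B : Rabs a <= A -> Rabs b <= B -> Rabs (a + b) <= A + B.
Proof. intros. apply Rle_trans with (1 := Rabs_triang _ _). lra. Qed.

Lemma Rabs_sub_le a b A B : Rabs a <= A -> Rabs b <= B -> Rabs (a - b) <= A + B.
Proof. intros. apply Rabs_add_le; trivial. now rewrite Rabs_Ropp. Qed.

Lemma lip_of_derive (g g1 : R -> R) N x y :
  (forall t, is_derive g t (g1 t)) -> (forall t, Rabs (g1 t) <= N) ->
  Rabs (g y - g x) <= N * Rabs (y - x).
Proof.
  intros Hg HN. destruct (MVT_gen g x y g1) as [c [_ Hc]].
  - intros; apply Hg.
  - intros t _. apply continuity_pt_filterlim, (ex_derive_continuous g). exists (g1 t). apply Hg.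
  - rewrite Hc, Rabs_mult. apply Rmult_le_compat_r; [apply Rabs_pos|apply HN].
Qed.

Lemma jet_lip f i j N M x s x' s' : smooth3 f -> (i + j < 3)%nat ->
  (forall x s, Rabs (f (S i) j x s) <= N) -> (forall x s, Rabs (f i (S j) x s) <= M) ->
  Rabs (f i j x' s' - f i j x s) <= N * Rabs (x' - x) + M * Rabs (s' - s).
Proof.
  intros [Hf _] Hij HN HM.
  replace (f i j x' s' - f i j x s) with ((f i j x' s' - f i j x s') + (f i j x s' - f i j x s)) by ring.
  apply Rabs_add_le.
  - apply (lip_of_derive (fun x => f i j x s') (fun x => f (S i) j x s')); intros; [now apply Hf|apply HN].
  - apply (lip_of_derive (fun s => f i j x s) (fun s => f i (S j) x s)); intros; [now apply Hf|apply HM].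
Qed.

Definition en (u v : R) : R := sqrt (u ^ 2 + v ^ 2).

Lemma en_pos u v : 0 <= en u v.
Proof. apply sqrt_pos. Qed.

Lemma en_sq u v : en u v ^ 2 = u ^ 2 + v ^ 2.
Proof. unfold en. rewrite <- Rsqr_pow2, Rsqr_sqrt; nra. Qed.

Lemma en_l u v : Rabs u <= en u v.
Proof. unfold en. rewrite <- sqrt_Rsqr_abs. apply sqrt_le_1_alt. unfold Rsqr. nra. Qed.

Lemma en_r u v : Rabs v <= en u v.
Proof. unfold en. rewrite <- sqrt_Rsqr_abs. apply sqrt_le_1_alt. unfold Rsqr. nra. Qed.

Lemma en_le u v c : 0 <= c -> u ^ 2 + v ^ 2 <= c ^ 2 -> en u v <= c.
Proof.
  intros Hc H. unfold en. rewrite <- (sqrt_Rsqr c Hc), Rsqr_pow2. now apply sqrt_le_1_alt.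
Qed.

Definition D1 (f : jet) x s u v : R := f 1%nat 0%nat x s * u + f 0%nat 1%nat x s * v.
Definition D2 (f : jet) x s u v : R :=
  f 2%nat 0%nat x s * u ^ 2 + 2 * f 1%nat 1%nat x s * u * v + f 0%nat 2%nat x s * v ^ 2.
Definition D3 (f : jet) x s u v : R :=
  f 3%nat 0%nat x s * u ^ 3 + 3 * f 2%nat 1%nat x s * u ^ 2 * v
  + 3 * f 1%nat 2%nat x s * u * v ^ 2 + f 0%nat 3%nat x s * v ^ 3.

Definition bd1 (f : jet) (N : R) : Prop := forall x s u v, Rabs (D1 f x s u v) <= N * en u v.
Definition bd2 (f : jet) (N : R) : Prop := forall x s u v, Rabs (D2 f x s u v) <= N * en u v ^ 2.
Definition bd3 (f : jet) (N : R) : Prop := forall x s u v, Rabs (D3 f x s u v) <= N * en u v ^ 3.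

Lemma bd1_entries f N : bd1 f N ->
  (forall x s, Rabs (f 1%nat 0%nat x s) <= N) /\ (forall x s, Rabs (f 0%nat 1%nat x s) <= N).
Proof.
  intros H. assert (E : en 1 0 = 1 /\ en 0 1 = 1).
  { unfold en. split; [replace (1 ^ 2 + 0 ^ 2) with 1 by ring|replace (0 ^ 2 + 1 ^ 2) with 1 by ring]; apply sqrt_1. }
  split; intros x s.
  - specialize (H x s 1 0). unfold D1 in H. rewrite (proj1 E), Rmult_0_r, !Rmult_1_r, Rplus_0_r in H. exact H.
  - specialize (H x s 0 1). unfold D1 in H. rewrite (proj2 E), Rmult_0_r, !Rmult_1_r, Rplus_0_l in H. exact H.
Qed.

Lemma bd2_entries f N : bd2 f N ->
  (forall x s, Rabs (f 2%nat 0%nat x s) <= N) /\ (forall x s, Rabs (f 1%nat 1%nat x s) <= N) /\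
  (forall x s, Rabs (f 0%nat 2%nat x s) <= N).
Proof.
  intros H. unfold bd2, D2 in H. repeat split; intros x s.
  - specialize (H x s 1 0). rewrite en_sq in H. apply Rabs_le_between in H. apply Rabs_le_between. lra.
  - pose proof (H x s 1 1) as A. pose proof (H x s 1 (-1)) as B. rewrite en_sq in A, B.
    apply Rabs_le_between in A, B. apply Rabs_le_between. lra.
  - specialize (H x s 0 1). rewrite en_sq in H. apply Rabs_le_between in H. apply Rabs_le_between. lra.
Qed.

(** Polarisation along [(1, 1)] and [(1, -1)], with [3] as an upper bound for the cube [2 * sqrt 2]
    of their norm. *)
Lemma bd3_entries f N : 0 <= N -> bd3 f N ->
  (forall x s, Rabs (f 3%nat 0%nat x s) <= N) /\ (forall x s, Rabs (f 2%nat 1%nat x s) <= 2 * N) /\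
  (forall x s, Rabs (f 1%nat 2%nat x s) <= 2 * N) /\ (forall x s, Rabs (f 0%nat 3%nat x s) <= N).
Proof.
  intros HN H. unfold bd3, D3 in H.
  assert (E1 : en 1 0 ^ 3 = 1).
  { unfold en. replace (1 ^ 2 + 0 ^ 2) with 1 by ring. rewrite sqrt_1. ring. }
  assert (E2 : en 0 1 ^ 3 = 1).
  { unfold en. replace (0 ^ 2 + 1 ^ 2) with 1 by ring. rewrite sqrt_1. ring. }
  assert (E3 : forall v, v ^ 2 = 1 -> N * en 1 v ^ 3 <= N * 3).
  { intros v Hv. apply Rmult_le_compat_l; trivial.
    pose proof (en_sq 1 v) as Q. rewrite Hv in Q. pose proof (en_pos 1 v).
    assert (en 1 v <= 3 / 2) by (apply en_le; lra).
    replace (en 1 v ^ 3) with (en 1 v ^ 2 * en 1 v) by ring. rewrite Q. lra. }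
  assert (A : forall x s, Rabs (f 3%nat 0%nat x s) <= N).
  { intros x s. specialize (H x s 1 0). rewrite E1 in H.
    apply Rabs_le_between in H. apply Rabs_le_between. lra. }
  assert (B : forall x s, Rabs (f 0%nat 3%nat x s) <= N).
  { intros x s. specialize (H x s 0 1). rewrite E2 in H.
    apply Rabs_le_between in H. apply Rabs_le_between. lra. }
  repeat split; trivial; intros x s; specialize (A x s); specialize (B x s);
    pose proof (H x s 1 1) as P1; pose proof (H x s 1 (-1)) as P2;
    pose proof (E3 1 ltac:(ring)); pose proof (E3 (-1) ltac:(ring));
    apply Rabs_le_between in A, B, P1, P2; apply Rabs_le_between; lra.
Qed.

Section Walk_bounds.
Variables xo xe so se : nat -> R -> R.
Variable k : R.
Hypothesis Hk : 0 <= k <= 1.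

Local Notation DX := (dx xo xe).
Local Notation DS := (ds so se).
Local Notation PULL := (pull xo xe so se).

Definition avg2 (f : jet) : jet := fun i j x s =>
  / 2 * (PULL k f i j x s + PULL (- k) f i j x s).

Definition coef_bd (n : nat) (L : R) : Prop := forall s,
  Rabs (xo n s) <= L /\ Rabs (xe n s) <= L /\ Rabs (so n s) <= L /\ Rabs (se n s) <= L.

(** Only odd parts are bounded here. The even part of the displacement contains the drift of sigma,
    whose bound depends on a truncation radius that must stay out of the growth rates of the
    derivatives. *)
Definition odd_bd (L : R) : Prop := forall s, Rabs (xo 0%nat s) <= L /\ Rabs (so 0%nat s) <= L.

(* The second moment of the tangent map of a pair of opposite steps; its odd part
   cancels, which is why it exceeds 1 by [O(k^2)] only. *)
Lemma tangent_sq L u v s : coef_bd 1 L -> 1 <= L ->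
  let e := en u v in
  exists X Y, (u + DX k 1 s * v) ^ 2 + ((1 + DS k 1 s) * v) ^ 2 = X + k * Y /\
    (u + DX (- k) 1 s * v) ^ 2 + ((1 + DS (- k) 1 s) * v) ^ 2 = X - k * Y /\
    0 <= X <= e ^ 2 * (1 + 8 * L ^ 2 * k ^ 2) /\ Rabs Y <= 8 * L ^ 2 * e ^ 2.
Proof.
  intros HL HL1 e. destruct (HL s) as [Ha [Hb [Hc Hd]]]. unfold dx, ds.
  set (a := xo 1%nat s) in *. set (b := xe 1%nat s) in *.
  set (c := so 1%nat s) in *. set (d := se 1%nat s) in *.
  (* The even and odd parts in [k] of the squared length of the tangent vector. *)
  exists (u ^ 2 + v ^ 2 + k ^ 2 * (2 * b * u * v + v ^ 2 * (2 * d + k ^ 2 * d ^ 2 + c ^ 2 + a ^ 2 + k ^ 2 * b ^ 2))).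
  exists (2 * a * u * v + 2 * v ^ 2 * (k ^ 2 * a * b + c * (1 + k ^ 2 * d))).
  assert (Hu : Rabs u <= e) by apply en_l. assert (Hv : Rabs v <= e) by apply en_r.
  assert (He : 0 <= e) by apply en_pos. assert (Hk2 : 0 <= k ^ 2 <= 1) by nra.
  assert (Hkk : Rabs (k ^ 2) <= 1) by (rewrite Rabs_pos_eq; lra).
  assert (Hv2 : Rabs (v ^ 2) <= e ^ 2).
  { replace (v ^ 2) with (v * v) by ring. replace (e ^ 2) with (e * e) by ring. now apply Rabs_mul_le. }
  assert (Huv : forall p, Rabs p <= L -> Rabs (2 * p * u * v) <= 2 * L * e * e).
  { intros p Hp. repeat apply Rabs_mul_le; trivial. rewrite Rabs_pos_eq; lra. }
  assert (Hsq : forall p, Rabs p <= L -> Rabs (p ^ 2) <= L ^ 2).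
  { intros p Hp. replace (p ^ 2) with (p * p) by ring. replace (L ^ 2) with (L * L) by ring. now apply Rabs_mul_le. }
  assert (HLL : L <= L ^ 2) by nra. assert (He2 : 0 <= e ^ 2) by nra.
  assert (T : Rabs (2 * b * u * v + v ^ 2 * (2 * d + k ^ 2 * d ^ 2 + c ^ 2 + a ^ 2 + k ^ 2 * b ^ 2))
     <= e ^ 2 * (8 * L ^ 2)).
  { apply Rle_trans with (2 * L * e * e + e ^ 2 * (2 * L + 1 * L ^ 2 + L ^ 2 + L ^ 2 + 1 * L ^ 2)).
    - apply Rabs_add_le; [now apply Huv|]. apply Rabs_mul_le; trivial.
      repeat apply Rabs_add_le; auto; apply Rabs_mul_le; auto. rewrite Rabs_pos_eq; lra.
    - assert (e ^ 2 * L <= e ^ 2 * L ^ 2) by (apply Rmult_le_compat_l; lra). nra. }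
  assert (TY : Rabs (2 * a * u * v + 2 * v ^ 2 * (k ^ 2 * a * b + c * (1 + k ^ 2 * d))) <= 8 * L ^ 2 * e ^ 2).
  { apply Rle_trans with (2 * L * e * e + 2 * e ^ 2 * (1 * L * L + L * (1 + 1 * L))).
    - apply Rabs_add_le; [now apply Huv|]. apply Rabs_mul_le.
      + apply Rabs_mul_le; trivial. rewrite Rabs_pos_eq; lra.
      + apply Rabs_add_le; repeat apply Rabs_mul_le; trivial. apply Rabs_add_le; [rewrite Rabs_R1; lra|].
        now apply Rabs_mul_le.
    - assert (e ^ 2 * L <= e ^ 2 * L ^ 2) by (apply Rmult_le_compat_l; lra). nra. }
  pose proof (en_sq u v) as Hen. fold e in Hen.
  assert (E1 : (u + (k * a + k ^ 2 * b) * v) ^ 2 + ((1 + (k * c + k ^ 2 * d)) * v) ^ 2 =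
    u ^ 2 + v ^ 2 + k ^ 2 * (2 * b * u * v + v ^ 2 * (2 * d + k ^ 2 * d ^ 2 + c ^ 2 + a ^ 2 + k ^ 2 * b ^ 2))
    + k * (2 * a * u * v + 2 * v ^ 2 * (k ^ 2 * a * b + c * (1 + k ^ 2 * d)))) by ring.
  assert (E2 : (u + (- k * a + (- k) ^ 2 * b) * v) ^ 2 + ((1 + (- k * c + (- k) ^ 2 * d)) * v) ^ 2 =
    u ^ 2 + v ^ 2 + k ^ 2 * (2 * b * u * v + v ^ 2 * (2 * d + k ^ 2 * d ^ 2 + c ^ 2 + a ^ 2 + k ^ 2 * b ^ 2))
    - k * (2 * a * u * v + 2 * v ^ 2 * (k ^ 2 * a * b + c * (1 + k ^ 2 * d)))) by ring.
  split; [exact E1|]. split; [exact E2|]. split; [|exact TY]. split.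
  - pose proof (pow2_ge_0 (u + (k * a + k ^ 2 * b) * v)). pose proof (pow2_ge_0 ((1 + (k * c + k ^ 2 * d)) * v)).
    pose proof (pow2_ge_0 (u + (- k * a + (- k) ^ 2 * b) * v)).
    pose proof (pow2_ge_0 ((1 + (- k * c + (- k) ^ 2 * d)) * v)). lra.
  - rewrite <- Hen. apply Rabs_le_between in T.
    assert (k ^ 2 * (2 * b * u * v + v ^ 2 * (2 * d + k ^ 2 * d ^ 2 + c ^ 2 + a ^ 2 + k ^ 2 * b ^ 2))
      <= k ^ 2 * (e ^ 2 * (8 * L ^ 2))) by (apply Rmult_le_compat_l; lra). lra.
Qed.

(** The inequalities [e * t <= (t ^ 2 + e ^ 2) / 2] and [e * t ^ 3 <= (t ^ 4 + t ^ 2 * e ^ 2) / 2]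
    reduce odd moments to even ones, where the terms of order [k] cancel; half the sum of fourth
    powers is [X ^ 2 + k ^ 2 * Y ^ 2]. *)
Lemma tangent_moments L u v s : coef_bd 1 L -> 1 <= L ->
  let e := en u v in
  let tp := en (u + DX k 1 s * v) ((1 + DS k 1 s) * v) in
  let tm := en (u + DX (- k) 1 s * v) ((1 + DS (- k) 1 s) * v) in
  / 2 * (tp + tm) <= e * (1 + 4 * L ^ 2 * k ^ 2) /\
  / 2 * (tp ^ 2 + tm ^ 2) <= e ^ 2 * (1 + 8 * L ^ 2 * k ^ 2) /\
  / 2 * (tp ^ 3 + tm ^ 3) <= e ^ 3 * (1 + 100 * L ^ 4 * k ^ 2).
Proof.
  intros HL HL1 e tp tm.
  destruct (tangent_sq L u v s HL HL1) as [X [Y [E1 [E2 [HX HY]]]]]. fold e in HX, HY.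
  rewrite <- en_sq in E1, E2. fold tp in E1. fold tm in E2.
  assert (He : 0 <= e) by apply en_pos.
  assert (Hp : 0 <= tp) by apply en_pos. assert (Hm : 0 <= tm) by apply en_pos.
  destruct (Req_dec e 0) as [He0|He0].
  { rewrite He0 in HX, HY |- *. replace (0 ^ 2 * (1 + 8 * L ^ 2 * k ^ 2)) with 0 in HX by ring.
    replace (8 * L ^ 2 * 0 ^ 2) with 0 in HY by ring. apply Rabs_le_between in HY.
    assert (X = 0) as X0 by lra. assert (Y = 0) as Y0 by lra. rewrite X0, Y0, Rmult_0_r in E1, E2.
    assert (tp = 0) as -> by (apply Rsqr_0_uniq; unfold Rsqr; lra).
    assert (tm = 0) as -> by (apply Rsqr_0_uniq; unfold Rsqr; lra). repeat split; lra. }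
  assert (Hep : 0 < e) by lra.
  assert (HL2 : 1 <= L ^ 2) by nra.
  assert (HL4 : L ^ 2 <= L ^ 4) by (replace (L ^ 4) with (L ^ 2 * L ^ 2) by ring; nra).
  assert (Hk2 : 0 <= k ^ 2 <= 1) by nra.
  assert (HYY : Y ^ 2 <= 64 * L ^ 4 * e ^ 4).
  { replace (64 * L ^ 4 * e ^ 4) with ((8 * L ^ 2 * e ^ 2) ^ 2) by ring. rewrite <- (pow2_abs Y).
    apply pow_incr. split; [apply Rabs_pos|exact HY]. }
  assert (HXX : X ^ 2 <= e ^ 4 * (1 + 16 * L ^ 2 * k ^ 2 + 64 * L ^ 4 * k ^ 2)).
  { apply Rle_trans with ((e ^ 2 * (1 + 8 * L ^ 2 * k ^ 2)) ^ 2).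
    - apply pow_incr. lra.
    - assert (0 <= e ^ 4) by (apply pow_le; lra).
      replace ((e ^ 2 * (1 + 8 * L ^ 2 * k ^ 2)) ^ 2) with (e ^ 4 * (1 + 16 * L ^ 2 * k ^ 2 + 64 * L ^ 4 * (k ^ 2 * k ^ 2))) by ring.
      apply Rmult_le_compat_l; trivial. apply Rplus_le_compat_l. apply Rmult_le_compat_l; nra. }
  split; [|split].
  - apply Rmult_le_reg_l with e; trivial.
    assert (e * tp <= / 2 * (tp ^ 2 + e ^ 2)) by (pose proof (pow2_ge_0 (tp - e)); nra).
    assert (e * tm <= / 2 * (tm ^ 2 + e ^ 2)) by (pose proof (pow2_ge_0 (tm - e)); nra). lra.
  - lra.
  - apply Rmult_le_reg_l with e; trivial.
    assert (P : forall t, 0 <= t -> e * t ^ 3 <= / 2 * (t ^ 2 * t ^ 2 + t ^ 2 * e ^ 2)).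
    { intros t Ht. assert (0 <= t ^ 2) by apply pow2_ge_0. pose proof (pow2_ge_0 (t - e)).
      assert (0 <= t ^ 2 * (t - e) ^ 2) by (apply Rmult_le_pos; trivial). lra. }
    pose proof (P tp Hp) as P1. pose proof (P tm Hm) as P2. rewrite E1 in P1. rewrite E2 in P2.
    assert (Hk2Y : k ^ 2 * Y ^ 2 <= k ^ 2 * (64 * L ^ 4 * e ^ 4)) by (apply Rmult_le_compat_l; lra).
    assert (HXe : X * e ^ 2 <= e ^ 2 * (1 + 8 * L ^ 2 * k ^ 2) * e ^ 2) by (apply Rmult_le_compat_r; nra).
    assert (Hfin : (e ^ 4 * (1 + 16 * L ^ 2 * k ^ 2 + 64 * L ^ 4 * k ^ 2) + k ^ 2 * (64 * L ^ 4 * e ^ 4)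
       + e ^ 2 * (1 + 8 * L ^ 2 * k ^ 2) * e ^ 2) <= 2 * (e * (e ^ 3 * (1 + 100 * L ^ 4 * k ^ 2)))).
    { assert (0 <= e ^ 4 * k ^ 2) by (apply Rmult_le_pos; [apply pow_le|]; lra).
      assert (e ^ 4 * k ^ 2 * L ^ 2 <= e ^ 4 * k ^ 2 * L ^ 4) by (apply Rmult_le_compat_l; lra).
      assert (0 <= e ^ 4 * k ^ 2 * L ^ 4) by (apply Rmult_le_pos; lra). lra. }
    lra.
Qed.

(** The even parts of opposite displacements agree, so the two points differ by [2 * k] times the
    odd part. *)
Lemma odd_diff f i j N M L x s : smooth3 f -> (i + j < 3)%nat -> odd_bd L ->
  (forall x s, Rabs (f (S i) j x s) <= N) -> (forall x s, Rabs (f i (S j) x s) <= M) ->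
  Rabs (f i j (x + DX k 0 s) (s + DS k 0 s) - f i j (x + DX (- k) 0 s) (s + DS (- k) 0 s))
    <= k * (2 * L * (N + M)).
Proof.
  intros Hf Hij HL HN HM. destruct (HL s) as [Ha Hc].
  eapply Rle_trans; [apply (jet_lip f i j N M); trivial|]. unfold dx, ds.
  replace (x + (k * xo 0%nat s + k ^ 2 * xe 0%nat s) - (x + (- k * xo 0%nat s + (- k) ^ 2 * xe 0%nat s)))
    with (2 * k * xo 0%nat s) by ring.
  replace (s + (k * so 0%nat s + k ^ 2 * se 0%nat s) - (s + (- k * so 0%nat s + (- k) ^ 2 * se 0%nat s)))
    with (2 * k * so 0%nat s) by ring.
  assert (H2 : Rabs (2 * k) <= 2 * k) by (rewrite Rabs_pos_eq; lra).
  pose proof (Rabs_mul_le _ _ _ _ H2 Ha). pose proof (Rabs_mul_le _ _ _ _ H2 Hc).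
  assert (0 <= N) by (eapply Rle_trans; [apply Rabs_pos|apply (HN 0 0)]).
  assert (0 <= M) by (eapply Rle_trans; [apply Rabs_pos|apply (HM 0 0)]).
  assert (N * Rabs (2 * k * xo 0%nat s) <= N * (2 * k * L)) by (apply Rmult_le_compat_l; trivial).
  assert (M * Rabs (2 * k * so 0%nat s) <= M * (2 * k * L)) by (apply Rmult_le_compat_l; trivial).
  lra.
Qed.

Lemma avg2_bd1 f N L : coef_bd 1 L -> 1 <= L -> 0 <= N -> bd1 f N ->
  bd1 (avg2 f) (N * (1 + 4 * L ^ 2 * k ^ 2)).
Proof.
  intros HL HL1 HN Hf x s u v.
  destruct (tangent_moments L u v s HL HL1) as [M1 _].
  pose proof (Hf (x + DX k 0 s) (s + DS k 0 s) (u + DX k 1 s * v) ((1 + DS k 1 s) * v)) as Fp.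
  pose proof (Hf (x + DX (- k) 0 s) (s + DS (- k) 0 s) (u + DX (- k) 1 s * v) ((1 + DS (- k) 1 s) * v)) as Fm.
  match type of Fp with Rabs ?a <= _ => set (dp := a) in * end.
  match type of Fm with Rabs ?a <= _ => set (dm := a) in * end.
  assert (E : D1 (avg2 f) x s u v = / 2 * (dp + dm)).
  { unfold dp, dm, D1, avg2, pull. cbv zeta. ring. }
  rewrite E. apply Rabs_le_between in Fp, Fm. apply Rabs_le_between.
  apply (Rmult_le_compat_l N) in M1; trivial. lra.
Qed.

(** Besides [D2 f] along the tangent vectors, there are first derivatives of [f] times second
    derivatives of the step. In these the odd coefficients, of size [k], have opposite signs and
    thus meet only the difference of first derivatives of [f] at opposite points, again of size
    [k]. *)
Lemma avg2_bd2 f N1 N2 L : smooth3 f -> odd_bd L -> coef_bd 1 L -> coef_bd 2 L -> 1 <= L ->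
  0 <= N1 -> N1 <= N2 -> bd1 f N1 -> bd2 f N2 ->
  bd2 (avg2 f) (N2 * (1 + 20 * L ^ 2 * k ^ 2)).
Proof.
  intros Hf HL0 HL1 HL2 HL HN1 HN12 F1 F2 x s u v.
  destruct (tangent_moments L u v s HL1 HL) as [_ [M2 _]].
  destruct (bd1_entries f N1 F1) as [F10 F01].
  destruct (bd2_entries f N2 F2) as [F20 [F11 F02]].
  pose proof (F2 (x + DX k 0 s) (s + DS k 0 s) (u + DX k 1 s * v) ((1 + DS k 1 s) * v)) as Fp.
  pose proof (F2 (x + DX (- k) 0 s) (s + DS (- k) 0 s) (u + DX (- k) 1 s * v) ((1 + DS (- k) 1 s) * v)) as Fm.
  match type of Fp with Rabs ?a <= _ => set (dp := a) in * end.
  match type of Fm with Rabs ?a <= _ => set (dm := a) in * end.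
  pose proof (odd_diff f 1 0 N2 N2 L x s Hf ltac:(lia) HL0 F20 F11) as O1.
  pose proof (odd_diff f 0 1 N2 N2 L x s Hf ltac:(lia) HL0 F11 F02) as O2.
  set (g10p := f 1%nat 0%nat (x + DX k 0 s) (s + DS k 0 s)) in *.
  set (g10m := f 1%nat 0%nat (x + DX (- k) 0 s) (s + DS (- k) 0 s)) in *.
  set (g01p := f 0%nat 1%nat (x + DX k 0 s) (s + DS k 0 s)) in *.
  set (g01m := f 0%nat 1%nat (x + DX (- k) 0 s) (s + DS (- k) 0 s)) in *.
  assert (E : D2 (avg2 f) x s u v = / 2 * (dp + dm)
     + v ^ 2 * (/ 2 * k * (xo 2%nat s * (g10p - g10m) + so 2%nat s * (g01p - g01m))
                + k ^ 2 * (/ 2 * (xe 2%nat s * (g10p + g10m) + se 2%nat s * (g01p + g01m))))).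
  { unfold dp, dm, D2, avg2, pull, g10p, g10m, g01p, g01m, dx, ds. cbv zeta. ring. }
  rewrite E. clear E. destruct (HL2 s) as [A1 [A2 [A3 A4]]].
  assert (B1 : Rabs (xo 2%nat s * (g10p - g10m) + so 2%nat s * (g01p - g01m)) <= L * (k * (2 * L * (N2 + N2))) + L * (k * (2 * L * (N2 + N2)))).
  { apply Rabs_add_le; now apply Rabs_mul_le. }
  assert (B2 : Rabs (/ 2 * (xe 2%nat s * (g10p + g10m) + se 2%nat s * (g01p + g01m))) <= / 2 * (L * (N1 + N1) + L * (N1 + N1))).
  { apply Rabs_mul_le; [rewrite Rabs_pos_eq; lra|].
    apply Rabs_add_le; apply Rabs_mul_le; trivial; apply Rabs_add_le; [apply F10|apply F10|apply F01|apply F01]. }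
  set (e := en u v) in *. assert (He : 0 <= e) by apply en_pos.
  assert (Hv : Rabs (v ^ 2) <= e ^ 2).
  { rewrite Rabs_pos_eq by apply pow2_ge_0. unfold e. rewrite en_sq. pose proof (pow2_ge_0 u). lra. }
  assert (B3 : Rabs (/ 2 * k * (xo 2%nat s * (g10p - g10m) + so 2%nat s * (g01p - g01m)) +
     k ^ 2 * (/ 2 * (xe 2%nat s * (g10p + g10m) + se 2%nat s * (g01p + g01m))))
     <= / 2 * k * (L * (k * (2 * L * (N2 + N2))) + L * (k * (2 * L * (N2 + N2)))) + k ^ 2 * (/ 2 * (L * (N1 + N1) + L * (N1 + N1)))).
  { apply Rabs_add_le; apply Rabs_mul_le; trivial; rewrite Rabs_pos_eq; nra. }
  pose proof (Rabs_mul_le _ _ _ _ Hv B3) as B4.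
  apply (Rmult_le_compat_l N2) in M2; [|lra].
  apply Rabs_le_between in Fp, Fm.
  apply Rle_trans with (N2 * (e ^ 2 * (1 + 8 * L ^ 2 * k ^ 2)) + e ^ 2 *
       (/ 2 * k * (L * (k * (2 * L * (N2 + N2))) + L * (k * (2 * L * (N2 + N2)))) + k ^ 2 * (/ 2 * (L * (N1 + N1) + L * (N1 + N1))))).
  - apply Rabs_add_le; trivial. apply Rabs_le_between. lra.
  - assert (H1 : 0 <= e ^ 2 * k ^ 2) by (apply Rmult_le_pos; apply pow2_ge_0).
    assert (H2 : L * N1 <= L ^ 2 * N2) by (apply Rmult_le_compat; nra).
    assert (H3 : e ^ 2 * k ^ 2 * (L * N1) <= e ^ 2 * k ^ 2 * (L ^ 2 * N2)) by (apply Rmult_le_compat_l; trivial).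
    assert (H4 : 0 <= e ^ 2 * k ^ 2 * (L ^ 2 * N2)) by (apply Rmult_le_pos; nra).
    lra.
Qed.

(** The products of order [k] are opposite for the two steps, so they appear only with the factor
    [Hp - Hm], itself of order [k]. *)
Lemma pair_bound Hp Hm ue uo vo ve N M U V : 0 <= M ->
  Rabs Hp <= N -> Rabs Hm <= N -> Rabs (Hp - Hm) <= k * M ->
  Rabs ue <= U -> Rabs uo <= U -> Rabs vo <= V -> Rabs ve <= V ->
  Rabs (/ 2 * (Hp * ((ue + k * uo) * (k * vo + k ^ 2 * ve))
             + Hm * ((ue - k * uo) * (- k * vo + k ^ 2 * ve)))) <= k ^ 2 * ((2 * N + M) * (U * V)).
Proof.
  intros HM Hp1 Hm1 Hd H1 H2 H3 H4.
  replace (/ 2 * (Hp * ((ue + k * uo) * (k * vo + k ^ 2 * ve)) + Hm * ((ue - k * uo) * (- k * vo + k ^ 2 * ve))))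
    with (/ 2 * k ^ 2 * ((Hp + Hm) * (ue * ve + uo * vo)) + / 2 * k * ((Hp - Hm) * (ue * vo + k ^ 2 * (uo * ve))))
    by ring.
  assert (Hk2 : 0 <= k ^ 2 <= 1) by nra.
  assert (HUV : 0 <= U * V).
  { apply Rmult_le_pos; (eapply Rle_trans; [apply Rabs_pos|eassumption]). }
  apply Rle_trans with (/ 2 * k ^ 2 * ((N + N) * (U * V + U * V)) + / 2 * k * (k * M * (U * V + 1 * (U * V)))).
  - apply Rabs_add_le; apply Rabs_mul_le; try (rewrite Rabs_pos_eq; lra).
    + apply Rabs_mul_le; [now apply Rabs_add_le|]. apply Rabs_add_le; now apply Rabs_mul_le.
    + apply Rabs_mul_le; trivial. apply Rabs_add_le; [now apply Rabs_mul_le|].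
      apply Rabs_mul_le; [rewrite Rabs_pos_eq; lra|now apply Rabs_mul_le].
  - apply Req_le. field.
Qed.

Lemma avg2_bd3 f N1 N2 N3 L : smooth3 f ->
  odd_bd L -> coef_bd 1 L -> coef_bd 2 L -> coef_bd 3 L -> 1 <= L ->
  0 <= N1 -> N1 <= N2 -> N2 <= N3 -> bd1 f N1 -> bd2 f N2 -> bd3 f N3 ->
  bd3 (avg2 f) (N3 * (1 + 400 * L ^ 4 * k ^ 2)).
Proof.
  intros Hf HL0 HL1 HL2 HL3 HL HN1 HN12 HN23 F1 F2 F3 x s u v.
  destruct (tangent_moments L u v s HL1 HL) as [_ [_ M3]].
  destruct (bd1_entries f N1 F1) as [F10 F01].
  destruct (bd2_entries f N2 F2) as [F20 [F11 F02]].
  destruct (bd3_entries f N3 ltac:(lra) F3) as [F30 [F21 [F12 F03]]].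
  pose proof (F3 (x + DX k 0 s) (s + DS k 0 s) (u + DX k 1 s * v) ((1 + DS k 1 s) * v)) as Fp.
  pose proof (F3 (x + DX (- k) 0 s) (s + DS (- k) 0 s) (u + DX (- k) 1 s * v) ((1 + DS (- k) 1 s) * v)) as Fm.
  match type of Fp with Rabs ?a <= _ => set (dp := a) in * end.
  match type of Fm with Rabs ?a <= _ => set (dm := a) in * end.
  pose proof (odd_diff f 1 0 N2 N2 L x s Hf ltac:(lia) HL0 F20 F11) as O10.
  pose proof (odd_diff f 0 1 N2 N2 L x s Hf ltac:(lia) HL0 F11 F02) as O01.
  pose proof (odd_diff f 2 0 N3 (2 * N3) L x s Hf ltac:(lia) HL0 F30 F21) as O20.
  pose proof (odd_diff f 1 1 (2 * N3) (2 * N3) L x s Hf ltac:(lia) HL0 F21 F12) as O11.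
  pose proof (odd_diff f 0 2 (2 * N3) N3 L x s Hf ltac:(lia) HL0 F12 F03) as O02.
  set (g := fun i j => f i j (x + DX k 0 s) (s + DS k 0 s)) in *.
  set (h := fun i j => f i j (x + DX (- k) 0 s) (s + DS (- k) 0 s)) in *.
  change (Rabs (g 1%nat 0%nat - h 1%nat 0%nat) <= k * (2 * L * (N2 + N2))) in O10.
  change (Rabs (g 0%nat 1%nat - h 0%nat 1%nat) <= k * (2 * L * (N2 + N2))) in O01.
  change (Rabs (g 2%nat 0%nat - h 2%nat 0%nat) <= k * (2 * L * (N3 + 2 * N3))) in O20.
  change (Rabs (g 1%nat 1%nat - h 1%nat 1%nat) <= k * (2 * L * (2 * N3 + 2 * N3))) in O11.
  change (Rabs (g 0%nat 2%nat - h 0%nat 2%nat) <= k * (2 * L * (2 * N3 + N3))) in O02.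
  destruct (HL1 s) as [A1 [B1 [C1 E1]]]. destruct (HL2 s) as [A2 [B2 [C2 E2]]].
  destruct (HL3 s) as [A3 [B3 [C3 E3]]].
  set (a1 := xo 1%nat s) in *. set (b1 := xe 1%nat s) in *. set (c1 := so 1%nat s) in *. set (e1 := se 1%nat s) in *.
  set (a2 := xo 2%nat s) in *. set (b2 := xe 2%nat s) in *. set (c2 := so 2%nat s) in *. set (e2 := se 2%nat s) in *.
  set (a3 := xo 3%nat s) in *. set (b3 := xe 3%nat s) in *. set (c3 := so 3%nat s) in *. set (e3 := se 3%nat s) in *.
  (* Apart from the third derivative along the tangent vectors, every term of the chain rule is a
     derivative of [f] times a tangent component times a second derivative of the step, or a first
     derivative of [f] times a third derivative of the step; with factor 1 in the latter case, all
     have the shape of [pair_bound]. *)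
  set (pr := fun Hp Hm ue uo vo ve => / 2 * (Hp * ((ue + k * uo) * (k * vo + k ^ 2 * ve))
             + Hm * ((ue - k * uo) * (- k * vo + k ^ 2 * ve)))).
  assert (E : D3 (avg2 f) x s u v = / 2 * (dp + dm)
    + 3 * ((pr (g 2%nat 0%nat) (h 2%nat 0%nat) (u + k ^ 2 * b1 * v) (a1 * v) (a2 * v ^ 2) (b2 * v ^ 2)
    + pr (g 1%nat 1%nat) (h 1%nat 1%nat) (u + k ^ 2 * b1 * v) (a1 * v) (c2 * v ^ 2) (e2 * v ^ 2))
    + (pr (g 1%nat 1%nat) (h 1%nat 1%nat) (v + k ^ 2 * e1 * v) (c1 * v) (a2 * v ^ 2) (b2 * v ^ 2)
    + pr (g 0%nat 2%nat) (h 0%nat 2%nat) (v + k ^ 2 * e1 * v) (c1 * v) (c2 * v ^ 2) (e2 * v ^ 2)))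
    + (pr (g 1%nat 0%nat) (h 1%nat 0%nat) 1 0 (a3 * v ^ 3) (b3 * v ^ 3)
    + pr (g 0%nat 1%nat) (h 0%nat 1%nat) 1 0 (c3 * v ^ 3) (e3 * v ^ 3))).
  { unfold dp, dm, D3, avg2, pull. cbv zeta. 
    change (fun i j => f i j (x + DX k 0 s) (s + DS k 0 s)) with g.
    assert (Eg : forall i j, f i j (x + DX k 0 s) (s + DS k 0 s) = g i j) by reflexivity.
    assert (Eh : forall i j, f i j (x + DX (- k) 0 s) (s + DS (- k) 0 s) = h i j) by reflexivity.
    rewrite !Eg, !Eh. clearbody g h. unfold pr, dx, ds.
    fold a1 b1 c1 e1 a2 b2 c2 e2 a3 b3 c3 e3. clearbody a1 b1 c1 e1 a2 b2 c2 e2 a3 b3 c3 e3. ring. }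
  rewrite E. clear E.
  set (e := en u v) in *. assert (He : 0 <= e) by apply en_pos.
  assert (Hu : Rabs u <= e) by apply en_l. assert (Hv : Rabs v <= e) by apply en_r.
  assert (Hk2 : 0 <= k ^ 2 <= 1) by nra.
  assert (Hv2 : Rabs (v ^ 2) <= e ^ 2).
  { rewrite <- RPow_abs. apply pow_incr. split; [apply Rabs_pos|exact Hv]. }
  assert (Hv3 : Rabs (v ^ 3) <= e ^ 3).
  { rewrite <- RPow_abs. apply pow_incr. split; [apply Rabs_pos|exact Hv]. }
  assert (Hue : forall w b, Rabs w <= e -> Rabs b <= L -> Rabs (w + k ^ 2 * b * v) <= 2 * L * e).
  { intros w b Hw Hb. apply Rle_trans with (e + 1 * L * e).
    - apply Rabs_add_le; trivial. repeat apply Rabs_mul_le; trivial. rewrite Rabs_pos_eq; lra.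
    - assert (1 * e <= L * e) by (apply Rmult_le_compat_r; lra). lra. }
  assert (Huo : forall a, Rabs a <= L -> Rabs (a * v) <= 2 * L * e).
  { intros a Ha. apply Rle_trans with (L * e); [now apply Rabs_mul_le|].
    assert (0 <= L * e) by (apply Rmult_le_pos; lra). lra. }
  assert (Hvv : forall a, Rabs a <= L -> Rabs (a * v ^ 2) <= L * e ^ 2) by (intros; now apply Rabs_mul_le).
  assert (Hvvv : forall a, Rabs a <= L -> Rabs (a * v ^ 3) <= L * e ^ 3) by (intros; now apply Rabs_mul_le).
  assert (HLN : 0 <= L * N3) by (apply Rmult_le_pos; lra).
  assert (HLN2 : 0 <= L * N2) by (apply Rmult_le_pos; lra).
  assert (HM : forall p, 0 <= k * p -> k * p <= k * p) by (intros; lra).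
  assert (P2 : forall i j ue uo vo ve, (i + j = 2)%nat -> Rabs ue <= 2 * L * e -> Rabs uo <= 2 * L * e ->
     Rabs vo <= L * e ^ 2 -> Rabs ve <= L * e ^ 2 ->
     Rabs (pr (g i j) (h i j) ue uo vo ve) <= k ^ 2 * ((2 * N2 + 8 * (L * N3)) * (2 * L * e * (L * e ^ 2)))).
  { intros i j ue uo vo ve Hij. apply pair_bound; [lra| | |].
    - destruct i as [|[|[|i]]]; [replace j with 2%nat by lia; apply F02|replace j with 1%nat by lia; apply F11|
        replace j with 0%nat by lia; apply F20|lia].
    - destruct i as [|[|[|i]]]; [replace j with 2%nat by lia; apply F02|replace j with 1%nat by lia; apply F11|
        replace j with 0%nat by lia; apply F20|lia].
    - destruct i as [|[|[|i]]]; [replace j with 2%nat by lia|replace j with 1%nat by lia|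
        replace j with 0%nat by lia|lia].
      + eapply Rle_trans; [apply O02|]. apply Rmult_le_compat_l; lra.
      + eapply Rle_trans; [apply O11|]. apply Rmult_le_compat_l; lra.
      + eapply Rle_trans; [apply O20|]. apply Rmult_le_compat_l; lra. }
  assert (P1 : forall i j vo ve, (i + j = 1)%nat -> Rabs vo <= L * e ^ 3 -> Rabs ve <= L * e ^ 3 ->
     Rabs (pr (g i j) (h i j) 1 0 vo ve) <= k ^ 2 * ((2 * N1 + 4 * (L * N2)) * (1 * (L * e ^ 3)))).
  { intros i j vo ve Hij. apply pair_bound; try (rewrite ?Rabs_R1, ?Rabs_R0; lra).
    - destruct i as [|[|i]]; [replace j with 1%nat by lia; apply F01|replace j with 0%nat by lia; apply F10|lia].
    - destruct i as [|[|i]]; [replace j with 1%nat by lia; apply F01|replace j with 0%nat by lia; apply F10|lia].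
    - destruct i as [|[|i]]; [replace j with 1%nat by lia|replace j with 0%nat by lia|lia].
      + eapply Rle_trans; [apply O01|]. apply Rmult_le_compat_l; lra.
      + eapply Rle_trans; [apply O10|]. apply Rmult_le_compat_l; lra. }
  apply (Rmult_le_compat_l N3) in M3; [|lra].
  apply Rabs_le_between in Fp, Fm.
  eapply Rle_trans.
  { apply Rabs_add_le; [apply Rabs_add_le|apply Rabs_add_le].
    - instantiate (1 := N3 * (e ^ 3 * (1 + 100 * L ^ 4 * k ^ 2))). apply Rabs_le_between. lra.
    - apply Rabs_mul_le; [rewrite Rabs_pos_eq; [apply Rle_refl|lra]|].
      apply Rabs_add_le; apply Rabs_add_le; apply P2; auto.
    - apply P1; auto.
    - apply P1; auto. }
  assert (Q0 : 0 <= k ^ 2 * e ^ 3) by (apply Rmult_le_pos; [lra|apply pow_le; lra]).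
  assert (HL2' : L <= L ^ 2) by nra. assert (HL3' : L ^ 2 <= L ^ 3) by nra.
  assert (HL4' : L ^ 3 <= L ^ 4) by nra.
  assert (Q1 : L * N1 <= L ^ 4 * N3) by (apply Rmult_le_compat; lra).
  assert (Q2 : L ^ 2 * N2 <= L ^ 4 * N3) by (apply Rmult_le_compat; lra).
  assert (Q3 : L ^ 3 * N3 <= L ^ 4 * N3) by (apply Rmult_le_compat_r; lra).
  apply Rle_trans with (N3 * (e ^ 3 * (1 + 100 * L ^ 4 * k ^ 2)) +
     k ^ 2 * e ^ 3 * (56 * (L ^ 2 * N2) + 192 * (L ^ 3 * N3) + 4 * (L * N1))).
  { apply Req_le. ring. }
  assert (k ^ 2 * e ^ 3 * (56 * (L ^ 2 * N2) + 192 * (L ^ 3 * N3) + 4 * (L * N1)) <= k ^ 2 * e ^ 3 * (300 * (L ^ 4 * N3))).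
  { apply Rmult_le_compat_l; trivial. assert (0 <= L ^ 4 * N3) by (apply Rmult_le_pos; [apply pow_le|]; lra). lra. }
  lra.
Qed.
End Walk_bounds.

(** * Taylor estimates for jets *)

Lemma mvt_sym (g g1 : R -> R) x y : (forall t, is_derive g t (g1 t)) ->
  exists c, Rabs (c - x) <= Rabs (y - x) /\ g y - g x = g1 c * (y - x).
Proof.
  intros Hg. destruct (MVT_gen g x y g1) as [c [Hc1 Hc2]].
  - intros; apply Hg.
  - intros t _. apply continuity_pt_filterlim, (ex_derive_continuous g). exists (g1 t). apply Hg.
  - exists c. split; trivial. unfold Rmin, Rmax in Hc1. destruct (Rle_dec x y).
    + rewrite !Rabs_pos_eq; lra.
    + rewrite !Rabs_left1; lra.
Qed.

Lemma jet_taylor1 f i j M x s u v : smooth3 f -> (i + j <= 1)%nat ->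
  (forall x s, Rabs (f (S (S i)) j x s) <= M) -> (forall x s, Rabs (f (S i) (S j) x s) <= M) ->
  (forall x s, Rabs (f i (S (S j)) x s) <= M) ->
  Rabs (f i j (x + u) (s + v) - f i j x s - (f (S i) j x s * u + f i (S j) x s * v))
    <= M * (Rabs u + Rabs v) ^ 2.
Proof.
  intros Hf Hij M1 M2 M3. pose proof Hf as [Hf1 _].
  assert (HM : 0 <= M) by (eapply Rle_trans; [apply Rabs_pos|apply (M1 0 0)]).
  destruct (mvt_sym (fun x => f i j x (s + v)) (fun x => f (S i) j x (s + v)) x (x + u)) as [c [Hc Ec]].
  { intros; apply Hf1; lia. }
  destruct (mvt_sym (fun s => f i j x s) (fun s => f i (S j) x s) s (s + v)) as [d [Hd Ed]].
  { intros; apply Hf1; lia. }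
  replace (x + u - x) with u in * by ring. replace (s + v - s) with v in * by ring.
  replace (f i j (x + u) (s + v) - f i j x s - (f (S i) j x s * u + f i (S j) x s * v))
    with ((f (S i) j c (s + v) - f (S i) j x s) * u + (f i (S j) x d - f i (S j) x s) * v).
  2: { replace (f i j (x + u) (s + v) - f i j x s) with
       ((f i j (x + u) (s + v) - f i j x (s + v)) + (f i j x (s + v) - f i j x s)) by ring.
       rewrite Ec, Ed. ring. }
  pose proof (jet_lip f (S i) j M M x s c (s + v) Hf ltac:(lia) M1 M2) as L1.
  pose proof (jet_lip f i (S j) M M x s x d Hf ltac:(lia) M2 M3) as L2.
  replace (s + v - s) with v in L1 by ring. rewrite Rminus_diag, Rabs_R0 in L2.
  apply Rle_trans with ((M * Rabs u + M * Rabs v) * Rabs u + (M * Rabs v) * Rabs v).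
  - apply Rabs_add_le; apply Rabs_mul_le; try lra.
    + assert (M * Rabs (c - x) <= M * Rabs u) by (apply Rmult_le_compat_l; trivial). lra.
    + assert (M * Rabs (d - s) <= M * Rabs v) by (apply Rmult_le_compat_l; trivial). lra.
  - pose proof (Rabs_pos u). pose proof (Rabs_pos v).
    assert (0 <= M * (Rabs u * Rabs v)) by (repeat apply Rmult_le_pos; trivial). nra.
Qed.

(** The mean value theorem for the remainder along the segment leaves the first-order remainder of
    the gradient, covered by [jet_taylor1]; hence the crude constant. *)
Lemma jet_taylor2 f M x s u v : smooth3 f ->
  (forall i j x s, (i + j = 3)%nat -> Rabs (f i j x s) <= M) ->
  Rabs (f 0%nat 0%nat (x + u) (s + v) - f 0%nat 0%nat x s - D1 f x s u v - / 2 * D2 f x s u v)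
    <= 2 * M * (Rabs u + Rabs v) ^ 3.
Proof.
  intros Hf HM. pose proof Hf as [Hf1 Hf2].
  assert (HM0 : 0 <= M) by (eapply Rle_trans; [apply Rabs_pos|apply (HM 3%nat 0%nat 0 0); lia]).
  set (g := fun th => f 0%nat 0%nat (x + th * u) (s + th * v) - th * D1 f x s u v - th ^ 2 * (/ 2 * D2 f x s u v)).
  set (g1 := fun th => u * f 1%nat 0%nat (x + th * u) (s + th * v) + v * f 0%nat 1%nat (x + th * u) (s + th * v)
     - D1 f x s u v - 2 * th * (/ 2 * D2 f x s u v)).
  assert (Hg : forall th, is_derive g th (g1 th)).
  { intros th. unfold g, g1.
    assert (A : is_derive (fun th => f 0%nat 0%nat (x + th * u) (s + th * v)) th
       (u * f 1%nat 0%nat (x + th * u) (s + th * v) + v * f 0%nat 1%nat (x + th * u) (s + th * v))).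
    { apply (is_derive_comp2 (f 0%nat 0%nat) (f 1%nat 0%nat) _ (fun th => x + th * u) (fun th => s + th * v)).
      - intros; apply Hf1; lia.
      - apply Hf1; lia.
      - apply Hf2; lia.
      - auto_derive; trivial. ring.
      - auto_derive; trivial. ring. }
    assert (B : is_derive (fun th => th * D1 f x s u v) th (D1 f x s u v)) by (auto_derive; trivial; ring).
    assert (C : is_derive (fun th => th ^ 2 * (/ 2 * D2 f x s u v)) th (2 * th * (/ 2 * D2 f x s u v)))
      by (auto_derive; trivial; ring).
    exact (is_derive_minus _ _ _ _ _ (is_derive_minus _ _ _ _ _ A B) C). }
  destruct (MVT_gen g 0 1 g1) as [c [Hc Ec]].
  { intros; apply Hg. }
  { intros t _. apply continuity_pt_filterlim, (ex_derive_continuous g). exists (g1 t). apply Hg. }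
  rewrite Rmin_left, Rmax_right in Hc by lra.
  replace (f 0%nat 0%nat (x + u) (s + v) - f 0%nat 0%nat x s - D1 f x s u v - / 2 * D2 f x s u v)
    with (g 1 - g 0).
  2: { unfold g. replace (x + 1 * u) with (x + u) by ring. replace (s + 1 * v) with (s + v) by ring.
       replace (x + 0 * u) with x by ring. replace (s + 0 * v) with s by ring. ring. }
  rewrite Ec, Rminus_0_r, Rmult_1_r. unfold g1.
  pose proof (jet_taylor1 f 1 0 M x s (c * u) (c * v) Hf ltac:(lia) (fun x s => HM 3%nat 0%nat x s ltac:(lia))
    (fun x s => HM 2%nat 1%nat x s ltac:(lia))
    (fun x s => HM 1%nat 2%nat x s ltac:(lia))) as T1.
  pose proof (jet_taylor1 f 0 1 M x s (c * u) (c * v) Hf ltac:(lia) (fun x s => HM 2%nat 1%nat x s ltac:(lia))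
    (fun x s => HM 1%nat 2%nat x s ltac:(lia))
    (fun x s => HM 0%nat 3%nat x s ltac:(lia))) as T2.
  assert (Hcu : forall w, Rabs (c * w) <= Rabs w).
  { intros w. rewrite <- (Rmult_1_l (Rabs w)). apply Rabs_mul_le; [rewrite Rabs_pos_eq; lra|lra]. }
  assert (Hq : M * (Rabs (c * u) + Rabs (c * v)) ^ 2 <= M * (Rabs u + Rabs v) ^ 2).
  { apply Rmult_le_compat_l; trivial. apply pow_incr. pose proof (Hcu u). pose proof (Hcu v).
    pose proof (Rabs_pos (c * u)). pose proof (Rabs_pos (c * v)). lra. }
  apply (Rle_trans _ _ _ T1) in Hq as T1'. apply (Rle_trans _ _ _ T2) in Hq as T2'.
  assert (Hu : Rabs u <= Rabs u) by lra. assert (Hv : Rabs v <= Rabs v) by lra.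
  pose proof (Rabs_add_le _ _ _ _ (Rabs_mul_le _ _ _ _ Hu T1') (Rabs_mul_le _ _ _ _ Hv T2')) as T.
  match type of T with Rabs ?a <= ?b => match goal with |- Rabs ?c <= ?d =>
    replace c with a; [replace d with (2 * b); [pose proof (Rabs_pos a); lra|]|] end end.
  - ring.
  - unfold D1, D2. field.
Qed.

Lemma pull_close xo xe so se k f x s i j L N : -1 <= k <= 1 -> smooth3 f -> 1 <= L ->
  (i + j <= 2)%nat -> (1 <= i + j)%nat ->
  coef_bd xo xe so se 0 L -> coef_bd xo xe so se 1 L -> coef_bd xo xe so se 2 L ->
  (forall i j x s, (i + j <= 3)%nat -> (1 <= i + j)%nat -> Rabs (f i j x s) <= N) ->
  Rabs (pull xo xe so se k f i j x s - f i j x s) <= Rabs k * (40 * L ^ 2 * N).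
Proof.
  intros Hk Hf HL Hij Hij1 H0 H1 H2 HN.
  assert (Hak : Rabs k <= 1) by (apply Rabs_le_between; lra).
  assert (Hpk : 0 <= Rabs k) by apply Rabs_pos.
  assert (HN0 : 0 <= N) by (eapply Rle_trans; [apply Rabs_pos|apply (HN 1%nat 0%nat 0 0); lia]).
  assert (comb : forall a b, Rabs a <= L -> Rabs b <= L -> Rabs (k * a + k ^ 2 * b) <= Rabs k * (2 * L)).
  { intros a b Ha Hb. apply Rle_trans with (Rabs k * L + Rabs k * 1 * L); [|lra].
    apply Rabs_add_le; [apply Rabs_mul_le; lra|]. apply Rabs_mul_le; trivial.
    replace (k ^ 2) with (k * k) by ring. apply Rabs_mul_le; lra. }
  assert (P : forall n, (n <= 2)%nat -> Rabs (dx xo xe k n s) <= Rabs k * (2 * L) /\ Rabs (ds so se k n s) <= Rabs k * (2 * L)).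
  { intros n Hn. unfold dx, ds.
    destruct n as [|[|[|n]]]; [destruct (H0 s) as [? [? [? ?]]]|destruct (H1 s) as [? [? [? ?]]]|destruct (H2 s) as [? [? [? ?]]]|lia];
      split; now apply comb. }
  assert (close : forall i j, (i + j <= 2)%nat -> (1 <= i + j)%nat ->
    Rabs (f i j (x + dx xo xe k 0 s) (s + ds so se k 0 s) - f i j x s) <= Rabs k * (4 * L * N)).
  { intros i' j' Hi Hi1. eapply Rle_trans; [apply (jet_lip f i' j' N N); trivial; try lia; intros; apply HN; lia|].
    replace (x + dx xo xe k 0 s - x) with (dx xo xe k 0 s) by ring.
    replace (s + ds so se k 0 s - s) with (ds so se k 0 s) by ring.
    destruct (P 0%nat ltac:(lia)) as [Px Ps].
    apply (Rmult_le_compat_l N) in Px; trivial. apply (Rmult_le_compat_l N) in Ps; trivial. lra. }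
  destruct (P 1%nat ltac:(lia)) as [P1 Q1]. destruct (P 2%nat ltac:(lia)) as [P2 Q2].
  assert (HL2 : L <= L ^ 2) by nra.
  assert (HkLN : Rabs k * L * N <= Rabs k * L ^ 2 * N).
  { apply Rmult_le_compat_r; trivial. apply Rmult_le_compat_l; trivial. }
  assert (HkLN0 : 0 <= Rabs k * L * N) by (repeat apply Rmult_le_pos; lra).
  assert (Hone : Rabs k * (2 * L) <= 2 * L).
  { rewrite <- (Rmult_1_l (2 * L)) at 2. apply Rmult_le_compat_r; lra. }
  assert (Hq : Rabs (2 + ds so se k 1 s) <= 4 * L).
  { apply Rle_trans with (2 + Rabs k * (2 * L)); [|lra].
    apply Rabs_add_le; trivial. rewrite Rabs_pos_eq; lra. }
  assert (Hq' : Rabs (1 + ds so se k 1 s) <= 3 * L).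
  { apply Rle_trans with (1 + Rabs k * (2 * L)); [|lra].
    apply Rabs_add_le; trivial. rewrite Rabs_R1; lra. }
  assert (HN' : forall i j, (i + j <= 3)%nat -> (1 <= i + j)%nat ->
    Rabs (f i j (x + dx xo xe k 0 s) (s + ds so se k 0 s)) <= N) by (intros; now apply HN).
  unfold pull. cbv zeta. destruct j as [|[|[|j]]]; [| | |lia].
  - eapply Rle_trans; [apply close; lia|]. lra.
  - match goal with |- Rabs (?p * ?a + (1 + ?q) * ?b - ?c) <= _ =>
      replace (p * a + (1 + q) * b - c) with (p * a + q * b + (b - c)) by ring end.
    eapply Rle_trans.
    { apply Rabs_add_le; [apply Rabs_add_le; apply Rabs_mul_le|]; [apply P1|apply HN'; lia|apply Q1|apply HN'; lia|apply close; lia]. }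
    lra.
  - assert (i = 0)%nat by lia. subst i.
    match goal with |- Rabs (?p2 * ?a + ?q2 * ?b + ?p1 ^ 2 * ?c + 2 * ?p1 * (1 + ?q) * ?d + (1 + ?q) ^ 2 * ?e - ?g) <= _ =>
      replace (p2 * a + q2 * b + p1 ^ 2 * c + 2 * p1 * (1 + q) * d + (1 + q) ^ 2 * e - g)
      with (p2 * a + q2 * b + p1 * (p1 * c) + p1 * (2 * (1 + q) * d) + q * ((2 + q) * e) + (e - g)) by ring end.
    eapply Rle_trans.
    { apply Rabs_add_le; [apply Rabs_add_le; [apply Rabs_add_le; [apply Rabs_add_le; [apply Rabs_add_le|]|]|]|apply close; lia]; apply Rabs_mul_le;
        [apply P2|apply HN'; lia|apply Q2|apply HN'; lia|apply P1| |apply P1| |apply Q1|].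
      - apply Rabs_mul_le; [eapply Rle_trans; [apply P1|apply Hone]|apply HN'; lia].
      - apply Rabs_mul_le; [apply Rabs_mul_le; [rewrite Rabs_pos_eq; [apply Rle_refl|lra]|apply Hq']|apply HN'; lia].
      - apply Rabs_mul_le; [apply Hq|apply HN'; lia]. }
    lra.
Qed.

Lemma smooth3_half_sum f g : smooth3 f -> smooth3 g ->
  smooth3 (fun i j x s => / 2 * (f i j x s + g i j x s)).
Proof.
  intros [F1 F2] [G1 G2]. split.
  - intros i j x s Hij. split.
    + apply (is_derive_scal (fun x => f i j x s + g i j x s)).
      apply (is_derive_plus (fun x => f i j x s) (fun x => g i j x s)); [now apply F1|now apply G1].
    + apply (is_derive_scal (fun s => f i j x s + g i j x s)).
      apply (is_derive_plus (fun s => f i j x s) (fun s => g i j x s)); [now apply F1|now apply G1].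
  - intros i j x s Hij.
    apply (continuous_scal_r (/ 2) (fun p : R * R => f i j (fst p) (snd p) + g i j (fst p) (snd p))).
    apply (continuous_plus (fun p : R * R => f i j (fst p) (snd p)) (fun p => g i j (fst p) (snd p)));
      [now apply F2|now apply G2].
Qed.

Lemma avg2_smooth3 xo xe so se k f : smooth_coef xo -> smooth_coef xe -> smooth_coef so -> smooth_coef se ->
  smooth3 f -> smooth3 (avg2 xo xe so se k f).
Proof.
  intros. apply (smooth3_half_sum (pull xo xe so se k f) (pull xo xe so se (- k) f)); now apply pull_smooth3.
Qed.

Lemma half_sum_le a b c : Rabs a <= c -> Rabs b <= c -> Rabs (/ 2 * (a + b)) <= c.
Proof. intros Ha Hb. apply Rabs_le_between in Ha, Hb. apply Rabs_le_between. lra. Qed.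

(** * The walk for the pair (ln S, sigma) *)

Section Real_walk.
Variables r rho : R.
Variables be bb ga : nat -> R -> R.
Hypothesis Hrho : -1 <= rho <= 1.

(** Given the sign of the diffusive increment of sigma, that of ln S is the same sign times
    [k * be * z], with [z] equal to [zp] or [zm] with equal probability. The mean of [z] is [rho]
    and its mean square is 1, which gives the right covariance. *)
Definition zp : R := rho + sqrt (1 - rho ^ 2).
Definition zm : R := rho - sqrt (1 - rho ^ 2).

Lemma z_spec : Rabs zp <= 2 /\ Rabs zm <= 2 /\ zp + zm = 2 * rho /\ zp ^ 2 + zm ^ 2 = 2.
Proof.
  assert (H : 0 <= 1 - rho ^ 2) by nra.
  pose proof (sqrt_pos (1 - rho ^ 2)) as S0. pose proof (pow2_sqrt _ H) as S1.
  assert (S2 : sqrt (1 - rho ^ 2) <= 1) by nra.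
  unfold zp, zm. repeat split; [apply Rabs_le_between; lra|apply Rabs_le_between; lra|ring|].
  replace ((rho + sqrt (1 - rho ^ 2)) ^ 2 + (rho - sqrt (1 - rho ^ 2)) ^ 2)
    with (2 * rho ^ 2 + 2 * sqrt (1 - rho ^ 2) ^ 2) by ring. rewrite S1. ring.
Qed.

Definition xod (z : R) (n : nat) (s : R) : R := z * be n s.

Definition drift (n : nat) (s : R) : R :=
  match n with
  | 0%nat => r - be 0%nat s ^ 2 / 2
  | 1%nat => - (be 0%nat s * be 1%nat s)
  | 2%nat => - (be 1%nat s ^ 2 + be 0%nat s * be 2%nat s)
  | _ => - (3 * be 1%nat s * be 2%nat s + be 0%nat s * be 3%nat s)
  end.

(* One step of a random walk approximating (ln S, sigma): the two Brownian
   increments are independent signs times [k], the square root of the time step. *)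
Definition walk (k : R) (f : jet) : jet := fun i j x s =>
  / 2 * (avg2 (xod zp) drift bb ga k f i j x s + avg2 (xod zm) drift bb ga k f i j x s).

Definition gen (f : jet) (x s : R) : R :=
  (r - be 0%nat s ^ 2 / 2) * f 1%nat 0%nat x s + ga 0%nat s * f 0%nat 1%nat x s
  + / 2 * be 0%nat s ^ 2 * f 2%nat 0%nat x s + rho * be 0%nat s * bb 0%nat s * f 1%nat 1%nat x s
  + / 2 * bb 0%nat s ^ 2 * f 0%nat 2%nat x s.

Hypothesis Hbe : smooth_coef be.
Hypothesis Hbb : smooth_coef bb.
Hypothesis Hga : smooth_coef ga.

Lemma xod_smooth z : smooth_coef (xod z).
Proof.
  split.
  - intros n s Hn. apply (is_derive_scal (be n)). now apply Hbe.
  - intros s. apply (continuous_scal_r z (be 3%nat)). apply Hbe.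
Qed.

Lemma drift_smooth : smooth_coef drift.
Proof.
  assert (Hd : forall n s, (n < 3)%nat -> is_derive (be n) s (be (S n) s)) by apply Hbe.
  assert (Hm : forall n m s, (n < 3)%nat -> (m < 3)%nat ->
    is_derive (fun s => be n s * be m s) s (be (S n) s * be m s + be n s * be (S m) s)).
  { intros n m s Hn Hm. apply (is_derive_mult (be n) (be m)); [now apply Hd|now apply Hd|apply Rmult_comm]. }
  split.
  - intros n s Hn. destruct n as [|[|[|n]]]; [| | |lia].
    + apply (is_derive_ext (fun s => r + - / 2 * (be 0%nat s * be 0%nat s))).
      { intros t. simpl. match goal with |- ?a = ?b => change (@eq R a b) end. field. }
      pose proof (is_derive_plus (fun _ : R => r) _ s _ _ (is_derive_const r s)
        (is_derive_scal _ s (- / 2) _ (Hm 0%nat 0%nat s ltac:(lia) ltac:(lia)))) as T.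
      refine (eq_ind _ (fun l : R => is_derive _ s l) T _ _). clear T.
      match goal with |- ?a = ?b => change (@eq R a b) end. change plus with Rplus. change zero with 0. simpl. field.
    + apply (is_derive_ext (fun s => - 1 * (be 0%nat s * be 1%nat s))).
      { intros t. simpl. match goal with |- ?a = ?b => change (@eq R a b) end. ring. }
      pose proof (is_derive_scal _ s (- 1) _ (Hm 0%nat 1%nat s ltac:(lia) ltac:(lia))) as T.
      refine (eq_ind _ (fun l : R => is_derive _ s l) T _ _). clear T.
      match goal with |- ?a = ?b => change (@eq R a b) end. simpl. ring.
    + apply (is_derive_ext (fun s => - 1 * (be 1%nat s * be 1%nat s + be 0%nat s * be 2%nat s))).
      { intros t. simpl. match goal with |- ?a = ?b => change (@eq R a b) end. ring. }
      pose proof (is_derive_scal _ s (- 1) _ (is_derive_plus _ _ s _ _ (Hm 1%nat 1%nat s ltac:(lia) ltac:(lia))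
        (Hm 0%nat 2%nat s ltac:(lia) ltac:(lia)))) as T.
      refine (eq_ind _ (fun l : R => is_derive _ s l) T _ _). clear T.
      match goal with |- ?a = ?b => change (@eq R a b) end. change plus with Rplus. simpl. ring.
  - intros s. assert (C : forall n, (n <= 3)%nat -> continuous (be n) s) by (intros; now apply smooth_coef_continuous).
    apply (continuous_opp (fun s => 3 * be 1%nat s * be 2%nat s + be 0%nat s * be 3%nat s)).
    apply (continuous_plus (fun s => 3 * be 1%nat s * be 2%nat s) (fun s => be 0%nat s * be 3%nat s)).
    + apply (continuous_mult (fun s => 3 * be 1%nat s) (be 2%nat)); [|apply C; lia].
      apply (continuous_scal_r 3 (be 1%nat)). apply C; lia.
    + apply (continuous_mult (be 0%nat) (be 3%nat)); apply C; lia.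
Qed.

Variable k : R.
Hypothesis Hk : 0 <= k <= 1.

Lemma walk_smooth3 f : smooth3 f -> smooth3 (walk k f).
Proof.
  intros Hf. apply smooth3_half_sum; apply avg2_smooth3; trivial using xod_smooth, drift_smooth.
Qed.

Lemma walk_sup f B : (forall x s, Rabs (f 0%nat 0%nat x s) <= B) ->
  forall x s, Rabs (walk k f 0%nat 0%nat x s) <= B.
Proof. intros Hf x s. unfold walk, avg2, pull. repeat apply half_sum_le; apply Hf. Qed.

(** The displacement does not depend on [x], so [f_xx - f_x] after the step is an average of its
    values before. *)
Lemma walk_convex f : (forall x s, 0 <= f 2%nat 0%nat x s - f 1%nat 0%nat x s) ->
  forall x s, 0 <= walk k f 2%nat 0%nat x s - walk k f 1%nat 0%nat x s.
Proof.
  intros Hf x s. unfold walk, avg2, pull. cbv zeta.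
  pose proof (Hf (x + dx (xod zp) drift k 0 s) (s + ds bb ga k 0 s)).
  pose proof (Hf (x + dx (xod zp) drift (- k) 0 s) (s + ds bb ga (- k) 0 s)).
  pose proof (Hf (x + dx (xod zm) drift k 0 s) (s + ds bb ga k 0 s)).
  pose proof (Hf (x + dx (xod zm) drift (- k) 0 s) (s + ds bb ga (- k) 0 s)). lra.
Qed.

Definition lev (n : nat) (L : R) : Prop :=
  forall z, Rabs z <= 2 -> coef_bd (xod z) drift bb ga n L.

Definition lev_odd (L : R) : Prop := forall z, Rabs z <= 2 -> odd_bd (xod z) bb L.

Lemma walk_bd1 f N L : lev 1 L -> 1 <= L -> 0 <= N -> bd1 f N -> bd1 (walk k f) (N * (1 + 4 * L ^ 2 * k ^ 2)).
Proof.
  intros HL HL1 HN Hf x s u v. destruct z_spec as [Z1 [Z2 _]].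
  pose proof (avg2_bd1 _ _ _ _ k Hk f N L (HL zp Z1) HL1 HN Hf x s u v) as A.
  pose proof (avg2_bd1 _ _ _ _ k Hk f N L (HL zm Z2) HL1 HN Hf x s u v) as B.
  eapply Rle_trans; [|apply (half_sum_le _ _ _ A B)]. apply Req_le. f_equal. unfold D1, walk. ring.
Qed.

Lemma walk_bd2 f N1 N2 L : smooth3 f -> lev_odd L -> lev 1 L -> lev 2 L -> 1 <= L ->
  0 <= N1 -> N1 <= N2 -> bd1 f N1 -> bd2 f N2 -> bd2 (walk k f) (N2 * (1 + 20 * L ^ 2 * k ^ 2)).
Proof.
  intros Hf H0 H1 H2 HL HN1 HN12 F1 F2 x s u v. destruct z_spec as [Z1 [Z2 _]].
  pose proof (avg2_bd2 _ _ _ _ k Hk f N1 N2 L Hf (H0 zp Z1) (H1 zp Z1) (H2 zp Z1) HL HN1 HN12 F1 F2 x s u v) as A.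
  pose proof (avg2_bd2 _ _ _ _ k Hk f N1 N2 L Hf (H0 zm Z2) (H1 zm Z2) (H2 zm Z2) HL HN1 HN12 F1 F2 x s u v) as B.
  eapply Rle_trans; [|apply (half_sum_le _ _ _ A B)]. apply Req_le. f_equal. unfold D2, walk. ring.
Qed.

Lemma walk_bd3 f N1 N2 N3 L : smooth3 f -> lev_odd L -> lev 1 L -> lev 2 L -> lev 3 L -> 1 <= L ->
  0 <= N1 -> N1 <= N2 -> N2 <= N3 -> bd1 f N1 -> bd2 f N2 -> bd3 f N3 ->
  bd3 (walk k f) (N3 * (1 + 400 * L ^ 4 * k ^ 2)).
Proof.
  intros Hf H0 H1 H2 H3 HL HN1 HN12 HN23 F1 F2 F3 x s u v. destruct z_spec as [Z1 [Z2 _]].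
  pose proof (avg2_bd3 _ _ _ _ k Hk f N1 N2 N3 L Hf (H0 zp Z1) (H1 zp Z1) (H2 zp Z1) (H3 zp Z1) HL HN1 HN12 HN23 F1 F2 F3 x s u v) as A.
  pose proof (avg2_bd3 _ _ _ _ k Hk f N1 N2 N3 L Hf (H0 zm Z2) (H1 zm Z2) (H2 zm Z2) (H3 zm Z2) HL HN1 HN12 HN23 F1 F2 F3 x s u v) as B.
  eapply Rle_trans; [|apply (half_sum_le _ _ _ A B)]. apply Req_le. f_equal. unfold D3, walk. ring.
Qed.

Definition jet_bd (f : jet) (N : R) : Prop :=
  forall i j x s, (1 <= i + j)%nat -> (i + j <= 3)%nat -> Rabs (f i j x s) <= N.

(** No cancellation is used: each of the four steps moves the derivative by [O(k)], which suffices
    for interpolating between two time levels. *)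
Lemma walk_close f i j L N x s : smooth3 f -> 1 <= L -> (i + j <= 2)%nat -> (1 <= i + j)%nat ->
  lev 0 L -> lev 1 L -> lev 2 L -> jet_bd f N ->
  Rabs (walk k f i j x s - f i j x s) <= k * (40 * L ^ 2 * N).
Proof.
  intros Hf HL Hij Hij1 H0 H1 H2 HN. destruct z_spec as [Z1 [Z2 _]].
  assert (HN' : forall i j x s, (i + j <= 3)%nat -> (1 <= i + j)%nat -> Rabs (f i j x s) <= N) by (intros; now apply HN).
  assert (P : forall z k', Rabs z <= 2 -> Rabs k' = k ->
    Rabs (pull (xod z) drift bb ga k' f i j x s - f i j x s) <= k * (40 * L ^ 2 * N)).
  { intros z k' Hz Hk'. rewrite <- Hk'. apply pull_close; auto.
    apply Rabs_le_between. lra. }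
  replace (walk k f i j x s - f i j x s) with
    (/ 2 * (/ 2 * ((pull (xod zp) drift bb ga k f i j x s - f i j x s) + (pull (xod zp) drift bb ga (- k) f i j x s - f i j x s))
          + / 2 * ((pull (xod zm) drift bb ga k f i j x s - f i j x s) + (pull (xod zm) drift bb ga (- k) f i j x s - f i j x s))))
    by (unfold walk, avg2; field).
  repeat apply half_sum_le; apply P; trivial; rewrite ?Rabs_Ropp; apply Rabs_pos_eq; lra.
Qed.

(** Opposite steps cancel the odd terms of the second-order expansion; with only third derivatives
    bounded, the remainder is [O(k^3)] rather than [O(k^4)]. *)
Lemma walk_consistent f L N x s : smooth3 f -> 1 <= L -> lev 0 L -> jet_bd f N ->
  Rabs (walk k f 0%nat 0%nat x s - f 0%nat 0%nat x s - k ^ 2 * gen f x s) <= k ^ 3 * (200 * L ^ 3 * N).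
Proof.
  intros Hf HL H0 HN. destruct z_spec as [Z1 [Z2 [Z3 Z4]]].
  assert (HN0 : 0 <= N) by (eapply Rle_trans; [apply Rabs_pos|apply (HN 1%nat 0%nat 0 0); lia]).
  set (genz := fun z => drift 0 s * f 1%nat 0%nat x s + ga 0%nat s * f 0%nat 1%nat x s
    + / 2 * (z ^ 2 * be 0%nat s ^ 2 * f 2%nat 0%nat x s + 2 * z * be 0%nat s * bb 0%nat s * f 1%nat 1%nat x s
             + bb 0%nat s ^ 2 * f 0%nat 2%nat x s)).
  assert (E : gen f x s = / 2 * (genz zp + genz zm)).
  { unfold genz, gen, drift. replace (/ 2 * be 0%nat s ^ 2) with (/ 4 * (zp ^ 2 + zm ^ 2) * be 0%nat s ^ 2) by (rewrite Z4; field).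
    replace rho with (/ 2 * (zp + zm)) by lra. field. }
  assert (P : forall z, Rabs z <= 2 ->
    Rabs (avg2 (xod z) drift bb ga k f 0%nat 0%nat x s - f 0%nat 0%nat x s - k ^ 2 * genz z) <= k ^ 3 * (200 * L ^ 3 * N)).
  { intros z Hz. destruct (H0 z Hz s) as [A1 [A2 [A3 A4]]].
    set (a := xod z 0 s) in *. set (b := drift 0 s) in *. set (c := bb 0%nat s) in *. set (d := ga 0%nat s) in *.
    assert (Hk3 : 0 <= k ^ 2 <= 1) by nra.
    assert (T : forall k', Rabs k' = k ->
      Rabs (f 0%nat 0%nat (x + (k' * a + k' ^ 2 * b)) (s + (k' * c + k' ^ 2 * d)) - f 0%nat 0%nat x s
        - D1 f x s (k' * a + k' ^ 2 * b) (k' * c + k' ^ 2 * d) - / 2 * D2 f x s (k' * a + k' ^ 2 * b) (k' * c + k' ^ 2 * d))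
        <= k ^ 3 * (128 * L ^ 3 * N)).
    { intros k' Hk'. eapply Rle_trans; [apply (jet_taylor2 f N); trivial; intros; apply HN; lia|].
      assert (C : forall a b, Rabs a <= L -> Rabs b <= L -> Rabs (k' * a + k' ^ 2 * b) <= k * (2 * L)).
      { intros a0 b0 Ha Hb. apply Rle_trans with (k * L + k * k * L); [|assert (k * k * L <= k * 1 * L) by (apply Rmult_le_compat_r; [|apply Rmult_le_compat_l]; lra); lra].
        apply Rabs_add_le; [apply Rabs_mul_le; lra|]. apply Rabs_mul_le; trivial.
        replace (k' ^ 2) with (k' * k') by ring. apply Rabs_mul_le; lra. }
      apply Rle_trans with (2 * N * (k * (4 * L)) ^ 3).
      - apply Rmult_le_compat_l; [lra|]. apply pow_incr. 
        pose proof (C a b A1 A2). pose proof (C c d A3 A4).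
        pose proof (Rabs_pos (k' * a + k' ^ 2 * b)). pose proof (Rabs_pos (k' * c + k' ^ 2 * d)). lra.
      - apply Req_le. ring. }
    pose proof (T k ltac:(apply Rabs_pos_eq; lra)) as T1.
    pose proof (T (- k) ltac:(rewrite Rabs_Ropp; apply Rabs_pos_eq; lra)) as T2.
    pose proof (half_sum_le _ _ _ T1 T2) as T3.
    (* The quadratic term of the even displacement [k ^ 2 * (b, d)], not part of the generator. *)
    assert (Q : Rabs (/ 2 * k ^ 4 * D2 f x s b d) <= k ^ 3 * (2 * L ^ 2 * N)).
    { assert (HD : Rabs (D2 f x s b d) <= N * L ^ 2 + 2 * N * L * L + N * L ^ 2).
      { unfold D2. assert (Hsq : forall p, Rabs p <= L -> Rabs (p ^ 2) <= L ^ 2).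
        { intros p Hp. rewrite <- RPow_abs. apply pow_incr. split; [apply Rabs_pos|trivial]. }
        apply Rabs_add_le; [apply Rabs_add_le|].
        - apply Rabs_mul_le; [apply HN; lia|auto].
        - apply Rabs_mul_le; trivial. apply Rabs_mul_le; trivial.
          apply Rabs_mul_le; [rewrite Rabs_pos_eq; lra|apply HN; lia].
        - apply Rabs_mul_le; [apply HN; lia|auto]. }
      assert (Hk4 : Rabs (/ 2 * k ^ 4) <= / 2 * k ^ 3).
      { assert (0 <= k ^ 3) by (apply pow_le; lra). rewrite Rabs_pos_eq; nra. }
      pose proof (Rabs_mul_le _ _ _ _ Hk4 HD). lra. }
    replace (avg2 (xod z) drift bb ga k f 0%nat 0%nat x s - f 0%nat 0%nat x s - k ^ 2 * genz z) with
      (/ 2 * (f 0%nat 0%nat (x + (k * a + k ^ 2 * b)) (s + (k * c + k ^ 2 * d)) - f 0%nat 0%nat x s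
        - D1 f x s (k * a + k ^ 2 * b) (k * c + k ^ 2 * d) - / 2 * D2 f x s (k * a + k ^ 2 * b) (k * c + k ^ 2 * d)
       + (f 0%nat 0%nat (x + (- k * a + (- k) ^ 2 * b)) (s + (- k * c + (- k) ^ 2 * d)) - f 0%nat 0%nat x s
        - D1 f x s (- k * a + (- k) ^ 2 * b) (- k * c + (- k) ^ 2 * d) - / 2 * D2 f x s (- k * a + (- k) ^ 2 * b) (- k * c + (- k) ^ 2 * d)))
       + / 2 * k ^ 4 * D2 f x s b d).
    - eapply Rle_trans; [apply (Rabs_add_le _ _ _ _ T3 Q)|].
      assert (L ^ 2 <= L ^ 3) by (simpl; nra).
      assert (0 <= k ^ 3 * N) by (apply Rmult_le_pos; [apply pow_le|]; lra).
      assert (k ^ 3 * N * L ^ 2 <= k ^ 3 * N * L ^ 3) by (apply Rmult_le_compat_l; trivial).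
      assert (0 <= k ^ 3 * N * L ^ 3) by (apply Rmult_le_pos; [|apply pow_le]; lra). lra.
    - unfold avg2, pull, genz. cbv zeta. unfold dx, ds. fold a b c d. unfold D1, D2.
      set (Fp := f 0%nat 0%nat (x + (k * a + k ^ 2 * b)) (s + (k * c + k ^ 2 * d))).
      set (Fm := f 0%nat 0%nat (x + (- k * a + (- k) ^ 2 * b)) (s + (- k * c + (- k) ^ 2 * d))).
      assert (Ha : a = z * be 0%nat s) by reflexivity. clearbody Fp Fm a b c d. rewrite Ha. field. }
  rewrite E. replace (walk k f 0%nat 0%nat x s - f 0%nat 0%nat x s - k ^ 2 * (/ 2 * (genz zp + genz zm)))
    with (/ 2 * ((avg2 (xod zp) drift bb ga k f 0%nat 0%nat x s - f 0%nat 0%nat x s - k ^ 2 * genz zp)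
      + (avg2 (xod zm) drift bb ga k f 0%nat 0%nat x s - f 0%nat 0%nat x s - k ^ 2 * genz zm)))
    by (unfold walk; field).
  apply half_sum_le; now apply P.
Qed.
End Real_walk.

(* Expanding about the centre of the four points: the terms of order [k^2] not
   controlled by [f_s >= - m] are [be be' (f_xx - f_x) >= 0] and
   [rho be' bb f_xs], and the latter is absorbed by a shift of [x]. *)
Lemma walk_mono r rho be bb ga k f m K N x s :
  -1 <= rho <= 1 -> 0 <= k -> 3 * K ^ 2 * k <= 1 -> 1 <= K -> smooth3 f -> jet_bd f N ->
  0 <= be 0%nat s <= K -> 0 <= be 1%nat s <= K ->
  Rabs (bb 0%nat s) <= K -> Rabs (bb 1%nat s) <= K -> Rabs (ga 1%nat s) <= K ->
  (forall x s, 0 <= f 2%nat 0%nat x s - f 1%nat 0%nat x s) ->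
  0 <= m -> (forall x s, - m <= f 0%nat 1%nat x s) ->
  - (m * (1 + K * k ^ 2)) - k ^ 3 * (60 * K ^ 5 * N) <= walk r rho be bb ga k f 0%nat 1%nat x s.
Proof.
  intros Hrho Hk HKk HK Hf HN Hb0 Hb1 Hc0 Hc1 Hg1 Hconv Hm Hfm.
  destruct (z_spec rho Hrho) as [Z1 [Z2 [Z3 Z4]]].
  assert (HN0 : 0 <= N) by (eapply Rle_trans; [apply Rabs_pos|apply (HN 1%nat 0%nat 0 0); lia]).
  set (b0 := be 0%nat s) in *. set (b1 := be 1%nat s) in *. set (c0 := bb 0%nat s) in *.
  set (c1 := bb 1%nat s) in *. set (g1 := ga 1%nat s) in *.
  (* The centre of the four points, which are [(X + u, S + v)] and [(X - u, S - v)] for the two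
     values of [z]. *)
  set (X := x + k ^ 2 * drift r be 0 s). set (S := s + k ^ 2 * ga 0%nat s).
  set (w := rho * b1 * c0).
  assert (HKK : K <= K ^ 2) by nra.
  assert (Hk1 : k <= 1 / 3) by nra.
  assert (HkK : k * K <= 1 / 3) by nra.
  assert (Hb0' : Rabs b0 <= K) by (rewrite Rabs_pos_eq; lra).
  assert (Hb1' : Rabs b1 <= K) by (rewrite Rabs_pos_eq; lra).
  assert (Hw : Rabs w <= K ^ 2).
  { replace (K ^ 2) with (1 * K * K) by ring. apply Rabs_mul_le; trivial. apply Rabs_mul_le; trivial.
    apply Rabs_le_between. lra. }
  assert (Hk2 : 0 <= k ^ 2) by apply pow2_ge_0.
  assert (Hk3 : 0 <= k ^ 3) by (apply pow_le; lra).
  assert (HKp : K ^ 2 <= K ^ 3 <= K ^ 4) by (split; simpl; nra).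
  assert (HKp5 : K ^ 4 <= K ^ 5) by (assert (0 <= K ^ 4) by (apply pow_le; lra); simpl in *; nra).
  set (P := fun z => avg2 (xod be z) (drift r be) bb ga k f 0%nat 1%nat x s).
  set (G := fun z => k ^ 2 * (z ^ 2 * b0 * b1 * f 2%nat 0%nat X S + z * b1 * c0 * f 1%nat 1%nat X S)
     - k ^ 2 * (b0 * b1) * f 1%nat 0%nat X S - m * (1 + K * k ^ 2) - k ^ 2 * w * f 1%nat 1%nat X S
     - k ^ 3 * (60 * K ^ 5 * N)).
  assert (main : forall z, Rabs z <= 2 -> G z <= P z).
  { intros z Hz.
    set (u := k * (z * b0)). set (v := k * c0).
    assert (Hu : Rabs u <= k * (2 * K)).
    { apply Rabs_mul_le; [rewrite Rabs_pos_eq; lra|]. now apply Rabs_mul_le. }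
    assert (Hv : Rabs v <= k * K) by (apply Rabs_mul_le; trivial; rewrite Rabs_pos_eq; lra).
    assert (Huv : 0 <= Rabs u + Rabs v <= k * (3 * K)).
    { pose proof (Rabs_pos u). pose proof (Rabs_pos v). lra. }
    set (fp := fun i j => f i j (X + u) (S + v)). set (fm := fun i j => f i j (X + - u) (S + - v)).
    assert (EP : P z = / 2 * (k * (z * b1) * (fp 1%nat 0%nat - fm 1%nat 0%nat)
        - k ^ 2 * (b0 * b1) * (fp 1%nat 0%nat + fm 1%nat 0%nat)
        + (1 + k * c1 + k ^ 2 * g1) * fp 0%nat 1%nat + (1 - k * c1 + k ^ 2 * g1) * fm 0%nat 1%nat)).
    { unfold P, avg2, pull, fp, fm. cbv zeta.
      replace (x + dx (xod be z) (drift r be) k 0 s) with (X + u) by (unfold dx, X, u, xod, b0; ring).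
      replace (s + ds bb ga k 0 s) with (S + v) by (unfold ds, S, v, c0; ring).
      replace (x + dx (xod be z) (drift r be) (- k) 0 s) with (X + - u) by (unfold dx, X, u, xod, b0; ring).
      replace (s + ds bb ga (- k) 0 s) with (S + - v) by (unfold ds, S, v, c0; ring).
      replace (dx (xod be z) (drift r be) k 1 s) with (k * (z * b1) - k ^ 2 * (b0 * b1)) by (unfold dx, xod, drift; fold b0 b1; ring).
      replace (dx (xod be z) (drift r be) (- k) 1 s) with (- k * (z * b1) - k ^ 2 * (b0 * b1)) by (unfold dx, xod, drift; fold b0 b1; ring).
      replace (ds bb ga k 1 s) with (k * c1 + k ^ 2 * g1) by (unfold ds; fold c1 g1; ring).
      replace (ds bb ga (- k) 1 s) with (- k * c1 + k ^ 2 * g1) by (unfold ds; fold c1 g1; ring).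
      ring. }
    rewrite EP. clear EP.
    pose proof (jet_taylor1 f 1 0 N X S u v Hf ltac:(lia) (fun x s => HN 3%nat 0%nat x s ltac:(lia) ltac:(lia))
      (fun x s => HN 2%nat 1%nat x s ltac:(lia) ltac:(lia)) (fun x s => HN 1%nat 2%nat x s ltac:(lia) ltac:(lia))) as T1.
    pose proof (jet_taylor1 f 1 0 N X S (- u) (- v) Hf ltac:(lia) (fun x s => HN 3%nat 0%nat x s ltac:(lia) ltac:(lia))
      (fun x s => HN 2%nat 1%nat x s ltac:(lia) ltac:(lia)) (fun x s => HN 1%nat 2%nat x s ltac:(lia) ltac:(lia))) as T2.
    rewrite !Rabs_Ropp in T2.
    assert (HQ : N * (Rabs u + Rabs v) ^ 2 <= N * (k ^ 2 * (9 * K ^ 2))).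
    { apply Rmult_le_compat_l; trivial. replace (k ^ 2 * (9 * K ^ 2)) with ((k * (3 * K)) ^ 2) by ring.
      apply pow_incr. lra. }
    apply (fun a => Rle_trans _ _ _ a HQ) in T1. apply (fun a => Rle_trans _ _ _ a HQ) in T2.
    fold (fp 1%nat 0%nat) in T1. fold (fm 1%nat 0%nat) in T2.
    assert (A1 : Rabs (/ 2 * (k * (z * b1) * (fp 1%nat 0%nat - fm 1%nat 0%nat))
       - k ^ 2 * (z ^ 2 * b0 * b1 * f 2%nat 0%nat X S + z * b1 * c0 * f 1%nat 1%nat X S)) <= k ^ 3 * (18 * K ^ 3 * N)).
    { pose proof (Rabs_sub_le _ _ _ _ T1 T2) as T.
      assert (Hzb : Rabs (/ 2 * (k * (z * b1))) <= / 2 * (k * (2 * K))).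
      { apply Rabs_mul_le; [rewrite Rabs_pos_eq; lra|]. apply Rabs_mul_le; [rewrite Rabs_pos_eq; lra|].
        now apply Rabs_mul_le. }
      pose proof (Rabs_mul_le _ _ _ _ Hzb T) as T'.
      match type of T' with Rabs ?a <= ?b => match goal with |- Rabs ?c <= ?d =>
        replace c with a; [replace d with b; [exact T'|field]|unfold u, v; field] end end. }
    pose proof (jet_lip f 1 0 N N X S (X + u) (S + v) Hf ltac:(lia) (fun x s => HN 2%nat 0%nat x s ltac:(lia) ltac:(lia))
      (fun x s => HN 1%nat 1%nat x s ltac:(lia) ltac:(lia))) as L1.
    pose proof (jet_lip f 1 0 N N X S (X + - u) (S + - v) Hf ltac:(lia) (fun x s => HN 2%nat 0%nat x s ltac:(lia) ltac:(lia))
      (fun x s => HN 1%nat 1%nat x s ltac:(lia) ltac:(lia))) as L2.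
    replace (X + u - X) with u in L1 by ring. replace (S + v - S) with v in L1 by ring.
    replace (X + - u - X) with (- u) in L2 by ring. replace (S + - v - S) with (- v) in L2 by ring.
    rewrite !Rabs_Ropp in L2. fold (fp 1%nat 0%nat) in L1. fold (fm 1%nat 0%nat) in L2.
    assert (HQ' : N * Rabs u + N * Rabs v <= N * (k * (3 * K))).
    { rewrite <- Rmult_plus_distr_l. apply Rmult_le_compat_l; trivial. lra. }
    apply (fun a => Rle_trans _ _ _ a HQ') in L1. apply (fun a => Rle_trans _ _ _ a HQ') in L2.
    assert (A2 : Rabs (/ 2 * (k ^ 2 * (b0 * b1) * (fp 1%nat 0%nat + fm 1%nat 0%nat)) - k ^ 2 * (b0 * b1) * f 1%nat 0%nat X S)
      <= k ^ 3 * (3 * K ^ 3 * N)).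
    { pose proof (half_sum_le _ _ _ L1 L2) as T.
      assert (Hbb' : Rabs (k ^ 2 * (b0 * b1)) <= k ^ 2 * (K * K)).
      { apply Rabs_mul_le; [rewrite Rabs_pos_eq; lra|]. now apply Rabs_mul_le. }
      pose proof (Rabs_mul_le _ _ _ _ Hbb' T) as T'.
      match type of T' with Rabs ?a <= ?b => match goal with |- Rabs ?c <= ?d =>
        replace c with a; [replace d with b; [exact T'|field]|field] end end. }
    (* The bound [f_s >= - m] is used at a point shifted by [k ^ 2 * w] in [x]. Shifting back costs
       [k ^ 2 * w * f_xs], which may be evaluated at the centre with an error of order [k ^ 3]. *)
    assert (A3 : forall p q, Rabs p <= Rabs u -> Rabs q <= Rabs v ->
      - m - k ^ 2 * w * f 1%nat 1%nat X S - k ^ 3 * (4 * K ^ 4 * N) <= f 0%nat 1%nat (X + p) (S + q)).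
    { intros p q Hp Hq.
      destruct (mvt_sym (fun x => f 0%nat 1%nat x (S + q)) (fun x => f 1%nat 1%nat x (S + q)) (X + p) (X + p + k ^ 2 * w))
        as [c [Hc Ec]]; [intros; apply Hf; lia|].
      replace (X + p + k ^ 2 * w - (X + p)) with (k ^ 2 * w) in * by ring.
      pose proof (Hfm (X + p + k ^ 2 * w) (S + q)) as Hlow.
      pose proof (jet_lip f 1 1 N N X S c (S + q) Hf ltac:(lia) (fun x s => HN 2%nat 1%nat x s ltac:(lia) ltac:(lia))
        (fun x s => HN 1%nat 2%nat x s ltac:(lia) ltac:(lia))) as L3.
      replace (S + q - S) with q in L3 by ring.
      assert (Hkw : Rabs (k ^ 2 * w) <= k ^ 2 * K ^ 2) by (apply Rabs_mul_le; trivial; rewrite Rabs_pos_eq; lra).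
      assert (HcX : Rabs (c - X) <= k ^ 2 * K ^ 2 + Rabs u).
      { replace (c - X) with ((c - (X + p)) + p) by ring. apply Rabs_add_le; lra. }
      assert (HL3 : N * Rabs (c - X) + N * Rabs q <= N * (k * (4 * K ^ 2))).
      { rewrite <- Rmult_plus_distr_l. apply Rmult_le_compat_l; trivial.
        assert (k ^ 2 * K ^ 2 <= k * K ^ 2).
        { apply Rmult_le_compat_r; [lra|]. nra. }
        assert (k * K <= k * K ^ 2) by (apply Rmult_le_compat_l; lra). lra. }
      apply (fun a => Rle_trans _ _ _ a HL3) in L3.
      pose proof (Rabs_mul_le _ _ _ _ Hkw L3) as T. apply Rabs_le_between in T.
      replace (k ^ 2 * K ^ 2 * (N * (k * (4 * K ^ 2)))) with (k ^ 3 * (4 * K ^ 4 * N)) in T by ring.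
      lra. }
    pose proof (A3 u v ltac:(lra) ltac:(lra)) as B1.
    pose proof (A3 (- u) (- v) ltac:(rewrite Rabs_Ropp; lra) ltac:(rewrite Rabs_Ropp; lra)) as B2.
    fold (fp 0%nat 1%nat) in B1. fold (fm 0%nat 1%nat) in B2.
    set (low := - m - k ^ 2 * w * f 1%nat 1%nat X S - k ^ 3 * (4 * K ^ 4 * N)) in *.
    assert (Hkc : Rabs (k * c1) <= 1 / 3).
    { apply Rle_trans with (k * K); trivial. apply Rabs_mul_le; trivial. rewrite Rabs_pos_eq; lra. }
    assert (Hkg : Rabs (k ^ 2 * g1) <= k ^ 2 * K) by (apply Rabs_mul_le; trivial; rewrite Rabs_pos_eq; lra).
    assert (Hkg' : k ^ 2 * K <= 1 / 3) by nra.
    apply Rabs_le_between in Hkc, Hkg, A1, A2.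
    assert (C1 : (1 + k * c1 + k ^ 2 * g1) * low <= (1 + k * c1 + k ^ 2 * g1) * fp 0%nat 1%nat) by (apply Rmult_le_compat_l; lra).
    assert (C2 : (1 - k * c1 + k ^ 2 * g1) * low <= (1 - k * c1 + k ^ 2 * g1) * fm 0%nat 1%nat) by (apply Rmult_le_compat_l; lra).
    assert (C3 : - (m * (1 + K * k ^ 2)) - k ^ 2 * w * f 1%nat 1%nat X S - k ^ 3 * (9 * K ^ 5 * N) <= (1 + k ^ 2 * g1) * low).
    { assert (D1' : m * (k ^ 2 * g1) <= m * (k ^ 2 * K)) by (apply Rmult_le_compat_l; lra).
      assert (D2' : Rabs (k ^ 2 * g1 * (k ^ 2 * w * f 1%nat 1%nat X S)) <= k ^ 2 * K * (k ^ 2 * K ^ 2 * N)).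
      { apply Rabs_mul_le; [apply Rabs_le_between; lra|]. apply Rabs_mul_le; [|apply HN; lia].
        apply Rabs_mul_le; trivial. rewrite Rabs_pos_eq; lra. }
      assert (D3' : k ^ 2 * K * (k ^ 2 * K ^ 2 * N) <= k ^ 3 * (K ^ 5 * N)).
      { replace (k ^ 2 * K * (k ^ 2 * K ^ 2 * N)) with (k ^ 3 * (k * K ^ 3 * N)) by ring.
        apply Rmult_le_compat_l; trivial. apply Rmult_le_compat_r; trivial.
        apply Rle_trans with (1 * K ^ 3); [apply Rmult_le_compat_r; lra|lra]. }
      assert (D4' : (1 + k ^ 2 * g1) * (k ^ 3 * (4 * K ^ 4 * N)) <= 2 * (k ^ 3 * (4 * K ^ 5 * N))).
      { apply Rmult_le_compat; try lra.
        - apply Rmult_le_pos; trivial. apply Rmult_le_pos; trivial. assert (0 <= K ^ 4) by (apply pow_le; lra). lra.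
        - apply Rmult_le_compat_l; trivial. apply Rmult_le_compat_r; trivial. lra. }
      apply Rabs_le_between in D2'. unfold low. lra. }
    assert (HKN : k ^ 3 * (K ^ 3 * N) <= k ^ 3 * (K ^ 5 * N)).
    { apply Rmult_le_compat_l; trivial. apply Rmult_le_compat_r; trivial. lra. }
    assert (HKN0 : 0 <= k ^ 3 * (K ^ 5 * N)).
    { apply Rmult_le_pos; trivial. apply Rmult_le_pos; trivial. apply pow_le; lra. }
    unfold G. lra. }
  pose proof (main _ Z1) as M1. pose proof (main _ Z2) as M2.
  assert (E : walk r rho be bb ga k f 0%nat 1%nat x s = / 2 * (P (zp rho) + P (zm rho))) by reflexivity.
  rewrite E.
  (* The mean [rho] of [z] cancels the [f_xs] terms against the shift, and its mean square 1 leaves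
     the convexity term. *)
  assert (EG : / 2 * (G (zp rho) + G (zm rho)) =
    k ^ 2 * (b0 * b1) * (f 2%nat 0%nat X S - f 1%nat 0%nat X S) - m * (1 + K * k ^ 2) - k ^ 3 * (60 * K ^ 5 * N)).
  { unfold G, w. replace (/ 2 * _) with (/ 2 * (k ^ 2 * ((zp rho ^ 2 + zm rho ^ 2) * b0 * b1 * f 2%nat 0%nat X S
      + (zp rho + zm rho) * b1 * c0 * f 1%nat 1%nat X S)) - k ^ 2 * (b0 * b1) * f 1%nat 0%nat X S - m * (1 + K * k ^ 2)
      - k ^ 2 * (rho * b1 * c0) * f 1%nat 1%nat X S - k ^ 3 * (60 * K ^ 5 * N)) by field.
    rewrite Z3, Z4. field. }
  assert (0 <= k ^ 2 * (b0 * b1) * (f 2%nat 0%nat X S - f 1%nat 0%nat X S)).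
  { apply Rmult_le_pos; [|apply Hconv]. apply Rmult_le_pos; trivial. apply Rmult_le_pos; lra. }
  lra.
Qed.

(** * Mollification *)

Lemma mvt_right (g g1 : R -> R) x h : 0 < h -> (forall t, is_derive g t (g1 t)) ->
  exists c, x <= c <= x + h /\ g (x + h) - g x = g1 c * h.
Proof.
  intros Hh Hg. destruct (MVT_gen g x (x + h) g1) as [c [Hc1 Hc2]].
  - intros; apply Hg.
  - intros t _. apply continuity_pt_filterlim, (ex_derive_continuous g). exists (g1 t). apply Hg.
  - exists c. rewrite Rmin_left, Rmax_right in Hc1 by lra. split; trivial. rewrite Hc2. ring.
Qed.

Lemma steklov (g : R -> R) eps : 0 < eps -> (forall x, continuous g x) ->
  exists F G, (forall x, is_derive F x (g x)) /\ (forall x, G x = (F (x + eps) - F x) / eps) /\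
    (forall x, is_derive G x ((g (x + eps) - g x) / eps)).
Proof.
  intros He Hg. destruct (antiderivative g Hg) as [F HF].
  exists F, (fun x => (F (x + eps) - F x) / eps). split; [exact HF|]. split; [reflexivity|].
  intros x. apply (is_derive_ext (fun x => / eps * (F (x + eps) - F x))).
  { intros t. apply Rmult_comm. }
  unfold Rdiv. rewrite Rmult_comm. apply is_derive_scal.
  apply (is_derive_minus (fun x => F (x + eps)) F); [|apply HF].
  apply (is_derive_shift F). apply HF.
Qed.

(* Three iterated Steklov averages. *)
Lemma mollify (f : R -> R) L eps : 0 < eps -> (forall x y, Rabs (f x - f y) <= L * Rabs (x - y)) ->
  exists m, smooth_coef m /\
    (forall x, exists c, x <= c <= x + 3 * eps /\ m 0%nat x = f c) /\
    (forall x, exists c, x <= c <= x + 2 * eps /\ m 1%nat x = (f (c + eps) - f c) / eps) /\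
    (forall x, exists c, x <= c <= x + eps /\
       m 2%nat x = (f (c + 2 * eps) - 2 * f (c + eps) + f c) / eps ^ 2) /\
    (forall x, m 3%nat x = (f (x + 3 * eps) - 3 * f (x + 2 * eps) + 3 * f (x + eps) - f x) / eps ^ 3).
Proof.
  intros He HL.
  assert (Cf : forall x, continuous f x).
  { intros x. apply continuity_pt_filterlim. intros e Hep.
    assert (HL0 : 0 <= Rabs L) by apply Rabs_pos.
    exists (e / (Rabs L + 1)). split; [apply Rdiv_lt_0_compat; lra|].
    intros y [_ Hy]. simpl in *. unfold R_dist in *.
    apply Rle_lt_trans with (1 := HL y x).
    apply Rle_lt_trans with (Rabs L * Rabs (y - x)).
    { apply Rmult_le_compat_r; [apply Rabs_pos|apply Rle_abs]. }
    apply Rle_lt_trans with (Rabs L * (e / (Rabs L + 1))).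
    { apply Rmult_le_compat_l; lra. }
    apply Rmult_lt_reg_r with (Rabs L + 1); [lra|]. field_simplify; lra. }
  assert (Cd : forall (g g1 : R -> R), (forall x, is_derive g x (g1 x)) -> forall x, continuous g x).
  { intros g g1 Hg x. apply (ex_derive_continuous g). exists (g1 x). apply Hg. }
  destruct (steklov f eps He Cf) as [F1 [s1 [HF1 [E1 H1]]]].
  destruct (steklov s1 eps He (Cd _ _ H1)) as [F2 [s2 [HF2 [E2 H2]]]].
  destruct (steklov s2 eps He (Cd _ _ H2)) as [F3 [s3 [HF3 [E3 H3]]]].
  set (m := fun (n : nat) (x : R) => match n with
    | 0%nat => s3 x
    | 1%nat => (s2 (x + eps) - s2 x) / eps
    | 2%nat => (s1 (x + 2 * eps) - 2 * s1 (x + eps) + s1 x) / eps ^ 2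
    | _ => (f (x + 3 * eps) - 3 * f (x + 2 * eps) + 3 * f (x + eps) - f x) / eps ^ 3 end).
  assert (mean : forall F g G x, (forall x, is_derive F x (g x)) -> (forall x, G x = (F (x + eps) - F x) / eps) ->
     exists c, x <= c <= x + eps /\ G x = g c).
  { intros F g G x HF HG. destruct (mvt_right F g x eps He HF) as [c [Hc Ec]].
    exists c. split; trivial. rewrite HG, Ec. field. lra. }
  exists m. split; [split|split; [|split; [|split]]].
  - intros n x Hn. destruct n as [|[|[|n]]]; [| | |lia].
    + apply H3.
    + pose proof (is_derive_scal _ x (/ eps) _ (is_derive_minus _ _ x _ _ (is_derive_shift s2 eps x _ (H2 (x + eps))) (H2 x))) as T.
      refine (is_derive_ext _ _ _ _ _ (eq_ind _ (fun l : R => is_derive _ x l) T _ _)).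
      * intros t. apply Rmult_comm.
      * change (@eq R (/ eps * ((s1 (x + eps + eps) - s1 (x + eps)) / eps - (s1 (x + eps) - s1 x) / eps)) (m 2%nat x)).
        unfold m. replace (x + eps + eps) with (x + 2 * eps) by ring. field. lra.
    + pose proof (is_derive_scal _ x (/ eps ^ 2) _ (is_derive_plus _ _ x _ _ (is_derive_minus _ _ x _ _
        (is_derive_shift s1 (2 * eps) x _ (H1 (x + 2 * eps))) (is_derive_scal _ x 2 _ (is_derive_shift s1 eps x _ (H1 (x + eps))))) (H1 x))) as T.
      refine (is_derive_ext _ _ _ _ _ (eq_ind _ (fun l : R => is_derive _ x l) T _ _)).
      * intros t. apply Rmult_comm.
      * change (@eq R (/ eps ^ 2 * (((f (x + 2 * eps + eps) - f (x + 2 * eps)) / eps - 2 * ((f (x + eps + eps) - f (x + eps)) / eps)) + (f (x + eps) - f x) / eps)) (m 3%nat x)).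
        unfold m. replace (x + eps + eps) with (x + 2 * eps) by ring.
        replace (x + 2 * eps + eps) with (x + 3 * eps) by ring. field. lra.
  - intros x. simpl.
    assert (Cs : forall c, continuous (fun x => f (x + c)) x).
    { intros c. apply (continuous_comp (fun x => x + c) f); [|apply Cf].
      apply (continuous_plus (fun x => x) (fun _ => c)); [apply continuous_id|apply continuous_const]. }
    apply (continuous_mult (fun x => f (x + 3 * eps) - 3 * f (x + 2 * eps) + 3 * f (x + eps) - f x) (fun _ => / eps ^ 3));
      [|apply continuous_const].
    apply (continuous_minus (fun x => f (x + 3 * eps) - 3 * f (x + 2 * eps) + 3 * f (x + eps)) f); [|apply Cf].
    apply (continuous_plus (fun x => f (x + 3 * eps) - 3 * f (x + 2 * eps)) (fun x => 3 * f (x + eps))).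
    + apply (continuous_minus (fun x => f (x + 3 * eps)) (fun x => 3 * f (x + 2 * eps))); [apply Cs|].
      apply (continuous_scal_r 3 (fun x => f (x + 2 * eps))). apply Cs.
    + apply (continuous_scal_r 3 (fun x => f (x + eps))). apply Cs.
  - intros x. destruct (mean F3 s2 s3 x HF3 E3) as [c3 [I3 J3]].
    destruct (mean F2 s1 s2 c3 HF2 E2) as [c2 [I2 J2]].
    destruct (mean F1 f s1 c2 HF1 E1) as [c1 [I1 J1]].
    exists c1. split; [lra|]. simpl. congruence.
  - intros x. simpl. destruct (mvt_right s2 _ x eps He H2) as [c2 [I2 J2]].
    destruct (mvt_right s1 _ c2 eps He H1) as [c1 [I1 J1]].
    exists c1. split; [lra|]. rewrite J2, J1. field. lra.
  - intros x. simpl.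
    (* Applied to the second difference of the primitive, the mean value theorem puts the same [c]
       into all three values of [f], so that the sign and size of second differences of [f] pass to
       [m 2]. *)
    destruct (mvt_right (fun x => F1 (x + 2 * eps) - 2 * F1 (x + eps) + F1 x)
      (fun x => f (x + 2 * eps) - 2 * f (x + eps) + f x) x eps He) as [c [Ic Jc]].
    { intros t. apply (is_derive_plus (fun x => F1 (x + 2 * eps) - 2 * F1 (x + eps)) F1); [|apply HF1].
      apply (is_derive_minus (fun x => F1 (x + 2 * eps)) (fun x => 2 * F1 (x + eps))).
      - apply (is_derive_shift F1), HF1.
      - apply (is_derive_scal (fun x => F1 (x + eps))). apply (is_derive_shift F1), HF1. }
    exists c. split; trivial. rewrite !E1.
    replace (x + 2 * eps + eps) with (x + eps + 2 * eps) by ring.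
    replace (x + 2 * eps) with (x + eps + eps) in * by ring.
    replace (f (c + 2 * eps) - 2 * f (c + eps) + f c) with
      ((F1 (x + eps + 2 * eps) - 2 * F1 (x + eps + eps) + F1 (x + eps) - (F1 (x + eps + eps) - 2 * F1 (x + eps) + F1 x)) / eps)
      by (rewrite Jc; field; lra).
    field. lra.
  - reflexivity.
Qed.

Lemma second_difference f f1 M eps x : 0 < eps -> (forall x, is_derive f x (f1 x)) ->
  (forall x y, Rabs (f1 x - f1 y) <= M * Rabs (x - y)) ->
  Rabs (f (x + 2 * eps) - 2 * f (x + eps) + f x) <= M * eps ^ 2.
Proof.
  intros He Hf HM.
  destruct (mvt_right (fun x => f (x + eps) - f x) (fun x => f1 (x + eps) - f1 x) x eps He) as [c [_ Ec]].
  { intros t. apply (is_derive_minus (fun x => f (x + eps)) f); [|apply Hf]. apply (is_derive_shift f), Hf. }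
  replace (f (x + 2 * eps) - 2 * f (x + eps) + f x) with (f (x + eps + eps) - f (x + eps) - (f (x + eps) - f x))
    by (replace (x + eps + eps) with (x + 2 * eps) by ring; ring).
  rewrite Ec. specialize (HM (c + eps) c). replace (c + eps - c) with eps in HM by ring.
  rewrite (Rabs_pos_eq eps) in HM by lra.
  replace (M * eps ^ 2) with (M * eps * eps) by ring. apply Rabs_mul_le; trivial. rewrite Rabs_pos_eq; lra.
Qed.

(* The chain rule for [x -> m 0 (K - exp x)]. *)
Definition payoff_jet (K : R) (m : nat -> R -> R) : jet := fun i j x _ =>
  match j with
  | 0%nat =>
    let y := K - exp x in
    match i with
    | 0%nat => m 0%nat y
    | 1%nat => - (exp x * m 1%nat y)
    | 2%nat => exp x ^ 2 * m 2%nat y - exp x * m 1%nat y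
    | _ => - (exp x ^ 3 * m 3%nat y) + 3 * exp x ^ 2 * m 2%nat y - exp x * m 1%nat y
    end
  | _ => 0
  end.

Lemma payoff_smooth3 K m : smooth_coef m -> smooth3 (payoff_jet K m).
Proof.
  intros Hm. pose proof Hm as [Hm1 Hm2].
  assert (De : forall x, is_derive exp x (exp x)) by (intros; apply is_derive_exp).
  assert (Dm : forall n x, (n < 3)%nat -> is_derive (fun x => m n (K - exp x)) x (- (exp x * m (S n) (K - exp x)))).
  { intros n x Hn. pose proof (is_derive_comp (m n) (fun x => K - exp x) x _ _ (Hm1 n (K - exp x) Hn)
      (is_derive_minus (fun _ : R => K) exp x _ _ (is_derive_const K x) (De x))) as T.
    refine (eq_ind _ (fun l : R => is_derive _ x l) T _ _).
    change (@eq R ((0 - exp x) * m (S n) (K - exp x)) (- (exp x * m (S n) (K - exp x)))). ring. }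
  assert (Dp : forall (p p1 : R -> R) n x, (n < 3)%nat -> is_derive p x (p1 x) ->
    is_derive (fun x => p x * m n (K - exp x)) x (p1 x * m n (K - exp x) - p x * exp x * m (S n) (K - exp x))).
  { intros p p1 n x Hn Hp. pose proof (is_derive_mult p (fun x => m n (K - exp x)) x _ _ Hp (Dm n x Hn) Rmult_comm) as T.
    refine (eq_ind _ (fun l : R => is_derive _ x l) T _ _).
    change (@eq R (p1 x * m n (K - exp x) + p x * (- (exp x * m (S n) (K - exp x)))) (p1 x * m n (K - exp x) - p x * exp x * m (S n) (K - exp x))). ring. }
  assert (D2' : forall x, is_derive (fun x => exp x ^ 2) x (2 * exp x ^ 2)).
  { intros x. pose proof (is_derive_pow exp 2 x _ (De x)) as T.
    refine (eq_ind _ (fun l : R => is_derive _ x l) T _ _). simpl.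
    match goal with |- ?a = ?b => change (@eq R a b) end. ring. }
  split.
  - intros i j x s Hij. split.
    + destruct j as [|j].
      * destruct i as [|[|[|i]]]; [| | |lia]; unfold payoff_jet; cbv zeta.
        -- apply Dm; lia.
        -- pose proof (is_derive_opp _ x _ (Dp exp exp 1%nat x ltac:(lia) (De x))) as T.
           refine (eq_ind _ (fun l : R => is_derive _ x l) T _ _).
           change opp with Ropp. match goal with |- ?a = ?b => change (@eq R a b) end. ring.
        -- pose proof (is_derive_minus _ _ x _ _ (Dp (fun x => exp x ^ 2) (fun x => 2 * exp x ^ 2) 2%nat x ltac:(lia) (D2' x))
             (Dp exp exp 1%nat x ltac:(lia) (De x))) as T.
           refine (eq_ind _ (fun l : R => is_derive _ x l) T _ _).
           change minus with Rminus. match goal with |- ?a = ?b => change (@eq R a b) end. ring.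
      * apply (is_derive_const 0).
    + destruct j as [|j]; [exact (is_derive_const (payoff_jet K m i 0%nat x 0) s)|exact (is_derive_const (0 : R) s)].
  - intros i j x s Hij. destruct j as [|j]; [|apply continuous_const].
    apply (continuous_comp (fun p : R * R => fst p) (fun x => payoff_jet K m i 0%nat x 0)); [apply continuous_fst|].
    simpl fst.
    assert (Ce : forall x, continuous exp x) by (intros; apply (ex_derive_continuous exp); eexists; apply De).
    assert (Cm : forall n, (n <= 3)%nat -> continuous (fun x => m n (K - exp x)) x).
    { intros n Hn. apply (continuous_comp (fun x => K - exp x) (m n)); [|now apply smooth_coef_continuous].
      apply (continuous_minus (fun _ => K) exp); [apply continuous_const|apply Ce]. }
    assert (Cp : forall p n, (n <= 3)%nat -> continuous p x -> continuous (fun x => p x * m n (K - exp x)) x).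
    { intros p n Hn Hp. apply (continuous_mult p (fun x => m n (K - exp x))); [exact Hp|apply Cm; exact Hn]. }
    assert (C2 : forall n, continuous (fun x => exp x ^ n) x).
    { intros n. induction n as [|n IH]; [apply continuous_const|]. apply (continuous_mult exp (fun x => exp x ^ n)); [apply Ce|exact IH]. }
    assert (i <= 3)%nat by lia.
    destruct i as [|[|[|[|i]]]]; [| | | |lia]; unfold payoff_jet; cbv zeta.
    + apply Cm; lia.
    + apply (continuous_opp (fun x => exp x * m 1%nat (K - exp x))). apply (Cp exp); [lia|apply Ce].
    + apply (continuous_minus (fun x => exp x ^ 2 * m 2%nat (K - exp x)) (fun x => exp x * m 1%nat (K - exp x))).
      * apply (Cp (fun x => exp x ^ 2)); [lia|apply C2].
      * apply (Cp exp); [lia|apply Ce].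
    + apply (continuous_minus (fun x => - (exp x ^ 3 * m 3%nat (K - exp x)) + 3 * exp x ^ 2 * m 2%nat (K - exp x)) (fun x => exp x * m 1%nat (K - exp x))).
      * apply (continuous_plus (fun x => - (exp x ^ 3 * m 3%nat (K - exp x))) (fun x => 3 * exp x ^ 2 * m 2%nat (K - exp x))).
        -- apply (continuous_opp (fun x => exp x ^ 3 * m 3%nat (K - exp x))). apply (Cp (fun x => exp x ^ 3)); [lia|apply C2].
        -- apply (Cp (fun x => 3 * exp x ^ 2)); [lia|]. apply (continuous_scal_r 3 (fun x => exp x ^ 2)). apply C2.
      * apply (Cp exp); [lia|apply Ce].
Qed.

(** With [m] a mollified positive part, [f_xx - f_x] is [exp x ^ 2 * m 2], nonnegative by convexity.
    The powers of [exp x] are harmless because [m 1], [m 2] and [m 3] vanish at [K - exp x] once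
    [exp x >= K + 3 * e]. *)
Lemma put_approx K eps : 0 < K -> 0 < eps -> exists (f : jet) N,
  smooth3 f /\ 0 <= N /\ bd1 f N /\ bd2 f N /\ bd3 f N /\ (forall x s, Rabs (f 0%nat 0%nat x s) <= N) /\
  (forall x s, 0 <= f 2%nat 0%nat x s - f 1%nat 0%nat x s) /\ (forall x s, f 0%nat 1%nat x s = 0) /\
  (forall x s, Rabs (f 0%nat 0%nat x s - put_payoff K (exp x)) <= eps).
Proof.
  intros HK Heps. set (e := eps / 3). assert (He : 0 < e) by (unfold e; lra).
  set (p := fun y => Rmax y 0).
  assert (Hp : forall x y, Rabs (p x - p y) <= 1 * Rabs (x - y)).
  { intros x y. unfold p, Rmax. destruct (Rle_dec x 0), (Rle_dec y 0); unfold Rabs;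
      repeat match goal with |- context [Rcase_abs ?a] => destruct (Rcase_abs a) end; lra. }
  assert (Hp0 : forall y, y <= 0 -> p y = 0) by (intros y Hy; unfold p; apply Rmax_right; trivial).
  assert (Hpc : forall y, 0 <= p (y + 2 * e) - 2 * p (y + e) + p y).
  { intros y. unfold p, Rmax. destruct (Rle_dec (y + 2 * e) 0), (Rle_dec (y + e) 0), (Rle_dec y 0); lra. }
  destruct (mollify p 1 e He Hp) as [m [Hm [M0 [M1 [M2 M3]]]]].
  set (Q := K + 3 * e).
  assert (B1 : forall y, Rabs (m 1%nat y) <= 1).
  { intros y. destruct (M1 y) as [c [_ ->]]. specialize (Hp (c + e) c). replace (c + e - c) with e in Hp by ring.
    rewrite Rabs_div, (Rabs_pos_eq e) in * by lra.
    apply Rmult_le_reg_r with e; trivial. unfold Rdiv. rewrite Rmult_assoc, Rinv_l; lra. }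
  assert (He2 : 0 < e ^ 2) by (apply pow_lt; lra). assert (He3 : 0 < e ^ 3) by (apply pow_lt; lra).
  assert (B2 : forall y, Rabs (m 2%nat y) <= 2 * e / e ^ 2).
  { intros y. destruct (M2 y) as [c [_ ->]].
    rewrite Rabs_div, (Rabs_pos_eq (e ^ 2)) by lra. apply Rmult_le_compat_r; [apply Rlt_le, Rinv_0_lt_compat; trivial|].
    replace (p (c + 2 * e) - 2 * p (c + e) + p c) with ((p (c + 2 * e) - p (c + e)) - (p (c + e) - p c)) by ring.
    pose proof (Hp (c + 2 * e) (c + e)) as A. pose proof (Hp (c + e) c) as B.
    replace (c + 2 * e - (c + e)) with e in A by ring. replace (c + e - c) with e in B by ring.
    rewrite (Rabs_pos_eq e) in A, B by lra. pose proof (Rabs_sub_le _ _ _ _ A B). lra. }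
  assert (B3 : forall y, Rabs (m 3%nat y) <= 4 * e / e ^ 3).
  { intros y. rewrite M3.
    rewrite Rabs_div, (Rabs_pos_eq (e ^ 3)) by lra. apply Rmult_le_compat_r; [apply Rlt_le, Rinv_0_lt_compat; trivial|].
    replace (p (y + 3 * e) - 3 * p (y + 2 * e) + 3 * p (y + e) - p y) with
      ((p (y + 3 * e) - p (y + 2 * e)) - 2 * (p (y + 2 * e) - p (y + e)) + (p (y + e) - p y)) by ring.
    pose proof (Hp (y + 3 * e) (y + 2 * e)) as A. pose proof (Hp (y + 2 * e) (y + e)) as B. pose proof (Hp (y + e) y) as C.
    replace (y + 3 * e - (y + 2 * e)) with e in A by ring. replace (y + 2 * e - (y + e)) with e in B by ring.
    replace (y + e - y) with e in C by ring. rewrite (Rabs_pos_eq e) in A, B, C by lra.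
    assert (B' : Rabs (2 * (p (y + 2 * e) - p (y + e))) <= 2 * (1 * e)).
    { apply Rabs_mul_le; trivial. rewrite Rabs_pos_eq; lra. }
    pose proof (Rabs_add_le _ _ _ _ (Rabs_sub_le _ _ _ _ A B') C). lra. }
  assert (Z1 : forall y, y <= - (3 * e) -> m 1%nat y = 0).
  { intros y Hy. destruct (M1 y) as [c [Hc ->]]. rewrite !Hp0 by lra. field. lra. }
  assert (Z2 : forall y, y <= - (3 * e) -> m 2%nat y = 0).
  { intros y Hy. destruct (M2 y) as [c [Hc ->]]. rewrite !Hp0 by lra. field. lra. }
  assert (Z3 : forall y, y <= - (3 * e) -> m 3%nat y = 0).
  { intros y Hy. rewrite M3. rewrite !Hp0 by lra. field. lra. }
  assert (Cv : forall y, 0 <= m 2%nat y).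
  { intros y. destruct (M2 y) as [c [_ ->]]. apply Rmult_le_pos; [apply Hpc|]. apply Rlt_le, Rinv_0_lt_compat; trivial. }
  assert (HQ : 0 < Q) by (unfold Q; lra).
  assert (Hexp : forall x, K - exp x <= - (3 * e) \/ 0 < exp x <= Q).
  { intros x. destruct (Rle_dec (K - exp x) (- (3 * e))); [now left|right]. split; [apply exp_pos|unfold Q; lra]. }
  set (b2 := 2 * e / e ^ 2) in *. set (b3 := 4 * e / e ^ 3) in *.
  assert (Hb2 : 0 <= b2) by (unfold b2; apply Rlt_le, Rdiv_lt_0_compat; lra).
  assert (Hb3 : 0 <= b3) by (unfold b3; apply Rlt_le, Rdiv_lt_0_compat; lra).
  set (f := payoff_jet K m).
  set (N := Q + Q ^ 2 * b2 + Q * 1 + (Q ^ 3 * b3 + 3 * Q ^ 2 * b2 + Q * 1)).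
  assert (P2 : 0 <= Q ^ 2 * b2) by (apply Rmult_le_pos; [apply pow_le|]; lra).
  assert (P3 : 0 <= Q ^ 3 * b3) by (apply Rmult_le_pos; [apply pow_le|]; lra).
  assert (HN : 0 <= N) by (unfold N; lra).
  assert (A1 : forall x, Rabs (exp x * m 1%nat (K - exp x)) <= Q * 1).
  { intros x. destruct (Hexp x) as [H|H].
    - rewrite Z1, Rmult_0_r, Rabs_R0 by trivial. lra.
    - apply Rabs_mul_le; trivial. rewrite Rabs_pos_eq; lra. }
  assert (A2 : forall x, Rabs (exp x ^ 2 * m 2%nat (K - exp x)) <= Q ^ 2 * b2).
  { intros x. destruct (Hexp x) as [H|H].
    - rewrite Z2, Rmult_0_r, Rabs_R0 by trivial. trivial.
    - apply Rabs_mul_le; trivial. rewrite Rabs_pos_eq by (apply pow_le; lra). apply pow_incr. lra. }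
  assert (A3 : forall x, Rabs (exp x ^ 3 * m 3%nat (K - exp x)) <= Q ^ 3 * b3).
  { intros x. destruct (Hexp x) as [H|H].
    - rewrite Z3, Rmult_0_r, Rabs_R0 by trivial. trivial.
    - apply Rabs_mul_le; trivial. rewrite Rabs_pos_eq by (apply pow_le; lra). apply pow_incr. lra. }
  assert (F1 : forall x s, Rabs (f 1%nat 0%nat x s) <= N).
  { intros x s. unfold f, payoff_jet. rewrite Rabs_Ropp. specialize (A1 x). unfold N. lra. }
  assert (F2 : forall x s, Rabs (f 2%nat 0%nat x s) <= N).
  { intros x s. unfold f, payoff_jet. pose proof (Rabs_sub_le _ _ _ _ (A2 x) (A1 x)). cbv zeta. unfold N. lra. }
  assert (F3 : forall x s, Rabs (f 3%nat 0%nat x s) <= N).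
  { intros x s. unfold f, payoff_jet. cbv zeta.
    assert (T2 : Rabs (3 * exp x ^ 2 * m 2%nat (K - exp x)) <= 3 * (Q ^ 2 * b2)).
    { rewrite Rmult_assoc. apply Rabs_mul_le; trivial. rewrite Rabs_pos_eq; lra. }
    pose proof (A3 x) as T3. rewrite <- Rabs_Ropp in T3.
    pose proof (Rabs_sub_le _ _ _ _ (Rabs_add_le _ _ _ _ T3 T2) (A1 x)). unfold N. lra. }
  assert (Happ : forall x s, Rabs (f 0%nat 0%nat x s - put_payoff K (exp x)) <= eps).
  { intros x s. unfold f, payoff_jet, put_payoff. cbv zeta. destruct (M0 (K - exp x)) as [c [Hc ->]].
    change (Rmax (K - exp x) 0) with (p (K - exp x)). apply Rle_trans with (1 := Hp _ _).
    rewrite Rabs_pos_eq by lra. unfold e in Hc. lra. }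
  assert (Ez : forall u v, Rabs u <= en u v) by apply en_l.
  exists f, N. repeat match goal with |- _ /\ _ => split end; trivial.
  - now apply payoff_smooth3.
  - intros x s u v. unfold D1. change (f 0%nat 1%nat x s) with 0. rewrite Rmult_0_l, Rplus_0_r.
    apply Rabs_mul_le; auto.
  - intros x s u v. unfold D2. change (f 0%nat 2%nat x s) with 0. change (f 1%nat 1%nat x s) with 0.
    replace (f 2%nat 0%nat x s * u ^ 2 + 2 * 0 * u * v + 0 * v ^ 2) with (f 2%nat 0%nat x s * u ^ 2) by ring.
    apply Rabs_mul_le; auto. rewrite <- RPow_abs. apply pow_incr. split; [apply Rabs_pos|auto].
  - intros x s u v. unfold D3. change (f 0%nat 3%nat x s) with 0. change (f 1%nat 2%nat x s) with 0.
    change (f 2%nat 1%nat x s) with 0.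
    replace (f 3%nat 0%nat x s * u ^ 3 + 3 * 0 * u ^ 2 * v + 3 * 0 * u * v ^ 2 + 0 * v ^ 3) with (f 3%nat 0%nat x s * u ^ 3) by ring.
    apply Rabs_mul_le; auto. rewrite <- RPow_abs. apply pow_incr. split; [apply Rabs_pos|auto].
  - intros x s. unfold f, payoff_jet. cbv zeta. destruct (M0 (K - exp x)) as [c [Hc ->]].
    pose proof (exp_pos x). unfold p. rewrite Rabs_pos_eq by apply Rmax_r.
    apply Rmax_lub; unfold N, Q in *; lra.
  - intros x s. unfold f, payoff_jet. cbv zeta.
    replace (exp x ^ 2 * m 2%nat (K - exp x) - exp x * m 1%nat (K - exp x) - - (exp x * m 1%nat (K - exp x)))
      with (exp x ^ 2 * m 2%nat (K - exp x)) by ring.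
    apply Rmult_le_pos; [apply pow2_ge_0|apply Cv].
Qed.

(** * Test functions and the barrier *)

(** Joint continuity in filter form, for which sums, products and compositions are available;
    [cont_pos_of] and [cont3_of_pos] translate. *)
Definition cont3 (f : R -> R -> R -> R) (S s t : R) : Prop :=
  continuous (fun p : R * R * R => f (fst (fst p)) (snd (fst p)) (snd p)) (S, s, t).

Lemma cont3_eps f S s t : cont3 f S s t -> forall eps, 0 < eps -> exists d, 0 < d /\
  forall S' s' t', Rabs (S' - S) < d -> Rabs (s' - s) < d -> Rabs (t' - t) < d ->
    Rabs (f S' s' t' - f S s t) < eps.
Proof.
  intros Hf eps He.
  destruct (Hf (ball (f S s t) (mkposreal eps He)) (locally_ball _ _)) as [d Hd].
  exists d. split; [apply cond_pos|]. intros S' s' t' H1 H2 H3.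
  apply (Hd (S', s', t')). repeat split; trivial.
Qed.

Lemma cont3_of_eps f S s t : (forall eps, 0 < eps -> exists d, 0 < d /\
  forall S' s' t', Rabs (S' - S) < d -> Rabs (s' - s) < d -> Rabs (t' - t) < d ->
    Rabs (f S' s' t' - f S s t) < eps) -> cont3 f S s t.
Proof.
  intros Hf P [eps HP]. destruct (Hf eps (cond_pos eps)) as [d [Hd H]].
  exists (mkposreal d Hd). intros [[S' s'] t'] [[H1 H2] H3]. apply HP. now apply H.
Qed.

Lemma cont_pos_of f : (forall S s t, 0 < S -> cont3 f S s t) -> cont_pos f.
Proof.
  intros Hf S s t HS eps He. destruct (cont3_eps f S s t (Hf S s t HS) eps He) as [d [Hd H]].
  exists d. split; trivial. intros; now apply H.
Qed.

Lemma cont3_of_pos f S s t : cont_pos f -> 0 < S -> cont3 f S s t.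
Proof.
  intros Hf HS. apply cont3_of_eps. intros eps He.
  destruct (Hf S s t HS eps He) as [d [Hd H]]. exists (Rmin d S). split; [apply Rmin_pos; trivial|].
  intros S' s' t' H1 H2 H3. pose proof (Rmin_l d S). pose proof (Rmin_r d S).
  apply H; try lra. apply Rabs_def2 in H1. lra.
Qed.

Lemma cont3_plus f g S s t : cont3 f S s t -> cont3 g S s t -> cont3 (fun S s t => f S s t + g S s t) S s t.
Proof. intros Hf Hg. exact (continuous_plus _ _ _ Hf Hg). Qed.

Lemma cont3_mult f g S s t : cont3 f S s t -> cont3 g S s t -> cont3 (fun S s t => f S s t * g S s t) S s t.
Proof. intros Hf Hg. exact (continuous_mult _ _ _ Hf Hg). Qed.

Lemma cont3_const c S s t : cont3 (fun _ _ _ => c) S s t.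
Proof. apply continuous_const. Qed.

Lemma cont3_1 g S s t : continuous g S -> cont3 (fun S _ _ => g S) S s t.
Proof.
  intros Hg. apply (continuous_comp (fun p : R * R * R => fst (fst p)) g); [|exact Hg].
  apply (continuous_comp (fun p : R * R * R => fst p) (fun q : R * R => fst q)); [apply continuous_fst|apply continuous_fst].
Qed.

Lemma cont3_2 g S s t : continuous g s -> cont3 (fun _ s _ => g s) S s t.
Proof.
  intros Hg. apply (continuous_comp (fun p : R * R * R => snd (fst p)) g); [|exact Hg].
  apply (continuous_comp (fun p : R * R * R => fst p) (fun q : R * R => snd q)); [apply continuous_fst|apply continuous_snd].
Qed.

Lemma cont3_3 g S s t : continuous g t -> cont3 (fun _ _ t => g t) S s t.
Proof. intros Hg. apply (continuous_comp (fun p : R * R * R => snd p) g); [apply continuous_snd|exact Hg]. Qed.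

Lemma cont3_12 (F : R -> R -> R) g S s t : continuous g S ->
  continuous (fun p : R * R => F (fst p) (snd p)) (g S, s) -> cont3 (fun S s _ => F (g S) s) S s t.
Proof.
  intros Hg HF.
  apply (continuous_comp_2 (fun p : R * R * R => g (fst (fst p))) (fun p : R * R * R => snd (fst p)) F (S, s, t)).
  - exact (cont3_1 g S s t Hg).
  - exact (cont3_2 (fun s => s) S s t (continuous_id s)).
  - exact HF.
Qed.

Lemma tf_plus_scal c q qt qS qs qSS qSs qss q' qt' qS' qs' qSS' qSs' qss' :
  test_fun q qt qS qs qSS qSs qss -> test_fun q' qt' qS' qs' qSS' qSs' qss' ->
  test_fun (fun S s t => q S s t + c * q' S s t) (fun S s t => qt S s t + c * qt' S s t)
    (fun S s t => qS S s t + c * qS' S s t) (fun S s t => qs S s t + c * qs' S s t)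
    (fun S s t => qSS S s t + c * qSS' S s t) (fun S s t => qSs S s t + c * qSs' S s t)
    (fun S s t => qss S s t + c * qss' S s t).
Proof.
  intros [D [C1 [C2 [C3 [C4 [C5 [C6 C7]]]]]]] [D' [C1' [C2' [C3' [C4' [C5' [C6' C7']]]]]]].
  assert (Hd : forall (f g : R -> R) x l l', is_derive f x l -> is_derive g x l' ->
    is_derive (fun x => f x + c * g x) x (l + c * l')).
  { intros f g x l l' Hf Hg. apply (is_derive_plus f (fun x => c * g x)); trivial. now apply is_derive_scal. }
  assert (Hc : forall f g, cont_pos f -> cont_pos g -> cont_pos (fun S s t => f S s t + c * g S s t)).
  { intros f g Hf Hg. apply cont_pos_of. intros S s t HS. apply cont3_plus; [now apply cont3_of_pos|].
    apply cont3_mult; [apply cont3_const|now apply cont3_of_pos]. }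
  split; [|repeat match goal with |- _ /\ _ => split end; now apply Hc].
  intros S s t HS. destruct (D S s t HS) as [E1 [E2 [E3 [E4 [E5 E6]]]]].
  destruct (D' S s t HS) as [E1' [E2' [E3' [E4' [E5' E6']]]]].
  repeat match goal with |- _ /\ _ => split end; now apply Hd.
Qed.

Lemma tf_time z z1 : (forall t, is_derive z t (z1 t)) -> (forall t, continuous z1 t) ->
  test_fun (fun _ _ t => z t) (fun _ _ t => z1 t) (fun _ _ _ => 0) (fun _ _ _ => 0)
    (fun _ _ _ => 0) (fun _ _ _ => 0) (fun _ _ _ => 0).
Proof.
  intros Hz Hz1. split.
  - intros S s t HS. repeat match goal with |- _ /\ _ => split end; try exact (is_derive_const _ _). apply Hz.
  - assert (C0 : cont_pos (fun _ _ _ => 0)) by (apply cont_pos_of; intros; apply cont3_const).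
    repeat match goal with |- _ /\ _ => split end; trivial.
    + apply cont_pos_of. intros S s t _. apply cont3_3. apply (ex_derive_continuous z). exists (z1 t). apply Hz.
    + apply cont_pos_of. intros S s t _. apply cont3_3. apply Hz1.
Qed.

(** The term [r * (e t * q)] of the time derivative will cancel the [- r * v] of the
    Hamiltonians. *)
Lemma tf_discount r T q qt qS qs qSS qSs qss : test_fun q qt qS qs qSS qSs qss ->
  let e t := exp (- r * (T - t)) in
  test_fun (fun S s t => e t * q S s t) (fun S s t => r * (e t * q S s t) + e t * qt S s t)
    (fun S s t => e t * qS S s t) (fun S s t => e t * qs S s t) (fun S s t => e t * qSS S s t)
    (fun S s t => e t * qSs S s t) (fun S s t => e t * qss S s t).
Proof.
  intros [D [C1 [C2 [C3 [C4 [C5 [C6 C7]]]]]]] e.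
  assert (De : forall t, is_derive e t (r * e t)).
  { intros t. unfold e. auto_derive; trivial. unfold Rminus. ring. }
  assert (Ce : forall S s t, cont3 (fun _ _ t => e t) S s t).
  { intros S s t. apply cont3_3. apply (ex_derive_continuous e). eexists. apply De. }
  assert (Hc : forall f, cont_pos f -> cont_pos (fun S s t => e t * f S s t)).
  { intros f Hf. apply cont_pos_of. intros S s t HS. apply cont3_mult; [apply Ce|now apply cont3_of_pos]. }
  split.
  - intros S s t HS. destruct (D S s t HS) as [E1 [E2 [E3 [E4 [E5 E6]]]]].
    repeat match goal with |- _ /\ _ => split end; try (now apply is_derive_scal).
    pose proof (is_derive_mult e (fun t => q S s t) t _ _ (De t) E1 Rmult_comm) as H.
    refine (eq_ind _ (fun l : R => is_derive _ t l) H _ _).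
    change plus with Rplus. change mult with Rmult. match goal with |- ?a = ?b => change (@eq R a b) end. ring.
  - repeat match goal with |- _ /\ _ => split end; try (now apply Hc).
    apply cont_pos_of. intros S s t HS. apply cont3_plus.
    + apply cont3_mult; [apply cont3_const|]. apply cont3_mult; [apply Ce|now apply cont3_of_pos].
    + apply cont3_mult; [apply Ce|now apply cont3_of_pos].
Qed.

Lemma continuous_ln S : 0 < S -> continuous ln S.
Proof. intros HS. apply (ex_derive_continuous ln). eexists. now apply is_derive_ln. Qed.

Lemma continuous_inv S : 0 < S -> continuous Rinv S.
Proof. intros HS. apply (continuous_Rinv S). lra. Qed.

(** Linear in time between [f] at [t2] and [g] at [t2 - h]. It is smooth on one time slab only, so
    slabs are treated one by one. *)
Definition interp (f g : jet) (t2 h : R) (i j : nat) (x s t : R) : R :=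
  f i j x s + (t2 - t) / h * (g i j x s - f i j x s).

Lemma tf_interp f g t2 h : 0 < h -> smooth3 f -> smooth3 g ->
  test_fun (fun S s t => interp f g t2 h 0 0 (ln S) s t)
    (fun S s t => - ((g 0%nat 0%nat (ln S) s - f 0%nat 0%nat (ln S) s) / h))
    (fun S s t => interp f g t2 h 1 0 (ln S) s t * / S)
    (fun S s t => interp f g t2 h 0 1 (ln S) s t)
    (fun S s t => (interp f g t2 h 2 0 (ln S) s t - interp f g t2 h 1 0 (ln S) s t) * (/ S * / S))
    (fun S s t => interp f g t2 h 1 1 (ln S) s t * / S)
    (fun S s t => interp f g t2 h 0 2 (ln S) s t).
Proof.
  intros Hh [F1 F2] [G1 G2].
  assert (Cln : forall S, 0 < S -> continuous ln S) by apply continuous_ln.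
  assert (Ci : forall i j S s t, 0 < S -> (i + j <= 3)%nat -> cont3 (fun S s t => interp f g t2 h i j (ln S) s t) S s t).
  { intros i j S s t HS Hij. unfold interp.
    assert (A : cont3 (fun S s _ => f i j (ln S) s) S s t).
    { apply (cont3_12 (f i j)); [now apply Cln|now apply F2]. }
    assert (B : cont3 (fun S s _ => g i j (ln S) s) S s t).
    { apply (cont3_12 (g i j)); [now apply Cln|now apply G2]. }
    apply cont3_plus; trivial. apply cont3_mult.
    - apply (cont3_3 (fun t => (t2 - t) / h)).
      apply (ex_derive_continuous (fun t => (t2 - t) / h)). auto_derive. lra.
    - apply (cont3_plus (fun S s _ => g i j (ln S) s) (fun S s _ => - f i j (ln S) s)); trivial.
      exact (continuous_opp _ _ A). }
  assert (Cinv : forall S s t, 0 < S -> cont3 (fun S _ _ => / S) S s t).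
  { intros S s t HS. apply (cont3_1 Rinv). now apply continuous_inv. }
  assert (Dx : forall i j S s t, 0 < S -> (i + j < 3)%nat ->
    is_derive (fun S => interp f g t2 h i j (ln S) s t) S (interp f g t2 h (Datatypes.S i) j (ln S) s t * / S)).
  { intros i j S s t HS Hij. unfold interp.
    assert (D : forall k : jet, (forall x, is_derive (fun x => k i j x s) x (k (Datatypes.S i) j x s)) ->
      is_derive (fun S => k i j (ln S) s) S (/ S * k (Datatypes.S i) j (ln S) s)).
    { intros k Hk. apply (is_derive_comp (fun x => k i j x s) ln); [apply Hk|now apply is_derive_ln]. }
    pose proof (D f (fun x => proj1 (F1 i j x s Hij))) as Df.
    pose proof (D g (fun x => proj1 (G1 i j x s Hij))) as Dg.
    pose proof (is_derive_plus _ _ _ _ _ Df (is_derive_scal _ _ ((t2 - t) / h) _ (is_derive_minus _ _ _ _ _ Dg Df))) as H.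
    refine (eq_ind _ (fun l : R => is_derive _ S l) H _ _).
    change plus with Rplus. change minus with Rminus. match goal with |- ?a = ?b => change (@eq R a b) end. ring. }
  assert (Ds : forall i j S s t, (i + j < 3)%nat ->
    is_derive (fun s => interp f g t2 h i j (ln S) s t) s (interp f g t2 h i (Datatypes.S j) (ln S) s t)).
  { intros i j S s t Hij. unfold interp.
    pose proof (proj2 (F1 i j (ln S) s Hij)) as Df. pose proof (proj2 (G1 i j (ln S) s Hij)) as Dg.
    exact (is_derive_plus _ _ _ _ _ Df (is_derive_scal _ _ ((t2 - t) / h) _ (is_derive_minus _ _ _ _ _ Dg Df))). }
  split.
  - intros S s t HS. repeat match goal with |- _ /\ _ => split end.
    + unfold interp. auto_derive; [lra|]. field. lra.
    + apply Dx; trivial; lia.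
    + apply Ds; lia.
    + pose proof (is_derive_mult _ _ S _ _ (Dx 1%nat 0%nat S s t HS ltac:(lia)) (is_derive_inv (fun S => S) S 1 (is_derive_id S) ltac:(lra)) Rmult_comm) as H.
      refine (eq_ind _ (fun l : R => is_derive _ S l) H _ _).
      change plus with Rplus. change mult with Rmult. match goal with |- ?a = ?b => change (@eq R a b) end. field. lra.
    + pose proof (is_derive_scal _ s (/ S) _ (Ds 1%nat 0%nat S s t ltac:(lia))) as H.
      apply (is_derive_ext (fun s => / S * interp f g t2 h 1 0 (ln S) s t)); [intros; apply Rmult_comm|].
      rewrite Rmult_comm. exact H.
    + apply Ds; lia.
  - repeat match goal with |- _ /\ _ => split end; apply cont_pos_of; intros S s t HS.
    + apply Ci; trivial; lia.
    + apply (cont3_12 (fun x s => - ((g 0%nat 0%nat x s - f 0%nat 0%nat x s) / h)) ln); [now apply Cln|].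
      apply (continuous_opp (fun p : R * R => (g 0%nat 0%nat (fst p) (snd p) - f 0%nat 0%nat (fst p) (snd p)) / h)).
      apply (continuous_mult (fun p : R * R => g 0%nat 0%nat (fst p) (snd p) - f 0%nat 0%nat (fst p) (snd p)) (fun _ => / h)); [|apply continuous_const].
      apply (continuous_minus (fun p : R * R => g 0%nat 0%nat (fst p) (snd p)) (fun p => f 0%nat 0%nat (fst p) (snd p))); [apply G2; lia|apply F2; lia].
    + apply cont3_mult; [apply Ci; trivial; lia|now apply Cinv].
    + apply Ci; trivial; lia.
    + apply (cont3_mult (fun S s t => interp f g t2 h 2 0 (ln S) s t - interp f g t2 h 1 0 (ln S) s t) (fun S _ _ => / S * / S)).
      * apply (cont3_plus (fun S s t => interp f g t2 h 2 0 (ln S) s t) (fun S s t => - interp f g t2 h 1 0 (ln S) s t)); [apply Ci; trivial; lia|].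
        exact (continuous_opp _ _ (Ci 1%nat 0%nat S s t HS ltac:(lia))).
      * apply cont3_mult; now apply Cinv.
    + apply cont3_mult; [apply Ci; trivial; lia|now apply Cinv].
    + apply Ci; trivial; lia.
Qed.

(** The sigma part of the barrier: it outgrows polynomials of degree [n], and the exponent [n + 2]
    leaves [n + 1] and [n] in the derivatives. *)
Definition bar (n : nat) (s : R) : R := (1 + s ^ 2) ^ (n + 2).
Definition bar1 (n : nat) (s : R) : R := 2 * (INR n + 2) * s * (1 + s ^ 2) ^ (n + 1).
Definition bar2 (n : nat) (s : R) : R :=
  2 * (INR n + 2) * (1 + s ^ 2) ^ (n + 1) + 4 * (INR n + 2) * (INR n + 1) * s ^ 2 * (1 + s ^ 2) ^ n.

Lemma is_derive_bar n s : is_derive (bar n) s (bar1 n s) /\ is_derive (bar1 n) s (bar2 n s).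
Proof.
  assert (Dq : forall s, is_derive (fun s => 1 + s ^ 2) s (2 * s)) by (intros; auto_derive; trivial; ring).
  assert (Dp : forall m s, is_derive (fun s => (1 + s ^ 2) ^ (m + 1)) s ((INR m + 1) * (2 * s) * (1 + s ^ 2) ^ m)).
  { intros m s0. pose proof (is_derive_pow (fun s => 1 + s ^ 2) (m + 1) s0 _ (Dq s0)) as H.
    refine (eq_ind _ (fun l : R => is_derive _ s0 l) H _ _).
    rewrite plus_INR. replace (pred (m + 1)) with m by lia. simpl INR. 
    match goal with |- ?a = ?b => change (@eq R a b) end. ring. }
  split.
  - unfold bar, bar1. replace (n + 2)%nat with ((n + 1) + 1)%nat by lia.
    pose proof (Dp (n + 1)%nat s) as H. refine (eq_ind _ (fun l : R => is_derive _ s l) H _ _).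
    rewrite plus_INR. simpl INR. match goal with |- ?a = ?b => change (@eq R a b) end. ring.
  - unfold bar1, bar2.
    pose proof (is_derive_mult (fun s => 2 * (INR n + 2) * s) (fun s => (1 + s ^ 2) ^ (n + 1)) s (2 * (INR n + 2)) _
      ltac:(auto_derive; trivial; ring) (Dp n s) Rmult_comm) as H.
    refine (eq_ind _ (fun l : R => is_derive _ s l) H _ _).
    change plus with Rplus. change mult with Rmult. match goal with |- ?a = ?b => change (@eq R a b) end. ring.
Qed.

Lemma tf_barrier kap Lam T n :
  let e t := kap * exp (Lam * (T - t)) in
  test_fun (fun S s t => e t * (S + / S + bar n s)) (fun S s t => - Lam * (e t * (S + / S + bar n s)))
    (fun S s t => e t * (1 - / S * / S)) (fun S s t => e t * bar1 n s)
    (fun S s t => e t * (2 * (/ S * / S * / S))) (fun _ _ _ => 0) (fun S s t => e t * bar2 n s).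
Proof.
  intros e.
  assert (De : forall t, is_derive e t (- Lam * e t)).
  { intros t. unfold e. auto_derive; trivial. unfold Rminus. ring. }
  assert (Ce : forall S s t, cont3 (fun _ _ t => e t) S s t).
  { intros S s t. apply cont3_3. apply (ex_derive_continuous e). eexists. apply De. }
  assert (Cinv : forall S s t, 0 < S -> cont3 (fun S _ _ => / S) S s t).
  { intros S s t HS. apply (cont3_1 Rinv). now apply continuous_inv. }
  assert (Cb : forall b, (forall s, ex_derive b s) -> forall S s t, cont3 (fun _ s _ => b s) S s t).
  { intros b Hb S s t. apply cont3_2. now apply (ex_derive_continuous b). }
  assert (Cb0 := Cb (bar n) (fun s => ex_intro _ _ (proj1 (is_derive_bar n s)))).
  assert (Cb1 := Cb (bar1 n) (fun s => ex_intro _ _ (proj2 (is_derive_bar n s)))).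
  assert (Cb2 : forall S s t, cont3 (fun _ s _ => bar2 n s) S s t).
  { apply Cb. intros s. unfold bar2. auto_derive. trivial. }
  assert (CS : forall S s t, cont3 (fun S _ _ => S) S s t) by (intros; apply (cont3_1 (fun S => S)); apply continuous_id).
  assert (CA : forall S s t, 0 < S -> cont3 (fun S s t => e t * (S + / S + bar n s)) S s t).
  { intros S s t HS. apply cont3_mult; [apply Ce|]. apply cont3_plus; [apply (cont3_plus (fun S _ _ => S) (fun S _ _ => / S))|]; auto. }
  split.
  - intros S s t HS. repeat match goal with |- _ /\ _ => split end.
    + pose proof (is_derive_scal e t (S + / S + bar n s) _ (De t)) as H.
      apply (is_derive_ext (fun t => (S + / S + bar n s) * e t)); [intros; apply Rmult_comm|].
      refine (eq_ind _ (fun l : R => is_derive _ t l) H _ _). match goal with |- ?a = ?b => change (@eq R a b) end. ring.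
    + auto_derive; [lra|]. field. lra.
    + apply is_derive_scal. pose proof (is_derive_plus (fun _ => S + / S) (bar n) s _ _ (is_derive_const _ s) (proj1 (is_derive_bar n s))) as H.
      refine (eq_ind _ (fun l : R => is_derive _ s l) H _ _). apply plus_zero_l.
    + auto_derive; [lra|]. field. lra.
    + exact (is_derive_const _ _).
    + apply is_derive_scal. apply is_derive_bar.
  - repeat match goal with |- _ /\ _ => split end; apply cont_pos_of; intros S s t HS.
    + now apply CA.
    + apply cont3_mult; [apply cont3_const|now apply CA].
    + apply cont3_mult; [apply Ce|]. 
      apply (cont3_plus (fun _ _ _ => 1) (fun S _ _ => - (/ S * / S))); [apply cont3_const|].
      exact (continuous_opp _ _ (cont3_mult _ _ S s t (Cinv S s t HS) (Cinv S s t HS))).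
    + apply cont3_mult; auto.
    + apply cont3_mult; [apply Ce|]. apply (cont3_mult (fun _ _ _ => 2)); [apply cont3_const|].
      apply (cont3_mult (fun S _ _ => / S * / S) (fun S _ _ => / S)); [apply cont3_mult|]; auto.
    + apply cont3_const.
    + apply cont3_mult; auto.
Qed.

(** * Slopes in time at a contact point *)

Definition hom (r rho B b c S pS ps pSS pSs pss : R) : R :=
  r * S * pS + c * ps + / 2 * B ^ 2 * S ^ 2 * pSS + rho * B * b * S * pSs + / 2 * b ^ 2 * pss.

(* The linear Hamiltonian up to a term vanishing where [u_sigma >= 0]. *)
Definition near_linear (T r mu rho alpha : R) (beta : R -> R) (a b : R -> R -> R) (C0 : R) (H : Ham) : Prop :=
  forall S s t v pS ps pSS pSs pss, 0 <= t <= T ->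
    Rabs (H S s t v pS ps pSS pSs pss - H_G r mu rho alpha beta a b S s t v pS ps pSS pSs pss)
      <= C0 * (Rabs ps - ps).

Section Touch.
Variables T r mu rho alpha : R.
Variable beta : R -> R.
Variables a b : R -> R -> R.
Variable C0 : R.
Variable H : Ham.
Hypothesis HH : near_linear T r mu rho alpha beta a b C0 H.
Variables q qt qS qs qSS qSs qss : R -> R -> R -> R.
Hypothesis Hq : test_fun q qt qS qs qSS qSs qss.
Variable u : R -> R -> R -> R.
Variables S0 s0 t0 : R.
Hypothesis HS0 : 0 < S0.
Hypothesis Ht0 : 0 < t0 < T.
Hypothesis Heq : u S0 s0 t0 = exp (- r * (T - t0)) * q S0 s0 t0.

Local Notation L := (hom r rho (beta s0) (b s0 t0) (gam r mu rho alpha beta a b s0 t0) S0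
  (qS S0 s0 t0) (qs S0 s0 t0) (qSS S0 s0 t0) (qSs S0 s0 t0) (qss S0 s0 t0)).

Lemma discount_H : exists e, 0 < e /\
  Rabs (r * (exp (- r * (T - t0)) * q S0 s0 t0) + exp (- r * (T - t0)) * qt S0 s0 t0
    + H S0 s0 t0 (u S0 s0 t0) (exp (- r * (T - t0)) * qS S0 s0 t0) (exp (- r * (T - t0)) * qs S0 s0 t0)
        (exp (- r * (T - t0)) * qSS S0 s0 t0) (exp (- r * (T - t0)) * qSs S0 s0 t0) (exp (- r * (T - t0)) * qss S0 s0 t0)
    - e * (qt S0 s0 t0 + L)) <= e * (C0 * (Rabs (qs S0 s0 t0) - qs S0 s0 t0)).
Proof.
  set (e := exp (- r * (T - t0))) in *. exists e. assert (He : 0 < e) by apply exp_pos. split; trivial.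
  pose proof (HH S0 s0 t0 (u S0 s0 t0) (e * qS S0 s0 t0) (e * qs S0 s0 t0) (e * qSS S0 s0 t0) (e * qSs S0 s0 t0)
    (e * qss S0 s0 t0) ltac:(lra)) as D.
  rewrite Rabs_mult, (Rabs_pos_eq e) in D by lra.
  replace (C0 * (e * Rabs (qs S0 s0 t0) - e * qs S0 s0 t0)) with (e * (C0 * (Rabs (qs S0 s0 t0) - qs S0 s0 t0))) in D by ring.
  apply Rle_trans with (2 := D). apply Req_le. f_equal. unfold H_G, hom. rewrite Heq. ring.
Qed.

Lemma sub_touch : visc_sub T H u ->
  (exists d, 0 < d /\ forall S s t, 0 < S -> 0 < t < T -> Rabs (S - S0) < d -> Rabs (s - s0) < d ->
     Rabs (t - t0) < d -> u S s t <= exp (- r * (T - t)) * q S s t) ->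
  0 <= qt S0 s0 t0 + L + C0 * (Rabs (qs S0 s0 t0) - qs S0 s0 t0).
Proof.
  intros Hu [d [Hd Hmax]].
  pose proof (Hu _ _ _ _ _ _ _ (tf_discount r T _ _ _ _ _ _ _ Hq) S0 s0 t0 HS0 Ht0) as V.
  destruct discount_H as [e [He D]]. cbv beta zeta in V.
  assert (V' := V ltac:(exists d; split; trivial; intros S s t H1 H2 H3 H4 H5; specialize (Hmax S s t H1 H2 H3 H4 H5); lra)).
  apply Rabs_le_between in D. apply Rmult_le_reg_l with e; trivial. rewrite Rmult_0_r. lra.
Qed.

Lemma super_touch : visc_super T H u ->
  (exists d, 0 < d /\ forall S s t, 0 < S -> 0 < t < T -> Rabs (S - S0) < d -> Rabs (s - s0) < d ->
     Rabs (t - t0) < d -> exp (- r * (T - t)) * q S s t <= u S s t) ->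
  qt S0 s0 t0 + L - C0 * (Rabs (qs S0 s0 t0) - qs S0 s0 t0) <= 0.
Proof.
  intros Hu [d [Hd Hmax]].
  pose proof (Hu _ _ _ _ _ _ _ (tf_discount r T _ _ _ _ _ _ _ Hq) S0 s0 t0 HS0 Ht0) as V.
  destruct discount_H as [e [He D]]. cbv beta zeta in V.
  assert (V' := V ltac:(exists d; split; trivial; intros S s t H1 H2 H3 H4 H5; specialize (Hmax S s t H1 H2 H3 H4 H5); lra)).
  apply Rabs_le_between in D. apply Rmult_le_reg_l with e; trivial. rewrite Rmult_0_r. lra.
Qed.
End Touch.

Definition visc_side (sg T : R) (H : Ham) (u : R -> R -> R -> R) : Prop :=
  (sg = 1 /\ visc_sub T H u) \/ (sg = -1 /\ visc_super T H u).

Definition chi (kap Lam T : R) (n : nat) (S s t : R) : R :=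
  kap * exp (Lam * (T - t)) * (S + / S + bar n s).

(** [interp + sg * (chi + z + c)] touches [exp (r * (T - t)) * u] from above if [sg = 1] and from
    below if [sg = -1]. [X] is the residual of the interpolation and [e * Y] that of the barrier.
    The last term bounds [C0 * (|p| - p)], that is [2 * C0] times the negative part of [p], for the
    sigma derivative [p >= - m - e * |bar1|] of the touching function. *)
Lemma side_touch sg T r mu rho alpha beta a b C0 H u f g t2 h kap Lam n z z1 c m S0 s0 t0 :
  near_linear T r mu rho alpha beta a b C0 H -> 0 <= C0 -> visc_side sg T H u ->
  0 < h -> smooth3 f -> smooth3 g -> 0 <= kap ->
  (forall t, is_derive z t (z1 t)) -> (forall t, continuous z1 t) ->
  0 < S0 -> 0 < t0 < T ->
  - m <= interp f g t2 h 0 1 (ln S0) s0 t0 ->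
  let w S s t := sg * (exp (r * (T - t)) * u S s t - interp f g t2 h 0 0 (ln S) s t) - chi kap Lam T n S s t - z t in
  w S0 s0 t0 = c ->
  (exists d, 0 < d /\ forall S s t, 0 < S -> 0 < t < T -> Rabs (S - S0) < d -> Rabs (s - s0) < d ->
     Rabs (t - t0) < d -> w S s t <= c) ->
  let D i j := interp f g t2 h i j (ln S0) s0 t0 in
  let ga := gam r mu rho alpha beta a b s0 t0 in
  let e := kap * exp (Lam * (T - t0)) in
  let X := - ((g 0%nat 0%nat (ln S0) s0 - f 0%nat 0%nat (ln S0) s0) / h)
     + ((r - / 2 * beta s0 ^ 2) * D 1%nat 0%nat + ga * D 0%nat 1%nat + / 2 * beta s0 ^ 2 * D 2%nat 0%nat
        + rho * beta s0 * b s0 t0 * D 1%nat 1%nat + / 2 * b s0 t0 ^ 2 * D 0%nat 2%nat) in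
  let Y := - Lam * (S0 + / S0 + bar n s0) + (r * (S0 - / S0) + ga * bar1 n s0 + beta s0 ^ 2 * / S0
        + / 2 * b s0 t0 ^ 2 * bar2 n s0) in
  - z1 t0 <= Rabs X + e * Y + 2 * C0 * (Rabs m + e * Rabs (bar1 n s0)).
Proof.
  intros HH HC0 Hside Hh Hf Hg Hkap Hz Hz1 HS0 Ht0 Hm w Hw Hmax D ga e X Y.
  assert (Hsg : sg * sg = 1) by (destruct Hside as [[-> _]|[-> _]]; ring).
  pose proof (tf_interp f g t2 h Hh Hf Hg) as T1.
  pose proof (tf_barrier kap Lam T n) as T2. cbv zeta in T2.
  assert (Hzc : forall t, is_derive (fun t => z t + c) t (z1 t)).
  { intros t. rewrite <- (Rplus_0_r (z1 t)). apply (is_derive_plus z (fun _ => c)); [apply Hz|exact (is_derive_const c t)]. }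
  pose proof (tf_time (fun t => z t + c) z1 Hzc Hz1) as T3.
  pose proof (tf_plus_scal sg _ _ _ _ _ _ _ _ _ _ _ _ _ _ T1
    (tf_plus_scal 1 _ _ _ _ _ _ _ _ _ _ _ _ _ _ T2 T3)) as TF.
  assert (Hexp : forall t, exp (- r * (T - t)) * exp (r * (T - t)) = 1).
  { intros t. rewrite <- exp_plus. replace (- r * (T - t) + r * (T - t)) with 0 by ring. apply exp_0. }
  assert (Hu : forall S s t, u S s t = exp (- r * (T - t)) * (exp (r * (T - t)) * u S s t)).
  { intros S s t. rewrite <- Rmult_assoc, Hexp. ring. }
  assert (He : 0 <= e) by (apply Rmult_le_pos; [trivial|apply Rlt_le, exp_pos]).
  assert (Hcontact : u S0 s0 t0 = exp (- r * (T - t0)) * (interp f g t2 h 0 0 (ln S0) s0 t0 +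
     sg * (kap * exp (Lam * (T - t0)) * (S0 + / S0 + bar n s0) + 1 * (z t0 + c)))).
  { rewrite (Hu S0 s0 t0). f_equal. unfold w, chi in Hw.
    set (U := exp (r * (T - t0)) * u S0 s0 t0) in *.
    set (C := kap * exp (Lam * (T - t0)) * (S0 + / S0 + bar n s0)) in *.
    replace (C + 1 * (z t0 + c)) with (sg * (U - interp f g t2 h 0 0 (ln S0) s0 t0)) by lra.
    rewrite <- Rmult_assoc, Hsg. ring. }
  assert (Hside2 : Rabs (D 0%nat 1%nat + sg * (e * bar1 n s0)) - (D 0%nat 1%nat + sg * (e * bar1 n s0))
      <= 2 * (Rabs m + e * Rabs (bar1 n s0))).
  { fold (D 0%nat 1%nat) in Hm.
    assert (H1 : Rabs (sg * (e * bar1 n s0)) = e * Rabs (bar1 n s0)).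
    { rewrite !Rabs_mult, (Rabs_pos_eq e) by trivial.
      destruct Hside as [[-> _]|[-> _]]; [rewrite Rabs_R1|rewrite Rabs_left by lra]; ring. }
    pose proof (Rle_abs m). pose proof (Rle_abs (- (sg * (e * bar1 n s0)))) as H2. rewrite Rabs_Ropp, H1 in H2.
    assert (0 <= e * Rabs (bar1 n s0)) by (apply Rmult_le_pos; [trivial|apply Rabs_pos]).
    pose proof (Rabs_pos m).
    unfold Rabs at 1. destruct (Rcase_abs _); lra. }
  assert (HC : C0 * (Rabs (D 0%nat 1%nat + sg * (e * bar1 n s0)) - (D 0%nat 1%nat + sg * (e * bar1 n s0)))
      <= C0 * (2 * (Rabs m + e * Rabs (bar1 n s0)))) by (apply Rmult_le_compat_l; trivial).
  pose proof (Rle_abs X) as HX. pose proof (Rle_abs (- X)) as HX'. rewrite Rabs_Ropp in HX'.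
  destruct Hmax as [d [Hd Hmax]].
  destruct Hside as [[Hs1 Hv]|[Hs1 Hv]].
  - pose proof (sub_touch T r mu rho alpha beta a b C0 H HH _ _ _ _ _ _ _ TF u S0 s0 t0 HS0 Ht0 Hcontact Hv) as V.
    assert (V' : 0 <= X + (e * Y + z1 t0) + C0 * (Rabs (D 0%nat 1%nat + sg * (e * bar1 n s0)) - (D 0%nat 1%nat + sg * (e * bar1 n s0)))).
    { lapply V; [clear V; intros V|].
      - replace (D 0%nat 1%nat + sg * (e * bar1 n s0)) with (D 0%nat 1%nat + sg * (e * bar1 n s0 + 1 * 0)) by ring.
        apply Rle_trans with (1 := V). apply Req_le. f_equal. 
        unfold hom, X, Y. fold ga e. fold (D 1%nat 0%nat) (D 0%nat 1%nat) (D 2%nat 0%nat) (D 1%nat 1%nat) (D 0%nat 2%nat).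
        rewrite Hs1. clearbody D ga e. field. lra.
      - exists d. split; trivial. intros S s t H1 H2 H3 H4 H5. specialize (Hmax S s t H1 H2 H3 H4 H5).
        unfold w, chi in Hmax. rewrite (Hu S s t). apply Rmult_le_compat_l; [apply Rlt_le, exp_pos|].
        rewrite Hs1 in *. lra. }
    lra.
  - pose proof (super_touch T r mu rho alpha beta a b C0 H HH _ _ _ _ _ _ _ TF u S0 s0 t0 HS0 Ht0 Hcontact Hv) as V.
    assert (V' : X - (e * Y + z1 t0) - C0 * (Rabs (D 0%nat 1%nat + sg * (e * bar1 n s0)) - (D 0%nat 1%nat + sg * (e * bar1 n s0))) <= 0).
    { lapply V; [clear V; intros V|].
      - replace (D 0%nat 1%nat + sg * (e * bar1 n s0)) with (D 0%nat 1%nat + sg * (e * bar1 n s0 + 1 * 0)) by ring.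
        apply Rle_trans with (2 := V). apply Req_le. f_equal. 
        unfold hom, X, Y. fold ga e. fold (D 1%nat 0%nat) (D 0%nat 1%nat) (D 2%nat 0%nat) (D 1%nat 1%nat) (D 0%nat 2%nat).
        rewrite Hs1. clearbody D ga e. field. lra.
      - exists d. split; trivial. intros S s t H1 H2 H3 H4 H5. specialize (Hmax S s t H1 H2 H3 H4 H5).
        unfold w, chi in Hmax. rewrite (Hu S s t). apply Rmult_le_compat_l; [apply Rlt_le, exp_pos|].
        rewrite Hs1 in *. lra. }
    lra.
Qed.

(** * Estimates for the barrier *)

Lemma bar_bounds n s : let N := INR n + 2 in
  1 + s ^ 2 <= bar n s /\ (1 + Rabs s) * Rabs (bar1 n s) <= 4 * N * bar n s /\
  0 <= bar2 n s <= 6 * N ^ 2 * bar n s.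
Proof.
  intros N. pose proof (pos_INR n). set (p := 1 + s ^ 2).
  assert (Hs2 : 0 <= s ^ 2) by apply pow2_ge_0. assert (Hp : 1 <= p) by (unfold p; lra).
  assert (Hpn : forall m, 1 <= p ^ m) by (intros m; apply pow_R1_Rle; trivial).
  assert (E1 : bar n s = p ^ n * p ^ 2) by (unfold bar; fold p; rewrite <- pow_add; reflexivity).
  assert (E2 : p ^ (n + 1) = p ^ n * p) by (rewrite pow_add; ring).
  pose proof (Hpn n) as P0.
  assert (P1 : p ^ n <= p ^ n * p) by nra.
  assert (P2 : p ^ n * p <= p ^ n * p ^ 2) by nra.
  split; [|split].
  - rewrite E1. fold p. nra.
  - unfold bar1. fold N p. rewrite !Rabs_mult, E2, E1.
    rewrite (Rabs_pos_eq 2), (Rabs_pos_eq N), (Rabs_pos_eq (p ^ n * p)) by (unfold N; nra).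
    assert (Ha : (1 + Rabs s) * Rabs s <= 2 * p).
    { unfold p. rewrite <- (pow2_abs s). pose proof (pow2_ge_0 (Rabs s - 1)). nra. }
    replace ((1 + Rabs s) * (2 * N * Rabs s * (p ^ n * p))) with (2 * N * (p ^ n * p) * ((1 + Rabs s) * Rabs s)) by ring.
    replace (4 * N * (p ^ n * p ^ 2)) with (2 * N * (p ^ n * p) * (2 * p)) by ring.
    apply Rmult_le_compat_l; trivial. apply Rmult_le_pos; [unfold N; lra|nra].
  - assert (HN : 2 <= N) by (unfold N; lra).
    assert (H0 : 0 <= s ^ 2 * p ^ n <= p ^ n * p ^ 2).
    { split; [nra|]. apply Rle_trans with (p ^ n * p); trivial. rewrite Rmult_comm. apply Rmult_le_compat_l; [lra|unfold p; lra]. }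
    assert (E3 : bar2 n s = 2 * N * (p ^ n * p) + 4 * N * (N - 1) * (s ^ 2 * p ^ n)).
    { unfold bar2. fold N p. rewrite E2. unfold N. ring. }
    rewrite E3, E1. split.
    + assert (0 <= 4 * N * (N - 1) * (s ^ 2 * p ^ n)) by (apply Rmult_le_pos; [nra|lra]).
      assert (0 <= 2 * N * (p ^ n * p)) by (apply Rmult_le_pos; nra). lra.
    + apply Rle_trans with (2 * N * (p ^ n * p ^ 2) + 4 * N * (N - 1) * (p ^ n * p ^ 2)).
      * apply Rplus_le_compat; apply Rmult_le_compat_l; try lra; nra.
      * assert (0 <= p ^ n * p ^ 2) by nra.
        assert (0 <= (2 * N ^ 2 + 2 * N) * (p ^ n * p ^ 2)) by (apply Rmult_le_pos; [pose proof (pow2_ge_0 N); lra|trivial]). lra.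
Qed.

(** Every positive term is at most a multiple of [A = S + / S + bar n s], and [Lam] exceeds the sum
    of the multiples by 1. The linear growth of the sigma drift is matched by the bound on
    [(1 + |s|) * |bar1|]. The surplus [- (1 + s ^ 2)] will absorb residuals that grow with [s]. *)
Lemma barrier_bound r B b c Kc Kg C0 Lam n S s : 0 < S -> 0 <= C0 ->
  Rabs B <= Kc -> Rabs b <= Kc -> Rabs c <= Kg * (1 + Rabs s) -> 0 <= Kg ->
  Rabs r + Kc ^ 2 + 4 * Kg * (INR n + 2) + 3 * (INR n + 2) ^ 2 * Kc ^ 2 + 4 * C0 * (INR n + 2) + 1 <= Lam ->
  - Lam * (S + / S + bar n s) + (r * (S - / S) + c * bar1 n s + B ^ 2 * / S + / 2 * b ^ 2 * bar2 n s)
    + 2 * C0 * Rabs (bar1 n s) <= - (1 + s ^ 2).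
Proof.
  intros HS HC0 HB Hb Hc HKg HLam.
  destruct (bar_bounds n s) as [Q1 [Q2 Q3]]. set (N := INR n + 2) in *.
  assert (HI : 0 < / S) by (apply Rinv_0_lt_compat; trivial).
  pose proof (pow2_ge_0 s). set (A := S + / S + bar n s).
  assert (HN : 2 <= N) by (unfold N; pose proof (pos_INR n); lra).
  assert (sq : forall p, Rabs p <= Kc -> p ^ 2 <= Kc ^ 2).
  { intros p Hp. rewrite <- (pow2_abs p). apply pow_incr. split; [apply Rabs_pos|trivial]. }
  assert (T1 : r * (S - / S) <= Rabs r * A).
  { apply Rle_trans with (1 := Rle_abs _). rewrite Rabs_mult. apply Rmult_le_compat_l; [apply Rabs_pos|].
    unfold A. apply Rabs_le_between. lra. }
  assert (T2 : B ^ 2 * / S <= Kc ^ 2 * A).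
  { apply Rmult_le_compat; [apply pow2_ge_0|lra|auto|unfold A; lra]. }
  assert (T3 : c * bar1 n s <= 4 * Kg * N * A).
  { apply Rle_trans with (1 := Rle_abs _). rewrite Rabs_mult.
    apply Rle_trans with (Kg * (1 + Rabs s) * Rabs (bar1 n s)); [apply Rmult_le_compat_r; [apply Rabs_pos|trivial]|].
    apply Rle_trans with (Kg * (4 * N * bar n s)); [rewrite Rmult_assoc; apply Rmult_le_compat_l; trivial|].
    replace (4 * Kg * N * A) with (Kg * (4 * N * A)) by ring. apply Rmult_le_compat_l; trivial.
    apply Rmult_le_compat_l; [lra|unfold A; lra]. }
  assert (T4 : / 2 * b ^ 2 * bar2 n s <= 3 * N ^ 2 * Kc ^ 2 * A).
  { apply Rle_trans with (/ 2 * Kc ^ 2 * (6 * N ^ 2 * bar n s)).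
    - apply Rmult_le_compat; [|lra| |lra].
      + pose proof (pow2_ge_0 b). lra.
      + specialize (sq b Hb). lra.
    - replace (3 * N ^ 2 * Kc ^ 2 * A) with (/ 2 * Kc ^ 2 * (6 * N ^ 2 * A)) by field.
      apply Rmult_le_compat_l; [pose proof (pow2_ge_0 Kc); lra|]. apply Rmult_le_compat_l; [nra|unfold A; lra]. }
  assert (T5 : 2 * C0 * Rabs (bar1 n s) <= 4 * C0 * N * A).
  { pose proof (Rabs_pos s). pose proof (Rabs_pos (bar1 n s)).
    assert (Hm : 2 * Rabs (bar1 n s) <= 4 * N * A).
    { assert (Hsm : 2 * Rabs (bar1 n s) <= (1 + Rabs s) * Rabs (bar1 n s) \/ Rabs s < 1) by (destruct (Rle_dec 1 (Rabs s)); [left; nra|right; lra]).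
      destruct Hsm as [Hsm|Hsm].
      - apply Rle_trans with (1 := Hsm). apply Rle_trans with (1 := Q2). apply Rmult_le_compat_l; [lra|unfold A; lra].
      - unfold bar1. fold N. rewrite !Rabs_mult, (Rabs_pos_eq 2), (Rabs_pos_eq N) by lra.
        assert (Hp : 0 <= (1 + s ^ 2) ^ (n + 1) <= bar n s).
        { split; [apply pow_le; lra|]. unfold bar. apply Rle_pow; [lra|lia]. }
        rewrite (Rabs_pos_eq ((1 + s ^ 2) ^ (n + 1))) by lra.
        replace (2 * (2 * N * Rabs s * (1 + s ^ 2) ^ (n + 1))) with (4 * N * (Rabs s * (1 + s ^ 2) ^ (n + 1))) by ring.
        apply Rmult_le_compat_l; [lra|]. apply Rle_trans with (1 * bar n s); [apply Rmult_le_compat; lra|unfold A; lra]. }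
    replace (4 * C0 * N * A) with (C0 * (4 * N * A)) by ring.
    rewrite (Rmult_comm 2 C0), Rmult_assoc. apply Rmult_le_compat_l; trivial. }
  assert (HA : 1 + s ^ 2 <= A) by (unfold A; lra).
  assert (Hfin : (Rabs r + Kc ^ 2 + 4 * Kg * N + 3 * N ^ 2 * Kc ^ 2 + 4 * C0 * N + 1) * A <= Lam * A).
  { apply Rmult_le_compat_r; [lra|trivial]. }
  lra.
Qed.

Lemma exp_ge_pow y n : 0 <= y -> (y / (INR n + 1)) ^ (n + 1) <= exp y.
Proof.
  intros Hy. pose proof (pos_INR n).
  replace (exp y) with (exp (y / (INR n + 1)) ^ (n + 1)).
  - apply pow_incr. split; [apply Rmult_le_pos; [trivial|apply Rlt_le, Rinv_0_lt_compat; lra]|].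
    destruct (Req_dec (y / (INR n + 1)) 0) as [->|Hne]; [apply Rlt_le, exp_pos|].
    pose proof (exp_ineq1 _ Hne). lra.
  - rewrite <- Rpower_pow by apply exp_pos. unfold Rpower. rewrite ln_exp, plus_INR. f_equal. simpl. field. lra.
Qed.

(** One of [|x|], [|s|] is at least half of their sum [l]. Either way the barrier is at least a
    multiple of [l ^ (n + 1)], one degree more than the growth to be beaten. *)
Lemma barrier_growth n kap D B c : 0 < kap -> 0 <= D -> exists A, forall x s,
  A <= Rabs x + Rabs s -> D * (1 + (Rabs x + Rabs s) ^ n) + B - kap * (exp x + / exp x + bar n s) <= c.
Proof.
  intros Hkap HD. pose proof (pos_INR n) as Hn.
  set (k := kap * (/ (2 * (INR n + 1))) ^ (n + 1)).
  assert (Hk : 0 < k).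
  { apply Rmult_lt_0_compat; trivial. apply pow_lt. apply Rinv_0_lt_compat. lra. }
  exists (Rmax 2 ((2 * D + Rabs (B - c)) / k)). intros x s.
  set (l := Rabs x + Rabs s). intros Hl.
  pose proof (Rmax_l 2 ((2 * D + Rabs (B - c)) / k)) as M1. pose proof (Rmax_r 2 ((2 * D + Rabs (B - c)) / k)) as M2.
  assert (Hl1 : 1 <= l / 2) by lra.
  assert (Hlp : 1 <= l ^ n) by (apply pow_R1_Rle; lra).
  assert (Hbig : (l / (2 * (INR n + 1))) ^ (n + 1) <= exp x + / exp x + bar n s).
  { pose proof (exp_pos x). assert (0 < / exp x) by (apply Rinv_0_lt_compat; trivial).
    pose proof (proj1 (bar_bounds n s)). pose proof (pow2_ge_0 s).
    assert (Hq : (l / (2 * (INR n + 1))) ^ (n + 1) = (l / 2 / (INR n + 1)) ^ (n + 1)) by (f_equal; field; lra).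
    rewrite Hq. destruct (Rle_dec (l / 2) (Rabs x)) as [Hx|Hx].
    - apply Rle_trans with (exp (Rabs x)).
      + apply Rle_trans with (1 := exp_ge_pow (l / 2) n ltac:(lra)).
        destruct Hx as [Hx|Hx]; [left; now apply exp_increasing|right; now rewrite Hx].
      + unfold Rabs. destruct (Rcase_abs x); [rewrite exp_Ropp|]; lra.
    - assert (Hs : l / 2 <= Rabs s) by (unfold l in *; lra).
      apply Rle_trans with (bar n s); [|lra].
      apply Rle_trans with ((l / 2) ^ (n + 1)).
      { apply pow_incr. split; [apply Rmult_le_pos; [lra|apply Rlt_le, Rinv_0_lt_compat; lra]|].
        apply Rmult_le_reg_r with (INR n + 1); [lra|]. unfold Rdiv at 1. rewrite Rmult_assoc, Rinv_l by lra.
        rewrite Rmult_1_r. nra. }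
      apply Rle_trans with ((1 + s ^ 2) ^ (n + 1)).
      { apply pow_incr. split; [lra|]. rewrite <- (pow2_abs s). nra. }
      unfold bar. apply Rle_pow; [lra|lia]. }
  assert (Hkl : k * l * l ^ n <= kap * (exp x + / exp x + bar n s)).
  { apply Rle_trans with (kap * (l / (2 * (INR n + 1))) ^ (n + 1)); [|apply Rmult_le_compat_l; lra].
    apply Req_le. unfold k, Rdiv. rewrite Rpow_mult_distr, (pow_add l). ring. }
  assert (H2 : 2 * D + Rabs (B - c) <= k * l).
  { apply Rmult_le_reg_r with (/ k); [apply Rinv_0_lt_compat; trivial|].
    replace (k * l * / k) with l by (field; lra). unfold Rdiv in *. lra. }
  assert (H3 : (2 * D + Rabs (B - c)) * l ^ n <= k * l * l ^ n) by (apply Rmult_le_compat_r; lra).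
  assert (H4 : D * 1 <= D * l ^ n) by (apply Rmult_le_compat_l; lra).
  assert (H5 : Rabs (B - c) * 1 <= Rabs (B - c) * l ^ n) by (apply Rmult_le_compat_l; [apply Rabs_pos|lra]).
  pose proof (Rle_abs (B - c)). lra.
Qed.

Definition poly_growth (T : R) (u : R -> R -> R -> R) (n : nat) : Prop :=
  exists A, forall S s t, 0 < S -> 0 <= t <= T -> A <= Rabs (ln S) + Rabs s ->
    Rabs (u S s t) <= 1 + (Rabs (ln S) + Rabs s) ^ n.

(** It holds for all large [n], so that one exponent, hence one barrier, serves two solutions. *)
Lemma class_C_growth T u : class_C T u -> exists n0, forall n, (n0 <= n)%nat -> poly_growth T u n.
Proof.
  intros [_ [k [Hk Hg]]]. destruct (Hg 1 Rlt_0_1) as [A HA].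
  destruct (nfloor_ex k ltac:(lra)) as [n0 Hn0]. exists (S n0). intros n Hn.
  exists (Rmax A 2). intros S s t HS Ht Hl.
  pose proof (Rmax_l A 2). pose proof (Rmax_r A 2).
  specialize (HA S s t HS Ht ltac:(lra)). set (l := Rabs (ln S) + Rabs s) in *.
  assert (Hp : 0 < Rpower l k) by apply exp_pos.
  assert (Hle : Rabs (u S s t) <= 1 + Rpower l k).
  { apply Rmult_le_reg_r with (/ (1 + Rpower l k)); [apply Rinv_0_lt_compat; lra|].
    rewrite Rinv_r by lra. exact HA. }
  apply Rle_trans with (1 := Hle). apply Rplus_le_compat_l.
  rewrite <- Rpower_pow by lra. apply Rle_Rpower; [lra|].
  apply le_INR in Hn. rewrite S_INR in Hn. lra.
Qed.

(** * Comparison on one time slab *)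

Lemma affine_ge c p q th : 0 <= th <= 1 -> c <= p -> c <= q -> c <= p + th * (q - p).
Proof.
  intros Hth Hp Hq. assert (0 <= th * (q - c)) by (apply Rmult_le_pos; lra).
  assert (0 <= (1 - th) * (p - c)) by (apply Rmult_le_pos; lra). lra.
Qed.

(** [sup_decrease] for the difference of the solution and the interpolation, penalised by the
    barrier. A touching slope is controlled by the residual [X] and the cost [2 * C0 * m] of the
    nonlinearity, less the surplus of the barrier; hence the allowance [kap * (1 + s ^ 2)] in the
    hypothesis on [X]. *)
Lemma slab sg T r mu rho alpha beta a b C0 H u f g t1 t2 kap Lam n m Kc Kg B Cb eta (E : R -> Prop) M :
  near_linear T r mu rho alpha beta a b C0 H -> 0 <= C0 -> visc_side sg T H u ->
  cont_on_dom T u -> poly_growth T u n ->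
  0 < kap -> 0 <= t1 -> t1 < t2 -> t2 <= T -> smooth3 f -> smooth3 g ->
  (forall x s, Rabs (f 0%nat 0%nat x s) <= B) -> (forall x s, Rabs (g 0%nat 0%nat x s) <= B) ->
  0 <= m -> (forall x s, - m <= f 0%nat 1%nat x s) -> (forall x s, - m <= g 0%nat 1%nat x s) ->
  (forall s, Rabs (beta s) <= Kc) -> (forall s t, 0 <= t <= T -> Rabs (b s t) <= Kc) ->
  (forall s t, 0 <= t <= T -> Rabs (gam r mu rho alpha beta a b s t) <= Kg * (1 + Rabs s)) -> 0 <= Kg ->
  Rabs r + Kc ^ 2 + 4 * Kg * (INR n + 2) + 3 * (INR n + 2) ^ 2 * Kc ^ 2 + 4 * C0 * (INR n + 2) + 1 <= Lam ->
  0 < Cb -> 0 <= eta ->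
  (forall x s t, t1 < t < t2 ->
     let D i j := interp f g t2 (t2 - t1) i j x s t in
     let ga := gam r mu rho alpha beta a b s t in
     let X := - ((g 0%nat 0%nat x s - f 0%nat 0%nat x s) / (t2 - t1))
       + ((r - / 2 * beta s ^ 2) * D 1%nat 0%nat + ga * D 0%nat 1%nat + / 2 * beta s ^ 2 * D 2%nat 0%nat
          + rho * beta s * b s t * D 1%nat 1%nat + / 2 * b s t ^ 2 * D 0%nat 2%nat) in
     Rabs X + 2 * C0 * m <= Cb + kap * (1 + s ^ 2) /\
     (E t -> Rabs X + 2 * C0 * m <= eta + kap * (1 + s ^ 2))) ->
  (forall x s, sg * (exp (r * (T - t2)) * u (exp x) s t2 - f 0%nat 0%nat x s) - chi kap Lam T n (exp x) s t2 <= M) ->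
  forall x s, sg * (exp (r * (T - t1)) * u (exp x) s t1 - g 0%nat 0%nat x s) - chi kap Lam T n (exp x) s t1
    <= M + eta * (t2 - t1) + Cb * (t2 - t1 - om E t1 t2).
Proof.
  intros HH HC0 Hside Hu Hgr Hkap Ht1 Ht12 Ht2 Hf Hg HfB HgB Hm Hfm Hgm Hbeta Hb Hgam HKg HLam HCb Heta Herr Hend.
  set (w := fun x s t => sg * (exp (r * (T - t)) * u (exp x) s t - interp f g t2 (t2 - t1) 0 0 x s t)
     - chi kap Lam T n (exp x) s t).
  assert (Hh : 0 < t2 - t1) by lra.
  assert (HLam0 : 0 <= Lam).
  { pose proof (Rabs_pos r). pose proof (pow2_ge_0 Kc). pose proof (pos_INR n).
    assert (0 <= Kg * (INR n + 2)) by (apply Rmult_le_pos; lra).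
    assert (0 <= C0 * (INR n + 2)) by (apply Rmult_le_pos; lra).
    assert (0 <= (INR n + 2) ^ 2 * Kc ^ 2) by (apply Rmult_le_pos; apply pow2_ge_0). lra. }
  assert (Hi1 : forall x s, interp f g t2 (t2 - t1) 0 0 x s t1 = g 0%nat 0%nat x s).
  { intros. unfold interp. field. lra. }
  assert (Hi2 : forall x s, interp f g t2 (t2 - t1) 0 0 x s t2 = f 0%nat 0%nat x s).
  { intros. unfold interp. field. lra. }
  assert (Hth : forall t, t1 <= t <= t2 -> 0 <= (t2 - t) / (t2 - t1) <= 1).
  { intros t Ht. split; [apply Rmult_le_pos; [lra|apply Rlt_le, Rinv_0_lt_compat; lra]|].
    apply Rmult_le_reg_r with (t2 - t1); [lra|]. unfold Rdiv. rewrite Rmult_assoc, Rinv_l; lra. }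
  assert (Hsg : sg = 1 \/ sg = -1) by (destruct Hside as [[-> _]|[-> _]]; auto).
  assert (main : forall x s, w x s t1 <= M + eta * (t2 - t1) + Cb * (t2 - t1 - om E t1 t2)).
  2: { intros x s. specialize (main x s). unfold w in main. now rewrite Hi1 in main. }
  apply (sup_decrease w); trivial.
  (* Clamping time to [[0, T]] extends [u] to a function continuous at all times, so that the rules
     for [cont3] apply. *)
  - set (cl := fun t => Rmax 0 (Rmin T t)).
    assert (Hcl : forall t, 0 <= cl t <= T).
    { intros t. unfold cl. split; [apply Rmax_l|]. apply Rmax_lub; [lra|apply Rmin_l]. }
    assert (Hclx : forall t, 0 <= t <= T -> cl t = t).
    { intros t Ht. unfold cl. rewrite Rmin_right, Rmax_right; lra. }
    assert (Hcl1 : forall t t', Rabs (cl t' - cl t) <= Rabs (t' - t)).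
    { intros t t'. unfold cl. apply Rle_trans with (Rabs (Rmin T t' - Rmin T t)).
      - generalize (Rmin T t') (Rmin T t). intros p q. unfold Rmax. destruct (Rle_dec 0 p), (Rle_dec 0 q); unfold Rabs;
          repeat match goal with |- context [Rcase_abs ?p] => destruct (Rcase_abs p) end; lra.
      - unfold Rmin. destruct (Rle_dec T t'), (Rle_dec T t); unfold Rabs;
          repeat match goal with |- context [Rcase_abs ?p] => destruct (Rcase_abs p) end; lra. }
    assert (Cexp : forall x, continuous exp x).
    { intros x. apply (ex_derive_continuous exp). eexists. apply is_derive_exp. }
    assert (Cu : forall x s t, cont3 (fun x s t => u (exp x) s (cl t)) x s t).
    { intros x s t. apply cont3_of_eps. intros eps He.
      destruct (Hu (exp x) s (cl t) (exp_pos x) (Hcl t) eps He) as [d [Hd Hs]].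
      destruct (Cexp x (ball (exp x) (mkposreal d Hd)) (locally_ball _ _)) as [d' Hd'].
      exists (Rmin d d'). split; [apply Rmin_pos; [trivial|apply cond_pos]|].
      intros x' s' t' H1 H2 H3. pose proof (Rmin_l d d'). pose proof (Rmin_r d d').
      apply Hs; auto using exp_pos; try lra.
      - apply (Hd' x'). change (Rabs (x' - x) < d'). lra.
      - apply Rle_lt_trans with (1 := Hcl1 t t'). lra. }
    assert (Cw : forall x s t, cont3 (fun x s t => sg * (exp (r * (T - t)) * u (exp x) s (cl t)
        + - interp f g t2 (t2 - t1) 0 0 x s t) + - chi kap Lam T n (exp x) s t) x s t).
    { intros x s t. apply cont3_plus; [apply cont3_mult; [apply cont3_const|]; apply cont3_plus; [apply cont3_mult|]|].
      - apply (cont3_3 (fun t => exp (r * (T - t)))). apply (ex_derive_continuous (fun t => exp (r * (T - t)))). auto_derive. trivial.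
      - apply Cu.
      - apply (continuous_opp (fun p : R * R * R => interp f g t2 (t2 - t1) 0 0 (fst (fst p)) (snd (fst p)) (snd p))).
        apply (cont3_plus (fun x s _ => f 0%nat 0%nat x s) (fun x s t => (t2 - t) / (t2 - t1) * (g 0%nat 0%nat x s - f 0%nat 0%nat x s))).
        + apply (cont3_12 (f 0%nat 0%nat) (fun x => x)); [apply continuous_id|apply Hf; lia].
        + apply (cont3_mult (fun _ _ t => (t2 - t) / (t2 - t1)) (fun x s _ => g 0%nat 0%nat x s - f 0%nat 0%nat x s)).
          * apply (cont3_3 (fun t => (t2 - t) / (t2 - t1))). apply (ex_derive_continuous (fun t => (t2 - t) / (t2 - t1))). auto_derive. lra.
          * apply (continuous_minus (fun p : R * R * R => g 0%nat 0%nat (fst (fst p)) (snd (fst p))) (fun p => f 0%nat 0%nat (fst (fst p)) (snd (fst p)))).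
            -- apply (cont3_12 (g 0%nat 0%nat) (fun x => x)); [apply continuous_id|apply Hg; lia].
            -- apply (cont3_12 (f 0%nat 0%nat) (fun x => x)); [apply continuous_id|apply Hf; lia].
      - apply (continuous_opp (fun p : R * R * R => chi kap Lam T n (exp (fst (fst p))) (snd (fst p)) (snd p))).
        unfold chi. apply (cont3_mult (fun _ _ t => kap * exp (Lam * (T - t))) (fun x s _ => exp x + / exp x + bar n s)).
        + apply (cont3_3 (fun t => kap * exp (Lam * (T - t)))). apply (ex_derive_continuous (fun t => kap * exp (Lam * (T - t)))). auto_derive. trivial.
        + apply (cont3_plus (fun x _ _ => exp x + / exp x) (fun _ s _ => bar n s)).
          * apply (cont3_1 (fun x => exp x + / exp x)). apply (ex_derive_continuous (fun x => exp x + / exp x)).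
            auto_derive. pose proof (exp_pos x). lra.
          * apply (cont3_2 (bar n)). apply (ex_derive_continuous (bar n)). exists (bar1 n s). exact (proj1 (is_derive_bar n s)). }
    intros x s t Ht eps He. destruct (cont3_eps _ x s t (Cw x s t) eps He) as [d [Hd Hs]].
    exists d. split; trivial. intros x' s' t' Ht' H1 H2 H3. specialize (Hs x' s' t' H1 H2 H3).
    rewrite !Hclx in Hs by lra. exact Hs.
  - intros c. destruct Hgr as [A HA].
    destruct (barrier_growth n kap (exp (Rabs r * T)) (exp (Rabs r * T) + 3 * B) c Hkap) as [A' HA'].
    { apply Rlt_le, exp_pos. }
    exists (Rmax A A'). intros x s t Ht Hl. pose proof (Rmax_l A A'). pose proof (Rmax_r A A').
    specialize (HA' x s ltac:(lra)). specialize (HA (exp x) s t (exp_pos x) ltac:(lra)).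
    rewrite ln_exp in HA. specialize (HA ltac:(lra)).
    set (l := Rabs x + Rabs s) in *.
    assert (He : 0 <= exp (r * (T - t)) <= exp (Rabs r * T)).
    { split; [apply Rlt_le, exp_pos|]. destruct (Rle_lt_or_eq_dec (r * (T - t)) (Rabs r * T)) as [Hlt|Heq].
      - apply Rle_trans with (1 := Rle_abs _). rewrite Rabs_mult, (Rabs_pos_eq (T - t)) by lra.
        apply Rmult_le_compat_l; [apply Rabs_pos|lra].
      - left. now apply exp_increasing.
      - right. now rewrite Heq. }
    assert (HU : Rabs (exp (r * (T - t)) * u (exp x) s t) <= exp (Rabs r * T) * (1 + l ^ n)).
    { apply Rabs_mul_le; trivial. rewrite Rabs_pos_eq; lra. }
    assert (HI : Rabs (interp f g t2 (t2 - t1) 0 0 x s t) <= B + 1 * (B + B)).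
    { unfold interp. apply Rabs_add_le; [apply HfB|]. apply Rabs_mul_le; [|apply Rabs_sub_le; [apply HgB|apply HfB]].
      specialize (Hth t Ht). rewrite Rabs_pos_eq; lra. }
    assert (HCh : kap * (exp x + / exp x + bar n s) <= chi kap Lam T n (exp x) s t).
    { unfold chi. apply Rmult_le_compat_r.
      - pose proof (exp_pos x). assert (0 < / exp x) by (apply Rinv_0_lt_compat; trivial).
        pose proof (proj1 (bar_bounds n s)). pose proof (pow2_ge_0 s). lra.
      - rewrite <- (Rmult_1_r kap) at 1. apply Rmult_le_compat_l; [lra|]. rewrite <- exp_0.
        assert (0 <= Lam * (T - t)) by (apply Rmult_le_pos; lra).
        destruct (Req_dec (Lam * (T - t)) 0) as [->|]; [lra|]. left. apply exp_increasing. lra. }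
    unfold w. apply Rabs_le_between in HU, HI. pose proof (exp_pos (Rabs r * T)).
    destruct Hsg as [-> | ->]; lra.
  - intros x0 s0 t0 z z1 Ht0 Hz Hz1 [d [Hd Hmax]].
    destruct (Herr x0 s0 t0 Ht0) as [He1 He2].
    assert (Hgoal : - z1 t0 <= Rabs (- ((g 0%nat 0%nat x0 s0 - f 0%nat 0%nat x0 s0) / (t2 - t1))
       + ((r - / 2 * beta s0 ^ 2) * interp f g t2 (t2 - t1) 1 0 x0 s0 t0
          + gam r mu rho alpha beta a b s0 t0 * interp f g t2 (t2 - t1) 0 1 x0 s0 t0
          + / 2 * beta s0 ^ 2 * interp f g t2 (t2 - t1) 2 0 x0 s0 t0
          + rho * beta s0 * b s0 t0 * interp f g t2 (t2 - t1) 1 1 x0 s0 t0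
          + / 2 * b s0 t0 ^ 2 * interp f g t2 (t2 - t1) 0 2 x0 s0 t0)) + 2 * C0 * m - kap * (1 + s0 ^ 2)).
    { pose proof (side_touch sg T r mu rho alpha beta a b C0 H u f g t2 (t2 - t1) kap Lam n z z1
        (w x0 s0 t0 - z t0) m (exp x0) s0 t0 HH HC0 Hside Hh Hf Hg ltac:(lra) Hz Hz1 (exp_pos x0) ltac:(lra)) as V.
      cbv zeta in V. rewrite !ln_exp in V.
      assert (V' := V ltac:(apply affine_ge; auto; apply Hth; lra)
        ltac:(unfold w; reflexivity)).
      clear V. lapply V'; [clear V'; intros V|].
      - rewrite (Rabs_pos_eq m) in V by trivial.
        pose proof (barrier_bound r (beta s0) (b s0 t0) (gam r mu rho alpha beta a b s0 t0) Kc Kg C0 Lam n (exp x0) s0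
          (exp_pos x0) HC0 (Hbeta s0) (Hb s0 t0 ltac:(lra)) (Hgam s0 t0 ltac:(lra)) HKg HLam) as BB.
        set (e := kap * exp (Lam * (T - t0))) in *.
        assert (He : kap <= e).
        { unfold e. rewrite <- (Rmult_1_r kap) at 1. apply Rmult_le_compat_l; [lra|]. rewrite <- exp_0.
          assert (0 <= Lam * (T - t0)) by (apply Rmult_le_pos; lra).
          destruct (Req_dec (Lam * (T - t0)) 0) as [->|]; [lra|]. left. apply exp_increasing. lra. }
        apply (Rmult_le_compat_l e) in BB; [|lra].
        assert (kap * (1 + s0 ^ 2) <= e * (1 + s0 ^ 2)) by (apply Rmult_le_compat_r; [pose proof (pow2_ge_0 s0)|]; lra).
        lra.
      - exists (Rmin d (Rmin (t0 - t1) (t2 - t0))). split; [repeat apply Rmin_pos; lra|].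
        intros S s t HS Ht _ _ Htd.
        pose proof (Rmin_l d (Rmin (t0 - t1) (t2 - t0))). pose proof (Rmin_r d (Rmin (t0 - t1) (t2 - t0))).
        pose proof (Rmin_l (t0 - t1) (t2 - t0)). pose proof (Rmin_r (t0 - t1) (t2 - t0)).
        assert (Htt : t1 < t < t2) by (apply Rabs_def2 in Htd; lra).
        specialize (Hmax (ln S) s t Htt ltac:(lra)). unfold w in Hmax at 1. rewrite exp_ln in Hmax by trivial.
        exact Hmax. }
    cbv zeta in He1, He2. split; [lra|]. intros HE. specialize (He2 HE). lra.
  - intros x s. unfold w. rewrite Hi2. apply Hend.
Qed.

(** * Backward induction along a tagged partition *)

(** The residual consists of the consistency error [A1], the error [A2] of replacing the
    coefficients, and the error [A3] of taking derivatives between two time levels. [A1] and [A3]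
    are [O(k)], with the factor [1 + |s|] due to the growth of the drift [c]. *)
Lemma err_bound r rho be bb ga k f L N N1 N2 Kc Kg B b c d1 d2 d3 t2 x s t :
  -1 <= rho <= 1 -> smooth_coef be -> smooth_coef bb -> smooth_coef ga ->
  0 < k <= 1 -> smooth3 f -> 1 <= L ->
  lev r be bb ga 0 L -> lev r be bb ga 1 L -> lev r be bb ga 2 L -> jet_bd f N ->
  bd1 f N1 -> bd2 f N2 -> 0 <= N1 -> 0 <= N2 ->
  Rabs B <= Kc -> Rabs b <= Kc -> Rabs (be 0%nat s) <= Kc -> Rabs (bb 0%nat s) <= Kc ->
  0 <= Kg -> Rabs c <= Kg * (1 + Rabs s) ->
  Rabs (be 0%nat s - B) <= d1 -> Rabs (bb 0%nat s - b) <= d2 -> Rabs (ga 0%nat s - c) <= d3 ->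
  t2 - k ^ 2 <= t <= t2 ->
  let g := walk r rho be bb ga k f in
  let D i j := interp f g t2 (k ^ 2) i j x s t in
  Rabs (- ((g 0%nat 0%nat x s - f 0%nat 0%nat x s) / k ^ 2)
       + ((r - / 2 * B ^ 2) * D 1%nat 0%nat + c * D 0%nat 1%nat + / 2 * B ^ 2 * D 2%nat 0%nat
          + rho * B * b * D 1%nat 1%nat + / 2 * b ^ 2 * D 0%nat 2%nat))
  <= k * ((200 * L ^ 3 * N + 40 * L ^ 2 * N * (Rabs r + 3 * Kc ^ 2 + Kg)) * (1 + Rabs s))
     + N1 * (Kc * d1 + d3) + N2 * (2 * Kc * (d1 + d2)).
Proof.
  intros Hrho Hbe Hbb Hga Hk Hf HL H0 H1 H2 HN F1 F2 HN1 HN2 HB Hb Hbe0 Hbb0 HKg Hc Hd1 Hd2 Hd3 Ht g D.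
  assert (Hk' : 0 <= k <= 1) by lra. assert (Hk2 : 0 < k ^ 2) by (apply pow_lt; lra).
  assert (HN0 : 0 <= N) by (eapply Rle_trans; [apply Rabs_pos|apply (HN 1%nat 0%nat 0 0); lia]).
  assert (HKc : 0 <= Kc) by (eapply Rle_trans; [apply Rabs_pos|exact HB]).
  destruct (bd1_entries f N1 F1) as [F10 F01]. destruct (bd2_entries f N2 F2) as [F20 [F11 F02]].
  set (th := (t2 - t) / k ^ 2).
  assert (Hth : 0 <= th <= 1).
  { unfold th. split; [apply Rmult_le_pos; [lra|apply Rlt_le, Rinv_0_lt_compat; lra]|].
    apply Rmult_le_reg_r with (k ^ 2); [lra|]. unfold Rdiv. rewrite Rmult_assoc, Rinv_l; lra. }
  set (W := k * (40 * L ^ 2 * N)).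
  assert (HW : 0 <= W) by (apply Rmult_le_pos; [lra|]; apply Rmult_le_pos; [pose proof (pow2_ge_0 L)|]; lra).
  assert (HD : forall i j, (i + j <= 2)%nat -> (1 <= i + j)%nat -> Rabs (th * (g i j x s - f i j x s)) <= W).
  { intros i j Hij Hij1. rewrite <- (Rmult_1_l W). apply Rabs_mul_le; [rewrite Rabs_pos_eq; lra|].
    apply (walk_close r rho be bb ga Hrho k Hk' f i j L N x s); trivial. }
  pose proof (walk_consistent r rho be bb ga Hrho k Hk' f L N x s Hf HL H0 HN) as HC.
  fold g in HC.
  set (f10 := f 1%nat 0%nat x s) in *. set (f01 := f 0%nat 1%nat x s) in *.
  set (f20 := f 2%nat 0%nat x s) in *. set (f11 := f 1%nat 1%nat x s) in *. set (f02 := f 0%nat 2%nat x s) in *.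
  set (e10 := th * (g 1%nat 0%nat x s - f10)). set (e01 := th * (g 0%nat 1%nat x s - f01)).
  set (e20 := th * (g 2%nat 0%nat x s - f20)). set (e11 := th * (g 1%nat 1%nat x s - f11)).
  set (e02 := th * (g 0%nat 2%nat x s - f02)).
  set (B' := be 0%nat s) in *. set (b' := bb 0%nat s) in *. set (c' := ga 0%nat s) in *.
  set (A1 := (g 0%nat 0%nat x s - f 0%nat 0%nat x s - k ^ 2 * gen r rho be bb ga f x s) / k ^ 2).
  set (A2 := - (/ 2 * ((B - B') * (B + B'))) * f10 + (c - c') * f01 + / 2 * ((B - B') * (B + B')) * f20
     + rho * ((B - B') * b + B' * (b - b')) * f11 + / 2 * ((b - b') * (b + b')) * f02).
  set (A3 := (r - / 2 * B ^ 2) * e10 + c * e01 + / 2 * B ^ 2 * e20 + rho * B * b * e11 + / 2 * b ^ 2 * e02).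
  assert (E : - ((g 0%nat 0%nat x s - f 0%nat 0%nat x s) / k ^ 2)
       + ((r - / 2 * B ^ 2) * D 1%nat 0%nat + c * D 0%nat 1%nat + / 2 * B ^ 2 * D 2%nat 0%nat
          + rho * B * b * D 1%nat 1%nat + / 2 * b ^ 2 * D 0%nat 2%nat) = - A1 + A2 + A3).
  { unfold A1, A2, A3, D, interp, gen, e10, e01, e20, e11, e02. fold th f10 f01 f20 f11 f02 B' b' c'. field. lra. }
  rewrite E. clear E.
  assert (T1 : Rabs (- A1) <= k * (200 * L ^ 3 * N)).
  { rewrite Rabs_Ropp. unfold A1. rewrite Rabs_div, (Rabs_pos_eq (k ^ 2)) by lra.
    apply Rmult_le_reg_r with (k ^ 2); [lra|]. unfold Rdiv. rewrite Rmult_assoc, Rinv_l, Rmult_1_r by lra.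
    apply Rle_trans with (1 := HC). apply Req_le. ring. }
  rewrite <- Rabs_Ropp in Hd1, Hd2, Hd3.
  replace (- (B' - B)) with (B - B') in Hd1 by ring. replace (- (b' - b)) with (b - b') in Hd2 by ring.
  replace (- (c' - c)) with (c - c') in Hd3 by ring.
  assert (Hhalf : Rabs (/ 2) <= / 2) by (rewrite Rabs_pos_eq; lra).
  assert (Hr1 : Rabs rho <= 1) by (apply Rabs_le_between; lra).
  assert (HBB : Rabs (/ 2 * ((B - B') * (B + B'))) <= Kc * d1).
  { replace (Kc * d1) with (/ 2 * (d1 * (Kc + Kc))) by field. apply Rabs_mul_le; trivial.
    apply Rabs_mul_le; trivial. now apply Rabs_add_le. }
  assert (Hbb' : Rabs (/ 2 * ((b - b') * (b + b'))) <= Kc * d2).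
  { replace (Kc * d2) with (/ 2 * (d2 * (Kc + Kc))) by field. apply Rabs_mul_le; trivial.
    apply Rabs_mul_le; trivial. now apply Rabs_add_le. }
  assert (T2 : Rabs A2 <= Kc * d1 * N1 + d3 * N1 + Kc * d1 * N2 + 1 * (d1 * Kc + Kc * d2) * N2 + Kc * d2 * N2).
  { unfold A2. apply Rabs_add_le; [apply Rabs_add_le; [apply Rabs_add_le; [apply Rabs_add_le|]|]|].
    - apply Rabs_mul_le; [rewrite Rabs_Ropp; trivial|apply F10].
    - apply Rabs_mul_le; [trivial|apply F01].
    - apply Rabs_mul_le; [trivial|apply F20].
    - apply Rabs_mul_le; [|apply F11]. apply Rabs_mul_le; trivial. apply Rabs_add_le; now apply Rabs_mul_le.
    - apply Rabs_mul_le; [trivial|apply F02]. }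
  assert (sq : forall p, Rabs p <= Kc -> Rabs (p ^ 2) <= Kc ^ 2).
  { intros p Hp. rewrite <- RPow_abs. apply pow_incr. split; [apply Rabs_pos|trivial]. }
  assert (T3 : Rabs A3 <= (Rabs r + / 2 * Kc ^ 2) * W + Kg * (1 + Rabs s) * W + / 2 * Kc ^ 2 * W + 1 * Kc * Kc * W + / 2 * Kc ^ 2 * W).
  { unfold A3. apply Rabs_add_le; [apply Rabs_add_le; [apply Rabs_add_le; [apply Rabs_add_le|]|]|];
      (apply Rabs_mul_le; [|apply HD; lia]).
    - apply Rabs_sub_le; [lra|]. apply Rabs_mul_le; auto.
    - trivial.
    - apply Rabs_mul_le; auto.
    - apply Rabs_mul_le; trivial. now apply Rabs_mul_le.
    - apply Rabs_mul_le; auto. }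
  pose proof (Rabs_pos s) as Hs. pose proof (Rabs_pos r) as Hr.
  assert (Q1 : (Rabs r + / 2 * Kc ^ 2) * W + Kg * (1 + Rabs s) * W + / 2 * Kc ^ 2 * W + 1 * Kc * Kc * W + / 2 * Kc ^ 2 * W
     <= (Rabs r + 3 * Kc ^ 2 + Kg) * (1 + Rabs s) * W).
  { rewrite <- !Rmult_plus_distr_r. apply Rmult_le_compat_r; trivial.
    pose proof (pow2_ge_0 Kc). assert (0 <= Rabs r * Rabs s) by (apply Rmult_le_pos; trivial).
    assert (0 <= Kc ^ 2 * Rabs s) by (apply Rmult_le_pos; trivial). lra. }
  assert (HLN : 0 <= k * (200 * L ^ 3 * N) * Rabs s).
  { repeat apply Rmult_le_pos; trivial; try lra; apply pow_le; lra. }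
  pose proof (Rabs_add_le _ _ _ _ (Rabs_add_le _ _ _ _ T1 T2) T3) as T.
  unfold W in *. lra.
Qed.

(** * Finitely many classes of times *)

Lemma floor_code (g : R -> R) M eta : 0 < eta -> (forall t, 0 <= g t <= M) ->
  exists N code, (forall t, (code t < N)%nat) /\
    forall t t', code t = code t' -> Rabs (g t - g t') <= eta.
Proof.
  intros He Hg.
  assert (Hpos : forall t, 0 <= g t / eta) by (intros t; apply Rmult_le_pos; [apply Hg|apply Rlt_le, Rinv_0_lt_compat; trivial]).
  destruct (choice (fun t n => INR n <= g t / eta < INR n + 1)) as [code Hcode].
  { intros t. destruct (nfloor_ex (g t / eta) (Hpos t)) as [n Hn]. now exists n. }
  assert (HM : 0 <= M / eta).
  { apply Rmult_le_pos; [specialize (Hg 0); lra|apply Rlt_le, Rinv_0_lt_compat; trivial]. }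
  destruct (nfloor_ex (M / eta) HM) as [N HN]. exists (S N), code. split.
  - intros t. apply INR_lt. rewrite S_INR. specialize (Hcode t).
    assert (g t / eta <= M / eta); [|lra].
    apply Rmult_le_compat_r; [apply Rlt_le, Rinv_0_lt_compat; trivial|apply Hg].
  - intros t t' E. pose proof (Hcode t) as A. pose proof (Hcode t') as B. rewrite E in A.
    replace (g t - g t') with (eta * (g t / eta - g t' / eta)) by (field; lra).
    apply Rle_trans with (eta * 1); [|lra]. apply Rabs_mul_le; [rewrite Rabs_pos_eq; lra|].
    apply Rabs_le_between. lra.
Qed.

Lemma pair_code (N N' : nat) (c c' : R -> nat) : (forall t, (c t < N)%nat) -> (forall t, (c' t < N')%nat) ->
  exists M code, (forall t, (code t < M)%nat) /\ forall t t', code t = code t' -> c t = c t' /\ c' t = c' t'.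
Proof.
  intros H H'. exists (N * N')%nat, (fun t => (c t * N' + c' t)%nat). split.
  - intros t. specialize (H t). specialize (H' t). nia.
  - intros t t' E. pose proof (H' t) as A. pose proof (H' t') as B.
    assert (c t = c t').
    { destruct (Nat.lt_trichotomy (c t) (c t')) as [Hl|[He|Hl]]; trivial; exfalso; nia. }
    split; trivial. nia.
Qed.

(* Total boundedness of an equi-Lipschitz family on [-R, R], by rounding the
   values on a grid. *)
Lemma family_code (F : R -> R -> R) T L R0 eta : 0 < eta -> 0 <= L -> 0 < R0 -> 0 <= T ->
  (exists M, forall s t, Rabs s <= R0 -> 0 <= t <= T -> Rabs (F s t) <= M) ->
  (forall s s' t, 0 <= t <= T -> Rabs (F s t - F s' t) <= L * Rabs (s - s')) ->
  exists N code, (forall t, (code t < N)%nat) /\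
    forall t t', 0 <= t <= T -> 0 <= t' <= T -> code t = code t' ->
      forall s, Rabs s <= R0 -> Rabs (F s t - F s t') <= eta.
Proof.
  intros He HL HR HT [M HM] HF.
  set (st := eta / (4 * (L + 1))). assert (Hst : 0 < st) by (apply Rdiv_lt_0_compat; lra).
  assert (HLst : L * st <= eta / 4).
  { apply Rle_trans with ((L + 1) * st); [apply Rmult_le_compat_r; lra|]. apply Req_le. unfold st. field. lra. }
  set (cl := fun t => Rmax 0 (Rmin T t)).
  assert (Hcl : forall t, 0 <= cl t <= T).
  { intros t. unfold cl. split; [apply Rmax_l|]. apply Rmax_lub; [lra|apply Rmin_l]. }
  assert (Hclx : forall t, 0 <= t <= T -> cl t = t).
  { intros t Ht. unfold cl. rewrite Rmin_right, Rmax_right; lra. }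
  set (p := fun i : nat => Rmin R0 (- R0 + INR i * st)).
  assert (Hp : forall i, Rabs (p i) <= R0).
  { intros i. apply Rabs_le_between. unfold p. split; [|apply Rmin_l].
    apply Rmin_glb; [lra|]. pose proof (pos_INR i). assert (0 <= INR i * st) by (apply Rmult_le_pos; lra). lra. }
  assert (HM0 : 0 <= M) by (eapply Rle_trans; [apply Rabs_pos|apply (HM 0 0); [rewrite Rabs_R0; lra|lra]]).
  assert (Hgrid : forall n, exists N code, (forall t, (code t < N)%nat) /\
    forall t t', code t = code t' -> forall i, (i < n)%nat -> Rabs (F (p i) (cl t) - F (p i) (cl t')) <= eta / 2).
  { induction n as [|n [N [code [H1 H2]]]].
    - exists 1%nat, (fun _ => 0%nat). split; [lia|]. intros t t' _ i Hi. lia.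
    - destruct (floor_code (fun t => F (p n) (cl t) + M) (2 * M) (eta / 2) ltac:(lra)) as [N' [code' [H1' H2']]].
      { intros t. pose proof (HM (p n) (cl t) (Hp n) (Hcl t)) as A. apply Rabs_le_between in A. lra. }
      destruct (pair_code N N' code code' H1 H1') as [Q [cc [HQ Hcc]]].
      exists Q, cc. split; trivial. intros t t' E i Hi. destruct (Hcc t t' E) as [E1 E2].
      destruct (Nat.eq_dec i n) as [->|Hn].
      + specialize (H2' t t' E2). simpl in H2'.
        replace (F (p n) (cl t) - F (p n) (cl t')) with (F (p n) (cl t) + M - (F (p n) (cl t') + M)) by ring. exact H2'.
      + apply H2; trivial; lia. }
  destruct (nfloor_ex (2 * R0 / st)) as [n Hn]; [apply Rlt_le, Rdiv_lt_0_compat; lra|].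
  destruct (Hgrid (S n)) as [N [code [H1 H2]]]. exists N, code. split; trivial.
  intros t t' Ht Ht' E s Hs. apply Rabs_le_between in Hs.
  destruct (nfloor_ex ((s + R0) / st)) as [i Hi].
  { apply Rmult_le_pos; [lra|apply Rlt_le, Rinv_0_lt_compat; trivial]. }
  assert (Hin : (i < S n)%nat).
  { apply INR_lt. rewrite S_INR. assert ((s + R0) / st <= 2 * R0 / st); [|lra].
    apply Rmult_le_compat_r; [apply Rlt_le, Rinv_0_lt_compat; trivial|lra]. }
  assert (Hi1 : INR i * st <= s + R0 < (INR i + 1) * st).
  { replace (s + R0) with ((s + R0) / st * st) by (field; lra). split.
    - apply Rmult_le_compat_r; lra.
    - apply Rmult_lt_compat_r; lra. }
  assert (Hsp : Rabs (s - p i) <= st).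
  { unfold p. rewrite Rmin_right by lra. rewrite Rabs_pos_eq; lra. }
  specialize (H2 t t' E i Hin). rewrite !Hclx in H2 by trivial.
  pose proof (HF s (p i) t Ht) as A. pose proof (HF s (p i) t' Ht') as B.
  assert (C : L * Rabs (s - p i) <= L * st) by (apply Rmult_le_compat_l; trivial).
  apply Rabs_le_between in A, B, H2. apply Rabs_le_between. lra.
Qed.

(** * Invariants of the induction *)

Lemma bd1_le f N N' : bd1 f N -> N <= N' -> bd1 f N'.
Proof. intros H HN x s u v. eapply Rle_trans; [apply H|]. apply Rmult_le_compat_r; trivial. apply en_pos. Qed.

Lemma bd2_le f N N' : bd2 f N -> N <= N' -> bd2 f N'.
Proof. intros H HN x s u v. eapply Rle_trans; [apply H|]. apply Rmult_le_compat_r; trivial. apply pow2_ge_0. Qed.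

Lemma bd3_le f N N' : bd3 f N -> N <= N' -> bd3 f N'.
Proof. intros H HN x s u v. eapply Rle_trans; [apply H|]. apply Rmult_le_compat_r; trivial. apply pow_le, en_pos. Qed.

Lemma lev_le r be bb ga n L L' : lev r be bb ga n L -> L <= L' -> lev r be bb ga n L'.
Proof. intros H HL z Hz s. destruct (H z Hz s) as [? [? [? ?]]]. repeat split; lra. Qed.

Lemma lev_odd_le be bb L L' : lev_odd be bb L -> L <= L' -> lev_odd be bb L'.
Proof. intros H HL z Hz s. destruct (H z Hz s) as [? ?]. split; lra. Qed.

Lemma mul3_pos x y z : 0 <= x -> 0 <= y -> 0 <= z -> 0 <= x * y * z.
Proof. intros. apply Rmult_le_pos; [apply Rmult_le_pos|]; trivial. Qed.

Lemma exp_le_compat x y : x <= y -> exp x <= exp y.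
Proof. intros [H|H]; [left; now apply exp_increasing|right; now rewrite H]. Qed.

Lemma gronwall_step N c T x y : 0 <= N -> x <= y ->
  N * exp (c * (T - y)) * (1 + c * (y - x)) <= N * exp (c * (T - x)).
Proof.
  intros HN Hxy. replace (c * (T - x)) with (c * (T - y) + c * (y - x)) by ring.
  rewrite exp_plus, <- Rmult_assoc. apply Rmult_le_compat_l.
  - apply Rmult_le_pos; [trivial|apply Rlt_le, exp_pos].
  - pose proof (exp_ineq1_le (c * (y - x))). lra.
Qed.

(** Each order has its own constant because they are fixed at different stages. [L0], which bounds
    the displacements including the truncated drift, does not enter the growth rates of the
    derivatives. *)
Definition coef_ok (r : R) (be bb ga : nat -> R -> R) (K1 L0 L1 L2 L3 : R) : Prop :=
  smooth_coef be /\ smooth_coef bb /\ smooth_coef ga /\ lev_odd be bb L1 /\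
  lev r be bb ga 0 L0 /\ lev r be bb ga 1 L1 /\ lev r be bb ga 2 L2 /\ lev r be bb ga 3 L3 /\
  forall s, 0 <= be 0%nat s <= K1 /\ 0 <= be 1%nat s <= K1 /\ Rabs (bb 0%nat s) <= K1 /\
    Rabs (bb 1%nat s) <= K1 /\ Rabs (ga 1%nat s) <= K1.

Section Chain.
Variables T r mu rho alpha : R.
Variable beta : R -> R.
Variables a b : R -> R -> R.
Variable g0 : R -> R.
Variable C0 : R.
Variable n : nat.
Variable be : nat -> R -> R.
Variables bbt gat : R -> nat -> R -> R.
Variable code : R -> nat.
Variables K1 Kg L0 L1 L2 L3 N0 kap Lam eps eta0 eta Cb0 Cb h : R.

Definition solution_side (sg : R) (u : R -> R -> R -> R) : Prop :=
  exists H, near_linear T r mu rho alpha beta a b C0 H /\ visc_side sg T H u /\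
    cont_on_dom T u /\ poly_growth T u n /\ forall S s, 0 < S -> u S s T = g0 S.

Let c1 := 4 * L1 ^ 2.
Let c2 := 20 * L2 ^ 2.
Let c3 := 400 * L3 ^ 4.
Let N1 := N0 * exp (c1 * T).
Let N2 := N0 * exp (c2 * T).
Let N3 := N0 * exp (c3 * T).
Let C5 := 60 * K1 ^ 5 * (2 * N3).
Let C6 := 200 * L0 ^ 3 * (2 * N3) + 40 * L0 ^ 2 * (2 * N3) * (Rabs r + 3 * K1 ^ 2 + Kg).
(** A step of time length [k ^ 2] worsens the lower bound on the sigma derivative by at most
    [k ^ 3 * C5], hence by [sqrt h * C5] per unit of time, apart from the exponential factor. *)
Let mb := sqrt h * C5 * T * exp (K1 * T).

Hypothesis HT : 0 < T.
Hypothesis Hrho : -1 <= rho <= 1.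
Hypothesis HC0 : 0 <= C0.
Hypothesis HK1 : 1 <= K1.
Hypothesis HKg : 0 <= Kg.
Hypothesis HL1 : 1 <= L1.
Hypothesis HL12 : L1 <= L2.
Hypothesis HL23 : L2 <= L3.
Hypothesis HL20 : L2 <= L0.
Hypothesis HN0 : 0 <= N0.
Hypothesis Hcoef : forall tag, 0 <= tag <= T -> coef_ok r be (bbt tag) (gat tag) K1 L0 L1 L2 L3.
Hypothesis Hbeta : forall s, Rabs (beta s) <= K1.
Hypothesis Hb : forall s t, 0 <= t <= T -> Rabs (b s t) <= K1.
Hypothesis Hgam : forall s t, 0 <= t <= T -> Rabs (gam r mu rho alpha beta a b s t) <= Kg * (1 + Rabs s).
Hypothesis Herr : forall tag t s, 0 <= tag <= T -> 0 <= t <= T ->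
  exists d1 d2 d3, Rabs (be 0%nat s - beta s) <= d1 /\ Rabs (bbt tag 0%nat s - b s t) <= d2 /\
    Rabs (gat tag 0%nat s - gam r mu rho alpha beta a b s t) <= d3 /\
    N1 * (K1 * d1 + d3) + N2 * (2 * K1 * (d1 + d2)) <= Cb0 + kap / 2 * (1 + s ^ 2) /\
    (code t = code tag -> N1 * (K1 * d1 + d3) + N2 * (2 * K1 * (d1 + d2)) <= eta0 + kap / 2 * (1 + s ^ 2)).
Hypothesis Hkap : 0 < kap.
Hypothesis HLam : Rabs r + K1 ^ 2 + 4 * Kg * (INR n + 2) + 3 * (INR n + 2) ^ 2 * K1 ^ 2 + 4 * C0 * (INR n + 2) + 1 <= Lam.
Hypothesis Hh : 0 < h <= 1.
Hypothesis HhK : 3 * K1 ^ 2 * sqrt h <= 1.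
Hypothesis HhC : sqrt h * (4 * C6) <= kap.
Hypothesis HCb : Cb0 + 2 * C0 * mb <= Cb.
Hypothesis HCb1 : 0 < Cb.
Hypothesis Heta : eta0 + 2 * C0 * mb <= eta.
Hypothesis Heta1 : 0 <= eta.

(* [d] bounds the measure of the times after [x] at which the coefficients used
   by the walk are not those of the class of the current time. *)
Definition state (x d : R) (f : jet) : Prop :=
  smooth3 f /\ (forall y s, Rabs (f 0%nat 0%nat y s) <= N0) /\
  bd1 f (N0 * exp (c1 * (T - x))) /\ bd2 f (N0 * exp (c2 * (T - x))) /\ bd3 f (N0 * exp (c3 * (T - x))) /\
  (forall y s, 0 <= f 2%nat 0%nat y s - f 1%nat 0%nat y s) /\
  (forall y s, - (sqrt h * C5 * (T - x) * exp (K1 * (T - x))) <= f 0%nat 1%nat y s) /\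
  forall sg u, solution_side sg u -> forall y s,
    sg * (exp (r * (T - x)) * u (exp y) s x - f 0%nat 0%nat y s) - chi kap Lam T n (exp y) s x
      <= eps + eta * (T - x) + Cb * d.

(** With [k = sqrt (y - x)] a step of the walk takes the time [y - x], so growth factors
    [1 + c * k ^ 2] compose to exponentials. The comparison is [slab] with [E] the class of the tag,
    whose deficit is charged at the rate [Cb]. *)
Lemma chain_step x y tag d f : 0 <= x -> x < y -> y <= T -> y - x <= h -> x <= tag <= y ->
  state y d f ->
  state x (d + (y - x - om (fun t => code t = code tag) x y)) (walk r rho be (bbt tag) (gat tag) (sqrt (y - x)) f).
Proof.
  intros Hx Hxy HyT Hyh Htag [Hf [Hf0 [F1 [F2 [F3 [Hconv [Hmono Hcomp]]]]]]].
  destruct (Hcoef tag ltac:(lra)) as [Sbe [Sbb [Sga [V0 [W0 [W1 [W2 [W3 Hs1]]]]]]]].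
  set (k := sqrt (y - x)). set (g := walk r rho be (bbt tag) (gat tag) k f).
  assert (Hk2 : k ^ 2 = y - x) by (unfold k; rewrite pow2_sqrt; lra).
  assert (Hk0 : 0 < k) by (apply sqrt_lt_R0; lra).
  assert (Hkh : k <= sqrt h) by (apply sqrt_le_1_alt; lra).
  assert (Hh1 : sqrt h <= 1) by (rewrite <- sqrt_1; apply sqrt_le_1_alt; lra).
  assert (Hsh : 0 <= sqrt h) by apply sqrt_pos.
  assert (Hk : 0 <= k <= 1) by lra.
  assert (He : forall c t, 0 <= t -> 0 <= exp (c * t)) by (intros; apply Rlt_le, exp_pos).
  assert (Hc12 : c1 <= c2) by (unfold c1, c2; nra).
  assert (Hc1 : 0 <= c1) by (unfold c1; nra).
  assert (Hc23 : c2 <= c3).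
  { unfold c2, c3. assert (L2 ^ 2 <= L3 ^ 2) by (apply pow_incr; lra).
    assert (1 <= L3 ^ 2) by nra. replace (L3 ^ 4) with (L3 ^ 2 * L3 ^ 2) by ring. nra. }
  assert (HNx : forall c c' t t', 0 <= c <= c' -> 0 <= t <= t' -> N0 * exp (c * t) <= N0 * exp (c' * t')).
  { intros c c' t t' Hcc Htt. apply Rmult_le_compat_l; trivial. apply exp_le_compat. apply Rmult_le_compat; lra. }
  assert (HN3 : 0 <= N3) by (unfold N3; apply Rmult_le_pos; [trivial|apply Rlt_le, exp_pos]).
  assert (F1' : bd1 f N1) by (apply (bd1_le _ _ _ F1); unfold N1; apply HNx; lra).
  assert (F2' : bd2 f N2) by (apply (bd2_le _ _ _ F2); unfold N2; apply HNx; lra).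
  assert (F3' : bd3 f N3) by (apply (bd3_le _ _ _ F3); unfold N3; apply HNx; lra).
  assert (HN1 : 0 <= N1 <= N3).
  { unfold N1, N3. split; [apply Rmult_le_pos; [trivial|apply Rlt_le, exp_pos]|]. apply HNx; lra. }
  assert (HN2 : 0 <= N2 <= N3).
  { unfold N2, N3. split; [apply Rmult_le_pos; [trivial|apply Rlt_le, exp_pos]|]. apply HNx; lra. }
  assert (Hjet : jet_bd f (2 * N3)).
  { destruct (bd1_entries _ _ F1') as [E10 E01]. destruct (bd2_entries _ _ F2') as [E20 [E11 E02]].
    destruct (bd3_entries _ _ HN3 F3') as [E30 [E21 [E12 E03]]].
    intros i j y' s Hij1 Hij3.
    destruct i as [|[|[|[|i]]]]; destruct j as [|[|[|[|j]]]]; try lia;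
    match goal with
    | |- Rabs (f 1%nat 0%nat _ _) <= _ => specialize (E10 y' s)
    | |- Rabs (f 0%nat 1%nat _ _) <= _ => specialize (E01 y' s)
    | |- Rabs (f 2%nat 0%nat _ _) <= _ => specialize (E20 y' s)
    | |- Rabs (f 1%nat 1%nat _ _) <= _ => specialize (E11 y' s)
    | |- Rabs (f 0%nat 2%nat _ _) <= _ => specialize (E02 y' s)
    | |- Rabs (f 3%nat 0%nat _ _) <= _ => specialize (E30 y' s)
    | |- Rabs (f 2%nat 1%nat _ _) <= _ => specialize (E21 y' s)
    | |- Rabs (f 1%nat 2%nat _ _) <= _ => specialize (E12 y' s)
    | |- Rabs (f 0%nat 3%nat _ _) <= _ => specialize (E03 y' s)
    end; lra. }
  set (n1 := N0 * exp (c1 * (T - y))) in *. set (n2 := N0 * exp (c2 * (T - y))) in *. set (n3 := N0 * exp (c3 * (T - y))) in *.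
  assert (Hn1 : 0 <= n1) by (unfold n1; apply Rmult_le_pos; [trivial|apply Rlt_le, exp_pos]).
  assert (Hn12 : n1 <= n2) by (unfold n1, n2; apply HNx; lra).
  assert (Hn23 : n2 <= n3) by (unfold n2, n3; apply HNx; lra).
  assert (HC5 : 0 <= C5).
  { unfold C5. apply Rmult_le_pos; [|lra]. assert (0 <= K1 ^ 5) by (apply pow_le; lra). lra. }
  set (M := fun z => sqrt h * C5 * (T - z) * exp (K1 * (T - z))).
  assert (HM0 : forall z, z <= T -> 0 <= M z).
  { intros z Hz. unfold M. apply Rmult_le_pos; [apply mul3_pos; lra|apply Rlt_le, exp_pos]. }
  assert (HMmb : forall z, 0 <= z <= T -> M z <= mb).
  { intros z Hz. unfold M, mb. apply Rmult_le_compat.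
    - apply mul3_pos; lra.
    - apply Rlt_le, exp_pos.
    - apply Rmult_le_compat_l; [apply Rmult_le_pos; lra|lra].
    - apply exp_le_compat. apply Rmult_le_compat_l; lra. }
  assert (G0 : smooth3 g) by (apply walk_smooth3; trivial).
  assert (G1 : forall y' s, Rabs (g 0%nat 0%nat y' s) <= N0) by (apply walk_sup; trivial).
  assert (Gm : forall y' s, - M x <= g 0%nat 1%nat y' s).
  { intros y' s. destruct (Hs1 s) as [B0 [B1 [B2 [B3 B4]]]].
    pose proof (walk_mono r rho be (bbt tag) (gat tag) k f (M y) K1 (2 * N3) y' s Hrho ltac:(lra)
      ltac:(eapply Rle_trans; [|exact HhK]; apply Rmult_le_compat_l; [nra|trivial]) HK1 Hf Hjet B0 B1 B2 B3 B4 Hconv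
      (HM0 y HyT) Hmono) as W.
    apply Rle_trans with (2 := W). fold C5. replace (k ^ 3) with (k * k ^ 2) by ring. rewrite Hk2.
    assert (P1 : k * (y - x) * C5 <= sqrt h * (y - x) * C5).
    { apply Rmult_le_compat_r; trivial. apply Rmult_le_compat_r; lra. }
    assert (P2 : M y * (1 + K1 * (y - x)) <= sqrt h * C5 * (T - y) * exp (K1 * (T - x))).
    { apply (gronwall_step (sqrt h * C5 * (T - y)) K1 T x y); [|lra]. apply mul3_pos; lra. }
    assert (P3 : sqrt h * (y - x) * C5 * 1 <= sqrt h * (y - x) * C5 * exp (K1 * (T - x))).
    { apply Rmult_le_compat_l; [apply mul3_pos; lra|]. rewrite <- exp_0. apply exp_le_compat.
      apply Rmult_le_pos; lra. }
    unfold M at 1. lra. }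
  split; [exact G0|]. split; [exact G1|]. split; [|split; [|split; [|split; [|split]]]].
  - eapply bd1_le; [apply (walk_bd1 r rho be (bbt tag) (gat tag) Hrho k Hk f n1 L1); trivial|].
    rewrite Hk2. apply gronwall_step; lra.
  - eapply bd2_le; [apply (walk_bd2 r rho be (bbt tag) (gat tag) Hrho k Hk f n1 n2 L2); trivial; try lra|].
    + apply (lev_odd_le _ _ _ _ V0); trivial.
    + apply (lev_le _ _ _ _ _ _ _ W1); trivial.
    + rewrite Hk2. apply gronwall_step; lra.
  - eapply bd3_le; [apply (walk_bd3 r rho be (bbt tag) (gat tag) Hrho k Hk f n1 n2 n3 L3); trivial; try lra|].
    + apply (lev_odd_le _ _ _ _ V0); lra.
    + apply (lev_le _ _ _ _ _ _ _ W1); lra.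
    + apply (lev_le _ _ _ _ _ _ _ W2); lra.
    + rewrite Hk2. apply gronwall_step; lra.
  - apply walk_convex; trivial.
  - exact Gm.
  - intros sg u Hu y' s. destruct Hu as [H [Hnl [Hside [Hcont [Hgr Hterm]]]]].
    replace (eps + eta * (T - x) + Cb * (d + (y - x - om (fun t => code t = code tag) x y)))
      with ((eps + eta * (T - y) + Cb * d) + eta * (y - x) + Cb * (y - x - om (fun t => code t = code tag) x y)) by ring.
    apply (slab sg T r mu rho alpha beta a b C0 H u f g x y kap Lam n mb K1 Kg N0 Cb eta (fun t => code t = code tag)); trivial.
    + apply Rle_trans with (M x); [apply HM0; lra|apply HMmb; lra].
    + intros z s'. specialize (Hmono z s'). pose proof (HMmb y ltac:(lra)). unfold M in *. lra.
    + intros z s'. specialize (Gm z s'). pose proof (HMmb x ltac:(lra)). lra.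
    + intros z s' t Ht. cbv zeta. destruct (Herr tag t s' ltac:(lra) ltac:(lra)) as [d1 [d2 [d3 [D1' [D2' [D3' [Q1 Q2]]]]]]].
      destruct (Hs1 s') as [B0 [B1 [B2 [B3 B4]]]].
      pose proof (err_bound r rho be (bbt tag) (gat tag) k f L0 (2 * N3) N1 N2 K1 Kg (beta s') (b s' t)
        (gam r mu rho alpha beta a b s' t) d1 d2 d3 y z s' t Hrho Sbe Sbb Sga ltac:(lra) Hf ltac:(lra) W0
        (lev_le _ _ _ _ _ _ L0 W1 (Rle_trans _ _ _ HL12 HL20)) (lev_le _ _ _ _ _ _ L0 W2 HL20) Hjet F1' F2' (proj1 HN1) (proj1 HN2)
        (Hbeta s') (Hb s' t ltac:(lra)) ltac:(rewrite Rabs_pos_eq; lra) B2 HKg (Hgam s' t ltac:(lra)) D1' D2' D3'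
        ltac:(rewrite Hk2; lra)) as EB.
      cbv zeta in EB. rewrite Hk2 in EB. fold g in EB. fold C6 in EB.
      assert (HC6 : 0 <= C6).
      { unfold C6. pose proof (Rabs_pos r). pose proof (pow2_ge_0 K1). pose proof (pow2_ge_0 L0).
        assert (0 <= L0 ^ 3) by (apply pow_le; lra).
        assert (0 <= 200 * L0 ^ 3 * (2 * N3)) by (apply Rmult_le_pos; lra).
        assert (0 <= 40 * L0 ^ 2 * (2 * N3) * (Rabs r + 3 * K1 ^ 2 + Kg)) by (apply mul3_pos; lra). lra. }
      assert (HS : 1 + Rabs s' <= 2 * (1 + s' ^ 2)).
      { rewrite <- (pow2_abs s'). pose proof (pow2_ge_0 (Rabs s' - 1)). pose proof (Rabs_pos s'). nra. }
      assert (HQ : k * (C6 * (1 + Rabs s')) <= kap / 2 * (1 + s' ^ 2)).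
      { apply Rle_trans with (sqrt h * (C6 * (2 * (1 + s' ^ 2)))).
        - pose proof (Rabs_pos s'). apply Rmult_le_compat; try lra; [apply Rmult_le_pos; lra|].
          apply Rmult_le_compat_l; trivial.
        - pose proof (pow2_ge_0 s').
          assert (sqrt h * (4 * C6) * (1 + s' ^ 2) <= kap * (1 + s' ^ 2)) by (apply Rmult_le_compat_r; lra). lra. }
      split; [lra|]. intros Hcode. specialize (Q2 Hcode). lra.
    + intros z s'. apply (Hcomp sg u). exists H. repeat split; trivial.
Qed.

Lemma chain x d f0 : part (fun s t => code t = code s) h T x d -> 0 <= x ->
  state T 0 f0 -> x <= T /\ exists f, state x d f.
Proof.
  intros Hp Hx Hf0. induction Hp as [|x y s d Hp IH Hxy Hyh Hs].
  - split; [lra|]. now exists f0.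
  - destruct (IH ltac:(lra)) as [HyT [f Hf]]. split; [lra|].
    exists (walk r rho be (bbt s) (gat s) (sqrt (y - x)) f). now apply chain_step.
Qed.
End Chain.

(** * Mollified coefficients and the common approximant *)

Lemma diff_quot_le L x e : 0 < e -> Rabs x <= L * e -> Rabs (x / e) <= L.
Proof.
  intros He H. rewrite Rabs_div, (Rabs_pos_eq e) by lra. apply Rmult_le_reg_r with e; trivial.
  unfold Rdiv. rewrite Rmult_assoc, Rinv_l; lra.
Qed.

(** For [beta] and [b]: the Lipschitz derivative keeps the second derivative bounded by [K] at every
    scale [e], and only the third one explodes. Averaging preserves sign and monotonicity. *)
Lemma smooth_approx (f f1 : R -> R) K e : 0 < e -> 0 <= K ->
  (forall x y, Rabs (f x - f y) <= K * Rabs (x - y)) -> (forall x, is_derive f x (f1 x)) ->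
  (forall x y, Rabs (f1 x - f1 y) <= K * Rabs (x - y)) -> (forall x, Rabs (f x) <= K) ->
  exists m, smooth_coef m /\ (forall x, Rabs (m 0%nat x - f x) <= 3 * K * e) /\
    (forall n x, (n <= 2)%nat -> Rabs (m n x) <= K) /\ (forall x, Rabs (m 3%nat x) <= 8 * K / e ^ 3) /\
    ((forall x, 0 <= f x) -> forall x, 0 <= m 0%nat x) /\
    ((forall x y, x <= y -> f x <= f y) -> forall x, 0 <= m 1%nat x).
Proof.
  intros He HK Hlip Hder Hlip1 Hbd. destruct (mollify f K e He Hlip) as [m [Sm [M0 [M1 [M2 M3]]]]].
  exists m. split; [trivial|]. split; [|split; [|split; [|split]]].
  - intros x. destruct (M0 x) as [c [Hc ->]]. eapply Rle_trans; [apply Hlip|].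
    rewrite Rabs_pos_eq by lra. replace (3 * K * e) with (K * (3 * e)) by ring. apply Rmult_le_compat_l; lra.
  - intros n x Hn. destruct n as [|[|[|n]]]; [| | |lia].
    + destruct (M0 x) as [c [_ ->]]. apply Hbd.
    + destruct (M1 x) as [c [_ ->]]. apply diff_quot_le; trivial. eapply Rle_trans; [apply Hlip|].
      rewrite Rabs_pos_eq by lra. apply Req_le. ring.
    + destruct (M2 x) as [c [_ ->]]. apply diff_quot_le; [apply pow_lt; lra|].
      apply (second_difference f f1); trivial.
  - intros x. rewrite M3. apply diff_quot_le; [apply pow_lt; lra|].
    replace (8 * K / e ^ 3 * e ^ 3) with (8 * K) by (field; lra).
    pose proof (Hbd (x + 3 * e)) as B3. pose proof (Hbd (x + 2 * e)) as B2. pose proof (Hbd (x + e)) as B1.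
    pose proof (Hbd x) as B0. apply Rabs_le_between in B0, B1, B2, B3. apply Rabs_le_between. lra.
  - intros Hf x. destruct (M0 x) as [c [_ ->]]. apply Hf.
  - intros Hf x. destruct (M1 x) as [c [_ ->]]. specialize (Hf c (c + e) ltac:(lra)).
    apply Rmult_le_pos; [lra|apply Rlt_le, Rinv_0_lt_compat; lra].
Qed.

(** For [gamma]: only the first derivative is bounded uniformly in [e]. Freezing the values beyond
    [R0] makes the drift bounded, while the bounds on its derivatives stay independent of [R0]. *)
Lemma lipschitz_approx (f : R -> R) K R0 e : 0 < e -> 0 <= K -> 0 < R0 ->
  (forall x y, Rabs (f x - f y) <= K * Rabs (x - y)) -> (forall x, Rabs (f x) <= K * (1 + Rabs x)) ->
  exists m, smooth_coef m /\ (forall x, Rabs x <= R0 -> Rabs (m 0%nat x - f x) <= 3 * K * e) /\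
    (forall x, Rabs (m 0%nat x) <= K * (1 + R0)) /\ (forall x, Rabs (m 1%nat x) <= K) /\
    (forall x, Rabs (m 2%nat x) <= 2 * K / e) /\ (forall x, Rabs (m 3%nat x) <= 4 * K / e ^ 2).
Proof.
  intros He HK HR Hlip Hbd.
  set (cl := fun x => Rmax (- R0) (Rmin R0 x)).
  assert (Hcl : forall x, Rabs (cl x) <= R0).
  { intros x. apply Rabs_le_between. unfold cl. split; [apply Rmax_l|]. apply Rmax_lub; [lra|apply Rmin_l]. }
  assert (Hclx : forall x, Rabs x <= R0 -> cl x = x).
  { intros x Hx. apply Rabs_le_between in Hx. unfold cl. rewrite Rmin_right, Rmax_right; lra. }
  assert (Hcl1 : forall x y, Rabs (cl x - cl y) <= Rabs (x - y)).
  { intros x y. unfold cl, Rmax, Rmin. repeat destruct (Rle_dec _ _); unfold Rabs; repeat destruct (Rcase_abs _); lra. }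
  set (g := fun x => f (cl x)).
  assert (Hg : forall x y, Rabs (g x - g y) <= K * Rabs (x - y)).
  { intros x y. unfold g. eapply Rle_trans; [apply Hlip|]. apply Rmult_le_compat_l; trivial. }
  assert (Hge : forall x y, x = y + e -> Rabs (g x - g y) <= K * e).
  { intros x y ->. eapply Rle_trans; [apply Hg|]. replace (y + e - y) with e by ring. rewrite Rabs_pos_eq; lra. }
  assert (Hg2 : forall x, Rabs (g (x + 2 * e) - 2 * g (x + e) + g x) <= 2 * K * e).
  { intros x. pose proof (Hge (x + 2 * e) (x + e) ltac:(ring)) as A. pose proof (Hge (x + e) x eq_refl) as B.
    apply Rabs_le_between in A, B. apply Rabs_le_between. lra. }
  destruct (mollify g K e He Hg) as [m [Sm [M0 [M1 [M2 M3]]]]].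
  exists m. split; [trivial|]. split; [|split; [|split; [|split]]].
  - intros x Hx. destruct (M0 x) as [c [Hc ->]]. rewrite <- (Hclx x Hx) at 1. fold (g x).
    eapply Rle_trans; [apply Hg|].
    rewrite Rabs_pos_eq by lra. replace (3 * K * e) with (K * (3 * e)) by ring. apply Rmult_le_compat_l; lra.
  - intros x. destruct (M0 x) as [c [_ ->]]. eapply Rle_trans; [apply Hbd|]. apply Rmult_le_compat_l; trivial.
    specialize (Hcl c). lra.
  - intros x. destruct (M1 x) as [c [_ ->]]. apply diff_quot_le; trivial. now apply Hge.
  - intros x. destruct (M2 x) as [c [_ ->]]. apply diff_quot_le; [apply pow_lt; lra|].
    eapply Rle_trans; [apply Hg2|]. apply Req_le. field. lra.
  - intros x. rewrite M3. apply diff_quot_le; [apply pow_lt; lra|].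
    pose proof (Hg2 (x + e)) as A. pose proof (Hg2 x) as B.
    replace (x + e + 2 * e) with (x + 3 * e) in A by ring. replace (x + e + e) with (x + 2 * e) in A by ring.
    replace (4 * K / e ^ 2 * e ^ 3) with (4 * K * e) by (field; lra).
    apply Rabs_le_between in A, B. apply Rabs_le_between. lra.
Qed.

Lemma pick_small (A : R) e : 0 <= A -> 0 < e -> exists d, 0 < d <= 1 /\ A * d <= e.
Proof.
  intros HA He. exists (Rmin 1 (e / (A + 1))).
  assert (0 < e / (A + 1)) by (apply Rdiv_lt_0_compat; lra).
  pose proof (Rmin_l 1 (e / (A + 1))). pose proof (Rmin_r 1 (e / (A + 1))).
  split; [split; [apply Rmin_pos; lra|trivial]|].
  apply Rle_trans with ((A + 1) * (e / (A + 1))).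
  - apply Rmult_le_compat; try lra. apply Rlt_le, Rmin_pos; lra.
  - apply Req_le. field. lra.
Qed.

(** [L1] involves [K] alone, [L2] also [eg], [L3] also [ec]; [R0] occurs only in [L0]. Products with
    [K] come from the drift of ln S, quadratic in [be]. *)
Lemma coef_ok_intro r be bb ga K R0 ec eg : 1 <= K -> 0 < R0 -> 0 < ec -> 0 < eg ->
  smooth_coef be -> smooth_coef bb -> smooth_coef ga ->
  (forall n s, (n <= 2)%nat -> Rabs (be n s) <= K) -> (forall s, Rabs (be 3%nat s) <= 8 * K / ec ^ 3) ->
  (forall n s, (n <= 2)%nat -> Rabs (bb n s) <= K) -> (forall s, Rabs (bb 3%nat s) <= 8 * K / ec ^ 3) ->
  (forall s, Rabs (ga 0%nat s) <= K * (1 + R0)) -> (forall s, Rabs (ga 1%nat s) <= K) ->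
  (forall s, Rabs (ga 2%nat s) <= 2 * K / eg) -> (forall s, Rabs (ga 3%nat s) <= 4 * K / eg ^ 2) ->
  (forall s, 0 <= be 0%nat s) -> (forall s, 0 <= be 1%nat s) ->
  let L1 := 2 * K ^ 2 in
  let L2 := L1 + 2 * K / eg in
  let L3 := L2 + 3 * K ^ 2 + K * (16 * K / ec ^ 3) + 4 * K / eg ^ 2 in
  let L0 := L2 + Rabs r + K * (1 + R0) in
  1 <= L1 /\ L1 <= L2 /\ L2 <= L3 /\ L2 <= L0 /\ coef_ok r be bb ga K L0 L1 L2 L3.
Proof.
  intros HK HR Hec Heg Sbe Sbb Sga Be Be3 Bb Bb3 Ga0 Ga1 Ga2 Ga3 P0 P1 L1 L2 L3 L0.
  assert (HK2 : K <= K ^ 2) by nra.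
  assert (Q1 : 0 < 2 * K / eg) by (apply Rdiv_lt_0_compat; lra).
  assert (Q2 : 0 < 8 * K / ec ^ 3) by (apply Rdiv_lt_0_compat; [lra|apply pow_lt; lra]).
  assert (Q3 : 0 < 4 * K / eg ^ 2) by (apply Rdiv_lt_0_compat; [lra|apply pow_lt; lra]).
  assert (Q4 : 16 * K / ec ^ 3 = 2 * (8 * K / ec ^ 3)) by (field; lra).
  assert (Q5 : 2 * (8 * K / ec ^ 3) <= K * (2 * (8 * K / ec ^ 3))) by nra.
  assert (Q6 : 0 < K * (1 + R0)) by (apply Rmult_lt_0_compat; lra).
  pose proof (Rabs_pos r).
  unfold L0, L3, L2, L1. rewrite Q4. clear L0 L3 L2 L1.
  set (X := 8 * K / ec ^ 3) in *. set (Y := 2 * K / eg) in *. set (Z := 4 * K / eg ^ 2) in *.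
  assert (Hxod : forall z n s A, Rabs z <= 2 -> Rabs (be n s) <= A -> Rabs (xod be z n s) <= 2 * A).
  { intros z n s A Hz HA. unfold xod. now apply Rabs_mul_le. }
  assert (BB : forall p q A B s, Rabs (be p s) <= A -> Rabs (be q s) <= B -> Rabs (be p s * be q s) <= A * B).
  { intros. now apply Rabs_mul_le. }
  assert (B0 : forall s, Rabs (be 0%nat s) <= K) by (intros; apply Be; lia).
  assert (B1 : forall s, Rabs (be 1%nat s) <= K) by (intros; apply Be; lia).
  assert (B2 : forall s, Rabs (be 2%nat s) <= K) by (intros; apply Be; lia).
  split; [nra|]. split; [lra|]. split; [nra|]. split; [lra|].
  unfold coef_ok. do 3 (split; [trivial|]).
  split; [|split; [|split; [|split; [|split]]]].
  - intros z Hz s. split.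
    + eapply Rle_trans; [apply (Hxod z 0%nat s K); trivial|]. lra.
    + eapply Rle_trans; [apply Bb; lia|]. lra.
  - intros z Hz s. split; [|split; [|split]].
    + eapply Rle_trans; [apply (Hxod z 0%nat s K); trivial|]. lra.
    + unfold drift. pose proof (BB 0%nat 0%nat K K s (B0 s) (B0 s)) as A. apply Rabs_le_between in A.
      pose proof (Rle_abs r). pose proof (Rle_abs (- r)) as A'. rewrite Rabs_Ropp in A'.
      apply Rabs_le_between. lra.
    + eapply Rle_trans; [apply Bb; lia|]. lra.
    + eapply Rle_trans; [apply Ga0|]. lra.
  - intros z Hz s. split; [|split; [|split]].
    + eapply Rle_trans; [apply (Hxod z 1%nat s K); trivial|]. lra.
    + unfold drift. rewrite Rabs_Ropp. eapply Rle_trans; [apply (BB 0%nat 1%nat K K s); trivial|]. lra.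
    + eapply Rle_trans; [apply Bb; lia|]. lra.
    + eapply Rle_trans; [apply Ga1|]. lra.
  - intros z Hz s. split; [|split; [|split]].
    + eapply Rle_trans; [apply (Hxod z 2%nat s K); trivial|]. lra.
    + unfold drift. pose proof (BB 1%nat 1%nat K K s (B1 s) (B1 s)) as A.
      pose proof (BB 0%nat 2%nat K K s (B0 s) (B2 s)) as A'. apply Rabs_le_between in A, A'.
      apply Rabs_le_between. lra.
    + eapply Rle_trans; [apply Bb; lia|]. lra.
    + eapply Rle_trans; [apply Ga2|]. lra.
  - intros z Hz s. split; [|split; [|split]].
    + eapply Rle_trans; [apply (Hxod z 3%nat s X); trivial|]. lra.
    + unfold drift. pose proof (BB 1%nat 2%nat K K s (B1 s) (B2 s)) as A.
      pose proof (BB 0%nat 3%nat K X s (B0 s) (Be3 s)) as A'. apply Rabs_le_between in A, A'.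
      apply Rabs_le_between. split; nra.
    + eapply Rle_trans; [apply Bb3|]. fold X. nra.
    + eapply Rle_trans; [apply Ga3|]. fold Z. nra.
  - intros s. specialize (P0 s). specialize (P1 s). pose proof (B0 s) as A. pose proof (B1 s) as A'.
    rewrite Rabs_pos_eq in A, A' by trivial. repeat split; trivial; try (apply Bb; lia).
Qed.

Section Approximation.
Variables T r mu rho alpha Kp : R.
Variable beta : R -> R.
Variables a b : R -> R -> R.
Variable C0 K : R.
Variable n : nat.
Local Notation gm := (gam r mu rho alpha beta a b).
Hypothesis HT : 0 < T.
Hypothesis Hrho : -1 <= rho <= 1.
Hypothesis HKp : 0 < Kp.
Hypothesis HC0 : 0 <= C0.
Hypothesis HK : 1 <= K.
Hypothesis Hbeta_pos : forall s, 0 < beta s.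
Hypothesis Hbeta_mono : forall s1 s2, s1 <= s2 -> beta s1 <= beta s2.
Hypothesis Hbeta_bd : forall s, Rabs (beta s) <= K.
Hypothesis Hbeta_lip : forall s1 s2, Rabs (beta s1 - beta s2) <= K * Rabs (s1 - s2).
Hypothesis Hbeta_diff : forall s, ex_derive beta s.
Hypothesis Hbeta'_lip : forall s1 s2, Rabs (Derive beta s1 - Derive beta s2) <= K * Rabs (s1 - s2).
Hypothesis Hb_bd : forall s t, 0 <= t <= T -> Rabs (b s t) <= K.
Hypothesis Hb_lip : forall s1 s2 t, 0 <= t <= T -> Rabs (b s1 t - b s2 t) <= K * Rabs (s1 - s2).
Hypothesis Hb_diff : forall s t, 0 <= t <= T -> ex_derive (fun x => b x t) s.
Hypothesis Hb'_lip : forall s1 s2 t, 0 <= t <= T ->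
  Rabs (Derive (fun x => b x t) s1 - Derive (fun x => b x t) s2) <= K * Rabs (s1 - s2).
Hypothesis Hgam_bd : forall s t, 0 <= t <= T -> Rabs (gm s t) <= K * (1 + Rabs s).
Hypothesis Hgam_lip : forall s1 s2 t, 0 <= t <= T -> Rabs (gm s1 t - gm s2 t) <= K * Rabs (s1 - s2).

Let Lam := Rabs r + K ^ 2 + 4 * K * (INR n + 2) + 3 * (INR n + 2) ^ 2 * K ^ 2 + 4 * C0 * (INR n + 2) + 1.

(* Order of choice: payoff, mollification of the drift, mollification of the
   volatilities, truncation radius, time classes, mesh. *)
Lemma common_approximation x0 e : 0 <= x0 <= T -> 0 < e ->
  exists f : R -> R -> R, forall sg u, solution_side T r mu rho alpha beta a b (put_payoff Kp) C0 n sg u ->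
    forall y s, sg * (exp (r * (T - x0)) * u (exp y) s x0 - f y s) - chi e Lam T n (exp y) s x0
      <= 2 * e * (1 + T).
Proof.
  intros Hx0 He.
  destruct (put_approx Kp e HKp He) as [f0 [N0 [Sf0 [HN0 [F1 [F2 [F3 [Fb [Fc [Fm Fa]]]]]]]]]].
  set (L1 := 2 * K ^ 2). set (N1 := N0 * exp (4 * L1 ^ 2 * T)).
  assert (HN1 : 0 <= N1) by (apply Rmult_le_pos; [trivial|apply Rlt_le, exp_pos]).
  (* [N1] depends on no mollification scale, so [eg] can be chosen against it. *)
  destruct (pick_small (N1 * (3 * K)) (e / 4)) as [eg [Heg Heg1]]; [apply Rmult_le_pos; lra|lra|].
  set (L2 := L1 + 2 * K / eg). set (N2 := N0 * exp (20 * L2 ^ 2 * T)).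
  assert (HN2 : 0 <= N2) by (apply Rmult_le_pos; [trivial|apply Rlt_le, exp_pos]).
  assert (HKK : 0 <= K ^ 2) by apply pow2_ge_0.
  assert (HNK1 : 0 <= N1 * (3 * K ^ 2)) by (apply Rmult_le_pos; lra).
  assert (HNK2 : 0 <= N2 * (12 * K ^ 2)) by (apply Rmult_le_pos; lra).
  (* [N2] depends on [eg] but not on [ec], so [ec] can be chosen against it. *)
  destruct (pick_small (N1 * (3 * K ^ 2) + N2 * (12 * K ^ 2)) (e / 4)) as [ec [Hec Hec1]]; [lra|lra|].
  set (Cx := N1 * (3 * K ^ 2 + 2 * K) + N2 * (10 * K ^ 2)).
  assert (HCx : 0 <= Cx) by (apply Rplus_le_le_0_compat; apply Rmult_le_pos; lra).
  (* The coefficient error is at most [Cx * (1 + |s|)] for [|s|] beyond [R0], and this radius makes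
     it smaller than the allowance [e / 2 * (1 + s ^ 2)]. *)
  set (R0 := 1 + 4 * Cx / e).
  assert (HR0 : 1 <= R0).
  { unfold R0. assert (0 <= 4 * Cx / e); [|lra].
    apply Rmult_le_pos; [lra|apply Rlt_le, Rinv_0_lt_compat; trivial]. }
  destruct (pick_small (N1 + N2 * (2 * K)) (e / 4)) as [ed [Hed Hed1]];
    [apply Rplus_le_le_0_compat; [trivial|apply Rmult_le_pos; lra]|lra|].
  destruct (family_code b T K R0 ed) as [Nb [cb [Hcb Hcb1]]]; try lra; [exists K; intros; now apply Hb_bd|intros; now apply Hb_lip|].
  destruct (family_code gm T K R0 ed) as [Ng [cg [Hcg Hcg1]]]; try lra; [|intros; now apply Hgam_lip|].
  { exists (K * (1 + R0)). intros s t Hs Ht. eapply Rle_trans; [now apply Hgam_bd|]. apply Rmult_le_compat_l; lra. }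
  destruct (pair_code Nb Ng cb cg Hcb Hcg) as [N [code [Hcode Hcode1]]].
  destruct (smooth_approx beta (Derive beta) K ec) as [be [Sbe [Be0 [Be2 [Be3 [Bep Bem]]]]]]; try lra; trivial.
  { intros x. now apply Derive_correct. }
  assert (Hbb : forall tag, exists bb, 0 <= tag <= T -> smooth_coef bb /\
    (forall x, Rabs (bb 0%nat x - b x tag) <= 3 * K * ec) /\
    (forall n x, (n <= 2)%nat -> Rabs (bb n x) <= K) /\ (forall x, Rabs (bb 3%nat x) <= 8 * K / ec ^ 3)).
  (* A dummy value for tags outside [[0, T]], so that [choice] yields a total function. *)
  { intros tag. destruct (classic (0 <= tag <= T)) as [Ht|Ht]; [|now exists (fun _ _ => 0)].
    destruct (smooth_approx (fun x => b x tag) (Derive (fun x => b x tag)) K ec) as [bb [S [Q1 [Q2 [Q3 _]]]]]; try lra; auto.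
    - intros x. apply Derive_correct, Hb_diff, Ht.
    - exists bb. tauto. }
  assert (Hga : forall tag, exists ga, 0 <= tag <= T -> smooth_coef ga /\
    (forall x, Rabs x <= R0 -> Rabs (ga 0%nat x - gm x tag) <= 3 * K * eg) /\
    (forall x, Rabs (ga 0%nat x) <= K * (1 + R0)) /\ (forall x, Rabs (ga 1%nat x) <= K) /\
    (forall x, Rabs (ga 2%nat x) <= 2 * K / eg) /\ (forall x, Rabs (ga 3%nat x) <= 4 * K / eg ^ 2)).
  { intros tag. destruct (classic (0 <= tag <= T)) as [Ht|Ht]; [|now exists (fun _ _ => 0)].
    destruct (lipschitz_approx (fun x => gm x tag) K R0 eg) as [ga Q]; try lra; auto.
    now exists ga. }
  destruct (choice _ Hbb) as [bbt Bb]. destruct (choice _ Hga) as [gat Ga]. clear Hbb Hga.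
  set (L3 := L2 + 3 * K ^ 2 + K * (16 * K / ec ^ 3) + 4 * K / eg ^ 2).
  set (L0 := L2 + Rabs r + K * (1 + R0)).
  assert (Hlev : forall tag, 0 <= tag <= T -> 1 <= L1 /\ L1 <= L2 /\ L2 <= L3 /\ L2 <= L0 /\
    coef_ok r be (bbt tag) (gat tag) K L0 L1 L2 L3).
  { intros tag Ht. destruct (Bb tag Ht) as [Sb [_ [Bb2 Bb3]]]. destruct (Ga tag Ht) as [Sg [_ [Ga0 [Ga1 [Ga2 Ga3]]]]].
    apply (coef_ok_intro r be (bbt tag) (gat tag) K R0 ec eg); trivial; try lra.
    apply Bep. intros. now apply Rlt_le. now apply Bem. }
  destruct (Hlev 0 ltac:(lra)) as [HL1 [HL12 [HL23 [HL20 _]]]].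
  set (Cb0 := Cx * (1 + R0) + e). set (Cb := Cb0 + e).
  assert (HCb0 : 0 <= Cx * (1 + R0)) by (apply Rmult_le_pos; lra).
  set (N3 := N0 * exp (400 * L3 ^ 4 * T)).
  assert (HN3 : 0 <= N3) by (apply Rmult_le_pos; [trivial|apply Rlt_le, exp_pos]).
  set (C5 := 60 * K ^ 5 * (2 * N3)).
  set (C6 := 200 * L0 ^ 3 * (2 * N3) + 40 * L0 ^ 2 * (2 * N3) * (Rabs r + 3 * K ^ 2 + K)).
  assert (HC5 : 0 <= C5 * T * exp (K * T)).
  { apply mul3_pos; [|lra|apply Rlt_le, exp_pos]. apply Rmult_le_pos; [|lra].
    assert (0 <= K ^ 5) by (apply pow_le; lra). lra. }
  assert (HC6 : 0 <= C6).
  { pose proof (Rabs_pos r). pose proof (pow2_ge_0 L0). assert (0 <= L0 ^ 3) by (apply pow_le; lra).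
    apply Rplus_le_le_0_compat; [apply Rmult_le_pos; lra|apply mul3_pos; lra]. }
  destruct (pick_small (3 * K ^ 2) 1) as [k1 [Hk1 Hk1']]; [lra|lra|].
  destruct (pick_small (4 * C6) e) as [k2 [Hk2 Hk2']]; [lra|lra|].
  assert (HCC : 0 <= 2 * C0 * (C5 * T * exp (K * T))) by (apply Rmult_le_pos; lra).
  destruct (pick_small (2 * C0 * (C5 * T * exp (K * T))) e) as [k3 [Hk3 Hk3']]; [lra|lra|].
  (* The mesh is [k ^ 2]. [k1] serves the monotonicity of a step, [k2] the [O(k)] part of the
     residual, [k3] the cost of slightly negative sigma derivatives. *)
  set (k := Rmin k1 (Rmin k2 k3)).
  assert (Hk : 0 < k /\ k <= k1 /\ k <= k2 /\ k <= k3).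
  { unfold k, Rmin. repeat destruct (Rle_dec _ _); lra. }
  assert (Hkh : sqrt (k ^ 2) = k) by (apply sqrt_pow2; lra).
  assert (Hsmall : forall A k' e', 0 <= A -> A * k' <= e' -> k <= k' -> A * k <= e').
  { intros A k' e' HA H H'. apply Rle_trans with (2 := H). now apply Rmult_le_compat_l. }
  assert (HCbp : 0 < Cb) by (unfold Cb, Cb0; lra).
  (* At times outside the class of the tag the slope is bounded by [Cb], so a deficit of [e / Cb]
     costs at most [e]. *)
  destruct (schedule code N x0 T (k ^ 2) (e / Cb)) as [d [Hd Hpart]]; try lra; trivial.
  { apply pow_lt; lra. } { apply Rdiv_lt_0_compat; lra. }
  assert (HCbd : Cb * d <= e).
  { apply Rle_trans with (Cb * (e / Cb)); [apply Rmult_le_compat_l; lra|]. apply Req_le. field. lra. }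
  destruct (chain T r mu rho alpha beta a b (put_payoff Kp) C0 n be bbt gat code K K L0 L1 L2 L3 N0 e Lam e e (2 * e)
    Cb0 Cb (k ^ 2)) with (x := x0) (d := d) (f0 := f0) as [_ [f Hf]]; trivial; try lra.
  - intros tag Ht. now destruct (Hlev tag Ht) as [_ [_ [_ [_ Q]]]].
  - fold N1 N2. intros tag t s Htag Ht.
    destruct (Bb tag Htag) as [_ [Bb0 [Bb2 _]]]. destruct (Ga tag Htag) as [_ [Ga0 [Ga1 _]]].
    specialize (Bb2 0%nat s ltac:(lia)). specialize (Ga1 s). specialize (Be0 s). specialize (Bb0 s). specialize (Ga0 s).
    pose proof (Hb_bd s t Ht) as Hbst. pose proof (Hgam_bd s t Ht) as Hgst. pose proof (pow2_ge_0 s) as Hs2.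
    pose proof (Rabs_pos s) as Hs0.
    assert (Hd2 : Rabs (bbt tag 0%nat s - b s t) <= 2 * K).
    { replace (2 * K) with (K + K) by ring. now apply Rabs_sub_le. }
    assert (Hd3 : Rabs (gat tag 0%nat s - gm s t) <= 2 * K * (1 + Rmax R0 (Rabs s))).
    { replace (2 * K * (1 + Rmax R0 (Rabs s))) with (K * (1 + Rmax R0 (Rabs s)) + K * (1 + Rmax R0 (Rabs s))) by ring.
      apply Rabs_sub_le; (eapply Rle_trans; [eassumption|]); apply Rmult_le_compat_l; try lra.
      pose proof (Rmax_l R0 (Rabs s)). lra. pose proof (Rmax_r R0 (Rabs s)). lra. }
    assert (HQ : N1 * (K * (3 * K * ec) + 2 * K * (1 + Rmax R0 (Rabs s))) + N2 * (2 * K * (3 * K * ec + 2 * K))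
       <= Cx * (1 + Rmax R0 (Rabs s))).
    { set (w := 1 + Rmax R0 (Rabs s)). assert (Hw : 1 <= w) by (pose proof (Rmax_l R0 (Rabs s)); unfold w; lra).
      unfold Cx. rewrite Rmult_plus_distr_r, !Rmult_assoc. apply Rplus_le_compat; apply Rmult_le_compat_l; trivial.
      - assert (3 * K ^ 2 * ec <= 3 * K ^ 2 * w) by (apply Rmult_le_compat_l; lra). lra.
      - assert (6 * K ^ 2 * ec <= 6 * K ^ 2 * w) by (apply Rmult_le_compat_l; lra).
        assert (K ^ 2 * 1 <= K ^ 2 * w) by (apply Rmult_le_compat_l; lra). lra. }
    destruct (Rle_lt_dec (Rabs s) R0) as [Hs|Hs].
    + rewrite Rmax_left in HQ, Hd3 by trivial.
      destruct (classic (code t = code tag)) as [Hc|Hc].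
      * destruct (Hcode1 _ _ Hc) as [Hc1 Hc2].
        specialize (Hcb1 tag t Htag Ht (eq_sym Hc1) s Hs). specialize (Hcg1 tag t Htag Ht (eq_sym Hc2) s Hs).
        exists (3 * K * ec), (3 * K * ec + ed), (3 * K * eg + ed).
        split; [trivial|]. split; [|split].
        -- replace (bbt tag 0%nat s - b s t) with (bbt tag 0%nat s - b s tag + (b s tag - b s t)) by ring.
           now apply Rabs_add_le.
        -- replace (gat tag 0%nat s - gm s t) with (gat tag 0%nat s - gm s tag + (gm s tag - gm s t)) by ring.
           apply Rabs_add_le; auto.
        -- assert (HE : N1 * (K * (3 * K * ec) + (3 * K * eg + ed)) + N2 * (2 * K * (3 * K * ec + (3 * K * ec + ed))) <= e) by lra.
           assert (0 <= e / 2 * (1 + s ^ 2)) by (apply Rmult_le_pos; lra).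
           unfold Cb0. split; [lra|]. intros _. lra.
      * exists (3 * K * ec), (2 * K), (2 * K * (1 + R0)). do 3 (split; [trivial|]).
        assert (0 <= e / 2 * (1 + s ^ 2)) by (apply Rmult_le_pos; lra).
        split; [unfold Cb0; lra|]. intros E. now elim Hc.
    + rewrite Rmax_right in HQ, Hd3 by lra.
      exists (3 * K * ec), (2 * K), (2 * K * (1 + Rabs s)). do 3 (split; [trivial|]).
      assert (HE : Cx * (1 + Rabs s) <= e / 2 * (1 + s ^ 2)).
      { apply Rle_trans with (2 * Cx * Rabs s); [assert (Cx * 1 <= Cx * Rabs s) by (apply Rmult_le_compat_l; lra); lra|].
        assert (HRe : 4 * Cx <= e * Rabs s).
        { apply Rle_trans with (e * R0); [|apply Rmult_le_compat_l; lra]. unfold R0.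
          replace (e * (1 + 4 * Cx / e)) with (e + 4 * Cx) by (field; lra). lra. }
        assert (4 * Cx * Rabs s <= e * Rabs s * Rabs s) by (apply Rmult_le_compat_r; trivial).
        rewrite <- (pow2_abs s). lra. }
      unfold Cb0. split; [lra|]. intros _. lra.
  - apply Rle_refl.
  - split; [apply pow_lt; lra|]. apply Rle_trans with (1 ^ 2); [apply pow_incr; lra|lra].
  - rewrite Hkh. apply (Hsmall _ k1); lra.
  - rewrite Hkh. fold N3. fold C6. rewrite Rmult_comm. apply (Hsmall _ k2); lra.
  - rewrite Hkh. fold N3. fold C5. unfold Cb.
    pose proof (Hsmall _ k3 e HCC Hk3' ltac:(lra)). lra.
  - rewrite Hkh. fold N3. fold C5. pose proof (Hsmall _ k3 e HCC Hk3' ltac:(lra)). lra.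
  - unfold state. replace (T - T) with 0 by ring. rewrite !Rmult_0_r, exp_0, !Rmult_1_r.
    do 6 (split; [trivial|]). split.
    + intros y s. rewrite Fm. lra.
    + intros sg u Hu y s. destruct Hu as [Hm [_ [Hs [_ [_ Ht]]]]].
      rewrite Ht by apply exp_pos. specialize (Fa y s). apply Rabs_le_between in Fa.
      assert (0 <= chi e Lam T n (exp y) s T).
      { unfold chi. pose proof (exp_pos y). pose proof (exp_pos (Lam * (T - T))).
        pose proof (Rinv_0_lt_compat _ (exp_pos y)). pose proof (pow2_ge_0 s).
        assert (0 <= bar n s) by (apply pow_le; lra).
        apply Rmult_le_pos; [apply Rmult_le_pos; lra|lra]. }
      destruct Hs as [[-> _]|[-> _]]; lra.
  - exists (f 0%nat 0%nat). intros sg u Hu y s. destruct Hf as [_ [_ [_ [_ [_ [_ [_ Hf]]]]]]].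
    eapply Rle_trans; [apply (Hf sg u Hu y s)|].
    assert (2 * e * (T - x0) <= 2 * e * T) by (apply Rmult_le_compat_l; lra). lra.
Qed.
End Approximation.

(** * The two equations and the equality of their solutions *)

Lemma near_linear_G T r mu rho alpha beta a b C0 : 0 <= C0 ->
  near_linear T r mu rho alpha beta a b C0 (H_G r mu rho alpha beta a b).
Proof.
  intros HC S s t v pS ps pSS pSs pss _. unfold Rminus at 1. rewrite Rplus_opp_r, Rabs_R0.
  apply Rmult_le_pos; trivial. pose proof (Rle_abs ps). lra.
Qed.

Lemma near_linear_P T r mu rho alpha beta a b K : 0 <= alpha -> (forall s t, 0 <= t <= T -> Rabs (b s t) <= K) ->
  near_linear T r mu rho alpha beta a b (alpha * sqrt (1 - rho ^ 2) * K) (H_P r mu rho alpha beta a b).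
Proof.
  intros Ha Hb S s t v pS ps pSS pSs pss Ht. pose proof (Rle_abs ps).
  replace (H_P r mu rho alpha beta a b S s t v pS ps pSS pSs pss - H_G r mu rho alpha beta a b S s t v pS ps pSS pSs pss)
    with (alpha * sqrt (1 - rho ^ 2) * b s t * (Rabs ps - ps)) by (unfold H_P, H_G, gam; ring).
  assert (0 <= alpha * sqrt (1 - rho ^ 2)) by (apply Rmult_le_pos; [trivial|apply sqrt_pos]).
  apply Rabs_mul_le; [apply Rabs_mul_le; [rewrite Rabs_pos_eq; lra|now apply Hb]|rewrite Rabs_pos_eq; lra].
Qed.

(** [/ beta] may be unbounded as sigma tends to minus infinity, so [gamma] is estimated directly at
    0 only, and elsewhere by its Lipschitz constant. *)
Lemma gam_growth T r mu rho alpha beta a b M L : 0 < beta 0 -> 0 <= alpha -> 0 <= M ->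
  (forall s t, 0 <= t <= T -> Rabs (a s t) <= M) -> (forall s t, 0 <= t <= T -> Rabs (b s t) <= M) ->
  (forall s1 s2 t, 0 <= t <= T -> Rabs (gam r mu rho alpha beta a b s1 t - gam r mu rho alpha beta a b s2 t)
     <= L * Rabs (s1 - s2)) ->
  exists C, forall s t, 0 <= t <= T -> Rabs (gam r mu rho alpha beta a b s t) <= C + L * Rabs s.
Proof.
  intros Hb0 Hal HM Ha Hb HL.
  exists (M + Rabs ((mu - r) * rho) * M * / beta 0 + alpha * sqrt (1 - rho ^ 2) * M).
  intros s t Ht. specialize (HL s 0 t Ht). rewrite Rminus_0_r in HL.
  replace (gam r mu rho alpha beta a b s t) with (gam r mu rho alpha beta a b 0 t
    + (gam r mu rho alpha beta a b s t - gam r mu rho alpha beta a b 0 t)) by ring.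
  apply Rabs_add_le; trivial. unfold gam, Rdiv.
  assert (0 <= alpha * sqrt (1 - rho ^ 2)) by (apply Rmult_le_pos; [trivial|apply sqrt_pos]).
  apply Rabs_add_le; [apply Rabs_sub_le|].
  - now apply Ha.
  - apply Rabs_mul_le; [|rewrite Rabs_pos_eq; [lra|]; now apply Rlt_le, Rinv_0_lt_compat].
    apply Rabs_mul_le; [lra|now apply Hb].
  - apply Rabs_mul_le; [rewrite Rabs_pos_eq; lra|now apply Hb].
Qed.

Lemma lip_weaken c L K x : c <= L * Rabs x -> Rabs L <= K -> c <= K * Rabs x.
Proof.
  intros H HL. apply Rle_trans with (1 := H). apply Rmult_le_compat_r; [apply Rabs_pos|].
  pose proof (Rle_abs L). lra.
Qed.

Theorem theorem3p7
  (T r mu rho alpha K : R) (beta : R -> R) (a b : R -> R -> R)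
  (HT : 0 < T) (Hr : 0 <= r) (Hrho : -1 <= rho <= 1) (Halpha : 0 <= alpha)
  (HK : 0 < K)
  (Hbeta_pos : forall s, 0 < beta s)
  (Hbeta_mono : forall s1 s2, s1 <= s2 -> beta s1 <= beta s2)
  (Ha_bd : exists M, forall s t, 0 <= t <= T -> Rabs (a s t) <= M)
  (Hb_bd : exists M, forall s t, 0 <= t <= T -> Rabs (b s t) <= M)
  (Hbeta_bd : exists M, forall s, Rabs (beta s) <= M)
  (Hnondeg : exists delta, 0 < delta /\
     forall s t, 0 <= t <= T -> delta <= Rmax (beta s) (b s t))
  (Hbeta_lip : exists L, forall s1 s2, Rabs (beta s1 - beta s2) <= L * Rabs (s1 - s2))
  (Hb_lip : exists L, forall s1 s2 t, 0 <= t <= T ->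
     Rabs (b s1 t - b s2 t) <= L * Rabs (s1 - s2))
  (Hgam_lip : exists L, forall s1 s2 t, 0 <= t <= T ->
     Rabs (gam r mu rho alpha beta a b s1 t - gam r mu rho alpha beta a b s2 t)
       <= L * Rabs (s1 - s2))
  (Hbeta_diff : forall s, ex_derive beta s)
  (Hb_diff : forall s t, 0 <= t <= T -> ex_derive (fun x => b x t) s)
  (Hgam_diff : forall s t, 0 <= t <= T ->
     ex_derive (fun x => gam r mu rho alpha beta a b x t) s)
  (Hbeta'_bd : exists M, forall s, Rabs (Derive beta s) <= M)
  (Hb'_bd : exists M, forall s t, 0 <= t <= T ->
     Rabs (Derive (fun x => b x t) s) <= M)
  (Hgam'_bd : exists M, forall s t, 0 <= t <= T ->
     Rabs (Derive (fun x => gam r mu rho alpha beta a b x t) s) <= M)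
  (Hbeta'_lip : exists L, forall s1 s2,
     Rabs (Derive beta s1 - Derive beta s2) <= L * Rabs (s1 - s2))
  (Hb'_lip : exists L, forall s1 s2 t, 0 <= t <= T ->
     Rabs (Derive (fun x => b x t) s1 - Derive (fun x => b x t) s2)
       <= L * Rabs (s1 - s2))
  (P G : R -> R -> R -> R)
  (HP : visc_sol_C T (H_P r mu rho alpha beta a b) (put_payoff K) P)
  (HG : visc_sol_C T (H_G r mu rho alpha beta a b) (put_payoff K) G) :
  forall S s t, 0 < S -> 0 <= t <= T -> P S s t = G S s t.
Proof.
  destruct Ha_bd as [Ma Ha]. destruct Hb_bd as [Mb Hb]. destruct Hbeta_bd as [Mbe Hbe].
  destruct Hbeta_lip as [Lbe Hbel]. destruct Hb_lip as [Lb Hbl]. destruct Hgam_lip as [Lg Hgl].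
  destruct Hbeta'_lip as [Lbe' Hbel']. destruct Hb'_lip as [Lb' Hbl'].
  destruct (gam_growth T r mu rho alpha beta a b (Rabs Ma + Rabs Mb) Lg) as [Mg Hg]; trivial.
  { pose proof (Rabs_pos Ma). pose proof (Rabs_pos Mb). lra. }
  { intros s t Ht. specialize (Ha s t Ht). pose proof (Rle_abs Ma). pose proof (Rabs_pos Mb). lra. }
  { intros s t Ht. specialize (Hb s t Ht). pose proof (Rle_abs Mb). pose proof (Rabs_pos Ma). lra. }
  (* One constant at least 1 for all bounds; the absolute values are there because the given
     constants may be negative. *)
  set (M := 1 + Rabs Mb + Rabs Mbe + Rabs Lbe + Rabs Lb + Rabs Lg + Rabs Lbe' + Rabs Lb' + Rabs Mg).
  assert (HM : 1 <= M /\ Rabs Mb <= M /\ Rabs Mbe <= M /\ Rabs Lbe <= M /\ Rabs Lb <= M /\ Rabs Lg <= M /\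
    Rabs Lbe' <= M /\ Rabs Lb' <= M /\ Rabs Mg <= M).
  { pose proof (Rabs_pos Mb). pose proof (Rabs_pos Mbe). pose proof (Rabs_pos Lbe). pose proof (Rabs_pos Lb).
    pose proof (Rabs_pos Lg). pose proof (Rabs_pos Lbe'). pose proof (Rabs_pos Lb'). pose proof (Rabs_pos Mg).
    unfold M. repeat split; lra. }
  clearbody M. destruct HM as [HM1 [HM2 [HM3 [HM4 [HM5 [HM6 [HM7 [HM8 HM9]]]]]]]].
  assert (HbM : forall s t, 0 <= t <= T -> Rabs (b s t) <= M).
  { intros s t Ht. specialize (Hb s t Ht). pose proof (Rle_abs Mb). lra. }
  set (C0 := alpha * sqrt (1 - rho ^ 2) * M).
  assert (HC0 : 0 <= C0) by (apply mul3_pos; [trivial|apply sqrt_pos|lra]).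
  destruct HP as [HPc [HPC [HPT [HPsub HPsup]]]]. destruct HG as [HGc [HGC [HGT [HGsub HGsup]]]].
  destruct (class_C_growth T P HPC) as [nP HnP]. destruct (class_C_growth T G HGC) as [nG HnG].
  set (n := (nP + nG)%nat).
  assert (SP : forall sg, sg = 1 \/ sg = -1 ->
    solution_side T r mu rho alpha beta a b (put_payoff K) C0 n sg P).
  { intros sg Hsg. exists (H_P r mu rho alpha beta a b). split; [now apply near_linear_P|].
    split; [unfold visc_side; tauto|]. split; [trivial|]. split; [apply HnP; unfold n; lia|trivial]. }
  assert (SG : forall sg, sg = 1 \/ sg = -1 ->
    solution_side T r mu rho alpha beta a b (put_payoff K) C0 n sg G).
  { intros sg Hsg. exists (H_G r mu rho alpha beta a b). split; [now apply near_linear_G|].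
    split; [unfold visc_side; tauto|]. split; [trivial|]. split; [apply HnG; unfold n; lia|trivial]. }
  intros S s t HS Ht.
  set (Lam := Rabs r + M ^ 2 + 4 * M * (INR n + 2) + 3 * (INR n + 2) ^ 2 * M ^ 2 + 4 * C0 * (INR n + 2) + 1).
  set (D := exp (r * (T - t)) * P S s t - exp (r * (T - t)) * G S s t).
  (* The approximant depends on [e] but neither on the solution nor on the side. Four applications
     place [exp (r * (T - t))] times each solution within [chi + 2 * e * (1 + T)] of it, and this
     barrier is proportional to [e]. *)
  assert (HD : forall e, 0 < e -> Rabs D <= (2 * chi 1 Lam T n S s t + 4 * (1 + T)) * e).
  { intros e He.
    destruct (common_approximation T r mu rho alpha K beta a b C0 M n) with (x0 := t) (e := e) as [f Hf]; trivial.
    - intros s'. specialize (Hbe s'). pose proof (Rle_abs Mbe). lra.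
    - intros. eapply lip_weaken; [apply Hbel|trivial].
    - intros. eapply lip_weaken; [apply Hbel'|trivial].
    - intros. eapply lip_weaken; [now apply Hbl|trivial].
    - intros. eapply lip_weaken; [now apply Hbl'|trivial].
    - intros s' t' Ht'. eapply Rle_trans; [now apply Hg|]. rewrite Rmult_plus_distr_l, Rmult_1_r.
      pose proof (Rle_abs Mg). apply Rplus_le_compat; [lra|]. eapply lip_weaken; [apply Rle_refl|trivial].
    - intros. eapply lip_weaken; [now apply Hgl|trivial].
    - fold Lam in Hf.
      pose proof (Hf 1 P (SP 1 (or_introl eq_refl)) (ln S) s) as P1.
      pose proof (Hf (-1) P (SP (-1) (or_intror eq_refl)) (ln S) s) as P2.
      pose proof (Hf 1 G (SG 1 (or_introl eq_refl)) (ln S) s) as G1.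
      pose proof (Hf (-1) G (SG (-1) (or_intror eq_refl)) (ln S) s) as G2.
      rewrite exp_ln in P1, P2, G1, G2 by trivial.
      replace (chi e Lam T n S s t) with (chi 1 Lam T n S s t * e) in P1, P2, G1, G2 by (unfold chi; ring).
      unfold D. apply Rabs_le_between. lra. }
  assert (HD0 : D = 0).
  { destruct (Req_dec D 0) as [|Hne]; trivial. exfalso. pose proof (Rabs_pos_lt D Hne) as Hp.
    destruct (pick_small (Rabs (2 * chi 1 Lam T n S s t + 4 * (1 + T))) (Rabs D / 2)) as [e [He1 He2]];
      [apply Rabs_pos|lra|].
    specialize (HD e ltac:(lra)). pose proof (Rle_abs (2 * chi 1 Lam T n S s t + 4 * (1 + T))) as Q.
    apply (Rmult_le_compat_r e) in Q; lra. }
  apply Rmult_eq_reg_l with (exp (r * (T - t))); [unfold D in HD0; lra|]. apply Rgt_not_eq, exp_pos.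
Qed.
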